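(* Let $D$ be a uniform domain in $\mathbb{C}$ such that $\overline{\mathbb{C}}\setminus D$ contains at least three points. Then there exists a constant $c>0$ such that if $f$ is a harmonic mapping in $D$ with Jacobian $J_f>0$ in $D$ and $\|S_f\|_D\le c$, then $f$ is injective in $D$.
   Context: $\overline{\mathbb{C}}=\mathbb{C}\cup\{\infty\}$ is the extended complex plane and $\mathbb{D}$ is the open unit disk. A domain $D\subset\mathbb{C}$ is called uniform if there exist positive constants $a$ and $b$ such that each pair of points $z_1,z_2\in D$ can be joined by an arc $\gamma\subset D$ so that for each $z\in\gamma$ $$\ell(\gamma)\le a\,|z_1-z_2|\qquad\text{and}\qquad \min_{j=1,2}\ell(\gamma_j)\le b\,\mathrm{dist}(z,\partial D),$$ where $\gamma_1,\gamma_2$ are the components of $\gamma\setminus\{z\}$, $\mathrm{dist}(z,\partial D)$ is the euclidean distance from $z$ to the boundary of $D$, and $\ell(\cdot)$ denotes euclidean length. A harmonic mapping in $D$ is a complex-valued harmonic function $f:D\to\mathbb{C}$. Its Jacobian is $J_f=|f_z|^2-|f_{\overline z}|^2$. By Lewy's theorem $f$ is locally univalent if and only if $J_f$ does not vanish. Schwarzian derivative (Hernández–Martín): for harmonic $f$ with $J_f>0$, set $$S_f=\rho_{zz}-\tfrac12(\rho_z)^2,\qquad \rho=\log J_f,$$ where the subscripts denote the Wirtinger derivative $\partial/\partial z$. Hyperbolic metric: when $\overline{\mathbb{C}}\setminus D$ contains at least three points, the density $\lambda_D$ is defined by $\lambda_D(\pi(z))\,|\pi'(z)|=\frac{1}{1-|z|^2}$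 for $z\in\mathbb{D}$, where $\pi:\mathbb{D}\to D$ is a (holomorphic) universal covering map. The norm of the Schwarzian derivative is $$\|S_f\|_D=\sup_{z\in D}\lambda_D(z)^{-2}|S_f(z)|.$$ *)

(* Defs.v *)
(* Stdlib reals with Coquelicot; the plane is Coquelicot's C = R * R. *)
From Stdlib Require Import Reals.
From Coquelicot Require Import Coquelicot.
Open Scope R_scope.

(** * Plane sets *)

Definition connected_set (D : C -> Prop) : Prop :=
  forall U V : C -> Prop, open U -> open V ->
    (forall z, D z -> U z \/ V z) ->
    (forall z, ~ (D z /\ U z /\ V z)) ->
    (forall z, D z -> U z) \/ (forall z, D z -> V z).

Definition domain (D : C -> Prop) : Prop :=
  open D /\ connected_set D /\ exists z, D z.

Definition boundary (D : C -> Prop) (w : C) : Prop :=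
  forall U : C -> Prop, open U -> U w ->
    (exists z, U z /\ D z) /\ (exists z, U z /\ ~ D z).

(* +oo when [A] is empty. *)
Definition dist_to (z : C) (A : C -> Prop) : Rbar :=
  Glb_Rbar (fun r => exists w, A w /\ r = Cmod (z - w)%C).

(* The extended plane: [None] is the point at infinity. *)
Definition Cbar : Type := option C.

Definition in_Cbar (D : C -> Prop) (p : Cbar) : Prop :=
  exists z, D z /\ p = Some z.

Definition compl_three_points (D : C -> Prop) : Prop :=
  exists p q r : Cbar, p <> q /\ p <> r /\ q <> r /\
    ~ in_Cbar D p /\ ~ in_Cbar D q /\ ~ in_Cbar D r.

(** * Uniform domains *)

Definition polygonal_length (g : R -> C) (p : nat -> R) (n : nat) : R :=
  sum_f_R0 (fun i => Cmod (g (p (S i)) - g (p i))%C) n.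

(* Length of [g] restricted to [s, t]; deleting an endpoint of the parameter
   interval does not change it. *)
Definition curve_length (g : R -> C) (s t : R) : Rbar :=
  Lub_Rbar (fun L => exists (p : nat -> R) (n : nat),
    (forall i, (i <= n)%nat -> p i <= p (S i)) /\
    s <= p 0%nat /\ p (S n) <= t /\ L = polygonal_length g p n).

Definition arc_in (D : C -> Prop) (z1 z2 : C) (g : R -> C) : Prop :=
  (forall t, 0 <= t <= 1 ->
     filterlim g (within (fun s => 0 <= s <= 1) (locally t)) (locally (g t))) /\
  (forall s t, 0 <= s <= 1 -> 0 <= t <= 1 -> g s = g t -> s = t) /\
  g 0 = z1 /\ g 1 = z2 /\
  (forall t, 0 <= t <= 1 -> D (g t)).

(* The pairs are pairs of distinct points: an arc is injective, hence has
   distinct endpoints. *)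
Definition uniform_domain (D : C -> Prop) : Prop :=
  domain D /\
  exists a b : R, 0 < a /\ 0 < b /\
    forall z1 z2 : C, D z1 -> D z2 -> z1 <> z2 ->
      exists g : R -> C, arc_in D z1 z2 g /\
        Rbar_le (curve_length g 0 1) (a * Cmod (z1 - z2)%C) /\
        forall t, 0 <= t <= 1 ->
          Rbar_le (Rbar_min (curve_length g 0 t) (curve_length g t 1))
                  (Rbar_mult b (dist_to (g t) (boundary D))).

(** * Wirtinger calculus and harmonic mappings *)

Definition Dx (f : C -> C) (z : C) : C :=
  (Derive (fun t => Re (f (t, Im z))) (Re z),
   Derive (fun t => Im (f (t, Im z))) (Re z)).

Definition Dy (f : C -> C) (z : C) : C :=
  (Derive (fun t => Re (f (Re z, t))) (Im z),
   Derive (fun t => Im (f (Re z, t))) (Im z)).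

Definition Dz (f : C -> C) (z : C) : C := ((Dx f z - Ci * Dy f z) / 2)%C.

Definition Dzbar (f : C -> C) (z : C) : C := ((Dx f z + Ci * Dy f z) / 2)%C.

Definition class_C1 (D : C -> Prop) (f : C -> C) : Prop :=
  forall z : C, D z ->
    ex_derive (fun t : R => f (t, Im z)) (Re z) /\
    ex_derive (fun t : R => f (Re z, t)) (Im z) /\
    continuous (Dx f) z /\ continuous (Dy f) z.

Definition class_C2 (D : C -> Prop) (f : C -> C) : Prop :=
  class_C1 D f /\ class_C1 D (Dx f) /\ class_C1 D (Dy f).

Definition harmonic (D : C -> Prop) (f : C -> C) : Prop :=
  class_C2 D f /\
  forall z : C, D z -> (Dx (Dx f) z + Dy (Dy f) z)%C = 0%C.

Definition jacobian (f : C -> C) (z : C) : R :=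
  Cmod (Dz f z) ^ 2 - Cmod (Dzbar f z) ^ 2.

Definition log_jacobian (f : C -> C) (z : C) : C := RtoC (ln (jacobian f z)).

Definition schwarzian (f : C -> C) (z : C) : C :=
  let rho := log_jacobian f in
  (Dz (Dz rho) z - / 2 * (Dz rho z * Dz rho z))%C.

(** * Hyperbolic metric *)

Definition unit_disk (z : C) : Prop := Cmod z < 1.

(* The sheets [U i] over [V] are mapped homeomorphically onto [V] by [p], with
   inverses [s i]. *)
Definition evenly_covered (E : C -> Prop) (p : C -> C) (V : C -> Prop) : Prop :=
  exists (I : Type) (U : I -> C -> Prop) (s : I -> C -> C),
    (forall i, open (U i)) /\
    (forall i j z, U i z -> U j z -> i = j) /\
    (forall z, E z /\ V (p z) <-> exists i, U i z) /\
    (forall i w, V w -> U i (s i w) /\ p (s i w) = w /\ continuous (s i) w) /\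
    (forall i z, U i z -> s i (p z) = z).

Definition covering_map (E B : C -> Prop) (p : C -> C) : Prop :=
  (forall z, E z -> B (p z) /\ continuous p z) /\
  (forall w, B w -> exists z, E z /\ p z = w) /\
  (forall w, B w -> exists V : C -> Prop,
     open V /\ V w /\ (forall v, V v -> B v) /\ evenly_covered E p V).

(* Universal because the disk is simply connected. [ex_derive] is complex
   differentiability here. *)
Definition holomorphic_universal_covering (D : C -> Prop) (p : C -> C) : Prop :=
  covering_map unit_disk D p /\ (forall z : C, unit_disk z -> ex_derive p z).

(* The set is a singleton when [D] is covered by the disk and [D w] holds, since
   the density does not depend on the covering nor on the preimage of [w];
   [Lub_Rbar] picks its element. The junk value, for an empty set, is 0. *)
Definition hyperbolic_density (D : C -> Prop) (w : C) : R :=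
  real (Lub_Rbar (fun l => exists (p : C -> C) (z : C),
    holomorphic_universal_covering D p /\ unit_disk z /\ p z = w /\
    l * Cmod (C_derive p z) = 1 / (1 - Cmod z ^ 2))).

(* x^-2 for x >= 0, with 0^-2 = +oo. *)
Definition inv_sqr (x : R) : Rbar :=
  if Req_dec_T x 0 then p_infty else Finite (/ x ^ 2).

Definition schwarzian_norm (D : C -> Prop) (f : C -> C) : Rbar :=
  Rbar_lub (fun r => exists z, D z /\
    r = Rbar_mult (inv_sqr (hyperbolic_density D z)) (Cmod (schwarzian f z))).

(* Main.v *)
Require Import Defs.
From Stdlib Require Import Reals Lra Lia Compare_dec Classical ClassicalEpsilon.
From Coquelicot Require Import Coquelicot.
(* again, for [Defs.Dx] is shadowed by the standard library *)
Import Defs.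
Open Scope R_scope.

(* Locally f = h + conj g, with h' = A and g' = B holomorphic on D, J = |A|^2 - |B|^2,
   P = d/dz log J and S = P_z - P^2/2. Let z1 <> z2 with f(z1) = f(z2) be joined by a
   curve as in the definition of a uniform domain. The function
   N = conj A (f - f(z1)) - conj (B (f - f(z1))) satisfies N_z = J, whence
   W = J/N - P/2 satisfies the Riccati equation W_z = - W^2 - S/2, and
   |W_zbar| <= t |J/N| + t^2/2, where t = |A B' - A' B|/J is the hyperbolic derivative
   of the dilatation B/A. If |S| and t^2 are at most eps/dist(., boundary)^2, integration
   along the curve from z1 to its midpoint z0 gives W(z0) = 1/(z0 - z1) up to a small
   multiple of 1/|z0 - z1|. The same holds with z2 instead of z1 for the same function
   W, which is a contradiction since |z0 - z1| + |z0 - z2| <= a |z1 - z2|.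

   That t is small when S is follows from rescaling to the unit disc: t is bounded by
   the Ahlfors-Schwarz lemma, then P is bounded, because P_z = P^2/2 + S forces a
   blow-up next to a point where |P| is large; so after an affine normalization A is
   bounded. Now J^2 S / conj(A)^2 is a quadratic polynomial in the conjugate of B/A with
   holomorphic coefficients, and its Taylor coefficients at conj z and conj z^2 bound
   t(0)^5.

   That |S| is small follows from the Schwarz lemma, lambda_D <= 1/dist(., boundary);
   it is applied to a section of the covering over a disc. *)

(** W is not holomorphic, so its value at z0 cannot be read off a linear second order equation; it
    is followed along the curve by continuity. What is estimated is Q = zeta^2 (W - 1/zeta), zeta =
    z - z1, which tends to 0 at z1. Its derivative in conj z contains t |J/N| with J/N = W + P/2,
    which is why P has to be bounded besides t and S. A bound on Q also keeps N away from 0, so N <>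
    0 is proved along with it; this is how a curve passing through other preimages of f(z1) is
    excluded.

    The curve provides room proportional to the arclength s travelled, whereas W is compared with
    1/zeta, and the curve may come back close to z1 when s is large. Such returns stay in a disc
    about z1 whose double lies in D, and there Q is controlled along radial segments.

    The bound on t is not linear in S. After normalization the coefficient of conj z is the unknown
    constant b(0) times conj of (B/A)'(0), where b is the middle coefficient of the quadratic
    polynomial. Only together with the coefficient of conj z^2 can b(0) be eliminated, and this
    costs the fifth power. *)

(* Coquelicot's lemmas leave equations typed in an abstract module. *)
Ltac req := cbv beta; match goal with |- @eq _ ?a ?b => change (@eq R a b) end.

Lemma Cmod_minus_sym (x y : C) : Cmod (x - y)%C = Cmod (y - x)%C.
Proof. rewrite <- Cmod_opp. f_equal. ring. Qed.

Lemma Cmod_triangle_sub (x y : C) : Cmod (x - y)%C <= Cmod x + Cmod y.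
Proof. unfold Cminus. rewrite <- (Cmod_opp y). apply Cmod_triangle. Qed.

Lemma Cmod_triangle_rev (x y : C) : Cmod x - Cmod y <= Cmod (x - y)%C.
Proof.
  assert (H := Cmod_triangle (x - y) y).
  replace (x - y + y)%C with x in H by ring. lra.
Qed.

Lemma Cmod_dist_triangle (x y z : C) :
  Cmod (x - z)%C <= Cmod (x - y)%C + Cmod (y - z)%C.
Proof. replace (x - z)%C with ((x - y) + (y - z))%C by ring. apply Cmod_triangle. Qed.

Lemma Cmod_RtoC_pos (x : R) : 0 <= x -> Cmod (RtoC x) = x.
Proof. intros H. rewrite Cmod_R. now apply Rabs_pos_eq. Qed.

Lemma im_le_Cmod (c : C) : Rabs (Im c) <= Cmod c.
Proof. apply Rle_trans with (2 := Rmax_Cmod c). apply Rmax_r. Qed.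

Lemma Re_le_Cmod (c : C) : Re c <= Cmod c.
Proof. assert (H := re_le_Cmod c). assert (G := Rle_abs (Re c)). lra. Qed.

Lemma Cconj_0 : Cconj 0 = 0%C.
Proof. apply injective_projections; simpl; ring. Qed.

Lemma Cconj_RtoC (x : R) : Cconj (RtoC x) = RtoC x.
Proof. apply injective_projections; simpl; ring. Qed.

Lemma Cminus_eq_0 (x y : C) : (x - y)%C = 0%C -> x = y.
Proof. intros H. replace x with (x - y + y)%C by ring. rewrite H. ring. Qed.

Lemma Cminus_neq_0 (x y : C) : x <> y -> (x - y)%C <> 0%C.
Proof. intros H G. now apply H, Cminus_eq_0. Qed.

Lemma Cconj_neq_0 (x : C) : x <> 0%C -> Cconj x <> 0%C.
Proof. intros H G. apply H. rewrite <- (Cconj_conj x), G. apply Cconj_0. Qed.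

Lemma re_minus (x y : C) : Re (x - y)%C = Re x - Re y.
Proof. reflexivity. Qed.

Lemma im_minus (x y : C) : Im (x - y)%C = Im x - Im y.
Proof. reflexivity. Qed.

(** * Wirtinger derivatives as first order expansions *)

Definition little_o (z : C) (r : C -> C) : Prop :=
  forall eps, 0 < eps -> exists delta, 0 < delta /\
    forall w, Cmod (w - z)%C < delta -> Cmod (r w) <= eps * Cmod (w - z)%C.

Definition bounded_near (z : C) (F : C -> C) : Prop :=
  exists M delta, 0 < M /\ 0 < delta /\
    forall w, Cmod (w - z)%C < delta -> Cmod (F w) <= M.

(** The explicit form of [locally] on the plane; [near_locally] identifies the two. *)
Definition near (z : C) (P : C -> Prop) : Prop :=
  exists delta, 0 < delta /\ forall w, Cmod (w - z)%C < delta -> P w.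

Definition cont (F : C -> C) (z : C) : Prop :=
  forall eps, 0 < eps -> near z (fun w => Cmod (F w - F z)%C < eps).

(* [a] and [b] are the Wirtinger derivatives of [F] at [z]. *)
Definition wd (F : C -> C) (z a b : C) : Prop :=
  little_o z (fun w => F w - F z - a * (w - z) - b * Cconj (w - z))%C.

Lemma near_and (z : C) (P Q : C -> Prop) :
  near z P -> near z Q -> near z (fun w => P w /\ Q w).
Proof.
  intros [d [Hd H]] [e [He G]]. exists (Rmin d e). split; [now apply Rmin_pos|].
  intros w Hw. split; [apply H|apply G]; apply Rlt_le_trans with (1 := Hw).
  apply Rmin_l. apply Rmin_r.
Qed.

Lemma near_imp (z : C) (P Q : C -> Prop) :
  (forall w, P w -> Q w) -> near z P -> near z Q.
Proof. intros I [d [Hd H]]. exists d. auto. Qed.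

Lemma near_self (z : C) (P : C -> Prop) : near z P -> P z.
Proof. intros [d [Hd H]]. apply H. replace (z - z)%C with (RtoC 0) by ring. now rewrite Cmod_0. Qed.

Lemma near_near (z : C) (P : C -> Prop) : near z P -> near z (fun w => near w P).
Proof.
  intros [d [Hd H]]. exists (d / 2). split; [lra|]. intros w Hw.
  exists (d / 2). split; [lra|]. intros v Hv. apply H.
  assert (T := Cmod_dist_triangle v w z). lra.
Qed.

Lemma near_ball (z c : C) (r : R) : Cmod (z - c)%C < r -> near z (fun w => Cmod (w - c)%C < r).
Proof.
  intros H. exists (r - Cmod (z - c)%C). split; [lra|]. intros w Hw.
  assert (T := Cmod_dist_triangle w z c). lra.
Qed.

Lemma near_ball_self (z : C) (r : R) : 0 < r -> near z (fun w => Cmod (w - z)%C < r).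
Proof. intros H. exists r. auto. Qed.

Lemma lo_plus z r s : little_o z r -> little_o z s -> little_o z (fun w => r w + s w)%C.
Proof.
  intros H G e He. destruct (H (e / 2)) as [d [Hd H1]]; [lra|].
  destruct (G (e / 2)) as [d' [Hd' G1]]; [lra|].
  exists (Rmin d d'). split; [now apply Rmin_pos|]. intros w Hw.
  assert (A := H1 w (Rlt_le_trans _ _ _ Hw (Rmin_l _ _))).
  assert (B := G1 w (Rlt_le_trans _ _ _ Hw (Rmin_r _ _))).
  assert (T := Cmod_triangle (r w) (s w)). lra.
Qed.

Lemma lo_ext_near z r s : near z (fun w => r w = s w) -> little_o z r -> little_o z s.
Proof.
  intros [d [Hd E]] H e He. destruct (H e He) as [d' [Hd' G]].
  exists (Rmin d d'). split; [now apply Rmin_pos|]. intros w Hw.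
  rewrite <- E. apply G. apply Rlt_le_trans with (1 := Hw), Rmin_r.
  apply Rlt_le_trans with (1 := Hw), Rmin_l.
Qed.

Lemma lo_ext z r s : (forall w, r w = s w) -> little_o z r -> little_o z s.
Proof. intros H. apply lo_ext_near. exists 1. split; [lra|]. auto. Qed.

Lemma lo_mult z r G : little_o z r -> bounded_near z G -> little_o z (fun w => G w * r w)%C.
Proof.
  intros H [M [d [HM [Hd G1]]]] e He.
  destruct (H (e / M)) as [d' [Hd' H1]]. { now apply Rdiv_lt_0_compat. }
  exists (Rmin d d'). split; [now apply Rmin_pos|]. intros w Hw.
  assert (A := G1 w (Rlt_le_trans _ _ _ Hw (Rmin_l _ _))).
  assert (B := H1 w (Rlt_le_trans _ _ _ Hw (Rmin_r _ _))).
  rewrite Cmod_mult. apply Rle_trans with (M * (e / M * Cmod (w - z)%C)).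
  - apply Rmult_le_compat; auto using Cmod_ge_0.
  - apply Req_le. field. lra.
Qed.

Lemma bounded_near_const z c : bounded_near z (fun _ => c).
Proof.
  exists (Cmod c + 1), 1. assert (H := Cmod_ge_0 c). repeat split; try lra. intros. lra.
Qed.

Lemma lo_scal z r c : little_o z r -> little_o z (fun w => c * r w)%C.
Proof. intros H. apply lo_mult; auto using bounded_near_const. Qed.

Lemma lo_quad z r M : near z (fun w => Cmod (r w) <= M * (Cmod (w - z)%C * Cmod (w - z)%C)) ->
  little_o z r.
Proof.
  intros [d [Hd H]] e He.
  exists (Rmin d (e / (Rabs M + 1))). assert (A := Rabs_pos M).
  split. { apply Rmin_pos; auto. apply Rdiv_lt_0_compat; lra. }
  intros w Hw.
  apply Rle_trans with (1 := H w (Rlt_le_trans _ _ _ Hw (Rmin_l _ _))).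
  rewrite <- Rmult_assoc. apply Rmult_le_compat_r. apply Cmod_ge_0.
  assert (B := Rlt_le_trans _ _ _ Hw (Rmin_r _ _)).
  apply Rle_trans with ((Rabs M + 1) * Cmod (w - z)%C).
  - apply Rmult_le_compat_r. apply Cmod_ge_0. assert (X := Rle_abs M). lra.
  - apply Rle_trans with ((Rabs M + 1) * (e / (Rabs M + 1))).
    + apply Rmult_le_compat_l; lra.
    + apply Req_le. field. lra.
Qed.

Lemma wd_lip F z a b e : wd F z a b -> 0 < e ->
  near z (fun w => Cmod (F w - F z)%C <= (Cmod a + Cmod b + e) * Cmod (w - z)%C).
Proof.
  intros H He. destruct (H e He) as [d [Hd G]]. exists d. split; auto. intros w Hw.
  assert (A := G w Hw).
  replace (F w - F z)%C with ((F w - F z - a * (w - z) - b * Cconj (w - z)) +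
    (a * (w - z) + b * Cconj (w - z)))%C by ring.
  apply Rle_trans with (1 := Cmod_triangle _ _).
  assert (B := Cmod_triangle (a * (w - z)) (b * Cconj (w - z))).
  rewrite 2!Cmod_mult, Cmod_conj in B. lra.
Qed.

Lemma wd_cont F z a b : wd F z a b -> cont F z.
Proof.
  intros H e He. destruct (wd_lip F z a b 1 H Rlt_0_1) as [d [Hd G]].
  set (M := Cmod a + Cmod b + 1).
  assert (HM : 0 < M). { unfold M. assert (X := Cmod_ge_0 a). assert (Y := Cmod_ge_0 b). lra. }
  exists (Rmin d (e / M)). split. { apply Rmin_pos; auto. now apply Rdiv_lt_0_compat. }
  intros w Hw. apply Rle_lt_trans with (1 := G w (Rlt_le_trans _ _ _ Hw (Rmin_l _ _))).
  fold M. assert (B := Rlt_le_trans _ _ _ Hw (Rmin_r _ _)).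
  apply Rlt_le_trans with (M * (e / M)). now apply Rmult_lt_compat_l.
  apply Req_le. field. lra.
Qed.

Lemma cont_bounded F z : cont F z -> bounded_near z F.
Proof.
  intros H. destruct (H 1 Rlt_0_1) as [d [Hd G]].
  exists (Cmod (F z) + 1), d. assert (X := Cmod_ge_0 (F z)). repeat split; try lra.
  intros w Hw. assert (A := G w Hw). assert (B := Cmod_triangle_rev (F w) (F z)). lra.
Qed.

Lemma wd_ext_near F G z a b : near z (fun w => F w = G w) -> wd F z a b -> wd G z a b.
Proof.
  intros E. assert (E0 := near_self _ _ E). apply lo_ext_near.
  revert E. apply near_imp. intros w Hw. now rewrite Hw, E0.
Qed.

Lemma wd_ext F G z a b : (forall w, F w = G w) -> wd F z a b -> wd G z a b.
Proof. intros H. apply wd_ext_near. exists 1. split; [lra|auto]. Qed.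

Lemma wd_eq F z a b a' b' : wd F z a b -> a = a' -> b = b' -> wd F z a' b'.
Proof. now intros H -> ->. Qed.

Lemma wd_const c z : wd (fun _ => c) z 0 0.
Proof.
  apply lo_quad with 0. exists 1. split; [lra|]. intros w _.
  replace (c - c - 0 * (w - z) - 0 * Cconj (w - z))%C with (RtoC 0) by ring.
  rewrite Cmod_0. lra.
Qed.

Lemma wd_id z : wd (fun w => w) z 1 0.
Proof.
  apply lo_quad with 0. exists 1. split; [lra|]. intros w _.
  replace (w - z - 1 * (w - z) - 0 * Cconj (w - z))%C with (RtoC 0) by ring.
  rewrite Cmod_0. lra.
Qed.

Lemma wd_conj F z a b : wd F z a b -> wd (fun w => Cconj (F w)) z (Cconj b) (Cconj a).
Proof.
  intros H e He. destruct (H e He) as [d [Hd G]]. exists d. split; auto. intros w Hw.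
  rewrite <- Cmod_conj.
  replace (Cconj _) with (F w - F z - a * (w - z) - b * Cconj (w - z))%C; auto.
  rewrite !Cminus_conj, !Cmult_conj, !Cminus_conj, !Cconj_conj. ring.
Qed.

Lemma wd_plus F G z a b a' b' : wd F z a b -> wd G z a' b' ->
  wd (fun w => F w + G w)%C z (a + a') (b + b').
Proof.
  intros H K. apply (lo_ext _ _ _ (fun w => eq_refl)) in H.
  assert (L := lo_plus _ _ _ H K). revert L. apply lo_ext. intros w. ring.
Qed.

Lemma wd_scal c F z a b : wd F z a b -> wd (fun w => c * F w)%C z (c * a) (c * b).
Proof. intros H. assert (L := lo_scal _ _ c H). revert L. apply lo_ext. intros w. ring. Qed.

Lemma wd_opp F z a b : wd F z a b -> wd (fun w => - F w)%C z (- a) (- b).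
Proof. intros H. assert (L := lo_scal _ _ (-(1))%C H). revert L. apply lo_ext. intros w. ring. Qed.

Lemma wd_minus F G z a b a' b' : wd F z a b -> wd G z a' b' ->
  wd (fun w => F w - G w)%C z (a - a') (b - b').
Proof. intros H K. apply wd_plus; auto. now apply wd_opp. Qed.

Lemma wd_lip_M F z a b : wd F z a b -> exists M, 0 < M /\
  near z (fun w => Cmod (F w - F z)%C <= M * Cmod (w - z)%C).
Proof.
  intros H. exists (Cmod a + Cmod b + 1). split.
  assert (X := Cmod_ge_0 a). assert (Y := Cmod_ge_0 b). lra. apply wd_lip; auto. lra.
Qed.

Lemma wd_mult F G z a b a' b' : wd F z a b -> wd G z a' b' ->
  wd (fun w => F w * G w)%C z (a * G z + F z * a') (b * G z + F z * b').
Proof.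
  intros H K.
  destruct (wd_lip_M _ _ _ _ H) as [M [HM HF]]. destruct (wd_lip_M _ _ _ _ K) as [M' [HM' HG]].
  (* What the linear terms leave over is the product of the two increments, each O(|w - z|) by
     [wd_lip_M]. *)
  assert (Q : little_o z (fun w => (F w - F z) * (G w - G z))%C).
  { apply lo_quad with (M * M'). generalize (near_and _ _ _ HF HG). apply near_imp.
    intros w [X Y]. rewrite Cmod_mult.
    replace (M * M' * (Cmod (w - z) * Cmod (w - z))) with
      ((M * Cmod (w - z)%C) * (M' * Cmod (w - z)%C)) by ring.
    apply Rmult_le_compat; auto using Cmod_ge_0. }
  assert (L := lo_plus _ _ _ (lo_plus _ _ _ (lo_scal _ _ (G z) H) (lo_scal _ _ (F z) K)) Q).
  revert L. apply lo_ext. intros w. ring.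
Qed.

Lemma cont_nonzero F z : cont F z -> F z <> 0%C ->
  near z (fun w => Cmod (F z) / 2 < Cmod (F w)).
Proof.
  intros H N. apply Cmod_gt_0 in N. assert (He : 0 < Cmod (F z) / 2) by lra.
  generalize (H _ He). apply near_imp. intros w X.
  rewrite Cmod_minus_sym in X. assert (T := Cmod_triangle_rev (F z) (F w)). lra.
Qed.

Lemma cont_neq_0 F z : cont F z -> F z <> 0%C -> near z (fun w => F w <> 0%C).
Proof.
  intros H N. generalize (cont_nonzero _ _ H N). apply near_imp. intros w X Y.
  rewrite Y, Cmod_0 in X. apply Cmod_gt_0 in N. lra.
Qed.

Lemma wd_inv F z a b : wd F z a b -> F z <> 0%C ->
  wd (fun w => / F w)%C z (- a / (F z * F z)) (- b / (F z * F z)).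
Proof.
  intros H N. destruct (wd_lip_M _ _ _ _ H) as [M [HM HF]].
  assert (HN := cont_nonzero _ _ (wd_cont _ _ _ _ H) N).
  assert (N0 := N). apply Cmod_gt_0 in N0.
  set (m := Cmod (F z)) in *.
  (* The exact remainder: 1/F(w) - 1/F(z) + (F(w) - F(z))/F(z)^2 = (F(w) - F(z))^2 / (F(w) F(z)^2),
     quadratic since F stays away from 0 near z. *)
  assert (Q : little_o z (fun w => (F w - F z) * (F w - F z) / (F w * (F z * F z)))%C).
  { apply lo_quad with (M * M / ((m / 2) * (m * m))).
    generalize (near_and _ _ _ HF HN). apply near_imp. intros w [X Y].
    assert (Fw : F w <> 0%C). { intros Z. rewrite Z, Cmod_0 in Y. lra. }
    rewrite Cmod_div, !Cmod_mult. fold m.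
    - replace (M * M / (m / 2 * (m * m)) * (Cmod (w - z) * Cmod (w - z))) with
        ((M * Cmod (w - z)%C) * (M * Cmod (w - z)%C) * / (m / 2 * (m * m))) by (field; lra).
      apply Rmult_le_compat.
      + apply Rmult_le_pos; apply Cmod_ge_0.
      + apply Rlt_le, Rinv_0_lt_compat. apply Rmult_lt_0_compat. lra. now apply Rmult_lt_0_compat.
      + apply Rmult_le_compat; auto using Cmod_ge_0.
      + apply Rinv_le_contravar. apply Rmult_lt_0_compat. lra. now apply Rmult_lt_0_compat.
        apply Rmult_le_compat_r. apply Rlt_le. now apply Rmult_lt_0_compat. lra.
    - repeat apply Cmult_neq_0; auto. }
  assert (L := lo_plus _ _ _ (lo_scal _ _ (- / (F z * F z))%C H) Q).
  revert L. apply lo_ext_near. generalize HN. apply near_imp. intros w Y.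
  assert (Fw : F w <> 0%C). { intros Z. rewrite Z, Cmod_0 in Y. lra. }
  field. split; auto.
Qed.

Lemma wd_div F G z a b a' b' : wd F z a b -> wd G z a' b' -> G z <> 0%C ->
  wd (fun w => F w / G w)%C z ((a * G z - F z * a') / (G z * G z))
    ((b * G z - F z * b') / (G z * G z)).
Proof.
  intros H K N. eapply wd_eq. apply (wd_mult _ _ _ _ _ _ _ H (wd_inv _ _ _ _ K N)).
  field; auto. field; auto.
Qed.

Lemma wd_comp H F z a b c d : wd F z a b -> wd H (F z) c d ->
  wd (fun w => H (F w)) z (c * a + d * Cconj b) (c * b + d * Cconj a).
Proof.
  intros HF HH. destruct (wd_lip_M _ _ _ _ HF) as [M [HM [d1 [Hd1 G1]]]].
  assert (Q : little_o z (fun w => H (F w) - H (F z) - c * (F w - F z)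
      - d * Cconj (F w - F z))%C).
  { intros e He. destruct (HH (e / M)) as [d2 [Hd2 G2]]. now apply Rdiv_lt_0_compat.
    exists (Rmin d1 (d2 / M)). split. apply Rmin_pos; auto. now apply Rdiv_lt_0_compat.
    intros w Hw. assert (A := G1 w (Rlt_le_trans _ _ _ Hw (Rmin_l _ _))).
    assert (B := Rlt_le_trans _ _ _ Hw (Rmin_r _ _)).
    assert (X : Cmod (F w - F z)%C < d2).
    { apply Rle_lt_trans with (1 := A). apply Rlt_le_trans with (M * (d2 / M)).
      now apply Rmult_lt_compat_l. apply Req_le; field; lra. }
    apply Rle_trans with (1 := G2 _ X). apply Rle_trans with (e / M * (M * Cmod (w - z)%C)).
    apply Rmult_le_compat_l; auto. apply Rlt_le. now apply Rdiv_lt_0_compat.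
    apply Req_le. field. lra. }
  assert (L := lo_plus _ _ _ Q (lo_plus _ _ _ (lo_scal _ _ c HF) (lo_scal _ _ d (wd_conj _ _ _ _ HF)))).
  revert L. apply lo_ext. intros w. rewrite !Cminus_conj. ring.
Qed.

(** [g] is extended to the plane as a function of the real part alone. In this form the chain rule
    [wd_comp] applies to outer functions of a real variable, such as [ln]. *)
Lemma wd_real (g : R -> R) (y dg : R) : is_derive g y dg ->
  wd (fun w => RtoC (g (Re w))) (RtoC y) (RtoC (dg / 2)) (RtoC (dg / 2)).
Proof.
  intros H e He. apply is_derive_Reals in H. destruct (H e He) as [d Hd].
  exists d. split. apply cond_pos. intros w Hw.
  set (h := Re (w - RtoC y)%C).
  assert (Eh : Re w = y + h). { unfold h. rewrite re_minus. simpl. ring. }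
  replace (RtoC (g (Re w)) - RtoC (g (Re (RtoC y))) - RtoC (dg / 2) * (w - RtoC y)
     - RtoC (dg / 2) * Cconj (w - RtoC y))%C with (RtoC (g (y + h) - g y - dg * h)).
  2:{ rewrite Eh. change (Re (RtoC y)) with y. unfold h. apply injective_projections; simpl; field. }
  rewrite Cmod_R.
  assert (Hh := re_le_Cmod (w - RtoC y)%C). fold h in Hh.
  destruct (Req_dec h 0) as [Z|Z].
  - rewrite Z. replace (g (y + 0) - g y - dg * 0) with 0. rewrite Rabs_R0.
    apply Rmult_le_pos; auto using Cmod_ge_0. lra. rewrite Rplus_0_r. ring.
  - assert (G := Hd h Z (Rle_lt_trans _ _ _ Hh Hw)).
    replace (g (y + h) - g y - dg * h) with (((g (y + h) - g y) / h - dg) * h) by (field; auto).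
    rewrite Rabs_mult. apply Rmult_le_compat; auto using Rabs_pos. lra.
Qed.

Lemma wd_comp_real (g : R -> R) (psi : C -> R) (z a : C) (dg : R) :
  wd (fun w => RtoC (psi w)) z a (Cconj a) -> is_derive g (psi z) dg ->
  wd (fun w => RtoC (g (psi w))) z (RtoC dg * a) (Cconj (RtoC dg * a)).
Proof.
  intros H G. apply wd_real in G.
  assert (L := wd_comp _ _ _ _ _ _ _ H G). cbv beta in L.
  apply wd_ext with (G := fun w => RtoC (g (psi w))) in L.
  2:{ intros w. now rewrite re_RtoC. }
  assert (D : RtoC dg = (RtoC (dg / 2) + RtoC (dg / 2))%C)
    by (rewrite <- RtoC_plus; f_equal; field).
  eapply wd_eq. apply L. rewrite Cconj_conj, D. ring.
  rewrite Cmult_conj, Cconj_RtoC, D. ring.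
Qed.

(** Increments in the directions 1 and i determine a + b and a - b. *)
Lemma wd_uniq F z a b a' b' : wd F z a b -> wd F z a' b' -> a = a' /\ b = b'.
Proof.
  intros H K.
  assert (X : forall e, Cmod e = 1 -> ((a - a') * e + (b - b') * Cconj e)%C = 0%C).
  { intros e E. apply Cmod_eq_0. apply Rle_antisym. 2: apply Cmod_ge_0.
    apply le_epsilon. intros eps Heps. rewrite Rplus_0_l.
    destruct (H (eps / 2)) as [d [Hd G]]; [lra|]. destruct (K (eps / 2)) as [d' [Hd' G']]; [lra|].
    set (t := Rmin d d' / 2). assert (0 < Rmin d d') by now apply Rmin_pos.
    assert (Ht : 0 < t) by (unfold t; lra).
    set (w := (z + RtoC t * e)%C).
    assert (Ew : Cmod (w - z)%C = t).
    { unfold w. replace (z + RtoC t * e - z)%C with (RtoC t * e)%C by ring.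
      rewrite Cmod_mult, E, Cmod_RtoC_pos; lra. }
    assert (A := G w). assert (A' := G' w). rewrite Ew in A, A'.
    assert (t < Rmin d d') by (unfold t; lra).
    assert (U := A (Rlt_le_trans _ _ _ H1 (Rmin_l _ _))).
    assert (U' := A' (Rlt_le_trans _ _ _ H1 (Rmin_r _ _))).
    assert (V := Cmod_triangle_sub (F w - F z - a' * (w - z) - b' * Cconj (w - z))
       (F w - F z - a * (w - z) - b * Cconj (w - z))).
    replace (_ - _)%C with (RtoC t * ((a - a') * e + (b - b') * Cconj e))%C in V.
    2:{ unfold w. replace (z + RtoC t * e - z)%C with (RtoC t * e)%C by ring.
        rewrite Cmult_conj, Cconj_RtoC. ring. }
    rewrite Cmod_mult, (Cmod_RtoC_pos t) in V by lra.
    apply Rmult_le_reg_l with t; auto. lra. }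
  assert (X1 := X 1%C Cmod_1). assert (X2 := X Ci Cmod_Ci).
  replace (Cconj 1) with (RtoC 1) in X1 by (apply injective_projections; simpl; ring).
  replace (Cconj Ci) with (- Ci)%C in X2 by (apply injective_projections; simpl; ring).
  assert (Y : ((a - a') - (b - b'))%C = 0%C).
  { replace ((a - a') - (b - b'))%C with (- Ci * ((a - a') * Ci + (b - b') * - Ci))%C.
    rewrite X2; ring.
    replace (- Ci * ((a - a') * Ci + (b - b') * - Ci))%C with (- (Ci * Ci) * ((a - a') - (b - b')))%C by ring.
    replace (Ci * Ci)%C with (-(1))%C. ring. apply injective_projections; simpl; ring. }
  assert (Z : forall u v : C, (u * 1 + v * 1)%C = 0%C -> (u - v)%C = 0%C -> u = 0%C /\ v = 0%C).
  { intros u v E1 E2. split.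
    replace u with (/ 2 * ((u * 1 + v * 1) + (u - v)))%C by field. rewrite E1, E2; ring.
    replace v with (/ 2 * ((u * 1 + v * 1) - (u - v)))%C by field. rewrite E1, E2; ring. }
  destruct (Z _ _ X1 Y). split; now apply Cminus_eq_0.
Qed.

(** The passage from the plane to one real variable: the mean value theorem and the fundamental
    theorem of calculus are applied to these components. *)
Lemma wd_line F z0 e t0 a b : wd F (z0 + RtoC t0 * e)%C a b ->
  is_derive (fun t : R => Re (F (z0 + RtoC t * e)%C)) t0 (Re (a * e + b * Cconj e)%C) /\
  is_derive (fun t : R => Im (F (z0 + RtoC t * e)%C)) t0 (Im (a * e + b * Cconj e)%C).
Proof.
  intros H.
  assert (X : forall eps, 0 < eps -> exists d, 0 < d /\ forall h, h <> 0 -> Rabs h < d ->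
     Cmod (F (z0 + RtoC (t0 + h) * e) - F (z0 + RtoC t0 * e) - RtoC h * (a * e + b * Cconj e))%C
       < eps * Rabs h).
  (* [Cmod e + 1] makes the estimate strict and allows e = 0. *)
  { intros eps He. assert (Ce := Cmod_ge_0 e).
    destruct (H (eps / (Cmod e + 1))) as [d [Hd G]]. apply Rdiv_lt_0_compat; lra.
    exists (d / (Cmod e + 1)). split. apply Rdiv_lt_0_compat; lra.
    intros h Hh Hh'.
    assert (Ew : (z0 + RtoC (t0 + h) * e - (z0 + RtoC t0 * e))%C = (RtoC h * e)%C)
      by (rewrite RtoC_plus; ring).
    assert (G1 := G (z0 + RtoC (t0 + h) * e)%C). rewrite Ew in G1.
    rewrite Cmod_mult, Cmod_R in G1.
    assert (P := Rabs_pos_lt _ Hh).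
    replace (_ - _ - _)%C with (F (z0 + RtoC (t0 + h) * e) - F (z0 + RtoC t0 * e) - a * (RtoC h * e)
      - b * Cconj (RtoC h * e))%C by (rewrite Cmult_conj, Cconj_RtoC; ring).
    assert (Y : Rabs h * Cmod e < d).
    { apply Rlt_div_r in Hh'; [|lra]. apply Rle_lt_trans with (2 := Hh').
      apply Rmult_le_compat_l; lra. }
    apply Rle_lt_trans with (1 := G1 Y).
    replace (eps / (Cmod e + 1) * (Rabs h * Cmod e)) with
      (eps * Rabs h * (Cmod e / (Cmod e + 1))) by (field; lra).
    rewrite <- (Rmult_1_r (eps * Rabs h)) at 2. apply Rmult_lt_compat_l.
    now apply Rmult_lt_0_compat. apply Rlt_div_l; lra. }
  assert (Y : forall u v l h eps : R, h <> 0 -> Rabs (u - v - h * l) < eps * Rabs h ->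
     Rabs ((u - v) / h - l) < eps).
  { intros u v l h eps Hh G. assert (P := Rabs_pos_lt _ Hh).
    replace ((u - v) / h - l) with ((u - v - h * l) / h) by (field; auto).
    unfold Rdiv. rewrite Rabs_mult, Rabs_inv. apply Rlt_div_l; auto. }
  split; apply is_derive_Reals; intros eps He; destruct (X eps He) as [d [Hd G]];
  exists (mkposreal d Hd); intros h Hh Hh'; assert (G1 := G h Hh Hh');
  apply Y; auto.
  - assert (U := re_le_Cmod (F (z0 + RtoC (t0 + h) * e) - F (z0 + RtoC t0 * e) - RtoC h * (a * e + b * Cconj e))%C).
    rewrite !re_minus, re_scal_l in U. lra.
  - assert (U := im_le_Cmod (F (z0 + RtoC (t0 + h) * e) - F (z0 + RtoC t0 * e) - RtoC h * (a * e + b * Cconj e))%C).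
    rewrite !im_minus, im_scal_l in U. lra.
Qed.

(** * Extreme values *)

Lemma Rle_div_pos (x y : R) : 0 <= x -> 0 < y -> 0 <= x / y.
Proof. intros. apply Rmult_le_pos; auto. now apply Rlt_le, Rinv_0_lt_compat. Qed.

Definition closed_bounded (K : C -> Prop) : Prop :=
  (exists M, forall z, K z -> Cmod z <= M) /\
  (forall z, ~ K z -> near z (fun w => ~ K w)).

(** Relative to [K], because weights such as 1/2 - |z| are nonnegative only there. *)
Definition usc_on (K : C -> Prop) (F : C -> R) : Prop :=
  forall z, K z -> forall eps, 0 < eps -> near z (fun w => K w -> F w < F z + eps).

(* One finite subcover argument gives both the bound and, applied to the gap to
   the supremum, its attainment. *)
Lemma compact_uniform (K : C -> Prop) (P : R -> C -> Prop) :
  closed_bounded K ->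
  (forall d d' w, 0 < d' -> d' <= d -> P d w -> P d' w) ->
  (forall z, K z -> exists d, 0 < d /\ near z (fun w => K w -> P d w)) ->
  exists d, 0 < d /\ forall w, K w -> P d w.
Proof.
  intros [[M HM] Hc] Mono H.
  (* [compactness_value_2d] controls the two coordinates separately; as sqrt 2 <= 2, twice the gauge
     covers the Euclidean distance. *)
  assert (X : forall z, exists d : posreal, forall w, Cmod (w - z)%C < 2 * d -> K w -> P d w).
  { intros z. destruct (classic (K z)) as [Kz|Kz].
    - destruct (H z Kz) as [d [Hd [e [He G]]]].
      assert (Hm : 0 < Rmin d (e / 2)) by (apply Rmin_pos; lra).
      exists (mkposreal _ Hm). simpl. intros w Hw Kw.
      apply Mono with d; auto. apply Rmin_l. apply G; auto.
      assert (A := Rmin_r d (e / 2)). lra.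
    - destruct (Hc z Kz) as [e [He G]]. assert (He2 : 0 < e / 2) by lra.
      exists (mkposreal _ He2). simpl. intros w Hw Kw. exfalso. apply (G w); auto. lra. }
  set (delta := fun z => proj1_sig (constructive_indefinite_description _ (X z))).
  assert (Hdelta : forall z w, Cmod (w - z)%C < 2 * delta z -> K w -> P (delta z) w)
    by (intros z; exact (proj2_sig (constructive_indefinite_description _ (X z)))).
  destruct (compactness_value_2d (- M) M (- M) M (fun x y => delta (x, y))) as [d Hd].
  exists d. split. apply cond_pos. intros w Kw. apply NNPP. intros Np.
  assert (A := HM w Kw). assert (B := Rmax_Cmod w).
  assert (B1 := Rmax_l (Rabs (fst w)) (Rabs (snd w))). assert (B2 := Rmax_r (Rabs (fst w)) (Rabs (snd w))).
  apply (Hd (fst w) (snd w)).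
  - apply Rabs_le_between. lra.
  - apply Rabs_le_between. lra.
  - intros [u [v [_ [_ [E1 [E2 E3]]]]]]. apply Np. apply Mono with (delta (u, v)); auto. apply cond_pos.
    apply (Hdelta (u, v)); auto.
    assert (T := Cmod_2Rmax (w - (u, v))%C). simpl in T.
    apply Rle_lt_trans with (1 := T).
    assert (S2 : sqrt 2 <= 2). { rewrite <- (sqrt_Rsqr 2) at 2 by lra. apply sqrt_le_1_alt. unfold Rsqr. lra. }
    assert (R1 : Rmax (Rabs (fst w + - u)) (Rabs (snd w + - v)) < delta (u, v))
      by now apply Rmax_lub_lt.
    apply Rle_lt_trans with (2 * Rmax (Rabs (fst w + - u)) (Rabs (snd w + - v))).
    apply Rmult_le_compat_r; auto. apply Rle_trans with (2 := Rmax_l _ _). apply Rabs_pos.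
    lra.
Qed.

Lemma usc_bounded (K : C -> Prop) (F : C -> R) :
  closed_bounded K -> usc_on K F -> exists M, forall w, K w -> F w <= M.
Proof.
  intros HK HF.
  destruct (compact_uniform K (fun d w => F w <= / d) HK) as [d [Hd G]].
  - intros d d' w H1 H2 H3. apply Rle_trans with (1 := H3). now apply Rinv_le_contravar.
  - intros z Kz. assert (A := Rabs_pos (F z)). assert (B := Rle_abs (F z)).
    exists (/ (Rabs (F z) + 1)). split. apply Rinv_0_lt_compat; lra.
    generalize (HF z Kz 1 Rlt_0_1). apply near_imp. intros w Hw Kw.
    rewrite Rinv_inv. specialize (Hw Kw). lra.
  - exists (/ d). auto.
Qed.

Lemma usc_max (K : C -> Prop) (F : C -> R) :
  closed_bounded K -> usc_on K F -> (exists z, K z) ->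
  exists z, K z /\ forall w, K w -> F w <= F z.
Proof.
  intros HK HF [z0 K0]. destruct (usc_bounded K F HK HF) as [M HM].
  destruct (completeness (fun y => exists w, K w /\ y = F w)) as [m [m1 m2]].
  { exists M. intros y [w [Kw ->]]. auto. }
  { exists (F z0). exists z0. auto. }
  assert (m1' : forall w, K w -> F w <= m). { intros w Kw. apply m1. exists w. auto. }
  apply NNPP. intros N.
  destruct (compact_uniform K (fun d w => F w <= m - d) HK) as [d [Hd G]].
  - intros d d' w H1 H2 H3. lra.
  - intros z Kz. assert (L : F z < m).
    { destruct (Rle_lt_or_eq_dec _ _ (m1' z Kz)) as [L|E]; auto. exfalso. apply N.
      exists z. split; auto. rewrite E. auto. }
    exists ((m - F z) / 2). split; [lra|].
    generalize (HF z Kz ((m - F z) / 2) (ltac:(lra))). apply near_imp.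
    intros w Hw Kw. specialize (Hw Kw). lra.
  - assert (m <= m - d); [|lra]. apply m2. intros y [w [Kw ->]]. auto.
Qed.

Lemma closed_ball_closed_bounded (c : C) (r : R) :
  closed_bounded (fun z => Cmod (z - c)%C <= r).
Proof.
  split.
  - exists (r + Cmod c). intros z Hz. assert (T := Cmod_triangle_rev z c). lra.
  - intros z Hz. apply Rnot_le_lt in Hz. exists (Cmod (z - c)%C - r). split; [lra|].
    intros w Hw. assert (T := Cmod_dist_triangle z w c). rewrite (Cmod_minus_sym z w) in T. lra.
Qed.

Lemma cont_RtoC_usc (K : C -> Prop) (F : C -> R) :
  (forall z, K z -> cont (fun w => RtoC (F w)) z) -> usc_on K F.
Proof.
  intros H z Kz e He. generalize (H z Kz e He). apply near_imp. intros w Hw _.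
  rewrite <- RtoC_minus, Cmod_R in Hw. assert (A := Rle_abs (F w - F z)). lra.
Qed.

(** If [m] were positive, then [v], which vanishes at 0 by Fermat's argument, would be positive just
    to the right of 0 and [u] would increase there. [v] is differentiated at 0 alone, which is what
    [local_max_laplacian] can supply. *)
Lemma local_max_1d (u v : R -> R) (m d : R) : 0 < d ->
  (forall t, Rabs t < d -> is_derive u t (v t)) -> is_derive v 0 m ->
  (forall t, Rabs t < d -> u t <= u 0) -> m <= 0.
Proof.
  intros Hd Hu Hv Hm. apply Rnot_lt_le. intros Pm.
  apply is_derive_Reals in Hv. destruct (Hv (m / 2)) as [e He]; [lra|].
  assert (v0 : v 0 = 0).
  { assert (H0 := Hu 0 (ltac:(rewrite Rabs_R0; lra))). apply is_derive_Reals in H0.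
    assert (D := fun eps Heps => H0 eps Heps). apply NNPP. intros N.
    destruct (D (Rabs (v 0) / 2)) as [e2 He2]. { assert (X := Rabs_pos_lt _ N). lra. }
    set (t := Rmin d e2 / 2). assert (P2 := cond_pos e2).
    assert (0 < Rmin d e2) by now apply Rmin_pos.
    assert (A1 := Rmin_l d e2). assert (A2 := Rmin_r d e2).
    destruct (Rlt_dec 0 (v 0)) as [Q|Q].
    - assert (B := He2 t). rewrite !(Rabs_pos_eq t) in B by (unfold t; lra).
      rewrite (Rabs_pos_eq (v 0)) in B by lra.
      assert (B' := B (ltac:(unfold t; lra)) (ltac:(unfold t; lra))).
      apply Rabs_lt_between in B'. rewrite Rplus_0_l in B'.
      assert (U := Hm t (ltac:(unfold t; rewrite Rabs_pos_eq; lra))).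
      assert (V : (u t - u 0) / t <= 0).
      { apply Rmult_le_reg_r with t. unfold t; lra. unfold Rdiv.
        rewrite Rmult_assoc, Rinv_l by (unfold t; lra). lra. }
      lra.
    - assert (B := He2 (- t)). rewrite !Rabs_Ropp, !(Rabs_pos_eq t) in B by (unfold t; lra).
      rewrite (Rabs_left (v 0)) in B by lra.
      assert (B' := B (ltac:(unfold t; lra)) (ltac:(unfold t; lra))).
      apply Rabs_lt_between in B'. rewrite Rplus_0_l in B'.
      assert (U := Hm (- t) (ltac:(unfold t; rewrite Rabs_Ropp, Rabs_pos_eq; lra))).
      assert (V : 0 <= (u (- t) - u 0) / (- t)).
      { apply Rmult_le_reg_r with t. unfold t; lra.
        replace ((u (- t) - u 0) / - t * t) with (u 0 - u (-t)) by (field; unfold t; lra). lra. }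
      lra. }
  set (t := Rmin d e / 2). assert (P2 := cond_pos e).
  assert (0 < Rmin d e) by now apply Rmin_pos.
  assert (A1 := Rmin_l d e). assert (A2 := Rmin_r d e).
  assert (U := Hm t (ltac:(unfold t; rewrite Rabs_pos_eq; lra))).
  (* The mean value point may be 0, so the strict increase is taken from t/2 on. *)
  destruct (MVT_gen u (t / 2) t v) as [c' [Hc1' Hc2']].
  { intros x Hx. rewrite Rmin_left, Rmax_right in Hx by (unfold t; lra). apply Hu.
    rewrite Rabs_pos_eq; unfold t in *; lra. }
  { intros x Hx. rewrite Rmin_left, Rmax_right in Hx by (unfold t; lra).
    apply derivable_continuous_pt. exists (v x). apply is_derive_Reals. apply Hu.
    rewrite Rabs_pos_eq; unfold t in *; lra. }
  destruct (MVT_gen u 0 (t / 2) v) as [c2 [Hc3 Hc4]].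
  { intros x Hx. rewrite Rmin_left, Rmax_right in Hx by (unfold t; lra). apply Hu.
    rewrite Rabs_pos_eq; unfold t in *; lra. }
  { intros x Hx. rewrite Rmin_left, Rmax_right in Hx by (unfold t; lra).
    apply derivable_continuous_pt. exists (v x). apply is_derive_Reals. apply Hu.
    rewrite Rabs_pos_eq; unfold t in *; lra. }
  rewrite Rmin_left, Rmax_right in Hc1', Hc3 by (unfold t; lra).
  assert (V : forall x, 0 < x <= t -> 0 < v x).
  { intros x Hx. assert (B := He x). rewrite (Rabs_pos_eq x) in B by lra.
    assert (B' := B (ltac:(lra)) (ltac:(unfold t in *; lra))).
    rewrite Rplus_0_l, v0 in B'. apply Rabs_lt_between in B'.
    assert (Y : 0 < (v x - 0) / x) by lra.
    replace (v x) with ((v x - 0) / x * x) by (field; lra). apply Rmult_lt_0_compat; lra. }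
  assert (V0 : 0 <= v c2).
  { destruct (Req_dec c2 0) as [->|Z]. lra. apply Rlt_le, V. unfold t in *. lra. }
  assert (V1 := V c' (ltac:(unfold t in *; lra))).
  assert (0 <= v c2 * (t / 2 - 0)) by (apply Rmult_le_pos; unfold t in *; lra).
  assert (0 < v c' * (t - t / 2)) by (apply Rmult_lt_0_compat; unfold t in *; lra).
  lra.
Qed.

(** [G] is the derivative of [Phi] in z, so Re gb is a quarter of the Laplacian. In a unit direction
    e the second derivative at z is 2 Re (ga e^2 + gb); adding the directions 1 and i cancels ga. *)
Lemma local_max_laplacian (Phi : C -> R) (G : C -> C) (z ga gb : C) :
  near z (fun w => wd (fun v => RtoC (Phi v)) w (G w) (Cconj (G w))) ->
  wd G z ga gb -> near z (fun w => Phi w <= Phi z) -> Re gb <= 0.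
Proof.
  intros H HG HM. destruct (near_and _ _ _ H HM) as [d [Hd X]].
  assert (Y : forall e, Cmod e = 1 -> 2 * Re (ga * (e * e) + gb * (e * Cconj e))%C <= 0).
  { intros e E.
    assert (L : forall t, Rabs t < d -> Cmod (z + RtoC t * e - z)%C < d).
    { intros t Ht. replace (z + RtoC t * e - z)%C with (RtoC t * e)%C by ring.
      rewrite Cmod_mult, E, Cmod_R. lra. }
    apply (local_max_1d (fun t => Phi (z + RtoC t * e)%C)
      (fun t => 2 * Re (G (z + RtoC t * e) * e)%C) _ d Hd).
    - intros t Ht. destruct (X _ (L t Ht)) as [X1 _]. apply wd_line in X1.
      destruct X1 as [X1 _]. evar_last. apply X1.
      rewrite <- Cmult_conj, re_plus, re_conj. req. ring.
    - assert (E0 : z = (z + RtoC 0 * e)%C) by ring. rewrite E0 in HG. apply wd_line in HG.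
      destruct HG as [G1 G2].
      apply is_derive_ext with (fun t => 2 * (Re e * Re (G (z + RtoC t * e)%C) - Im e * Im (G (z + RtoC t * e)%C))).
      { intros t. rewrite re_mult. req. ring. }
      evar_last. apply (is_derive_scal (fun t => Re e * Re (G (z + RtoC t * e)%C) - Im e * Im (G (z + RtoC t * e)%C)) 0 2).
      apply (is_derive_minus (fun t => Re e * Re (G (z + RtoC t * e)%C)) (fun t => Im e * Im (G (z + RtoC t * e)%C))).
      apply (is_derive_scal (fun t => Re (G (z + RtoC t * e)%C)) 0 (Re e)). apply G1.
      apply (is_derive_scal (fun t => Im (G (z + RtoC t * e)%C)) 0 (Im e)). apply G2.
      unfold minus, plus, opp; simpl. unfold Re, Im. req. simpl. ring.
    - intros t Ht. replace (z + RtoC 0 * e)%C with z by ring. apply X, L; auto. }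
  assert (Y1 := Y 1%C Cmod_1). assert (Y2 := Y Ci Cmod_Ci).
  assert (Y3 : 2 * Re (ga * (1 * 1) + gb * (1 * Cconj 1))%C +
     2 * Re (ga * (Ci * Ci) + gb * (Ci * Cconj Ci))%C = 4 * Re gb)
   by (unfold Re; simpl; ring).
  lra.
Qed.

(** * Integrals of complex-valued functions of a real variable *)

Definition contR (g : R -> C) (t : R) : Prop :=
  forall eps, 0 < eps -> exists d, 0 < d /\
    forall s, Rabs (s - t) < d -> Cmod (g s - g t)%C < eps.

Definition CI (g : R -> C) (a b : R) : C :=
  (RInt (fun t => Re (g t)) a b, RInt (fun t => Im (g t)) a b).

Definition contI (g : R -> C) (a b : R) : Prop :=
  forall t, Rmin a b <= t <= Rmax a b -> contR g t.

Lemma continuous_eps (u : R -> R) (t : R) :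
  (forall eps, 0 < eps -> exists d, 0 < d /\ forall s, Rabs (s - t) < d -> Rabs (u s - u t) < eps) ->
  continuous u t.
Proof.
  intros H. apply filterlim_locally. intros eps. destruct (H eps (cond_pos eps)) as [d [Hd G]].
  exists (mkposreal d Hd). intros s Hs. apply G, Hs.
Qed.

Lemma contR_re g t : contR g t -> continuous (fun t => Re (g t)) t.
Proof.
  intros H. apply continuous_eps. intros e He. destruct (H e He) as [d [Hd G]].
  exists d. split; auto. intros s Hs. apply Rle_lt_trans with (2 := G s Hs).
  rewrite <- re_minus. apply re_le_Cmod.
Qed.

Lemma contR_im g t : contR g t -> continuous (fun t => Im (g t)) t.
Proof.
  intros H. apply continuous_eps. intros e He. destruct (H e He) as [d [Hd G]].
  exists d. split; auto. intros s Hs. apply Rle_lt_trans with (2 := G s Hs).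
  rewrite <- im_minus. apply im_le_Cmod.
Qed.

Lemma CI_ex_re g a b : contI g a b -> ex_RInt (fun t => Re (g t)) a b.
Proof. intros H. apply (ex_RInt_continuous (V := R_CompleteNormedModule)). intros t Ht. now apply contR_re, H. Qed.

Lemma CI_ex_im g a b : contI g a b -> ex_RInt (fun t => Im (g t)) a b.
Proof. intros H. apply (ex_RInt_continuous (V := R_CompleteNormedModule)). intros t Ht. now apply contR_im, H. Qed.

Lemma norm_C_R (z : C) : norm (V := C_R_NormedModule) z = Cmod z.
Proof.
  unfold norm; simpl. unfold prod_norm, norm; simpl. unfold Cmod, abs; simpl.
  f_equal. rewrite !Rmult_1_r, <- !Rabs_mult, !Rabs_pos_eq; auto; apply Rle_0_sqr.
Qed.

(** The two components are put back together as one integral in [C_R_NormedModule], whose norm is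
    [Cmod]; bounding them separately would lose a factor and spoil the constants of
    [taylor_circle]. *)
Lemma CI_norm g a b M : a <= b -> contI g a b ->
  (forall t, a <= t <= b -> Cmod (g t) <= M) -> Cmod (CI g a b) <= M * (b - a).
Proof.
  intros Hab H HM.
  assert (X : is_RInt (V := C_R_NormedModule) g a b (CI g a b)).
  { apply (is_RInt_fct_extend_pair (U := R_NormedModule) (V := R_NormedModule) g a b).
    apply (RInt_correct (V := R_CompleteNormedModule)). now apply CI_ex_re.
    apply (RInt_correct (V := R_CompleteNormedModule)). now apply CI_ex_im. }
  assert (Y := is_RInt_const (V := R_NormedModule) a b M).
  rewrite Rmult_comm, <- norm_C_R.
  apply (norm_RInt_le g (fun _ => M) a b _ _ Hab); auto.
  intros t Ht. rewrite norm_C_R. auto.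
Qed.

Lemma contR_plus f g t : contR f t -> contR g t -> contR (fun t => f t + g t)%C t.
Proof.
  intros H K e He. destruct (H (e / 2)) as [d [Hd A]]; [lra|]. destruct (K (e / 2)) as [d' [Hd' B]]; [lra|].
  exists (Rmin d d'). split. now apply Rmin_pos. intros s Hs.
  assert (A' := A s (Rlt_le_trans _ _ _ Hs (Rmin_l _ _))).
  assert (B' := B s (Rlt_le_trans _ _ _ Hs (Rmin_r _ _))).
  replace (f s + g s - (f t + g t))%C with ((f s - f t) + (g s - g t))%C by ring.
  assert (T := Cmod_triangle (f s - f t) (g s - g t)). lra.
Qed.

Lemma contR_const c t : contR (fun _ => c) t.
Proof.
  intros e He. exists 1. split; [lra|]. intros s _. replace (c - c)%C with (RtoC 0) by ring.
  now rewrite Cmod_0.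
Qed.

Lemma contR_mult f g t : contR f t -> contR g t -> contR (fun t => f t * g t)%C t.
Proof.
  intros H K e He. assert (Pf := Cmod_ge_0 (f t)). assert (Pg := Cmod_ge_0 (g t)).
  set (M := Cmod (f t) + Cmod (g t) + 1). assert (HM : 0 < M) by (unfold M; lra).
  set (e1 := Rmin 1 (e / (2 * M))).
  assert (He1 : 0 < e1). { unfold e1. apply Rmin_pos. lra. apply Rdiv_lt_0_compat; lra. }
  destruct (H e1 He1) as [d [Hd A]]. destruct (K e1 He1) as [d' [Hd' B]].
  exists (Rmin d d'). split. now apply Rmin_pos. intros s Hs.
  assert (A' := A s (Rlt_le_trans _ _ _ Hs (Rmin_l _ _))).
  assert (B' := B s (Rlt_le_trans _ _ _ Hs (Rmin_r _ _))).
  replace (f s * g s - f t * g t)%C with ((f s - f t) * g s + f t * (g s - g t))%C by ring.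
  assert (T := Cmod_triangle ((f s - f t) * g s) (f t * (g s - g t))). rewrite !Cmod_mult in T.
  assert (Gs : Cmod (g s) <= M).
  { assert (X := Cmod_triangle_rev (g s) (g t)). assert (e1 <= 1) by apply Rmin_l. unfold M. lra. }
  assert (E2 : e1 * M <= e / 2).
  { apply Rle_trans with (e / (2 * M) * M). apply Rmult_le_compat_r. lra. apply Rmin_r.
    apply Req_le. field. lra. }
  assert (X1 : Cmod (f s - f t)%C * Cmod (g s) <= e / 2).
  { apply Rle_trans with (2 := E2). apply Rmult_le_compat; auto using Cmod_ge_0. lra. }
  assert (X2 : Cmod (f t) * Cmod (g s - g t)%C < e / 2).
  { destruct Pf as [Pf|Pf].
    - apply Rlt_le_trans with (2 := E2). rewrite (Rmult_comm e1). apply Rle_lt_trans with (M * Cmod (g s - g t)%C).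
      apply Rmult_le_compat_r. apply Cmod_ge_0. unfold M; lra. now apply Rmult_lt_compat_l.
    - rewrite <- Pf. lra. }
  lra.
Qed.

Lemma contR_scal c g t : contR g t -> contR (fun t => c * g t)%C t.
Proof. intros. apply contR_mult; auto. apply contR_const. Qed.

Lemma contR_comp F g t : cont F (g t) -> contR g t -> contR (fun t => F (g t)) t.
Proof.
  intros H K e He. destruct (H e He) as [d [Hd A]]. destruct (K d Hd) as [d' [Hd' B]].
  exists d'. auto.
Qed.

Lemma CI_ext f g a b : (forall t, Rmin a b <= t <= Rmax a b -> f t = g t) -> CI f a b = CI g a b.
Proof. intros H. unfold CI. f_equal; apply RInt_ext; intros t Ht; rewrite H; auto; lra. Qed.

Lemma CI_plus f g a b : contI f a b -> contI g a b ->
  CI (fun t => f t + g t)%C a b = (CI f a b + CI g a b)%C.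
Proof.
  intros H K. apply injective_projections; simpl.
  - apply (RInt_plus (V := R_CompleteNormedModule) (fun t => Re (f t)) (fun t => Re (g t))); now apply CI_ex_re.
  - apply (RInt_plus (V := R_CompleteNormedModule) (fun t => Im (f t)) (fun t => Im (g t))); now apply CI_ex_im.
Qed.

Lemma CI_scal c g a b : contI g a b -> CI (fun t => c * g t)%C a b = (c * CI g a b)%C.
Proof.
  intros H. assert (E1 := CI_ex_re _ _ _ H). assert (E2 := CI_ex_im _ _ _ H).
  assert (S : forall (k : R) u, ex_RInt u a b -> ex_RInt (fun t => k * u t) a b).
  { intros k u Hu. now apply (ex_RInt_scal (V := R_CompleteNormedModule) u a b k). }
  assert (S' : forall (k : R) u, ex_RInt u a b -> RInt (fun t => k * u t) a b = k * RInt u a b).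
  { intros k u Hu. now apply (RInt_scal (V := R_CompleteNormedModule) u a b k). }
  unfold CI. apply injective_projections.
  - change (RInt (fun t => Re c * Re (g t) - Im c * Im (g t)) a b =
      Re c * RInt (fun t => Re (g t)) a b - Im c * RInt (fun t => Im (g t)) a b).
    rewrite <- !S' by auto.
    apply (RInt_minus (V := R_CompleteNormedModule) (fun t => Re c * Re (g t)) (fun t => Im c * Im (g t))); auto.
  - change (RInt (fun t => Re c * Im (g t) + Im c * Re (g t)) a b =
      Re c * RInt (fun t => Im (g t)) a b + Im c * RInt (fun t => Re (g t)) a b).
    rewrite <- !S' by auto.
    apply (RInt_plus (V := R_CompleteNormedModule) (fun t => Re c * Im (g t)) (fun t => Im c * Re (g t))); auto.
Qed.

Lemma contI_plus f g a b : contI f a b -> contI g a b -> contI (fun t => f t + g t)%C a b.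
Proof. intros H K t Ht. apply contR_plus; auto. Qed.

Lemma contI_scal c g a b : contI g a b -> contI (fun t => c * g t)%C a b.
Proof. intros H t Ht. apply contR_scal; auto. Qed.

Lemma CI_minus f g a b : contI f a b -> contI g a b ->
  CI (fun t => f t - g t)%C a b = (CI f a b - CI g a b)%C.
Proof.
  intros H K. rewrite (CI_ext _ (fun t => f t + (-(1)) * g t)%C).
  rewrite CI_plus, CI_scal; auto. ring. now apply contI_scal. intros; ring.
Qed.

Lemma CI_chasles g a b c : (forall t, contR g t) \/ (contI g a b /\ contI g b c) ->
  (CI g a b + CI g b c)%C = CI g a c.
Proof.
  intros H. assert (H' : contI g a b /\ contI g b c).
  { destruct H as [H|H]; auto. split; intros t _; auto. } destruct H' as [H1 H2].
  apply injective_projections; simpl.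
  - apply (RInt_Chasles (V := R_CompleteNormedModule)); now apply CI_ex_re.
  - apply (RInt_Chasles (V := R_CompleteNormedModule)); now apply CI_ex_im.
Qed.

Lemma CI_point g a : CI g a a = 0%C.
Proof. apply injective_projections; simpl; apply (RInt_point (V := R_CompleteNormedModule)). Qed.

Lemma CI_swap g a b : contI g a b -> CI g b a = (- CI g a b)%C.
Proof.
  intros H. assert (H' : contI g b a). { intros t Ht. apply H. now rewrite Rmin_comm, Rmax_comm. }
  assert (X := CI_chasles g a b a (or_intror (conj H H'))). rewrite CI_point in X.
  replace (CI g b a) with (CI g a b + CI g b a - CI g a b)%C by ring. rewrite X. ring.
Qed.

Lemma CI_norm_abs g a b M : contI g a b ->
  (forall t, Rmin a b <= t <= Rmax a b -> Cmod (g t) <= M) -> Cmod (CI g a b) <= M * Rabs (b - a).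
Proof.
  intros H HM. destruct (Rle_dec a b) as [L|L].
  - rewrite Rmin_left, Rmax_right in HM by auto. rewrite Rabs_pos_eq by lra. now apply CI_norm.
  - assert (H' : contI g b a). { intros t Ht. apply H. now rewrite Rmin_comm, Rmax_comm. }
    rewrite CI_swap, Cmod_opp by auto. rewrite Rmin_right, Rmax_left in HM by lra.
    rewrite Rabs_left1 by lra. replace (- (b - a)) with (a - b) by ring. apply CI_norm; auto; lra.
Qed.

Lemma CI_FTC (G g : R -> C) a b : contI g a b ->
  (forall t, Rmin a b <= t <= Rmax a b -> is_derive (fun t => Re (G t)) t (Re (g t)) /\
    is_derive (fun t => Im (G t)) t (Im (g t))) ->
  CI g a b = (G b - G a)%C.
Proof.
  intros H D. apply injective_projections; simpl; apply is_RInt_unique.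
  - apply (is_RInt_derive (V := R_CompleteNormedModule) (fun t => Re (G t))).
    intros t Ht. apply D; auto. intros t Ht. apply contR_re. auto.
  - apply (is_RInt_derive (V := R_CompleteNormedModule) (fun t => Im (G t))).
    intros t Ht. apply D; auto. intros t Ht. apply contR_im. auto.
Qed.

(** * Goursat's theorem *)

Definition HI (F : C -> C) (y a b : R) : C := CI (fun x => F (x, y)) a b.
Definition VI (F : C -> C) (x c d : R) : C := CI (fun y => F (x, y)) c d.
(** The contour integral over the boundary, counterclockwise when a <= b and c <= d; [Ci] stands for
    dz = i dy on the vertical sides. *)
Definition rect_int (F : C -> C) (a b c d : R) : C :=
  (HI F c a b - HI F d a b + Ci * (VI F b c d - VI F a c d))%C.

(** The corners come in any order, because a primitive is integrated from a centre to points on all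
    sides of it. *)
Definition in_rect (a b c d : R) (z : C) : Prop :=
  Rmin a b <= Re z <= Rmax a b /\ Rmin c d <= Im z <= Rmax c d.

Lemma contR_pair_l (y t : R) : contR (fun x => (x, y)) t.
Proof.
  intros e He. exists e. split; auto. intros s Hs.
  replace ((s, y) - (t, y))%C with (RtoC (s - t)) by (apply injective_projections; simpl; ring).
  now rewrite Cmod_R.
Qed.

Lemma contR_pair_r (x t : R) : contR (fun y => (x, y)) t.
Proof.
  intros e He. exists e. split; auto. intros s Hs.
  replace ((x, s) - (x, t))%C with (RtoC (s - t) * Ci)%C by (apply injective_projections; simpl; ring).
  now rewrite Cmod_mult, Cmod_Ci, Cmod_R, Rmult_1_r.
Qed.

Lemma contI_h F y a b : (forall x, Rmin a b <= x <= Rmax a b -> cont F (x, y)) ->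
  contI (fun x => F (x, y)) a b.
Proof. intros H x Hx. apply (contR_comp F (fun x => (x, y))). auto. apply contR_pair_l. Qed.

Lemma contI_v F x c d : (forall y, Rmin c d <= y <= Rmax c d -> cont F (x, y)) ->
  contI (fun y => F (x, y)) c d.
Proof. intros H y Hy. apply (contR_comp F (fun y => (x, y))). auto. apply contR_pair_r. Qed.

Lemma minmax_l a b : Rmin a b <= a <= Rmax a b.
Proof. split. apply Rmin_l. apply Rmax_l. Qed.
Lemma minmax_r a b : Rmin a b <= b <= Rmax a b.
Proof. split. apply Rmin_r. apply Rmax_r. Qed.

Lemma rect_h F a b c d y : (forall z, in_rect a b c d z -> cont F z) ->
  Rmin c d <= y <= Rmax c d -> contI (fun x => F (x, y)) a b.
Proof. intros HF Hy. apply contI_h. intros x Hx. apply HF. split; auto. Qed.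

Lemma rect_v F a b c d x : (forall z, in_rect a b c d z -> cont F z) ->
  Rmin a b <= x <= Rmax a b -> contI (fun y => F (x, y)) c d.
Proof. intros HF Hx. apply contI_v. intros y Hy. apply HF. split; auto. Qed.

Lemma rect_int_plus F G a b c d :
  (forall z, in_rect a b c d z -> cont F z) -> (forall z, in_rect a b c d z -> cont G z) ->
  rect_int (fun z => F z + G z)%C a b c d = (rect_int F a b c d + rect_int G a b c d)%C.
Proof.
  intros HF HG. unfold rect_int, HI, VI.
  rewrite !CI_plus; first [ring | (apply rect_h with c d; auto using minmax_l, minmax_r) |
    (apply rect_v with a b; auto using minmax_l, minmax_r)].
Qed.

Lemma wd_h F x y a b : wd F (x, y) a b ->
  is_derive (fun t => Re (F (t, y))) x (Re (a + b)%C) /\ is_derive (fun t => Im (F (t, y))) x (Im (a + b)%C).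
Proof.
  intros H. assert (E : forall t, (t, y) = ((0, y) + RtoC t * 1)%C).
  { intros t. apply injective_projections; simpl; ring. }
  rewrite E in H. apply wd_line in H. destruct H as [H1 H2].
  replace (Cconj 1) with (RtoC 1) in * by (apply injective_projections; simpl; ring).
  rewrite !Cmult_1_r in *.
  split; (eapply is_derive_ext; [|eassumption]); intros t; req; now rewrite <- E.
Qed.

Lemma wd_v F x y a b : wd F (x, y) a b ->
  is_derive (fun t => Re (F (x, t))) y (Re (Ci * (a - b))%C) /\
  is_derive (fun t => Im (F (x, t))) y (Im (Ci * (a - b))%C).
Proof.
  intros H. assert (E : forall t, (x, t) = ((x, 0) + RtoC t * Ci)%C).
  { intros t. apply injective_projections; simpl; ring. }
  rewrite E in H. apply wd_line in H. destruct H as [H1 H2].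
  replace (a * Ci + b * Cconj Ci)%C with (Ci * (a - b))%C in *
    by (apply injective_projections; simpl; ring).
  split; (eapply is_derive_ext; [|eassumption]); intros t; req; now rewrite <- E.
Qed.

Lemma HI_primitive F G y a b : (forall x, Rmin a b <= x <= Rmax a b -> cont F (x, y) /\ wd G (x, y) (F (x, y)) 0) ->
  HI F y a b = (G (b, y) - G (a, y))%C.
Proof.
  intros H. apply (CI_FTC (fun x => G (x, y))).
  - apply contI_h. intros x Hx. apply H; auto.
  - intros x Hx. destruct (H x Hx) as [_ X]. apply wd_h in X. now rewrite Cplus_0_r in X.
Qed.

Lemma VI_primitive F G x c d : (forall y, Rmin c d <= y <= Rmax c d -> cont F (x, y) /\ wd G (x, y) (F (x, y)) 0) ->
  (Ci * VI F x c d)%C = (G (x, d) - G (x, c))%C.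
Proof.
  intros H. assert (K : contI (fun y => F (x, y)) c d).
  { apply contI_v. intros y Hy. apply H; auto. }
  unfold VI. rewrite <- CI_scal by auto. apply (CI_FTC (fun y => G (x, y))).
  - now apply contI_scal.
  - intros y Hy. destruct (H y Hy) as [_ X]. apply wd_v in X.
    replace (F (x, y) - 0)%C with (F (x, y)) in X by ring. auto.
Qed.

Lemma rect_int_primitive F G a b c d :
  (forall z, in_rect a b c d z -> cont F z /\ wd G z (F z) 0) -> rect_int F a b c d = 0%C.
Proof.
  intros H. unfold rect_int. replace (Ci * (VI F b c d - VI F a c d))%C with (Ci * VI F b c d - Ci * VI F a c d)%C by ring.
  rewrite (HI_primitive F G c), (HI_primitive F G d), (VI_primitive F G b), (VI_primitive F G a). ring.
  all: intros t Ht; apply H; split; simpl; auto using minmax_l, minmax_r.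
Qed.

Lemma rect_int_bound F a b c d M : a <= b -> c <= d ->
  (forall z, in_rect a b c d z -> cont F z) ->
  (forall z, in_rect a b c d z -> Cmod (F z) <= M) ->
  Cmod (rect_int F a b c d) <= 2 * M * ((b - a) + (d - c)).
Proof.
  intros Hab Hcd HF HM. unfold rect_int, HI, VI.
  assert (A1 : Cmod (CI (fun x => F (x, c)) a b) <= M * (b - a)).
  { apply CI_norm; auto. apply rect_h with c d; auto using minmax_l.
    intros t Ht. apply HM. split; simpl; auto using minmax_l. rewrite Rmin_left, Rmax_right; auto. }
  assert (A2 : Cmod (CI (fun x => F (x, d)) a b) <= M * (b - a)).
  { apply CI_norm; auto. apply rect_h with c d; auto using minmax_r.
    intros t Ht. apply HM. split; simpl; auto using minmax_r. rewrite Rmin_left, Rmax_right; auto. }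
  assert (A3 : Cmod (CI (fun y => F (a, y)) c d) <= M * (d - c)).
  { apply CI_norm; auto. apply rect_v with a b; auto using minmax_l.
    intros t Ht. apply HM. split; simpl; auto using minmax_l. rewrite Rmin_left, Rmax_right; auto. }
  assert (A4 : Cmod (CI (fun y => F (b, y)) c d) <= M * (d - c)).
  { apply CI_norm; auto. apply rect_v with a b; auto using minmax_r.
    intros t Ht. apply HM. split; simpl; auto using minmax_r. rewrite Rmin_left, Rmax_right; auto. }
  apply Rle_trans with (1 := Cmod_triangle _ _). rewrite Cmod_mult, Cmod_Ci.
  assert (B1 := Cmod_triangle_sub (CI (fun x => F (x, c)) a b) (CI (fun x => F (x, d)) a b)).
  assert (B2 := Cmod_triangle_sub (CI (fun y => F (b, y)) c d) (CI (fun y => F (a, y)) c d)).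
  lra.
Qed.

Lemma in_rect_sub a b c d a' b' c' d' z :
  Rmin a b <= a' <= Rmax a b -> Rmin a b <= b' <= Rmax a b ->
  Rmin c d <= c' <= Rmax c d -> Rmin c d <= d' <= Rmax c d ->
  in_rect a' b' c' d' z -> in_rect a b c d z.
Proof.
  intros H1 H2 H3 H4 [H5 H6].
  assert (Rmin a b <= Rmin a' b') by (apply Rmin_glb; lra).
  assert (Rmax a' b' <= Rmax a b) by (apply Rmax_lub; lra).
  assert (Rmin c d <= Rmin c' d') by (apply Rmin_glb; lra).
  assert (Rmax c' d' <= Rmax c d) by (apply Rmax_lub; lra).
  split; lra.
Qed.

Lemma rect_int_split F a b c d m n : a <= m <= b -> c <= n <= d ->
  (forall z, in_rect a b c d z -> cont F z) ->
  rect_int F a b c d = (rect_int F a m c n + rect_int F m b c n +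
    (rect_int F a m n d + rect_int F m b n d))%C.
Proof.
  intros Hm Hn HF.
  assert (HH : forall y p q, c <= y <= d -> a <= p <= b -> a <= q <= b -> contI (fun x => F (x, y)) p q).
  { intros y p q Hy Hp Hq. apply contI_h. intros x Hx. apply HF.
    apply in_rect_sub with p q y y; rewrite ?(Rmin_left a b), ?(Rmax_right a b), ?(Rmin_left c d), ?(Rmax_right c d); try lra.
    split; simpl; auto using minmax_l. }
  assert (HV : forall x p q, a <= x <= b -> c <= p <= d -> c <= q <= d -> contI (fun y => F (x, y)) p q).
  { intros y p q Hy Hp Hq. apply contI_v. intros x Hx. apply HF.
    apply in_rect_sub with y y p q; rewrite ?(Rmin_left a b), ?(Rmax_right a b), ?(Rmin_left c d), ?(Rmax_right c d); try lra.
    split; simpl; auto using minmax_l. }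
  unfold rect_int, HI, VI.
  rewrite <- !(CI_chasles _ a m b), <- !(CI_chasles _ c n d).
  ring.
  all: right; split; first [apply HH; lra | apply HV; lra].
Qed.

Lemma pow2_pos k : 0 < 2 ^ k.
Proof. apply pow_lt. lra. Qed.

Lemma pow2_unbounded (x : R) : exists k, x < 2 ^ k.
Proof.
  destruct (Pow_x_infinity 2 (ltac:(rewrite Rabs_pos_eq; lra)) (x + 1)) as [N HN].
  exists N. specialize (HN N (Nat.le_refl N)). rewrite Rabs_pos_eq in HN.
  lra. apply Rlt_le, pow2_pos.
Qed.

Lemma nested_intervals (u : nat -> R) (L : R) :
  (forall k, u k <= u (S k) /\ u (S k) + L / 2 ^ (S k) <= u k + L / 2 ^ k) -> 0 <= L ->
  exists x, forall k, u k <= x <= u k + L / 2 ^ k.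
Proof.
  intros H HL.
  assert (Q : forall k, 0 <= L / 2 ^ k) by (intros k; apply Rle_div_pos; auto using pow2_pos).
  assert (A : forall n k, u k <= u (k + n)%nat /\ u (k + n)%nat + L / 2 ^ (k + n) <= u k + L / 2 ^ k).
  { induction n; intros k. rewrite Nat.add_0_r. lra.
    rewrite Nat.add_succ_r. specialize (IHn k). specialize (H (k + n)%nat). lra. }
  assert (B : forall j k, u j <= u k + L / 2 ^ k).
  { intros j k. destruct (Nat.le_ge_cases j k) as [E|E].
    - replace k with (j + (k - j))%nat by lia. specialize (A (k - j)%nat j). specialize (Q (j + (k - j))%nat). lra.
    - replace j with (k + (j - k))%nat by lia. specialize (A (j - k)%nat k). specialize (Q (k + (j - k))%nat). lra. }
  destruct (completeness (fun y => exists j, y = u j)) as [x [x1 x2]].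
  - exists (u 0%nat + L / 2 ^ 0). intros y [j ->]. apply B.
  - exists (u 0%nat). now exists 0%nat.
  - exists x. intros k. split. apply x1. now exists k. apply x2. intros y [j ->]. apply B.
Qed.

Lemma in_rect_dist a b c d z w : a <= b -> c <= d -> in_rect a b c d z -> in_rect a b c d w ->
  Cmod (z - w)%C <= (b - a) + (d - c).
Proof.
  intros H1 H2 [H3 H4] [H5 H6]. rewrite Rmin_left, Rmax_right in * by auto.
  replace (z - w)%C with (RtoC (Re z - Re w) + RtoC (Im z - Im w) * Ci)%C
    by (apply injective_projections; unfold Re, Im; simpl; ring).
  apply Rle_trans with (1 := Cmod_triangle _ _). rewrite Cmod_mult, Cmod_Ci, !Cmod_R.
  assert (Rabs (Re z - Re w) <= b - a) by (apply Rabs_le; lra).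
  assert (Rabs (Im z - Im w) <= d - c) by (apply Rabs_le; lra). lra.
Qed.

Lemma wd_affine_primitive al be z0 z :
  wd (fun w => al * w + be * ((w - z0) * (w - z0)) / 2)%C z (al + be * (z - z0))%C 0.
Proof.
  assert (X := wd_minus _ _ _ _ _ _ _ (wd_id z) (wd_const z0 z)).
  assert (Y := wd_plus _ _ _ _ _ _ _ (wd_scal al _ _ _ _ (wd_id z))
     (wd_scal (be / 2)%C _ _ _ _ (wd_mult _ _ _ _ _ _ _ X X))).
  apply wd_ext with (G := (fun w => al * w + be * ((w - z0) * (w - z0)) / 2)%C) in Y.
  eapply wd_eq. apply Y. field. field. intros w. field.
Qed.

Lemma rect_int_ext F G a b c d : (forall w, F w = G w) -> rect_int F a b c d = rect_int G a b c d.
Proof.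
  intros H. unfold rect_int, HI, VI.
  rewrite (CI_ext (fun x => F (x, c)) (fun x => G (x, c))), (CI_ext (fun x => F (x, d)) (fun x => G (x, d))),
    (CI_ext (fun x => F (b, x)) (fun x => G (b, x))), (CI_ext (fun x => F (a, x)) (fun x => G (a, x))); auto.
Qed.

(** Bisection: of the four quarters one carries at least a quarter of the integral. At the common
    point z of the nested rectangles F is affine up to o(|w - z|), and the affine part has a
    primitive. Pointwise differentiability suffices, which is the starting point for
    [holo_deriv]. *)
Lemma goursat_rect F a b c d : a <= b -> c <= d ->
  (forall z, in_rect a b c d z -> exists l, wd F z l 0) -> rect_int F a b c d = 0%C.
Proof.
  intros Hab Hcd HF.
  set (L := b - a). set (M := d - c).
  assert (Q : forall X k, 0 <= X -> 0 <= X / 2 ^ k) by (intros X k; intros; apply Rle_div_pos; auto using pow2_pos).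
  assert (HL : 0 <= L) by (unfold L; lra). assert (HM : 0 <= M) by (unfold M; lra).
  assert (Hh : forall X k, X / 2 ^ k = X / 2 ^ (S k) + X / 2 ^ (S k)).
  { intros X k. simpl. field. apply Rgt_not_eq, pow2_pos. }
  set (I := fun k (p : R * R) => rect_int F (fst p) (fst p + L / 2 ^ k) (snd p) (snd p + M / 2 ^ k)).
  set (valid := fun k (p : R * R) => a <= fst p /\ fst p + L / 2 ^ k <= b /\ c <= snd p /\ snd p + M / 2 ^ k <= d).
  set (sub := fun k (p q : R * R) => fst p <= fst q /\ fst q + L / 2 ^ (S k) <= fst p + L / 2 ^ k /\
      snd p <= snd q /\ snd q + M / 2 ^ (S k) <= snd p + M / 2 ^ k).
  assert (C0 : forall z, in_rect a b c d z -> cont F z).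
  { intros z Hz. destruct (HF z Hz) as [l Hl]. now apply wd_cont in Hl. }
  assert (Sub : forall k p z, valid k p -> in_rect (fst p) (fst p + L / 2 ^ k) (snd p) (snd p + M / 2 ^ k) z ->
     in_rect a b c d z).
  { intros k p z [V1 [V2 [V3 V4]]]. assert (Q1 := Q L k HL). assert (Q2 := Q M k HM).
    apply in_rect_sub; rewrite ?(Rmin_left a b), ?(Rmax_right a b), ?(Rmin_left c d), ?(Rmax_right c d); lra. }
  (* [valid] is assumed under the existential so that the choice of a quarter, [next], is a total
     function. *)
  assert (Step : forall k p, exists q, valid k p -> sub k p q /\ Cmod (I k p) <= 4 * Cmod (I (S k) q)).
  { intros k p. destruct (classic (valid k p)) as [V|V]; [|exists p; tauto].
    apply NNPP. intros N.
    assert (N' : forall q, sub k p q -> 4 * Cmod (I (S k) q) < Cmod (I k p)).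
    { intros q Hq. apply Rnot_le_lt. intros G. apply N. exists q. auto. }
    assert (Q1 := Q L (S k) HL). assert (Q2 := Q M (S k) HM).
    assert (HL1 := Hh L k). assert (HM1 := Hh M k).
    assert (E : I k p = (I (S k) p + I (S k) (fst p + L / 2 ^ (S k), snd p)%R +
       (I (S k) (fst p, snd p + M / 2 ^ (S k))%R + I (S k) (fst p + L / 2 ^ (S k), snd p + M / 2 ^ (S k))%R))%C).
    { unfold I. rewrite (rect_int_split F _ _ _ _ (fst p + L / 2 ^ (S k)) (snd p + M / 2 ^ (S k))); try lra.
      - rewrite HL1, HM1. cbn [fst snd]. rewrite <- !Rplus_assoc. reflexivity.
      - intros z Hz. apply C0. revert Hz. now apply Sub. }
    assert (N1 := N' p). assert (N2 := N' (fst p + L / 2 ^ (S k), snd p)).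
    assert (N3 := N' (fst p, snd p + M / 2 ^ (S k))). assert (N4 := N' (fst p + L / 2 ^ (S k), snd p + M / 2 ^ (S k))).
    unfold sub in N1, N2, N3, N4. cbn [fst snd] in *.
    assert (N1' := N1 ltac:(lra)). assert (N2' := N2 ltac:(lra)).
    assert (N3' := N3 ltac:(lra)). assert (N4' := N4 ltac:(lra)).
    rewrite E in N1', N2', N3', N4'.
    set (i1 := I (S k) p) in *. set (i2 := I (S k) (fst p + L / 2 ^ (S k), snd p)) in *.
    set (i3 := I (S k) (fst p, snd p + M / 2 ^ (S k))) in *.
    set (i4 := I (S k) (fst p + L / 2 ^ (S k), snd p + M / 2 ^ (S k))) in *.
    assert (T1 := Cmod_triangle (i1 + i2) (i3 + i4)). assert (T2 := Cmod_triangle i1 i2).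
    assert (T3 := Cmod_triangle i3 i4). lra. }
  set (next := fun k p => proj1_sig (constructive_indefinite_description _ (Step k p))).
  assert (Hnext : forall k p, valid k p -> sub k p (next k p) /\ Cmod (I k p) <= 4 * Cmod (I (S k) (next k p))).
  { intros k p. exact (proj2_sig (constructive_indefinite_description _ (Step k p))). }
  set (s := fix s k := match k with O => (a, c) | S k => next k (s k) end).
  assert (V : forall k, valid k (s k)).
  { induction k. unfold valid, L, M; simpl. lra.
    destruct (Hnext k _ IHk) as [[S1 [S2 [S3 S4]]] _]. destruct IHk as [V1 [V2 [V3 V4]]].
    change (s (S k)) with (next k (s k)). unfold valid. lra. }
  assert (Sb : forall k, sub k (s k) (s (S k))) by (intros k; apply Hnext, V).
  assert (G : forall k, Cmod (I O (s O)) <= 4 ^ k * Cmod (I k (s k))).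
  { induction k. simpl. lra. destruct (Hnext k _ (V k)) as [_ G]. change (s (S k)) with (next k (s k)).
    apply Rle_trans with (1 := IHk). simpl. rewrite (Rmult_comm 4), Rmult_assoc.
    apply Rmult_le_compat_l; auto. apply pow_le; lra. }
  destruct (nested_intervals (fun k => fst (s k)) L) as [x Hx]; auto.
  { intros k. destruct (Sb k) as [S1 [S2 _]]. auto. }
  destruct (nested_intervals (fun k => snd (s k)) M) as [y Hy]; auto.
  { intros k. destruct (Sb k) as [_ [_ S2]]. auto. }
  set (z := (x, y) : C).
  assert (Hz : forall k, in_rect (fst (s k)) (fst (s k) + L / 2 ^ k) (snd (s k)) (snd (s k) + M / 2 ^ k) z).
  { intros k. specialize (Hx k). specialize (Hy k). split; simpl;
    rewrite Rmin_left, Rmax_right; lra. }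
  destruct (HF z (Sub _ _ _ (V O) (Hz O))) as [l Hl].
  apply Cmod_eq_0. apply Rle_antisym; [|apply Cmod_ge_0].
  apply le_epsilon. intros eps Heps. rewrite Rplus_0_l.
  set (N := L + M). assert (HN : 0 <= N) by (unfold N; lra).
  assert (HNN : 0 <= N * N) by now apply Rmult_le_pos.
  (* The k-th rectangle has half perimeter N / 2^k, so the error integrates to at most 2 (eps / (2
     (N^2 + 1))) (N / 2^k)^2. The factor 4^k from the bisection cancels 4^-k; N^2 + 1 instead of N^2
     serves degenerate rectangles. *)
  destruct (Hl (eps / (2 * (N * N + 1)))) as [del [Hdel Hw]]. { apply Rdiv_lt_0_compat; lra. }
  destruct (pow2_unbounded (N / del)) as [k Hk].
  assert (Pk := pow2_pos k).
  assert (HNk : N / 2 ^ k < del). { apply Rlt_div_l; auto. apply Rlt_div_l in Hk; auto. lra. }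
  assert (Gk := G k). unfold I at 1 in Gk. unfold L, M in Gk. cbn [s fst snd pow] in Gk.
  replace (a + (b - a) / 1) with b in Gk by field. replace (c + (d - c) / 1) with d in Gk by field.
  apply Rle_trans with (1 := Gk). clear Gk.
  set (Aff := fun w => (F z + l * (w - z))%C).
  set (Er := fun w => (F w - F z - l * (w - z) - 0 * Cconj (w - z))%C).
  assert (CA : forall w, cont Aff w).
  { intros w. unfold Aff. eapply wd_cont. apply wd_plus. apply wd_const. apply wd_scal.
    apply wd_minus. apply wd_id. apply wd_const. }
  assert (CE : forall w, in_rect a b c d w -> cont Er w).
  { intros w Hw'. destruct (HF w Hw') as [l' Hl']. unfold Er. eapply wd_cont. apply wd_minus. apply wd_minus.
    apply wd_minus. apply Hl'. apply wd_const. apply wd_scal. apply wd_minus. apply wd_id. apply wd_const.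
    apply wd_scal. apply wd_conj. apply wd_minus. apply wd_id. apply wd_const. }
  assert (E1 : I k (s k) = rect_int Er (fst (s k)) (fst (s k) + L / 2 ^ k) (snd (s k)) (snd (s k) + M / 2 ^ k)).
  { unfold I. transitivity (rect_int (fun w => Aff w + Er w)%C (fst (s k)) (fst (s k) + L / 2 ^ k) (snd (s k)) (snd (s k) + M / 2 ^ k)).
    - apply rect_int_ext. intros w. unfold Aff, Er. ring.
    - rewrite rect_int_plus; auto.
      rewrite (rect_int_primitive Aff (fun w => F z * w + l * ((w - z) * (w - z)) / 2)%C). ring.
      intros w _. split; auto. apply wd_affine_primitive.
      intros w Hw'. apply CE. now apply Sub with k (s k). }
  rewrite E1.
  assert (Q1 := Q L k HL). assert (Q2 := Q M k HM).
  assert (B := rect_int_bound Er (fst (s k)) (fst (s k) + L / 2 ^ k) (snd (s k)) (snd (s k) + M / 2 ^ k)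
     (eps / (2 * (N * N + 1)) * (N / 2 ^ k))).
  assert (EN : N / 2 ^ k = L / 2 ^ k + M / 2 ^ k) by (unfold N; field; lra).
  assert (B' : Cmod (rect_int Er (fst (s k)) (fst (s k) + L / 2 ^ k) (snd (s k)) (snd (s k) + M / 2 ^ k)) <=
     2 * (eps / (2 * (N * N + 1)) * (N / 2 ^ k)) * (N / 2 ^ k)).
  { eapply Rle_trans; [apply B; [lra|lra| |] | apply Req_le; rewrite EN; ring].
    - intros w Hw'. apply CE. now apply Sub with k (s k).
    - intros w Hw'. assert (D := in_rect_dist (fst (s k)) (fst (s k) + L / 2 ^ k) (snd (s k)) (snd (s k) + M / 2 ^ k) w z ltac:(lra) ltac:(lra) Hw' (Hz k)).
      assert (D' : Cmod (w - z)%C <= N / 2 ^ k) by lra.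
      apply Rle_trans with (1 := Hw w ltac:(lra)). apply Rmult_le_compat_l; auto.
      apply Rle_div_pos; lra. }
  apply Rle_trans with (4 ^ k * (2 * (eps / (2 * (N * N + 1)) * (N / 2 ^ k)) * (N / 2 ^ k))).
  apply Rmult_le_compat_l; auto. apply pow_le; lra.
  replace 4 with (2 * 2) by ring. rewrite Rpow_mult_distr.
  replace (2 ^ k * 2 ^ k * (2 * (eps / (2 * (N * N + 1)) * (N / 2 ^ k)) * (N / 2 ^ k))) with
    (eps * ((N * N) / (N * N + 1))) by (field; lra).
  rewrite <- (Rmult_1_r eps) at 2. apply Rmult_le_compat_l; [lra|]. apply Rle_div_l; lra.
Qed.

Lemma goursat F a b c d :
  (forall z, in_rect a b c d z -> exists l, wd F z l 0) -> rect_int F a b c d = 0%C.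
Proof.
  intros HF.
  assert (C0 : forall z, in_rect a b c d z -> cont F z).
  { intros z Hz. destruct (HF z Hz) as [l Hl]. now apply wd_cont in Hl. }
  assert (Sy1 : forall p q r s z, in_rect p q r s z -> in_rect q p r s z).
  { intros p q r s z [H1 H2]. split; auto. now rewrite Rmin_comm, Rmax_comm. }
  assert (Sy2 : forall p q r s z, in_rect p q r s z -> in_rect p q s r z).
  { intros p q r s z [H1 H2]. split; auto. now rewrite Rmin_comm, Rmax_comm. }
  assert (S1 : rect_int F b a c d = (- rect_int F a b c d)%C).
  { unfold rect_int, HI, VI. rewrite (CI_swap _ a b), (CI_swap _ a b). ring.
    apply rect_h with c d; auto using minmax_r. apply rect_h with c d; auto using minmax_l. }
  assert (S2 : rect_int F a b d c = (- rect_int F a b c d)%C).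
  { unfold rect_int, HI, VI. rewrite (CI_swap _ c d), (CI_swap _ c d). ring.
    apply rect_v with a b; auto using minmax_l. apply rect_v with a b; auto using minmax_r. }
  assert (S3 : rect_int F b a d c = rect_int F a b c d).
  { unfold rect_int, HI, VI. rewrite !(CI_swap _ a b), !(CI_swap _ c d). ring.
    all: first [apply rect_v with a b; auto using minmax_l, minmax_r; fail | apply rect_h with c d; auto using minmax_l, minmax_r]. }
  assert (Op : forall w : C, (- w)%C = 0%C -> w = 0%C).
  { intros w Hw. replace w with (- - w)%C by ring. rewrite Hw. ring. }
  destruct (Rle_dec a b); destruct (Rle_dec c d).
  - apply goursat_rect; auto.
  - apply Op. rewrite <- S2. apply goursat_rect; auto; lra.
  - apply Op. rewrite <- S1. apply goursat_rect; auto; lra.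
  - rewrite <- S3. apply goursat_rect; auto; lra.
Qed.

Definition in_square (z0 : C) (r : R) (z : C) : Prop :=
  Rabs (Re z - Re z0) < r /\ Rabs (Im z - Im z0) < r.

(** The primitive is the integral from the centre, first along a horizontal and then along a
    vertical side. *)
Lemma primitive_square F z0 r :
  (forall z, in_square z0 r z -> exists l, wd F z l 0) ->
  exists G, forall z, in_square z0 r z -> wd G z (F z) 0.
Proof.
  intros HF. set (x0 := Re z0). set (y0 := Im z0).
  exists (fun z => HI F y0 x0 (Re z) + Ci * VI F (Re z) y0 (Im z))%C.
  intros z [Hx Hy]. fold x0 in Hx. fold y0 in Hy.
  assert (C0 : forall z, in_square z0 r z -> cont F z).
  { intros w Hw. destruct (HF w Hw) as [l Hl]. now apply wd_cont in Hl. }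
  assert (Hr : 0 < r). { assert (X := Rabs_pos (Re z - x0)). lra. }
  assert (IR : forall a b c d w, Rabs (a - x0) < r -> Rabs (b - x0) < r -> Rabs (c - y0) < r -> Rabs (d - y0) < r ->
     in_rect a b c d w -> in_square z0 r w).
  { intros a b c d w H1 H2 H3 H4 [H5 H6]. apply Rabs_lt_between in H1, H2, H3, H4.
    assert (- r + x0 < Rmin a b) by (apply Rmin_glb_lt; lra).
    assert (Rmax a b < r + x0) by (apply Rmax_lub_lt; lra).
    assert (- r + y0 < Rmin c d) by (apply Rmin_glb_lt; lra).
    assert (Rmax c d < r + y0) by (apply Rmax_lub_lt; lra).
    split; apply Rabs_lt_between; fold x0 y0; lra. }
  assert (HH : forall y a b, Rabs (a - x0) < r -> Rabs (b - x0) < r -> Rabs (y - y0) < r ->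
      contI (fun x => F (x, y)) a b).
  { intros y a b H1 H2 H3. apply rect_h with y y; auto using minmax_l.
    intros w Hw. apply C0. revert Hw. now apply IR. }
  assert (HV : forall x a b, Rabs (a - y0) < r -> Rabs (b - y0) < r -> Rabs (x - x0) < r ->
      contI (fun y => F (x, y)) a b).
  { intros y a b H1 H2 H3. apply rect_v with y y; auto using minmax_l.
    intros w Hw. apply C0. revert Hw. now apply IR. }
  assert (R0 : Rabs (x0 - x0) < r) by (rewrite Rminus_diag, Rabs_R0; lra).
  assert (R0' : Rabs (y0 - y0) < r) by (rewrite Rminus_diag, Rabs_R0; lra).
  assert (Sq : forall w, Cmod (w - z)%C < Rmin (r - Rabs (Re z - x0)) (r - Rabs (Im z - y0)) ->
     Rabs (Re w - x0) < r /\ Rabs (Im w - y0) < r).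
  { intros w Hw. assert (M1 := Rmin_l (r - Rabs (Re z - x0)) (r - Rabs (Im z - y0))).
    assert (M2 := Rmin_r (r - Rabs (Re z - x0)) (r - Rabs (Im z - y0))).
    assert (A1 := re_le_Cmod (w - z)%C). assert (A2 := im_le_Cmod (w - z)%C).
    rewrite re_minus in A1. rewrite im_minus in A2.
    assert (B1 := Rabs_triang (Re w - Re z) (Re z - x0)). assert (B2 := Rabs_triang (Im w - Im z) (Im z - y0)).
    replace (Re w - Re z + (Re z - x0)) with (Re w - x0) in B1 by ring.
    replace (Im w - Im z + (Im z - y0)) with (Im w - y0) in B2 by ring. lra. }
  intros eps Heps.
  destruct (C0 z (conj Hx Hy) (eps / 2) ltac:(lra)) as [d1 [Hd1 Hc]].
  exists (Rmin (Rmin (r - Rabs (Re z - x0)) (r - Rabs (Im z - y0))) (d1 / 2)).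
  split. { repeat apply Rmin_pos; lra. }
  intros w Hw.
  destruct (Sq w (Rlt_le_trans _ _ _ Hw (Rmin_l _ _))) as [Wx Wy].
  assert (Hw2 := Rlt_le_trans _ _ _ Hw (Rmin_r _ _)).
  (* By Goursat's theorem on the rectangle between Re z, Re w, y0 and Im z, the path to w can be
     rerouted through z. What remains is the horizontal side starting at z and the vertical side
     ending at w. *)
  assert (E : (HI F y0 x0 (Re w) + Ci * VI F (Re w) y0 (Im w) - (HI F y0 x0 (Re z) + Ci * VI F (Re z) y0 (Im z)))%C
     = (HI F (Im z) (Re z) (Re w) + Ci * VI F (Re w) (Im z) (Im w))%C).
  { assert (GR := goursat F (Re z) (Re w) y0 (Im z)).
    assert (GR' : rect_int F (Re z) (Re w) y0 (Im z) = 0%C).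
    { apply GR. intros v Hv. apply HF. revert Hv. apply IR; auto. }
    unfold rect_int, HI, VI in GR' |- *.
    rewrite <- (CI_chasles (fun x => F (x, y0)) x0 (Re z) (Re w)).
    2:{ right; split; apply HH; auto. }
    rewrite <- (CI_chasles (fun y => F (Re w, y)) y0 (Im z) (Im w)).
    2:{ right; split; apply HV; auto. }
    match goal with |- ?l = ?rr => replace l with (rr + (l - rr))%C by ring end.
    match goal with |- (_ + ?q)%C = _ => replace q with (RtoC 0) end. ring.
    rewrite <- GR'. ring. }
  rewrite E. clear E.
  assert (Cst : (HI (fun _ => F z) (Im z) (Re z) (Re w) + Ci * VI (fun _ => F z) (Re w) (Im z) (Im w))%C = (F z * (w - z))%C).
  { assert (Wc : forall v, cont (fun _ => F z) v /\ wd (fun v => F z * v)%C v (F z) 0).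
    { intros v. split. eapply wd_cont. apply wd_const. eapply wd_eq. apply wd_scal. apply wd_id. ring. ring. }
    rewrite (HI_primitive (fun _ => F z) (fun v => F z * v)%C) by (intros; apply Wc).
    rewrite (VI_primitive (fun _ => F z) (fun v => F z * v)%C) by (intros; apply Wc).
    transitivity (F z * ((Re w, Im w) - (Re z, Im z)))%C. ring. now destruct w, z. }
  replace (HI F (Im z) (Re z) (Re w) + Ci * VI F (Re w) (Im z) (Im w) - F z * (w - z) - 0 * Cconj (w - z))%C with
    (CI (fun x => F (x, Im z) - F z) (Re z) (Re w) + Ci * CI (fun y => F (Re w, y) - F z) (Im z) (Im w))%C.
  2:{ rewrite <- Cst. unfold HI, VI. rewrite !CI_minus; auto. ring.
      intros t _; apply contR_const. intros t _; apply contR_const. }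
  assert (Dx1 : Rabs (Re w - Re z) <= Cmod (w - z)%C) by (rewrite <- re_minus; apply re_le_Cmod).
  assert (Dy1 : Rabs (Im w - Im z) <= Cmod (w - z)%C) by (rewrite <- im_minus; apply im_le_Cmod).
  assert (Near : forall x y, Rmin (Re z) (Re w) <= x <= Rmax (Re z) (Re w) ->
     Rmin (Im z) (Im w) <= y <= Rmax (Im z) (Im w) -> Cmod (F (x, y) - F z)%C <= eps / 2).
  { intros x y H1 H2. apply Rlt_le, Hc.
    assert (X1 : Rabs (x - Re z) <= Rabs (Re w - Re z)).
    { unfold Rmin, Rmax in H1. destruct (Rle_dec (Re z) (Re w)); unfold Rabs; repeat destruct Rcase_abs; lra. }
    assert (X2 : Rabs (y - Im z) <= Rabs (Im w - Im z)).
    { unfold Rmin, Rmax in H2. destruct (Rle_dec (Im z) (Im w)); unfold Rabs; repeat destruct Rcase_abs; lra. }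
    replace ((x, y) - z)%C with (RtoC (x - Re z) + RtoC (y - Im z) * Ci)%C
      by (apply injective_projections; unfold Re, Im; simpl; ring).
    apply Rle_lt_trans with (1 := Cmod_triangle _ _). rewrite Cmod_mult, Cmod_Ci, !Cmod_R. lra. }
  apply Rle_trans with (1 := Cmod_triangle _ _). rewrite Cmod_mult, Cmod_Ci, Rmult_1_l.
  assert (B1 : Cmod (CI (fun x => F (x, Im z) - F z)%C (Re z) (Re w)) <= eps / 2 * Rabs (Re w - Re z)).
  { apply CI_norm_abs. intros t Ht. apply contR_plus. apply (HH (Im z) (Re z) (Re w)); auto. apply contR_const.
    intros t Ht. apply Near; auto using minmax_l. }
  assert (B2 : Cmod (CI (fun y => F (Re w, y) - F z)%C (Im z) (Im w)) <= eps / 2 * Rabs (Im w - Im z)).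
  { apply CI_norm_abs. intros t Ht. apply contR_plus. apply (HV (Re w) (Im z) (Im w)); auto. apply contR_const.
    intros t Ht. apply Near; auto using minmax_r. }
  assert (eps / 2 * Rabs (Re w - Re z) <= eps / 2 * Cmod (w - z)%C) by (apply Rmult_le_compat_l; lra).
  assert (eps / 2 * Rabs (Im w - Im z) <= eps / 2 * Cmod (w - z)%C) by (apply Rmult_le_compat_l; lra).
  lra.
Qed.

(** * Cauchy's formula *)

(** h = 0 is allowed and the bound is not strict, so that remainders can be composed without
    division. *)
Definition cder (g : R -> C) (t : R) (l : C) : Prop :=
  forall eps, 0 < eps -> exists d, 0 < d /\ forall h, Rabs h < d ->
    Cmod (g (t + h)%R - g t - RtoC h * l)%C <= eps * Rabs h.

Lemma cder_components g t l : cder g t l ->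
  is_derive (fun t => Re (g t)) t (Re l) /\ is_derive (fun t => Im (g t)) t (Im l).
Proof.
  intros H.
  assert (Y : forall u v l h eps : R, 0 < eps -> h <> 0 -> Rabs (u - v - h * l) <= eps / 2 * Rabs h ->
     Rabs ((u - v) / h - l) < eps).
  { intros u v l' h eps He Hh G. assert (P := Rabs_pos_lt _ Hh).
    replace ((u - v) / h - l') with ((u - v - h * l') / h) by (field; auto).
    unfold Rdiv at 1. rewrite Rabs_mult, Rabs_inv. apply Rlt_div_l; auto.
    apply Rle_lt_trans with (1 := G). apply Rmult_lt_compat_r; lra. }
  split; apply is_derive_Reals; intros eps He; destruct (H (eps / 2) ltac:(lra)) as [d [Hd G]];
  exists (mkposreal d Hd); intros h Hh Hh'; apply Y; auto; apply Rle_trans with (2 := G h Hh').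
  - assert (U := re_le_Cmod (g (t + h)%R - g t - RtoC h * l)%C).
    now rewrite !re_minus, re_scal_l in U.
  - assert (U := im_le_Cmod (g (t + h)%R - g t - RtoC h * l)%C).
    now rewrite !im_minus, im_scal_l in U.
Qed.

Lemma cder_of_components g t l :
  is_derive (fun t => Re (g t)) t (Re l) -> is_derive (fun t => Im (g t)) t (Im l) -> cder g t l.
Proof.
  intros H1 H2. apply is_derive_Reals in H1. apply is_derive_Reals in H2.
  intros eps He. destruct (H1 (eps / 2) ltac:(lra)) as [d1 G1]. destruct (H2 (eps / 2) ltac:(lra)) as [d2 G2].
  exists (Rmin d1 d2). split. { apply Rmin_pos; apply cond_pos. }
  intros h Hh. destruct (Req_dec h 0) as [->|N].
  - rewrite Rplus_0_r, Rabs_R0. replace (_ - _ - _)%C with (RtoC 0) by ring. rewrite Cmod_0. lra.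
  - assert (A1 := G1 h N (Rlt_le_trans _ _ _ Hh (Rmin_l _ _))).
    assert (A2 := G2 h N (Rlt_le_trans _ _ _ Hh (Rmin_r _ _))).
    assert (Y : forall u v l h eps : R, h <> 0 -> Rabs ((u - v) / h - l) < eps / 2 ->
      Rabs (u - v - h * l) <= eps / 2 * Rabs h).
    { intros u v l' h' e' Hh' G. assert (P := Rabs_pos_lt _ Hh').
      replace (u - v - h' * l') with (((u - v) / h' - l') * h') by (field; auto).
      rewrite Rabs_mult. apply Rmult_le_compat_r; lra. }
    apply Y in A1; auto. apply Y in A2; auto.
    replace (g (t + h)%R - g t - RtoC h * l)%C with
      (RtoC (Re (g (t + h)%R) - Re (g t) - h * Re l) + RtoC (Im (g (t + h)%R) - Im (g t) - h * Im l) * Ci)%C.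
    2:{ apply injective_projections; unfold Re, Im; simpl; ring. }
    apply Rle_trans with (1 := Cmod_triangle _ _). rewrite Cmod_mult, Cmod_Ci, !Cmod_R. lra.
Qed.

Lemma cder_lip g t l : cder g t l -> exists d, 0 < d /\ forall h, Rabs h < d ->
  Cmod (g (t + h)%R - g t)%C <= (Cmod l + 1) * Rabs h.
Proof.
  intros H. destruct (H 1 Rlt_0_1) as [d [Hd G]]. exists d. split; auto. intros h Hh.
  specialize (G h Hh). replace (g (t + h)%R - g t)%C with ((g (t + h)%R - g t - RtoC h * l) + RtoC h * l)%C by ring.
  apply Rle_trans with (1 := Cmod_triangle _ _). rewrite Cmod_mult, Cmod_R. lra.
Qed.

Lemma cder_contR g t l : cder g t l -> contR g t.
Proof.
  intros H e He. destruct (cder_lip _ _ _ H) as [d [Hd G]].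
  assert (P := Cmod_ge_0 l).
  exists (Rmin d (e / (Cmod l + 1))). split. { apply Rmin_pos; auto. apply Rdiv_lt_0_compat; lra. }
  intros s Hs. replace s with (t + (s - t)) by ring.
  apply Rle_lt_trans with (1 := G _ (Rlt_le_trans _ _ _ Hs (Rmin_l _ _))).
  assert (B := Rlt_le_trans _ _ _ Hs (Rmin_r _ _)). apply Rlt_div_r in B; lra.
Qed.

Lemma cder_wd F g t a b l : wd F (g t) a b -> cder g t l ->
  cder (fun t => F (g t)) t (a * l + b * Cconj l)%C.
Proof.
  intros HF Hg. destruct (cder_lip _ _ _ Hg) as [d1 [Hd1 G1]]. assert (P := Cmod_ge_0 l).
  assert (Pa := Cmod_ge_0 a). assert (Pb := Cmod_ge_0 b).
  intros e He. destruct (HF (e / (2 * (Cmod l + 1)))) as [d2 [Hd2 G2]]. { apply Rdiv_lt_0_compat; lra. }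
  destruct (Hg (e / (2 * (Cmod a + Cmod b + 1)))) as [d3 [Hd3 G3]]. { apply Rdiv_lt_0_compat; lra. }
  exists (Rmin d3 (Rmin d1 (d2 / (Cmod l + 1)))).
  split. { repeat apply Rmin_pos; auto. apply Rdiv_lt_0_compat; lra. }
  intros h Hh. assert (H3 := G3 h (Rlt_le_trans _ _ _ Hh (Rmin_l _ _))).
  assert (Hh2 := Rlt_le_trans _ _ _ Hh (Rmin_r _ _)).
  assert (H1 := G1 h (Rlt_le_trans _ _ _ Hh2 (Rmin_l _ _))).
  assert (Hh3 := Rlt_le_trans _ _ _ Hh2 (Rmin_r _ _)).
  assert (L : Cmod (g (t + h)%R - g t)%C < d2).
  { apply Rle_lt_trans with (1 := H1). apply Rlt_div_r in Hh3; lra. }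
  assert (H2 := G2 _ L).
  set (u := (g (t + h)%R - g t - RtoC h * l)%C) in *.
  replace (F (g (t + h)%R) - F (g t) - RtoC h * (a * l + b * Cconj l))%C with
    ((F (g (t + h)%R) - F (g t) - a * (g (t + h)%R - g t) - b * Cconj (g (t + h)%R - g t)) +
      (a * u + b * Cconj u))%C.
  2:{ unfold u. rewrite !Cminus_conj, Cmult_conj, Cconj_RtoC. ring. }
  apply Rle_trans with (1 := Cmod_triangle _ _).
  assert (T := Cmod_triangle (a * u) (b * Cconj u)). rewrite !Cmod_mult, Cmod_conj in T.
  assert (X1 : e / (2 * (Cmod l + 1)) * Cmod (g (t + h)%R - g t)%C <= e / 2 * Rabs h).
  { apply Rle_trans with (e / (2 * (Cmod l + 1)) * ((Cmod l + 1) * Rabs h)).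
    apply Rmult_le_compat_l; auto. apply Rle_div_pos; lra. apply Req_le. field. lra. }
  assert (X2 : (Cmod a + Cmod b) * Cmod u <= e / 2 * Rabs h).
  { apply Rle_trans with ((Cmod a + Cmod b + 1) * (e / (2 * (Cmod a + Cmod b + 1)) * Rabs h)).
    apply Rmult_le_compat; auto using Cmod_ge_0; lra. apply Req_le. field. lra. }
  lra.
Qed.

Definition cis (t : R) : C := (cos t, sin t).

Lemma cder_cis t : cder cis t (Ci * cis t)%C.
Proof.
  apply cder_of_components; unfold cis, Re, Im; simpl.
  - evar_last. apply is_derive_cos. req. ring.
  - evar_last. apply is_derive_sin. req. ring.
Qed.

Lemma Cmod_cis t : Cmod (cis t) = 1.
Proof.
  unfold Cmod, cis. cbn [fst snd]. replace (cos t ^ 2 + sin t ^ 2) with (Rsqr (sin t) + Rsqr (cos t)) by (unfold Rsqr; ring).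
  rewrite sin2_cos2. apply sqrt_1.
Qed.

Lemma cis_2PI : cis (2 * PI) = cis 0.
Proof. unfold cis. now rewrite cos_2PI, sin_2PI, cos_0, sin_0. Qed.

Definition cont2 (G : R -> R -> C) (s t : R) : Prop :=
  forall eps, 0 < eps -> exists d, 0 < d /\ forall s' t', Rabs (s' - s) < d -> Rabs (t' - t) < d ->
    Cmod (G s' t' - G s t)%C < eps.

(** The tool for deforming contours: the integral of [G s] has as derivative the integral of [dG s],
    which is 0. The margin [eta] makes s = 0 and s = 1 interior points, as two-sided derivatives
    require. *)
Lemma CI_param_const (G dG : R -> R -> C) (a b eta : R) : 0 < eta ->
  (forall s t, - eta < s < 1 + eta ->
     is_derive (fun s => Re (G s t)) s (Re (dG s t)) /\
     is_derive (fun s => Im (G s t)) s (Im (dG s t))) ->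
  (forall s t, - eta < s < 1 + eta -> cont2 dG s t) ->
  (forall s t, - eta < s < 1 + eta -> contR (G s) t) ->
  (forall s, 0 <= s <= 1 -> CI (dG s) a b = 0%C) ->
  CI (G 1) a b = CI (G 0) a b.
Proof.
  intros Heta HD HC HG HI0.
  (* [pr] stands for [Re] and for [Im], so that the argument is made once. *)
  assert (Main : forall pr : C -> R,
     (forall g t, contR g t -> continuous (fun t => pr (g t)) t) ->
     (forall z w, Rabs (pr z - pr w) <= Cmod (z - w)%C) ->
     (forall s t, - eta < s < 1 + eta -> is_derive (fun s => pr (G s t)) s (pr (dG s t))) ->
     (forall s, 0 <= s <= 1 -> RInt (fun t => pr (dG s t)) a b = 0) ->
     RInt (fun t => pr (G 1 t)) a b = RInt (fun t => pr (G 0 t)) a b).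
  { intros pr P1 P2 PD P0. symmetry.
    apply (eq_is_derive (fun s => RInt (fun t => pr (G s t)) a b)); [|lra].
    intros s Hs.
    assert (Loc : locally s (fun y => - eta < y < 1 + eta)).
    { exists (mkposreal eta Heta). intros y Hy.
      assert (Hy' : Rabs (y - s) < eta) by exact Hy. apply Rabs_lt_between in Hy'. lra. }
    evar_last.
    - apply (is_derive_RInt_param (fun s t => pr (G s t))).
      + revert Loc. apply filter_imp. intros y Hy t _. exists (pr (dG y t)). now apply PD.
      + intros t _ eps. destruct (HC s t ltac:(lra) eps (cond_pos eps)) as [d [Hd Cn]].
        assert (Hm : 0 < Rmin d eta) by now apply Rmin_pos.
        exists (mkposreal _ Hm). intros u v Hu Hv.
        change (Rabs (u - s) < Rmin d eta) in Hu. change (Rabs (v - t) < Rmin d eta) in Hv.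
        change (Rabs (Derive (fun s => pr (G s v)) u - Derive (fun s => pr (G s t)) s) < eps).
        assert (M1 := Rmin_l d eta). assert (M2 := Rmin_r d eta).
        assert (Hu' : - eta < u < 1 + eta).
        { assert (X : Rabs (u - s) < eta) by lra. apply Rabs_lt_between in X. lra. }
        assert (Q1 : Derive (fun s => pr (G s v)) u = pr (dG u v)) by (apply is_derive_unique, PD; lra).
        assert (Q2 : Derive (fun s => pr (G s t)) s = pr (dG s t)) by (apply is_derive_unique, PD; lra).
        rewrite Q1, Q2.
        apply Rle_lt_trans with (1 := P2 _ _). apply Cn; lra.
      + revert Loc. apply filter_imp. intros y Hy. apply (ex_RInt_continuous (V := R_CompleteNormedModule)).
        intros t _. apply P1. now apply HG.
    - transitivity (RInt (fun t => pr (dG s t)) a b); [|exact (P0 s Hs)].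
      apply RInt_ext. intros t _. apply is_derive_unique. apply PD. lra. }
  unfold CI. f_equal.
  - apply (Main Re).
    + apply contR_re.
    + intros z w. rewrite <- re_minus. apply re_le_Cmod.
    + intros s t Hs. apply HD; auto.
    + intros s Hs. exact (f_equal Re (HI0 s Hs)).
  - apply (Main Im).
    + apply contR_im.
    + intros z w. rewrite <- im_minus. apply im_le_Cmod.
    + intros s t Hs. apply HD; auto.
    + intros s Hs. exact (f_equal Im (HI0 s Hs)).
Qed.

Definition circle (z0 : C) (r t : R) : C := (z0 + RtoC r * cis t)%C.

Lemma cder_circle z0 r t : cder (circle z0 r) t (Ci * RtoC r * cis t)%C.
Proof.
  assert (X := wd_plus _ _ _ _ _ _ _ (wd_const z0 (cis t)) (wd_scal (RtoC r) _ _ _ _ (wd_id (cis t)))).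
  assert (Y := cder_wd _ _ _ _ _ _ X (cder_cis t)). cbv beta in Y.
  unfold circle. replace (Ci * RtoC r * cis t)%C with
    ((0 + RtoC r * 1) * (Ci * cis t) + (0 + RtoC r * 0) * Cconj (Ci * cis t))%C by ring. exact Y.
Qed.

Lemma Cmod_circle z0 r t : 0 <= r -> Cmod (circle z0 r t - z0)%C = r.
Proof.
  intros H. unfold circle. replace (z0 + RtoC r * cis t - z0)%C with (RtoC r * cis t)%C by ring.
  rewrite Cmod_mult, Cmod_cis, Cmod_RtoC_pos; lra.
Qed.

Lemma contR_cis t : contR cis t.
Proof. eapply cder_contR. apply cder_cis. Qed.

Lemma contR_circle z0 r t : contR (circle z0 r) t.
Proof. eapply cder_contR. apply cder_circle. Qed.

Lemma circle_sep z0 r z t : 0 <= r -> r - Cmod (z - z0)%C <= Cmod (circle z0 r t - z)%C.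
Proof.
  intros H. assert (T := Cmod_dist_triangle (circle z0 r t) z z0).
  rewrite Cmod_circle in T by auto. lra.
Qed.

Lemma cont_Cinv (z : C) : z <> 0%C -> cont Cinv z.
Proof. intros H. eapply wd_cont. apply (wd_inv (fun w => w) z _ _ (wd_id z) H). Qed.

Lemma contR_inv (g : R -> C) (t : R) : contR g t -> g t <> 0%C -> contR (fun t => / g t)%C t.
Proof. intros H N. apply (contR_comp Cinv g t); auto. now apply cont_Cinv. Qed.

Lemma cont2_comp F G s t : cont F (G s t) -> cont2 G s t -> cont2 (fun s t => F (G s t)) s t.
Proof.
  intros HF HG e He. destruct (HF e He) as [d [Hd A]]. destruct (HG d Hd) as [d' [Hd' B]].
  exists d'. auto.
Qed.

Lemma cont2_mult F G s t : cont2 F s t -> cont2 G s t -> cont2 (fun s t => F s t * G s t)%C s t.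
Proof.
  intros H K e He. assert (Pf := Cmod_ge_0 (F s t)). assert (Pg := Cmod_ge_0 (G s t)).
  set (M := Cmod (F s t) + Cmod (G s t) + 1). assert (HM : 0 < M) by (unfold M; lra).
  set (e1 := Rmin 1 (e / (2 * M))).
  assert (He1 : 0 < e1). { unfold e1. apply Rmin_pos. lra. apply Rdiv_lt_0_compat; lra. }
  destruct (H e1 He1) as [d [Hd A]]. destruct (K e1 He1) as [d' [Hd' B]].
  exists (Rmin d d'). split. now apply Rmin_pos. intros s' t' Hs Ht.
  assert (A' := A s' t' (Rlt_le_trans _ _ _ Hs (Rmin_l _ _)) (Rlt_le_trans _ _ _ Ht (Rmin_l _ _))).
  assert (B' := B s' t' (Rlt_le_trans _ _ _ Hs (Rmin_r _ _)) (Rlt_le_trans _ _ _ Ht (Rmin_r _ _))).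
  replace (F s' t' * G s' t' - F s t * G s t)%C with
    ((F s' t' - F s t) * G s' t' + F s t * (G s' t' - G s t))%C by ring.
  apply Rle_lt_trans with (1 := Cmod_triangle _ _). rewrite !Cmod_mult.
  assert (Gs : Cmod (G s' t') <= M).
  { assert (X := Cmod_triangle_rev (G s' t') (G s t)). assert (e1 <= 1) by apply Rmin_l. unfold M. lra. }
  assert (E2 : e1 * M <= e / 2).
  { apply Rle_trans with (e / (2 * M) * M). apply Rmult_le_compat_r. lra. apply Rmin_r.
    apply Req_le. field. lra. }
  assert (X1 : Cmod (F s' t' - F s t)%C * Cmod (G s' t') <= e / 2).
  { apply Rle_trans with (2 := E2). apply Rmult_le_compat; auto using Cmod_ge_0. lra. }
  assert (X2 : Cmod (F s t) * Cmod (G s' t' - G s t)%C < e / 2).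
  { apply Rle_lt_trans with (Cmod (F s t) * e1). apply Rmult_le_compat_l; lra.
    apply Rlt_le_trans with (2 := E2). rewrite Rmult_comm. apply Rmult_lt_compat_l; auto. unfold M; lra. }
  lra.
Qed.

Lemma cont2_plus F G s t : cont2 F s t -> cont2 G s t -> cont2 (fun s t => F s t + G s t)%C s t.
Proof.
  intros H K e He. destruct (H (e / 2)) as [d [Hd A]]; [lra|]. destruct (K (e / 2)) as [d' [Hd' B]]; [lra|].
  exists (Rmin d d'). split. now apply Rmin_pos. intros s' t' Hs Ht.
  assert (A' := A s' t' (Rlt_le_trans _ _ _ Hs (Rmin_l _ _)) (Rlt_le_trans _ _ _ Ht (Rmin_l _ _))).
  assert (B' := B s' t' (Rlt_le_trans _ _ _ Hs (Rmin_r _ _)) (Rlt_le_trans _ _ _ Ht (Rmin_r _ _))).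
  replace (F s' t' + G s' t' - (F s t + G s t))%C with ((F s' t' - F s t) + (G s' t' - G s t))%C by ring.
  assert (T := Cmod_triangle (F s' t' - F s t) (G s' t' - G s t)). lra.
Qed.

Lemma cont2_const c s t : cont2 (fun _ _ => c) s t.
Proof.
  intros e He. exists 1. split; [lra|]. intros. replace (c - c)%C with (RtoC 0) by ring. now rewrite Cmod_0.
Qed.

Lemma cont2_l s t : cont2 (fun s _ => RtoC s) s t.
Proof.
  intros e He. exists e. split; auto. intros s' t' Hs _. now rewrite <- RtoC_minus, Cmod_R.
Qed.

Lemma cont2_r g s t : contR g t -> cont2 (fun _ t => g t) s t.
Proof. intros H e He. destruct (H e He) as [d [Hd A]]. exists d. auto. Qed.

Lemma cont2_contR G s t : cont2 G s t -> contR (G s) t.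
Proof.
  intros H e He. destruct (H e He) as [d [Hd A]]. exists d. split; auto. intros t' Ht. apply A; auto.
  rewrite Rminus_diag, Rabs_R0; auto.
Qed.

Lemma CI_cder (G g : R -> C) a b : (forall t, contR g t) -> (forall t, cder G t (g t)) ->
  CI g a b = (G b - G a)%C.
Proof. intros H D. apply CI_FTC. intros t _; auto. intros t _. apply cder_components. auto. Qed.

(** The pole is moved from the centre (s = 0, where the integrand is the constant i) to z (s = 1).
    The s-derivative of the integrand is the t-derivative of - w / den and hence integrates to 0
    over a period. *)
Lemma winding z0 r z : Cmod (z - z0)%C < r ->
  CI (fun t => Ci * RtoC r * cis t / (circle z0 r t - z))%C 0 (2 * PI) = (2 * PI * Ci)%C.
Proof.
  intros Hz. set (w := (z - z0)%C) in *. assert (Hw := Cmod_ge_0 w). assert (Hr : 0 < r) by lra.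
  (* With this margin (1 + eta) |w| is less than r, so the moving pole does not reach the circle. *)
  set (eta := (r - Cmod w) / (2 * r)).
  assert (Heta : 0 < eta) by (apply Rdiv_lt_0_compat; lra).
  set (den := fun s t => (RtoC r * cis t + - (RtoC s * w))%C).
  assert (Hden : forall s t, - eta < s < 1 + eta -> den s t <> 0%C).
  { intros s t Hs E. assert (T := Cmod_triangle_rev (RtoC r * cis t) (RtoC s * w)).
    change (RtoC r * cis t - RtoC s * w)%C with (den s t) in T. rewrite E, Cmod_0, !Cmod_mult, Cmod_cis, (Cmod_RtoC_pos r), Cmod_R in T by lra.
    assert (X : Rabs s * Cmod w < r); [|lra].
    apply Rle_lt_trans with ((1 + eta) * Cmod w). { apply Rmult_le_compat_r; auto. apply Rabs_le. lra. }
    apply Rlt_le_trans with (Cmod w + eta * (2 * r)).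
    - rewrite Rmult_plus_distr_r, Rmult_1_l. apply Rplus_lt_compat_l. apply Rmult_lt_compat_l; lra.
    - unfold eta. apply Req_le. field. lra. }
  assert (Cden : forall s t, cont2 den s t).
  { intros s t. unfold den. apply cont2_plus. apply cont2_mult. apply cont2_const. apply cont2_r, contR_cis.
    apply (cont2_comp Copp (fun s t => RtoC s * w)%C). eapply wd_cont. apply wd_opp. apply wd_id.
    apply cont2_mult. apply cont2_l. apply cont2_const. }
  assert (Cinvden : forall s t, - eta < s < 1 + eta -> cont2 (fun s t => / den s t)%C s t).
  { intros s t Hs. apply (cont2_comp Cinv den); auto. now apply cont_Cinv, Hden. }
  set (G := fun s t => (Ci * RtoC r * cis t * / den s t)%C).
  set (dG := fun s t => (Ci * RtoC r * cis t * (w * (/ den s t * / den s t)))%C).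
  assert (E1 : forall t, (circle z0 r t - z)%C = den 1 t).
  { intros t. unfold den, circle, w. ring. }
  rewrite (CI_ext _ (G 1)). 2:{ intros t _. unfold G. now rewrite E1. }
  rewrite (CI_param_const G dG 0 (2 * PI) eta Heta).
  - assert (E0 : forall t, G 0 t = Ci).
    { intros t. unfold G, den. rewrite Cmult_0_l. field. split.
      - intros E. assert (X := Cmod_cis t). rewrite E, Cmod_0 in X. lra.
      - intros E. apply RtoC_inj in E. lra. }
    rewrite (CI_ext _ (fun _ => Ci)) by auto.
    rewrite (CI_cder (fun t => RtoC t * Ci)%C).
    rewrite !RtoC_mult. ring. intros t; apply contR_const.
    intros t. intros e He. exists 1. split; [lra|]. intros h _. rewrite RtoC_plus.
    replace (_ - _ - _)%C with (RtoC 0) by ring. rewrite Cmod_0. apply Rmult_le_pos; [lra|apply Rabs_pos].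
  - intros s t Hs.
    assert (X : wd (fun v => Ci * RtoC r * cis t * / (RtoC r * cis t + - v))%C (RtoC s * w)%C
       (Ci * RtoC r * cis t * (/ den s t * / den s t))%C 0).
    { eapply wd_eq. apply wd_scal. apply wd_inv. apply wd_plus. apply wd_const. apply wd_opp. apply wd_id. apply Hden; auto.
      cbv beta. change (RtoC r * cis t + - (RtoC s * w))%C with (den s t). field. now apply Hden.
      cbv beta. change (RtoC r * cis t + - (RtoC s * w))%C with (den s t). field. now apply Hden. }
    replace (RtoC s * w)%C with (0 + RtoC s * w)%C in X by ring. apply wd_line in X.
    destruct X as [X1 X2]. split.
    + evar_last. eapply is_derive_ext; [|apply X1]. intros u. req. unfold G, den. now rewrite Cplus_0_l.
      req. f_equal. unfold dG. ring.
    + evar_last. eapply is_derive_ext; [|apply X2]. intros u. req. unfold G, den. now rewrite Cplus_0_l.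
      req. f_equal. unfold dG. ring.
  - intros s t Hs. unfold dG. repeat apply cont2_mult; auto; try apply cont2_const. apply cont2_r, contR_cis.
  - intros s t Hs. apply cont2_contR. unfold G. repeat apply cont2_mult; auto; try apply cont2_const. apply cont2_r, contR_cis.
  - intros s Hs. assert (Hs' : - eta < s < 1 + eta) by lra.
    rewrite (CI_cder (fun t => - w * / den s t)%C).
    + unfold den. rewrite cis_2PI. ring.
    + intros t. apply cont2_contR. unfold dG. repeat apply cont2_mult; auto; try apply cont2_const. apply cont2_r, contR_cis.
    + intros t. assert (X : wd (fun v => - w * / (RtoC r * v + - (RtoC s * w)))%C (cis t)
       (w * RtoC r * (/ den s t * / den s t))%C 0).
      { eapply wd_eq. apply wd_scal. apply wd_inv. apply wd_plus. apply wd_scal. apply wd_id. apply wd_const. now apply (Hden s t).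
        cbv beta. change (RtoC r * cis t + - (RtoC s * w))%C with (den s t). field. now apply Hden.
        cbv beta. change (RtoC r * cis t + - (RtoC s * w))%C with (den s t). field. now apply Hden. }
      assert (Y := cder_wd _ _ _ _ _ _ X (cder_cis t)).
      unfold dG. replace (Ci * RtoC r * cis t * (w * (/ den s t * / den s t)))%C with
        (w * RtoC r * (/ den s t * / den s t) * (Ci * cis t) + 0 * Cconj (Ci * cis t))%C by ring. exact Y.
Qed.

(** The circle is contracted towards z along the segments [path]. The kernel d zeta / (zeta - z) is
    invariant under this contraction, so that only F moves; at s = 0 what remains is F(z) times the
    winding integral. *)
Lemma cauchy_formula (F f : C -> C) (z0 : C) (R0 r : R) (z : C) :
  (forall w, Cmod (w - z0)%C < R0 -> wd F w (f w) 0 /\ cont f w) ->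
  r < R0 -> Cmod (z - z0)%C < r ->
  CI (fun t => F (circle z0 r t) * (Ci * RtoC r * cis t / (circle z0 r t - z)))%C 0 (2 * PI) =
    (2 * PI * Ci * F z)%C.
Proof.
  intros HF HrR Hz. assert (Hw := Cmod_ge_0 (z - z0)%C). assert (Hr : 0 < r) by lra.
  set (eta := (R0 - r) / (4 * r)).
  assert (Heta : 0 < eta) by (apply Rdiv_lt_0_compat; lra).
  set (u := fun t => (circle z0 r t - z)%C).
  set (path := fun s t => (z + RtoC s * u t)%C).
  assert (Hu : forall t, u t <> 0%C).
  { intros t E. assert (X := circle_sep z0 r z t (Rlt_le _ _ Hr)). fold (u t) in X. rewrite E, Cmod_0 in X. lra. }
  assert (Hpath : forall s t, - eta < s < 1 + eta -> Cmod (path s t - z0)%C < R0).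
  { intros s t Hs. replace (path s t - z0)%C with (RtoC (1 - s) * (z - z0) + RtoC s * (circle z0 r t - z0))%C.
    2:{ unfold path, u. rewrite RtoC_minus. ring. }
    apply Rle_lt_trans with (1 := Cmod_triangle _ _). rewrite !Cmod_mult, Cmod_circle, !Cmod_R by lra.
    apply Rle_lt_trans with ((Rabs (1 - s) + Rabs s) * r).
    { rewrite Rmult_plus_distr_r. apply Rplus_le_compat_r. apply Rmult_le_compat_l. apply Rabs_pos. lra. }
    apply Rle_lt_trans with ((1 + 2 * eta) * r).
    { apply Rmult_le_compat_r; [lra|]. unfold Rabs; destruct (Rcase_abs (1 - s)), (Rcase_abs s); lra. }
    replace ((1 + 2 * eta) * r) with (r + (R0 - r) / 2) by (unfold eta; field; lra). lra. }
  assert (Cu : forall t, contR u t). { intros t. apply contR_plus. apply contR_circle. apply contR_const. }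
  assert (Cpath : forall s t, cont2 path s t).
  { intros s t. apply cont2_plus. apply cont2_const. apply cont2_mult. apply cont2_l. now apply cont2_r. }
  set (k := fun t => (Ci * RtoC r * cis t / u t)%C).
  assert (Ck : forall t, contR k t).
  { intros t. unfold k. apply contR_mult. apply contR_scal, contR_cis. now apply contR_inv. }
  set (G := fun s t => (F (path s t) * k t)%C).
  set (dG := fun s t => (f (path s t) * (Ci * RtoC r * cis t))%C).
  assert (CdG : forall s t, - eta < s < 1 + eta -> cont2 dG s t).
  { intros s t Hs. apply cont2_mult. apply (cont2_comp f path); auto. apply HF, Hpath, Hs.
    apply cont2_r, contR_scal, contR_cis. }
  assert (E1 : CI (G 1) 0 (2 * PI) = CI (G 0) 0 (2 * PI)).
  { apply (CI_param_const G dG 0 (2 * PI) eta Heta); auto.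
    - intros s t Hs. destruct (HF _ (Hpath s t Hs)) as [D _].
      assert (X := wd_mult _ _ _ _ _ _ _ D (wd_const (k t) (path s t))).
      apply wd_line in X. destruct X as [X1 X2].
      assert (E : ((f (path s t) * k t + F (path s t) * 0) * u t + (0 * k t + F (path s t) * 0) * Cconj (u t))%C = dG s t).
      { unfold dG, k. field. apply Hu. }
      fold (path s t) in X1, X2. rewrite E in X1, X2. split; assumption.
    - intros s t Hs. apply cont2_contR. apply cont2_mult. apply (cont2_comp F path); auto.
      eapply wd_cont. apply HF, Hpath, Hs. now apply cont2_r.
    - intros s Hs. assert (Hs' : - eta < s < 1 + eta) by lra.
      assert (U2 : u (2 * PI) = u 0) by (unfold u, circle; now rewrite cis_2PI).
      (* For s <> 0 the integrand times s is the t-derivative of F along the contracted circle; at s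
         = 0 it is integrated directly. *)
      destruct (Req_dec s 0) as [->|Ns].
      + rewrite (CI_ext _ (fun t => f z * (Ci * RtoC r * cis t))%C).
        rewrite CI_scal. rewrite (CI_cder (circle z0 r)). unfold circle. rewrite cis_2PI. ring.
        intros t. apply contR_scal, contR_cis. intros t. apply cder_circle.
        intros t _. apply contR_scal, contR_cis.
        intros t _. unfold dG, path. now rewrite Cmult_0_l, Cplus_0_r.
      + assert (X : (RtoC s * CI (dG s) 0 (2 * PI))%C = 0%C).
        { rewrite <- CI_scal by (intros t _; now apply cont2_contR, CdG).
          rewrite (CI_cder (fun t => F (path s t))).
          - unfold path. rewrite U2. ring.
          - intros t. apply contR_scal. now apply cont2_contR, CdG.
          - intros t. destruct (HF _ (Hpath s t Hs')) as [D _].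
            assert (A : wd (fun v => z + RtoC s * (v - z))%C (circle z0 r t) (RtoC s) 0).
            { eapply wd_eq. apply wd_plus. apply wd_const. apply wd_scal. apply wd_minus. apply wd_id. apply wd_const. ring. ring. }
            assert (B := cder_wd _ _ _ _ _ _ A (cder_circle z0 r t)).
            assert (D' := cder_wd _ _ _ _ _ _ D B). cbv beta in D'.
            replace (RtoC s * dG s t)%C with (f (path s t) * (RtoC s * (Ci * RtoC r * cis t) + 0 * Cconj (Ci * RtoC r * cis t)) + 0 * Cconj (RtoC s * (Ci * RtoC r * cis t) + 0 * Cconj (Ci * RtoC r * cis t)))%C by (unfold dG; ring).
            exact D'. }
        assert (Ns' : RtoC s <> 0%C) by (intros E; apply RtoC_inj in E; auto).
        replace (CI (dG s) 0 (2 * PI)) with (/ RtoC s * (RtoC s * CI (dG s) 0 (2 * PI)))%C by (field; auto).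
        rewrite X. ring. }
  rewrite (CI_ext _ (G 1)).
  2:{ intros t _. unfold G, k, path. f_equal. f_equal. unfold u. ring. }
  rewrite E1. rewrite (CI_ext _ (fun t => F z * k t)%C).
  2:{ intros t _. unfold G, path. now rewrite Cmult_0_l, Cplus_0_r. }
  rewrite CI_scal by (intros t _; auto). unfold k, u. rewrite winding by auto. ring.
Qed.

(** First order expansion of u^-n with an error quadratic in h, uniform as long as |h| <= |u| / 2,
    where |u - h| >= |u| / 2. It allows differentiation of the Cauchy kernel under the integral. *)
Lemma inv_pow_remainder (n : nat) : exists c, 0 <= c /\ forall u h : C, u <> 0%C ->
  Cmod h <= Cmod u / 2 ->
  Cmod (/ (u - h) ^ n - / u ^ n - INR n * h / u ^ (S n))%C <= c * (Cmod h) ^ 2 / Cmod u ^ (n + 2).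
Proof.
  assert (Sep : forall u h : C, u <> 0%C -> Cmod h <= Cmod u / 2 -> (u - h)%C <> 0%C /\ / Cmod (u - h)%C <= 2 / Cmod u).
  { intros u h Hu Hh. apply Cmod_gt_0 in Hu. assert (T := Cmod_triangle_rev u h).
    assert (P : 0 < Cmod (u - h)%C) by lra. split. now apply Cmod_gt_0.
    replace (2 / Cmod u) with (/ (Cmod u / 2)) by (field; lra). apply Rinv_le_contravar; lra. }
  induction n as [|n [c [Hc IH]]].
  - exists 0. split; [lra|]. intros u h Hu Hh. simpl.
    replace (/ 1 - / 1 - 0 * h / (u * 1))%C with (RtoC 0) by (field; auto). rewrite Cmod_0. unfold Rdiv. lra.
  - exists (2 * c + 2 * INR (S n)). assert (Pn := pos_INR (S n)). split; [lra|].
    intros u h Hu Hh. destruct (Sep u h Hu Hh) as [Hs Hs']. specialize (IH u h Hu Hh).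
    assert (Pu := proj1 (Cmod_gt_0 u) Hu). assert (Ph := Cmod_ge_0 h).
    assert (Un : (u ^ n)%C <> 0%C). { intros E. assert (X := Cmod_pow u n). rewrite E, Cmod_0 in X. symmetry in X. apply pow_nonzero in X; lra. }
    assert (Sn : ((u - h) ^ n)%C <> 0%C). { intros E. assert (X := Cmod_pow (u - h) n). rewrite E, Cmod_0 in X. symmetry in X. apply pow_nonzero in X; auto. apply Cmod_gt_0 in Hs. lra. }
    replace (/ (u - h) ^ S n - / u ^ S n - INR (S n) * h / u ^ S (S n))%C with
      (/ (u - h) * (/ (u - h) ^ n - / u ^ n - INR n * h / u ^ (S n)) +
        / (u - h) * (INR (S n) * (h * h) / u ^ (n + 2)))%C.
    2:{ replace (n + 2)%nat with (S (S n)) by lia. rewrite !Cpow_S, S_INR, RtoC_plus.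
        field. repeat split; auto. }
    apply Rle_trans with (1 := Cmod_triangle _ _). rewrite !Cmod_mult, Cmod_inv by auto.
    assert (Unp : (u ^ (n + 2))%C <> 0%C). { intros E. assert (X := Cmod_pow u (n + 2)). rewrite E, Cmod_0 in X. symmetry in X. apply pow_nonzero in X; lra. }
    rewrite Cmod_div by auto. rewrite !Cmod_mult, Cmod_pow, Cmod_R, Rabs_pos_eq by apply pos_INR.
    assert (Pp : 0 < Cmod u ^ (n + 2)) by now apply pow_lt.
    assert (Q : 0 <= Cmod h ^ 2 / Cmod u ^ (n + 2)). { apply Rle_div_pos; auto. apply pow2_ge_0. }
    apply Rle_trans with (2 / Cmod u * (c * Cmod h ^ 2 / Cmod u ^ (n + 2)) + 2 / Cmod u * (INR (S n) * (Cmod h * Cmod h) / Cmod u ^ (n + 2))).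
    + apply Rplus_le_compat; apply Rmult_le_compat; auto using Cmod_ge_0; try lra.
      apply Rlt_le, Rinv_0_lt_compat, Cmod_gt_0; auto.
      apply Rlt_le, Rinv_0_lt_compat, Cmod_gt_0; auto.
      apply Rle_div_pos; auto. apply Rmult_le_pos; auto. apply Rmult_le_pos; auto.
    + apply Req_le. replace (S n + 2)%nat with (S (n + 2)) by lia. simpl pow. field. split; lra.
Qed.

(** [g] absorbs the boundary values and the differential of the circle, and the factor 1 / (2 pi i)
    is left out. Up to a constant, [cauchy_int g z0 r (S n)] is the n-th derivative of
    [cauchy_int g z0 r 1]. *)
Definition cauchy_int (g : R -> C) (z0 : C) (r : R) (n : nat) (z : C) : C :=
  CI (fun t => g t * / (circle z0 r t - z) ^ n)%C 0 (2 * PI).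

Lemma contR_ext f g t : (forall s, f s = g s) -> contR f t -> contR g t.
Proof.
  intros E H e He. destruct (H e He) as [d [Hd A]]. exists d. split; auto. intros s. rewrite <- !E. apply A.
Qed.

Lemma contR_pow g t n : contR g t -> contR (fun t => g t ^ n)%C t.
Proof.
  intros H. induction n. exact (contR_const 1 t). apply (contR_mult g (fun t => g t ^ n)%C); auto.
Qed.

Lemma Cpow_neq_0 (u : C) n : u <> 0%C -> (u ^ n)%C <> 0%C.
Proof.
  intros Hu E. assert (X := Cmod_pow u n). rewrite E, Cmod_0 in X. symmetry in X.
  apply pow_nonzero in X; auto. apply Cmod_gt_0 in Hu. lra.
Qed.

Lemma contR_bounded g a b : a <= b -> (forall t, contR g t) ->
  exists M, 0 <= M /\ forall t, a <= t <= b -> Cmod (g t) <= M.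
Proof.
  intros Hab H.
  assert (X : forall x, a <= x <= b -> continuity_pt (fun t => Cmod (g t)) x).
  { intros x _. apply continuity_pt_filterlim. apply continuous_eps.
    intros e He. destruct (H x e He) as [d [Hd A]]. exists d. split; auto. intros s Hs.
    apply Rle_lt_trans with (2 := A s Hs). apply Rabs_le.
    assert (T1 := Cmod_triangle_rev (g s) (g x)). assert (T2 := Cmod_triangle_rev (g x) (g s)).
    rewrite (Cmod_minus_sym (g x)) in T2. lra. }
  destruct (continuity_ab_maj _ a b Hab X) as [m [Hm _]].
  exists (Cmod (g m)). split; auto using Cmod_ge_0.
Qed.

Lemma circle_kernel_contR g z0 r n z t : Cmod (z - z0)%C < r -> (forall t, contR g t) ->
  contR (fun t => g t * / (circle z0 r t - z) ^ n)%C t.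
Proof.
  intros Hz Hg. assert (P := Cmod_ge_0 (z - z0)%C). apply contR_mult; auto.
  apply (contR_inv (fun t => (circle z0 r t - z) ^ n)%C).
  - apply (contR_pow (fun t => circle z0 r t - z)%C). apply contR_plus. apply contR_circle. apply contR_const.
  - apply Cpow_neq_0. intros E. assert (X := circle_sep z0 r z t ltac:(lra)). rewrite E, Cmod_0 in X. lra.
Qed.

(** The circle keeps the distance [del] from z, so the remainder of the kernel is O(|w - z|^2)
    uniformly in t. *)
Lemma cauchy_int_wd g z0 r n z : Cmod (z - z0)%C < r -> (forall t, contR g t) ->
  wd (cauchy_int g z0 r n) z (INR n * cauchy_int g z0 r (S n) z)%C 0.
Proof.
  intros Hz Hg. assert (P := Cmod_ge_0 (z - z0)%C). set (del := r - Cmod (z - z0)%C).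
  assert (Hdel : 0 < del) by (unfold del; lra).
  destruct (inv_pow_remainder n) as [c [Hc Hrem]].
  destruct (contR_bounded g 0 (2 * PI)) as [M [HM HgM]]; auto. { assert (X := PI_RGT_0). lra. }
  apply lo_quad with (M * (c / del ^ (n + 2)) * (2 * PI)).
  exists (del / 2). split; [lra|]. intros w Hw.
  assert (Hwz : Cmod (w - z0)%C < r).
  { assert (T := Cmod_dist_triangle w z z0). unfold del in Hw. lra. }
  set (h := (w - z)%C) in *.
  assert (E : (cauchy_int g z0 r n w - cauchy_int g z0 r n z - INR n * cauchy_int g z0 r (S n) z * h - 0 * Cconj h)%C =
     CI (fun t => g t * (/ (circle z0 r t - z - h) ^ n - / (circle z0 r t - z) ^ n - INR n * h / (circle z0 r t - z) ^ (S n)))%C 0 (2 * PI)).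
  { rewrite (CI_ext _ (fun t => g t * / (circle z0 r t - w) ^ n - g t * / (circle z0 r t - z) ^ n -
        (INR n * h) * (g t * / (circle z0 r t - z) ^ (S n)))%C).
    2:{ intros t _. replace (circle z0 r t - z - h)%C with (circle z0 r t - w)%C by (unfold h; ring).
        unfold Cdiv. ring. }
    rewrite CI_minus, CI_minus, CI_scal. unfold cauchy_int. ring.
    all: intros t _; try (apply contR_scal); try apply contR_plus; try (apply circle_kernel_contR; auto; fail).
    eapply (contR_comp Copp). eapply wd_cont; apply wd_opp; apply wd_id. apply circle_kernel_contR; auto. }
  rewrite E. clear E.
  assert (Hpi := PI_RGT_0).
  assert (Pd : 0 < del ^ (n + 2)) by now apply pow_lt.
  eapply Rle_trans; [apply (CI_norm _ 0 (2 * PI) (M * (c / del ^ (n + 2) * (Cmod h * Cmod h))))|].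
  - lra.
  - intros t _. 
    assert (X := contR_plus _ _ t (contR_plus _ _ t (circle_kernel_contR g z0 r n w t Hwz Hg)
       (contR_scal (-(1))%C _ t (circle_kernel_contR g z0 r n z t Hz Hg)))
       (contR_scal (- (INR n * h))%C _ t (circle_kernel_contR g z0 r (S n) z t Hz Hg))).
    revert X. apply contR_ext. intros s. replace w with (z + h)%C by (unfold h; ring).
    replace (circle z0 r s - (z + h))%C with (circle z0 r s - z - h)%C by ring. unfold Cdiv. ring.
  - intros t Ht. rewrite Cmod_mult. apply Rmult_le_compat; auto using Cmod_ge_0.
    assert (S1 := circle_sep z0 r z t ltac:(lra)). fold del in S1.
    set (u := (circle z0 r t - z)%C) in *.
    assert (Hu : u <> 0%C). { apply Cmod_gt_0. lra. }
    apply Rle_trans with (1 := Hrem u h Hu ltac:(lra)).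
    replace (c * Cmod h ^ 2 / Cmod u ^ (n + 2)) with (c * (Cmod h * Cmod h) * / Cmod u ^ (n + 2)) by (unfold Rdiv; ring).
    replace (c / del ^ (n + 2) * (Cmod h * Cmod h)) with (c * (Cmod h * Cmod h) * / del ^ (n + 2)) by (unfold Rdiv; ring).
    apply Rmult_le_compat_l. apply Rmult_le_pos; auto. apply Rmult_le_pos; apply Cmod_ge_0.
    apply Rinv_le_contravar; auto. apply pow_incr. lra.
  - apply Req_le. ring.
Qed.

Lemma Cpow_2 (u : C) : (u ^ 2)%C = (u * u)%C.
Proof. rewrite Cpow_S, Cpow_1_r. reflexivity. Qed.

Lemma Cpow_3 (u : C) : (u ^ 3)%C = (u * (u * u))%C.
Proof. rewrite Cpow_S, Cpow_2. reflexivity. Qed.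

Definition holo (F : C -> C) (z : C) : Prop := near z (fun w => exists l, wd F w l 0).

(** Chosen by [epsilon]; the value carries information only where a derivative exists. *)
Definition deriv (F : C -> C) (z : C) : C := epsilon (inhabits (RtoC 0)) (fun l => wd F z l 0).

Lemma deriv_spec F z : (exists l, wd F z l 0) -> wd F z (deriv F z) 0.
Proof. intros H. exact (epsilon_spec (inhabits (RtoC 0)) (fun l => wd F z l 0) H). Qed.

Lemma holo_wd F z : holo F z -> wd F z (deriv F z) 0.
Proof. intros H. apply deriv_spec. exact (near_self _ _ H). Qed.

Lemma wd_uniq1 F z a b a' b' : wd F z a b -> wd F z a' b' -> a = a'.
Proof. intros H K. exact (proj1 (wd_uniq _ _ _ _ _ _ H K)). Qed.

Lemma deriv_unique F z l : wd F z l 0 -> deriv F z = l.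
Proof. intros H. exact (wd_uniq1 _ _ _ _ _ _ (deriv_spec F z (ex_intro _ l H)) H). Qed.

Lemma two_PI_I_neq_0 : (2 * PI * Ci)%C <> 0%C.
Proof.
  intros E. apply (f_equal Im) in E. simpl in E. assert (X := PI_RGT_0).
  replace (_ * 1 + _ * 0) with (2 * PI) in E by ring. lra.
Qed.

(** Cauchy's formula asks for a continuous derivative, which F is not yet known to have. It is
    applied to a primitive Psi of F, whose derivative F is continuous. Differentiating the formula
    gives integrals for F and then for F', and the last integral can be differentiated once more. *)
Lemma holo_deriv F z0 : holo F z0 -> holo (deriv F) z0.
Proof.
  intros [d [Hd HF]].
  destruct (primitive_square F z0 (d / 2)) as [Psi HPsi].
  { intros z [H1 H2]. apply HF.
    replace (z - z0)%C with (RtoC (Re z - Re z0) + RtoC (Im z - Im z0) * Ci)%C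
      by (apply injective_projections; unfold Re, Im; simpl; ring).
    apply Rle_lt_trans with (1 := Cmod_triangle _ _). rewrite Cmod_mult, Cmod_Ci, !Cmod_R. lra. }
  assert (HP : forall w, Cmod (w - z0)%C < d / 2 -> wd Psi w (F w) 0 /\ cont F w).
  { intros w Hw. split.
    - apply HPsi. split. rewrite <- re_minus. apply Rle_lt_trans with (2 := Hw). apply re_le_Cmod.
      rewrite <- im_minus. apply Rle_lt_trans with (2 := Hw). apply im_le_Cmod.
    - destruct (HF w ltac:(lra)) as [l Hl]. now apply wd_cont in Hl. }
  set (r := d / 4).
  set (g := fun t => (Psi (circle z0 r t) * (Ci * RtoC r * cis t))%C).
  assert (Hr : 0 < r) by (unfold r; lra).
  assert (Hg : forall t, contR g t).
  { intros t. apply contR_mult. apply (contR_comp Psi). eapply wd_cont. apply HP. rewrite Cmod_circle; unfold r; lra.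
    apply contR_circle. apply contR_scal, contR_cis. }
  assert (E0 : forall z, Cmod (z - z0)%C < r -> cauchy_int g z0 r 1 z = (2 * PI * Ci * Psi z)%C).
  { intros z Hz. rewrite <- (cauchy_formula Psi F z0 (d / 2) r z HP); auto.
    unfold cauchy_int, g. apply CI_ext. intros t _. rewrite Cpow_1_r. unfold Cdiv. ring. unfold r; lra. }
  (* An integral formula for H becomes one for H', with the next power of the kernel, by uniqueness
     of derivatives. *)
  assert (Step : forall (H H' : C -> C) n, (forall z, Cmod (z - z0)%C < r -> cauchy_int g z0 r n z = H z) ->
      (forall z, Cmod (z - z0)%C < r -> wd H z (H' z) 0) ->
      forall z, Cmod (z - z0)%C < r -> (INR n * cauchy_int g z0 r (S n) z)%C = H' z).
  { intros H H' n EH DH z Hz. eapply wd_uniq1. 2: apply DH, Hz.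
    apply wd_ext_near with (cauchy_int g z0 r n). 2: now apply cauchy_int_wd.
    generalize (near_ball z z0 r Hz). apply near_imp. auto. }
  assert (N0 := two_PI_I_neq_0). set (k := (2 * PI * Ci)%C) in *.
  assert (E1 : forall z, Cmod (z - z0)%C < r -> cauchy_int g z0 r 2 z = (k * F z)%C).
  { intros z Hz. rewrite <- (Step (fun z => k * Psi z)%C (fun z => k * F z)%C 1%nat); auto.
    simpl. ring. intros w Hw. eapply wd_eq. apply wd_scal. apply HP. unfold r in Hw; lra. ring. ring. }
  assert (DF : forall z, Cmod (z - z0)%C < r -> wd F z (deriv F z) 0).
  { intros z Hz. apply deriv_spec, HF. unfold r in Hz; lra. }
  assert (E2 : forall z, Cmod (z - z0)%C < r -> (INR 2 * cauchy_int g z0 r 3 z)%C = (k * deriv F z)%C).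
  { apply (Step (fun z => k * F z)%C); auto.
    intros w Hw. eapply wd_eq. apply wd_scal. apply DF, Hw. ring. ring. }
  exists r. split; auto. intros z Hz.
  assert (X := wd_scal (INR 2 / k)%C _ _ _ _ (cauchy_int_wd g z0 r 3 z Hz Hg)).
  eexists. eapply wd_eq. eapply wd_ext_near. 2: exact X. 2: reflexivity. 2: ring.
  generalize (near_ball z z0 r Hz). apply near_imp. intros w Hw.
  replace (INR 2 / k * cauchy_int g z0 r 3 w)%C with ((INR 2 * cauchy_int g z0 r 3 w) / k)%C by (field; auto).
  rewrite E2 by auto. field; auto.
Qed.

(** The c n are Cauchy integrals over the circle of radius r, and the remainders come from a finite
    geometric expansion of the kernel. The factor 2 bounds r / (r - |z - z0|) for |z - z0| <= r / 2.
    Orders 1 to 3 are those that the comparison of coefficients in [tau_small] uses. *)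
Lemma taylor_circle (F : C -> C) (z0 : C) (R0 r M : R) : 0 < r -> r < R0 ->
  (forall w, Cmod (w - z0)%C < R0 -> holo F w) ->
  (forall w, Cmod (w - z0)%C < R0 -> Cmod (F w) <= M) ->
  exists c : nat -> C, c O = F z0 /\ c 1%nat = deriv F z0 /\
    (forall n, Cmod (c n) <= M / r ^ n) /\
    forall z, Cmod (z - z0)%C <= r / 2 ->
      Cmod (F z - c O)%C <= 2 * M * (Cmod (z - z0)%C / r) /\
      Cmod (F z - c O - c 1%nat * (z - z0))%C <= 2 * M * (Cmod (z - z0)%C / r) ^ 2 /\
      Cmod (F z - c O - c 1%nat * (z - z0) - c 2%nat * (z - z0) ^ 2)%C <= 2 * M * (Cmod (z - z0)%C / r) ^ 3.
Proof.
  intros Hr HrR HF HM.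
  assert (HF' : forall w, Cmod (w - z0)%C < R0 -> wd F w (deriv F w) 0 /\ cont (deriv F) w).
  { intros w Hw. split. now apply holo_wd, HF. assert (X := holo_wd _ _ (holo_deriv _ _ (HF w Hw))). now apply wd_cont in X. }
  assert (N0 := two_PI_I_neq_0). set (k := (2 * PI * Ci)%C) in *.
  assert (HPI := PI_RGT_0).
  assert (Ck : Cmod k = 2 * PI).
  { unfold k. rewrite !Cmod_mult, Cmod_Ci, !Cmod_R, !Rabs_pos_eq by lra. ring. }
  set (g := fun t => (F (circle z0 r t) * (Ci * RtoC r * cis t))%C).
  assert (HFc : forall t, Cmod (F (circle z0 r t)) <= M). { intros t. apply HM. rewrite Cmod_circle; lra. }
  assert (M0 : 0 <= M). { apply Rle_trans with (2 := HFc 0). apply Cmod_ge_0. }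
  assert (Hg : forall t, contR g t).
  { intros t. apply contR_mult. apply (contR_comp F). eapply wd_cont. apply HF'. rewrite Cmod_circle; lra.
    apply contR_circle. apply contR_scal, contR_cis. }
  assert (Hgn : forall t, Cmod (g t) <= M * r).
  { intros t. unfold g. rewrite !Cmod_mult, Cmod_Ci, Cmod_cis, Cmod_RtoC_pos by lra. specialize (HFc t).
    replace (Cmod (F (circle z0 r t)) * (1 * r * 1)) with (Cmod (F (circle z0 r t)) * r) by ring.
    apply Rmult_le_compat_r; lra. }
  assert (E0 : forall z, Cmod (z - z0)%C < r -> cauchy_int g z0 r 1 z = (k * F z)%C).
  { intros z Hz. unfold k. rewrite <- (cauchy_formula F (deriv F) z0 R0 r z HF'); auto.
    unfold cauchy_int, g. apply CI_ext. intros t _. rewrite Cpow_1_r. unfold Cdiv. ring. }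
  assert (Z0 : Cmod (z0 - z0)%C < r). { replace (z0 - z0)%C with (RtoC 0) by ring. rewrite Cmod_0; lra. }
  set (c := fun n => (cauchy_int g z0 r (S n) z0 / k)%C).
  assert (Ec : forall t, (circle z0 r t - z0)%C = (RtoC r * cis t)%C) by (intros t; unfold circle; ring).
  exists c.
  assert (C0 : c O = F z0). { unfold c. rewrite E0 by auto. field; auto. }
  split; auto. split; [|split].
  - assert (X : (INR 1 * cauchy_int g z0 r 2 z0)%C = (k * deriv F z0)%C).
    { apply (wd_uniq1 (cauchy_int g z0 r 1) z0 _ 0 _ 0). apply cauchy_int_wd; auto.
      apply wd_ext_near with (fun z => k * F z)%C.
      generalize (near_ball z0 z0 r Z0). apply near_imp. intros w Hw. symmetry; auto.
      eapply wd_eq. apply wd_scal. apply HF'. lra. ring. ring. }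
    unfold c. simpl INR in X. rewrite Cmult_1_l in X. rewrite X. field; auto.
  - intros n. unfold c. rewrite Cmod_div, Ck by auto. apply Rle_div_l; [lra|].
    assert (Pr : 0 < r ^ n) by now apply pow_lt.
    eapply Rle_trans. apply (CI_norm _ 0 (2 * PI) (M / r ^ n)).
    + lra.
    + intros t _. apply circle_kernel_contR; auto.
    + intros t _. rewrite Cmod_mult, Cmod_inv. rewrite Cmod_pow, Ec, Cmod_mult, Cmod_cis, Cmod_RtoC_pos by lra.
      rewrite Rmult_1_r. apply Rle_trans with (M * r * / r ^ S n). apply Rmult_le_compat_r; auto.
      apply Rlt_le, Rinv_0_lt_compat, pow_lt, Hr. apply Req_le. simpl. field. split; lra.
      apply Cpow_neq_0. intros E. assert (X := Cmod_circle z0 r t ltac:(lra)). rewrite E, Cmod_0 in X. lra.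
    + apply Req_le. ring.
  - intros z Hz. set (h := (z - z0)%C) in *. assert (Ph := Cmod_ge_0 h).
    assert (Hz' : Cmod (z - z0)%C < r) by (fold h; lra).
    (* 1/(u-h) = sum of h^j/u^(j+1), j < m, plus h^m/(u^m (u-h)) *)
    assert (Rem : forall (m : nat) (p : C),
       (k * F z - k * p)%C = CI (fun t => g t * (h ^ m / (RtoC r * cis t) ^ m * / (circle z0 r t - z)))%C 0 (2 * PI) ->
       Cmod (F z - p)%C <= 2 * M * (Cmod h / r) ^ m).
    { intros m p E.
      replace (F z - p)%C with ((k * F z - k * p) / k)%C by (field; auto).
      rewrite E, Cmod_div, Ck by auto. apply Rle_div_l; [lra|].
      assert (Hc0 : forall t, (RtoC r * cis t)%C <> 0%C).
      { intros t. apply Cmod_gt_0. rewrite Cmod_mult, Cmod_cis, Cmod_RtoC_pos; lra. }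
      assert (Hs : forall t, r / 2 <= Cmod (circle z0 r t - z)%C).
      { intros t. assert (X := circle_sep z0 r z t ltac:(lra)). fold h in X. lra. }
      assert (Prm : 0 < r ^ m) by now apply pow_lt. assert (Phm := pow_le _ m Ph).
      eapply Rle_trans. apply (CI_norm _ 0 (2 * PI) (M * r * (Cmod h ^ m / r ^ m * / (r / 2)))).
      + lra.
      + intros t _. apply contR_mult; auto. apply contR_mult. unfold Cdiv. apply contR_scal.
        apply (contR_inv (fun t => (RtoC r * cis t) ^ m)%C). apply (contR_pow (fun t => RtoC r * cis t)%C). apply contR_scal, contR_cis.
        now apply Cpow_neq_0. apply (contR_inv (fun t => circle z0 r t - z)%C). apply contR_plus. apply contR_circle. apply contR_const.
        apply Cmod_gt_0. specialize (Hs t). lra.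
      + intros t _. rewrite Cmod_mult. apply Rmult_le_compat; auto using Cmod_ge_0.
        rewrite Cmod_mult, Cmod_div, !Cmod_pow, Cmod_mult, Cmod_cis, Cmod_RtoC_pos, Rmult_1_r by (auto using Cpow_neq_0; lra).
        apply Rmult_le_compat_l. now apply Rle_div_pos. specialize (Hs t).
        rewrite Cmod_inv by (apply Cmod_gt_0; lra). apply Rinv_le_contravar; lra.
      + assert (Eq : (Cmod h / r) ^ m = Cmod h ^ m / r ^ m) by (unfold Rdiv; rewrite Rpow_mult_distr, pow_inv; reflexivity).
        rewrite Eq. apply Req_le. field. split; lra. }
    assert (Sep : forall t, (circle z0 r t - z)%C <> 0%C).
    { intros t. apply Cmod_gt_0. assert (X := circle_sep z0 r z t ltac:(lra)). fold h in X. lra. }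
    assert (Hc0 : forall t, (RtoC r * cis t)%C <> 0%C).
    { intros t. apply Cmod_gt_0. rewrite Cmod_mult, Cmod_cis, Cmod_RtoC_pos; lra. }
    assert (Eh : forall t, (circle z0 r t - z)%C = (RtoC r * cis t - h)%C).
    { intros t. unfold circle, h. ring. }
    assert (KC : forall n, (k * c n)%C = CI (fun t => g t * / (RtoC r * cis t) ^ (S n))%C 0 (2 * PI)).
    { intros n. unfold c, cauchy_int. replace (k * (CI (fun t => g t * / (circle z0 r t - z0) ^ S n)%C 0 (2 * PI) / k))%C with
        (CI (fun t => g t * / (circle z0 r t - z0) ^ S n)%C 0 (2 * PI)) by (field; auto).
      apply CI_ext. intros t _. now rewrite Ec. }
    assert (CK : forall n, contI (fun t => g t * / (RtoC r * cis t) ^ (S n))%C 0 (2 * PI)).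
    { intros n t _. apply contR_mult; auto. apply (contR_inv (fun t => (RtoC r * cis t) ^ (S n))%C).
      apply (contR_pow (fun t => RtoC r * cis t)%C). apply contR_scal, contR_cis. now apply Cpow_neq_0. }
    assert (CF : contI (fun t => g t * / (circle z0 r t - z) ^ 1)%C 0 (2 * PI)).
    { intros t _. now apply circle_kernel_contR. }
    assert (NZ : forall t, (RtoC r <> 0%C) /\ cis t <> 0%C).
    { intros t. split; intros E; apply (Hc0 t); rewrite E; ring. }
    split; [|split].
    + replace (Cmod h / r) with ((Cmod h / r) ^ 1) by ring. apply Rem.
      rewrite <- E0, KC by auto. unfold cauchy_int. rewrite <- CI_minus by auto. apply CI_ext.
      intros t _. rewrite !Eh, !Cpow_1_r. field. repeat split; try apply (NZ t). rewrite <- Eh. auto.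
    + replace (F z - c O - c 1%nat * h)%C with (F z - (c O + c 1%nat * h))%C by ring. apply Rem.
      replace (k * (c O + c 1%nat * h))%C with (k * c O + h * (k * c 1%nat))%C by ring.
      rewrite <- E0, !KC by auto. unfold cauchy_int. rewrite <- CI_scal by auto.
      rewrite <- CI_plus by auto using contI_scal. rewrite <- CI_minus by auto using contI_plus, contI_scal.
      apply CI_ext. intros t _. rewrite !Eh, ?Cpow_3, ?Cpow_2, ?Cpow_1_r. field. repeat split; try apply (NZ t). rewrite <- Eh. auto.
    + replace (F z - c O - c 1%nat * h - c 2%nat * h ^ 2)%C with (F z - (c O + c 1%nat * h + c 2%nat * h ^ 2))%C by ring. apply Rem.
      replace (k * (c O + c 1%nat * h + c 2%nat * h ^ 2))%C with (k * c O + h * (k * c 1%nat) + h ^ 2 * (k * c 2%nat))%C by ring.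
      rewrite <- E0, !KC by auto. unfold cauchy_int. rewrite <- !CI_scal by auto.
      rewrite <- !CI_plus by auto using contI_plus, contI_scal. rewrite <- CI_minus by auto using contI_plus, contI_scal.
      apply CI_ext. intros t _. rewrite !Eh, ?Cpow_3, ?Cpow_2, ?Cpow_1_r. field. repeat split; try apply (NZ t). rewrite <- Eh. auto.
Qed.

(** * Correspondence with the filters and derivatives of Coquelicot *)

Lemma near_locally (z : C) (P : C -> Prop) : near z P <-> locally (T := C_UniformSpace) z P.
Proof.
  split.
  - intros [d [Hd H]]. apply (proj2 (locally_C z P)). exists (mkposreal d Hd). intros y Hy. apply H. exact Hy.
  - intros H. apply (proj1 (locally_C z P)) in H. destruct H as [d H]. exists d. split. apply cond_pos.
    intros w Hw. apply H. exact Hw.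
Qed.

Lemma open_near (U : C -> Prop) z : open U -> U z -> near z U.
Proof. intros H Hz. apply near_locally. now apply H. Qed.

Lemma continuous_cont (F : C -> C) (z : C) : continuous F z <-> cont F z.
Proof.
  split.
  - intros H e He. apply near_locally. apply (H (fun y => Cmod (y - F z)%C < e)).
    apply near_locally. now apply near_ball_self.
  - intros H P HP. apply (near_locally (F z) P) in HP. destruct HP as [d [Hd G]].
    apply (near_locally z). generalize (H d Hd). apply near_imp. auto.
Qed.

Lemma ex_derive_wd (p : C -> C) (z : C) : ex_derive p z -> wd p z (C_derive p z) 0.
Proof.
  intros H. apply (C_derive_correct p z 0%C) in H. destruct H as [_ H].
  assert (L : is_filter_lim (locally (T := AbsRing_UniformSpace C_AbsRing) z) z) by (intros P HP; exact HP).
  specialize (H z L). intros e He. specialize (H (mkposreal e He)).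
  destruct H as [d H]. exists d. split. apply cond_pos. intros w Hw. specialize (H w Hw).
  replace (p w - p z - C_derive p z * (w - z) - 0 * Cconj (w - z))%C with
    (p w - p z - (w - z) * C_derive p z)%C by ring.
  exact H.
Qed.

Lemma cont_comp (F g : C -> C) z : cont F (g z) -> cont g z -> cont (fun w => F (g w)) z.
Proof.
  intros H K e He. destruct (H e He) as [d [Hd A]]. generalize (K d Hd). apply near_imp. auto.
Qed.

Lemma cont_near F z P : cont F z -> near (F z) P -> near z (fun w => P (F w)).
Proof. intros H [d [Hd A]]. generalize (H d Hd). apply near_imp. auto. Qed.

Lemma cont_ext_near F G z : near z (fun w => F w = G w) -> cont F z -> cont G z.
Proof.
  intros E H e He. assert (E0 := near_self _ _ E).
  generalize (near_and _ _ _ E (H e He)). apply near_imp. intros w [X Y]. now rewrite <- X, <- E0.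
Qed.

(** * Sections of coverings over disks *)

(** Continuity induction by a supremum argument. It lifts segments through coverings, propagates the
    bound on [QQ] along curves, and finds exit points from a domain. *)
Lemma real_induction (P : R -> Prop) : P 0 ->
  (forall t, 0 <= t < 1 -> P t -> exists d, 0 < d /\ forall s, t < s < t + d -> s <= 1 -> P s) ->
  (forall t, 0 < t <= 1 -> (forall s, 0 <= s < t -> P s) -> P t) ->
  forall t, 0 <= t <= 1 -> P t.
Proof.
  intros P0 PR PL.
  set (S := fun t => 0 <= t <= 1 /\ forall s, 0 <= s <= t -> P s).
  destruct (completeness S) as [m [m1 m2]].
  { exists 1. intros t [Ht _]. lra. }
  { exists 0. split. lra. intros s Hs. now replace s with 0 by lra. }
  assert (S0 : S 0). { split. lra. intros s Hs. now replace s with 0 by lra. }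
  assert (Hm0 : 0 <= m) by now apply m1.
  assert (Hm1 : m <= 1). { apply m2. intros t [Ht _]. lra. }
  assert (B : forall s, 0 <= s < m -> P s).
  { intros s Hs. apply NNPP. intros N. assert (m <= s); [|lra]. apply m2. intros t [Ht Pt].
    apply Rnot_lt_le. intros L. apply N, Pt. lra. }
  assert (Pm : P m). { destruct Hm0 as [Hm0|Hm0]. apply PL; auto. now rewrite <- Hm0. }
  assert (Sm : S m). { split; auto. intros s Hs. destruct (Req_dec s m) as [->|]; auto. apply B. lra. }
  destruct (Rle_lt_or_eq_dec _ _ Hm1) as [L|E].
  - exfalso. destruct (PR m ltac:(lra) Pm) as [d [Hd A]].
    set (t := Rmin 1 (m + d / 2)). assert (T1 := Rmin_l 1 (m + d / 2)). assert (T2 := Rmin_r 1 (m + d / 2)).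
    assert (T3 : m < t) by (apply Rmin_glb_lt; lra). fold t in T1, T2.
    assert (t <= m); [|lra]. apply m1. split. lra. intros s Hs.
    destruct (Rle_dec s m). apply Sm; lra. apply A; lra.
  - intros t Ht. apply Sm. lra.
Qed.

Definition convex_open (X : C -> Prop) : Prop :=
  (forall x, X x -> near x X) /\
  forall x y t, X x -> X y -> 0 <= t <= 1 -> X (x + RtoC t * (y - x))%C.

Lemma convex_open_inter X Y : convex_open X -> convex_open Y -> convex_open (fun x => X x /\ Y x).
Proof.
  intros [A1 A2] [B1 B2]. split.
  - intros x [H K]. apply near_and; auto.
  - intros x y t [H1 H2] [K1 K2] Ht. auto.
Qed.

Lemma convex_open_ball c r : convex_open (fun x => Cmod (x - c)%C < r).
Proof.
  split. intros x. apply near_ball.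
  intros x y t Hx Hy Ht. replace (x + RtoC t * (y - x) - c)%C with (RtoC (1 - t) * (x - c) + RtoC t * (y - c))%C
    by (rewrite RtoC_minus; ring).
  apply Rle_lt_trans with (1 := Cmod_triangle _ _). rewrite !Cmod_mult, !Cmod_RtoC_pos by lra.
  destruct (Req_dec t 0) as [->|N]. rewrite Rminus_0_r, Rmult_0_l, Rmult_1_l. lra.
  assert ((1 - t) * Cmod (x - c)%C <= (1 - t) * r) by (apply Rmult_le_compat_l; lra).
  assert (t * Cmod (y - c)%C < t * r) by (apply Rmult_lt_compat_l; lra). lra.
Qed.

Definition seg_point (w v : C) (t : R) : C := (w + RtoC t * (v - w))%C.

Definition tube (w v : C) (T eps : R) (x : C) : Prop :=
  exists t, 0 <= t <= T /\ Cmod (x - seg_point w v t)%C < eps.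

Lemma convex_open_tube w v T eps : convex_open (tube w v T eps).
Proof.
  split.
  - intros x [t [Ht Hx]]. generalize (near_ball _ _ _ Hx). apply near_imp. intros y Hy. exists t. auto.
  - intros x y s [t1 [H1 K1]] [t2 [H2 K2]] Hs.
    exists ((1 - s) * t1 + s * t2). split.
    { assert (0 <= (1 - s) * t1 <= (1 - s) * T) by (split; [apply Rmult_le_pos|apply Rmult_le_compat_l]; lra).
      assert (0 <= s * t2 <= s * T) by (split; [apply Rmult_le_pos|apply Rmult_le_compat_l]; lra). lra. }
    replace (x + RtoC s * (y - x) - seg_point w v ((1 - s) * t1 + s * t2))%C with
      (RtoC (1 - s) * (x - seg_point w v t1) + RtoC s * (y - seg_point w v t2))%C.
    2:{ unfold seg_point. rewrite RtoC_plus, !RtoC_mult, RtoC_minus. ring. }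
    apply Rle_lt_trans with (1 := Cmod_triangle _ _). rewrite !Cmod_mult, !Cmod_RtoC_pos by lra.
    destruct (Req_dec s 0) as [->|N]. rewrite Rminus_0_r, Rmult_0_l, Rmult_1_l. lra.
    assert ((1 - s) * Cmod (x - seg_point w v t1)%C <= (1 - s) * eps) by (apply Rmult_le_compat_l; lra).
    assert (s * Cmod (y - seg_point w v t2)%C < s * eps) by (apply Rmult_lt_compat_l; lra). lra.
Qed.

Definition section_on (E : C -> Prop) (p : C -> C) (X : C -> Prop) (h : C -> C) : Prop :=
  forall v, X v -> E (h v) /\ p (h v) = v /\ cont h v.

Lemma section_sub E p (X Y : C -> Prop) h : (forall v, Y v -> X v) -> section_on E p X h -> section_on E p Y h.
Proof. intros H K v Hv. auto. Qed.

(** The last clause holds because a value of a section over [V] lies in some sheet, and the sheets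
    are open and disjoint. It makes disagreement of two sections an open condition. *)
Lemma sheet_at E B p z : covering_map E B p -> E z ->
  exists (V U : C -> Prop) (s : C -> C),
    near (p z) V /\ near z U /\ (forall v, V v -> U (s v) /\ E (s v) /\ p (s v) = v /\ cont s v) /\
    (forall x, U x -> V (p x) /\ s (p x) = x) /\
    (forall h X v, section_on E p X h -> X v -> V v -> ~ U (h v) -> near (h v) (fun x => ~ U x)).
Proof.
  intros [H1 [H2 H3]] Ez. destruct (H3 (p z) (proj1 (H1 z Ez))) as [V [oV [Vz [VB [I [U [s [oU [disj [cov [sec inv]]]]]]]]]]].
  destruct (proj1 (cov z) (conj Ez Vz)) as [i Ui].
  exists V, (U i), (s i). split; [|split; [|split; [|split]]].
  - now apply open_near.
  - apply open_near; auto.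
  - intros v Vv. destruct (sec i v Vv) as [S1 [S2 S3]]. repeat split; auto.
    apply (proj2 (cov (s i v))). now exists i. now apply continuous_cont.
  - intros x Ux. split; auto. apply (proj2 (cov x)). now exists i.
  - intros h X v Hh Xv Vv N. destruct (Hh v Xv) as [E1 [E2 _]].
    rewrite <- E2 in Vv. destruct (proj1 (cov _) (conj E1 Vv)) as [j Uj].
    generalize (open_near _ _ (oU j) Uj). apply near_imp. intros x Ux Ux'.
    apply N. now rewrite (disj _ _ _ Ux' Ux).
Qed.

(** Agreement and disagreement are both open: values in a common sheet are determined by their
    projections, and values in different sheets are kept apart. *)
Lemma sections_local E B p X h1 h2 v : covering_map E B p ->
  section_on E p X h1 -> section_on E p X h2 -> X v ->
  near v (fun v' => X v' -> (h1 v' = h2 v' <-> h1 v = h2 v)).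
Proof.
  intros Hp S1 S2 Xv. destruct (S1 v Xv) as [E1 [P1 C1]]. destruct (S2 v Xv) as [E2 [P2 C2]].
  destruct (sheet_at E B p (h1 v) Hp E1) as [V [U [s [nV [nU [sec [inv cl]]]]]]].
  rewrite P1 in nV.
  destruct (classic (U (h2 v))) as [U2|U2].
  - assert (h1 v = h2 v).
    { rewrite <- (proj2 (inv _ (near_self _ _ nU))), <- (proj2 (inv _ U2)). now rewrite P1, P2. }
    assert (nU2 : near (h2 v) U) by now rewrite <- H.
    generalize (near_and _ _ _ (cont_near _ _ _ C1 nU) (cont_near _ _ _ (proj2 (proj2 (S2 v Xv))) nU2)).
    apply near_imp. intros v' [A1 A2] Xv'. split; auto. intros _.
    destruct (S1 v' Xv') as [_ [Q1 _]]. destruct (S2 v' Xv') as [_ [Q2 _]].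
    rewrite <- (proj2 (inv _ A1)), <- (proj2 (inv _ A2)). now rewrite Q1, Q2.
  - assert (N := cl h2 X v S2 Xv (near_self _ _ nV) U2).
    generalize (near_and _ _ _ (cont_near _ _ _ C1 nU) (cont_near _ _ _ C2 N)).
    apply near_imp. intros v' [A1 A2] Xv'. split.
    + intros Eq. exfalso. apply A2. now rewrite <- Eq.
    + intros Eq. exfalso. apply U2. rewrite <- Eq. apply (near_self _ _ nU).
Qed.

Lemma seg_point_near w v t (P : C -> Prop) : near (seg_point w v t) P ->
  exists d, 0 < d /\ forall s, Rabs (s - t) < d -> P (seg_point w v s).
Proof.
  intros [e [He H]]. assert (Pv := Cmod_ge_0 (v - w)%C).
  exists (e / (Cmod (v - w)%C + 1)). split. apply Rdiv_lt_0_compat; lra.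
  intros s Hs. apply H. replace (seg_point w v s - seg_point w v t)%C with (RtoC (s - t) * (v - w))%C
    by (unfold seg_point; rewrite RtoC_minus; ring).
  rewrite Cmod_mult, Cmod_R. apply Rlt_div_r in Hs; [|lra]. assert (X := Rabs_pos (s - t)). lra.
Qed.

(** Agreement is open and closed along the segment from x to y, which stays in [X]. *)
Lemma section_unique E B p X h1 h2 x y : covering_map E B p -> convex_open X ->
  section_on E p X h1 -> section_on E p X h2 -> X x -> X y -> h1 x = h2 x -> h1 y = h2 y.
Proof.
  intros Hp [_ HX] S1 S2 Xx Xy Exy.
  assert (Xs : forall t, 0 <= t <= 1 -> X (seg_point x y t)) by (intros; apply HX; auto).
  assert (G : forall t, 0 <= t <= 1 -> h1 (seg_point x y t) = h2 (seg_point x y t)).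
  { apply real_induction.
    - unfold seg_point. now replace (x + RtoC 0 * (y - x))%C with x by ring.
    - intros t Ht Et. destruct (seg_point_near _ _ _ _ (sections_local E B p X h1 h2 _ Hp S1 S2 (Xs t ltac:(lra)))) as [d [Hd A]].
      exists d. split; auto. intros s Hs Hs1. apply A; auto. apply Rabs_lt_between; lra. apply Xs; lra.
    - intros t Ht Hl. destruct (seg_point_near _ _ _ _ (sections_local E B p X h1 h2 _ Hp S1 S2 (Xs t ltac:(lra)))) as [d [Hd A]].
      set (s := Rmax 0 (t - d / 2)). assert (T1 := Rmax_l 0 (t - d / 2)). assert (T2 := Rmax_r 0 (t - d / 2)). fold s in T1, T2.
      assert (T3 : s < t) by (apply Rmax_lub_lt; lra).
      apply (A s). apply Rabs_lt_between; lra. apply Xs; lra. apply Hl; lra. }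
  specialize (G 1 ltac:(lra)). unfold seg_point in G. now replace (x + RtoC 1 * (y - x))%C with y in G by ring.
Qed.

(** The lift is extended along the segment by [real_induction]. A tube is lifted rather than the
    bare segment, so that the section lives on an open convex set and [section_unique] applies. *)
Lemma section_tube E B p w v z0 : covering_map E B p -> E z0 -> p z0 = w ->
  (forall t, 0 <= t <= 1 -> B (seg_point w v t)) ->
  exists eps h, 0 < eps /\ section_on E p (tube w v 1 eps) h /\ h w = z0.
Proof.
  intros Hp Ez Pz HB.
  assert (G : forall T, 0 <= T <= 1 -> exists eps h, 0 < eps /\ section_on E p (tube w v T eps) h /\ h w = z0);
  [|apply G; lra].
  apply (real_induction (fun T => exists eps h, 0 < eps /\ section_on E p (tube w v T eps) h /\ h w = z0)).
  - destruct (sheet_at E B p z0 Hp Ez) as [V [U [s [[e [He nV]] [nU [sec [inv _]]]]]]].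
    exists e, s. split; auto. split.
    + intros x [t [Ht Hx]]. replace t with 0 in Hx by lra. unfold seg_point in Hx.
      replace (w + RtoC 0 * (v - w))%C with w in Hx by ring. rewrite Pz in nV.
      destruct (sec x (nV x Hx)) as [_ X]. exact X.
    + rewrite <- Pz. apply (inv z0 (near_self _ _ nU)).
  - intros T HT [eps [h [He [Hh Hw]]]]. assert (Pv := Cmod_ge_0 (v - w)%C).
    exists (eps / 2 / (Cmod (v - w)%C + 1)). split. apply Rdiv_lt_0_compat; lra.
    intros s Hs _. exists (eps / 2), h. split; [lra|]. split; auto.
    revert Hh. apply section_sub. intros x [t [Ht Hx]].
    destruct (Rle_dec t T). exists t. split; lra.
    exists T. split. lra. apply Rle_lt_trans with (1 := Cmod_dist_triangle _ (seg_point w v t) _).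
    replace (seg_point w v t - seg_point w v T)%C with (RtoC (t - T) * (v - w))%C
      by (unfold seg_point; rewrite RtoC_minus; ring).
    rewrite Cmod_mult, Cmod_RtoC_pos by lra.
    assert (Y : t - T < eps / 2 / (Cmod (v - w)%C + 1)) by lra. apply Rlt_div_r in Y; [|lra].
    assert ((t - T) * Cmod (v - w)%C <= (t - T) * (Cmod (v - w)%C + 1)) by (apply Rmult_le_compat_l; lra). lra.
  - intros T HT Hl. assert (Pv := Cmod_ge_0 (v - w)%C).
    assert (Hp3 := proj2 (proj2 Hp)).
    destruct (Hp3 (seg_point w v T) (HB T ltac:(lra))) as [V [oV [VT [VB [I [U [s [oU [disj [cov [sec inv]]]]]]]]]]].
    destruct (open_near _ _ oV VT) as [eta [Heta nV]].
    set (t' := Rmax 0 (T - eta / 2 / (Cmod (v - w)%C + 1))).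
    assert (Q : 0 < eta / 2 / (Cmod (v - w)%C + 1)) by (apply Rdiv_lt_0_compat; lra).
    assert (T1 := Rmax_l 0 (T - eta / 2 / (Cmod (v - w)%C + 1))).
    assert (T2 := Rmax_r 0 (T - eta / 2 / (Cmod (v - w)%C + 1))). fold t' in T1, T2.
    assert (T3 : t' < T) by (apply Rmax_lub_lt; lra).
    assert (Dist : forall t, t' <= t <= T -> Cmod (seg_point w v t - seg_point w v T)%C < eta / 2).
    { intros t Ht. rewrite Cmod_minus_sym. replace (seg_point w v T - seg_point w v t)%C with (RtoC (T - t) * (v - w))%C
        by (unfold seg_point; rewrite RtoC_minus; ring).
      rewrite Cmod_mult, Cmod_RtoC_pos by lra.
      assert (Y : T - t <= eta / 2 / (Cmod (v - w)%C + 1)) by lra. apply Rle_div_r in Y; [|lra].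
      destruct (Req_dec t T) as [->|N]. rewrite Rminus_diag. lra.
      assert ((T - t) * Cmod (v - w)%C < (T - t) * (Cmod (v - w)%C + 1)) by (apply Rmult_lt_compat_l; lra). lra. }
    destruct (Hl t' ltac:(lra)) as [eps [h [He [Hh Hw]]]].
    set (v' := seg_point w v t').
    assert (Tv' : tube w v t' eps v').
    { exists t'. split. lra. fold v'. replace (v' - v')%C with (RtoC 0) by ring. rewrite Cmod_0. lra. }
    assert (Bv' : Cmod (v' - seg_point w v T)%C < eta). { assert (X := Dist t' ltac:(lra)). fold v' in X. lra. }
    destruct (Hh v' Tv') as [Eh [Ph Ch]].
    destruct (proj1 (cov (h v'))) as [i Ui]. { rewrite Ph. split; auto. }
    assert (Hs : section_on E p (fun x => Cmod (x - seg_point w v T)%C < eta) (s i)).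
    { intros x Hx. destruct (sec i x (nV x Hx)) as [S1 [S2 S3]]. repeat split; auto.
      apply (proj2 (cov (s i x))). now exists i. now apply continuous_cont. }
    (* Both pieces are sections over the intersection of the tube with the ball, which is convex,
       and they agree at v'; therefore they can be glued. *)
    assert (Agree : forall x, tube w v t' eps x -> Cmod (x - seg_point w v T)%C < eta -> h x = s i x).
    { intros x Hx1 Hx2.
      apply (section_unique E B p (fun x => tube w v t' eps x /\ Cmod (x - seg_point w v T)%C < eta) h (s i) v' x).
      - exact Hp.
      - apply convex_open_inter. apply convex_open_tube. apply convex_open_ball.
      - revert Hh. apply section_sub. tauto.
      - revert Hs. apply section_sub. tauto.
      - auto.
      - auto.
      - rewrite <- (inv i _ Ui). now rewrite Ph. }
    set (g := fun x => if excluded_middle_informative (tube w v t' eps x) then h x else s i x).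
    assert (G1 : forall x, tube w v t' eps x -> g x = h x).
    { intros x Hx. unfold g. destruct excluded_middle_informative; tauto. }
    assert (G2 : forall x, Cmod (x - seg_point w v T)%C < eta -> g x = s i x).
    { intros x Hx. unfold g. destruct excluded_middle_informative; auto. }
    exists (Rmin eps (eta / 2)), g. split; [apply Rmin_pos; lra|]. split.
    + intros x [t [Ht Hx]]. assert (M1 := Rmin_l eps (eta / 2)). assert (M2 := Rmin_r eps (eta / 2)).
      destruct (Rle_dec t t') as [L|L].
      * assert (Tx : tube w v t' eps x). { exists t. split; lra. }
        destruct (Hh x Tx) as [A1 [A2 A3]]. rewrite G1 by auto. repeat split; auto.
        apply cont_ext_near with h; auto.
        generalize (proj1 (convex_open_tube w v t' eps) x Tx). apply near_imp. intros y Hy. symmetry; auto.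
      * assert (Bx : Cmod (x - seg_point w v T)%C < eta).
        { apply Rle_lt_trans with (1 := Cmod_dist_triangle _ (seg_point w v t) _). assert (X := Dist t ltac:(lra)). lra. }
        destruct (Hs x Bx) as [A1 [A2 A3]]. rewrite G2 by auto. repeat split; auto.
        apply cont_ext_near with (s i); auto.
        generalize (near_ball _ _ _ Bx). apply near_imp. intros y Hy. symmetry; auto.
    + rewrite G1; auto. exists 0. split; [lra|]. unfold seg_point. replace (w - (w + RtoC 0 * (v - w)))%C with (RtoC 0) by ring. now rewrite Cmod_0.
Qed.

(** The value at v is taken from a section over a tube along the segment from w to v. Near v it
    coincides with the neighbouring choices: two tubes from w meet in a convex set containing w, and
    both sections take the value z0 at w. *)
Lemma section_ball E B p w z0 d : covering_map E B p -> E z0 -> p z0 = w -> 0 < d ->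
  (forall v, Cmod (v - w)%C < d -> B v) ->
  exists h, section_on E p (fun v => Cmod (v - w)%C < d) h /\ h w = z0.
Proof.
  intros Hp Ez Pz Hd HB.
  assert (HBs : forall v t, Cmod (v - w)%C < d -> 0 <= t <= 1 -> B (seg_point w v t)).
  { intros v t Hv Ht. apply HB. replace (seg_point w v t - w)%C with (RtoC t * (v - w))%C by (unfold seg_point; ring).
    rewrite Cmod_mult, Cmod_RtoC_pos by lra. apply Rle_lt_trans with (2 := Hv).
    rewrite <- (Rmult_1_l (Cmod _)) at 2. apply Rmult_le_compat_r. apply Cmod_ge_0. lra. }
  assert (X : forall v, exists q : R * (C -> C), Cmod (v - w)%C < d ->
     0 < fst q /\ section_on E p (tube w v 1 (fst q)) (snd q) /\ snd q w = z0).
  { intros v. destruct (classic (Cmod (v - w)%C < d)) as [L|L].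
    - destruct (section_tube E B p w v z0 Hp Ez Pz (fun t => HBs v t L)) as [eps [h Hh]]. exists (eps, h). auto.
    - exists (0, fun v => v). tauto. }
  set (q := fun v => proj1_sig (constructive_indefinite_description _ (X v))).
  assert (Hq : forall v, Cmod (v - w)%C < d -> 0 < fst (q v) /\ section_on E p (tube w v 1 (fst (q v))) (snd (q v)) /\ snd (q v) w = z0)
    by (intros v; exact (proj2_sig (constructive_indefinite_description _ (X v)))).
  assert (Tw : forall v e, 0 < e -> tube w v 1 e w).
  { intros v e He. exists 0. split; [lra|]. unfold seg_point. replace (w - (w + RtoC 0 * (v - w)))%C with (RtoC 0) by ring. now rewrite Cmod_0. }
  assert (Tv : forall v e x, Cmod (x - v)%C < e -> tube w v 1 e x).
  { intros v e x He. exists 1. split. lra. unfold seg_point. now replace (w + RtoC 1 * (v - w))%C with v by ring. }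
  assert (Ag : forall v v', Cmod (v - w)%C < d -> Cmod (v' - w)%C < d -> tube w v 1 (fst (q v)) v' ->
     snd (q v') v' = snd (q v) v').
  { intros v v' Hv Hv' Ht. destruct (Hq v Hv) as [P1 [S1 W1]]. destruct (Hq v' Hv') as [P2 [S2 W2]].
    apply (section_unique E B p (fun x => tube w v' 1 (fst (q v')) x /\ tube w v 1 (fst (q v)) x) _ _ w v'); auto.
    - apply convex_open_inter; apply convex_open_tube.
    - revert S2. apply section_sub. tauto.
    - revert S1. apply section_sub. tauto.
    - split; auto. apply Tv. replace (v' - v')%C with (RtoC 0) by ring. now rewrite Cmod_0.
    - congruence. }
  exists (fun v => snd (q v) v). split.
  - intros v Hv. destruct (Hq v Hv) as [P1 [S1 W1]].
    destruct (S1 v) as [A1 [A2 A3]]. { apply Tv. replace (v - v)%C with (RtoC 0) by ring. now rewrite Cmod_0. }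
    repeat split; auto. apply cont_ext_near with (snd (q v)); auto.
    generalize (near_and _ _ _ (near_ball _ _ _ Hv) (near_ball_self v _ P1)). apply near_imp.
    intros v' [B1 B2]. symmetry. apply Ag; auto.
  - apply Hq. replace (w - w)%C with (RtoC 0) by ring. now rewrite Cmod_0.
Qed.

(** [p] is injective on the sheet through h v, and h takes its values in that sheet near v. *)
Lemma section_left_inverse E B p X h v : covering_map E B p -> section_on E p X h -> X v -> near v X ->
  near (h v) (fun z => h (p z) = z).
Proof.
  intros Hp Hh Xv nX. destruct (Hh v Xv) as [A1 [A2 A3]].
  destruct (sheet_at E B p (h v) Hp A1) as [V [U [s [nV [nU [sec [inv _]]]]]]].
  assert (Cp : cont p (h v)). { apply continuous_cont. apply Hp. auto. }
  rewrite A2 in nV.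
  assert (N := near_and _ _ _ nX (cont_near _ _ _ A3 nU)).
  rewrite <- A2 in N. assert (N2 := cont_near _ _ _ Cp N).
  generalize (near_and _ _ _ N2 nU). apply near_imp. intros z [[Xz Uz] Uz'].
  destruct (Hh _ Xz) as [_ [B2 _]].
  rewrite <- (proj2 (inv _ Uz)), B2. exact (proj2 (inv _ Uz')).
Qed.

(** * The Schwarz lemma for coverings by the disc, and the hyperbolic density *)

Lemma Cmod2_pos (z : C) : z <> 0%C -> 0 < Cmod z ^ 2.
Proof. intros H. apply pow_lt. now apply Cmod_gt_0. Qed.

Lemma Cmod2_RtoC (z : C) : RtoC (Cmod z ^ 2) = (z * Cconj z)%C.
Proof. rewrite <- Cmod2_conj. apply injective_projections; simpl; ring. Qed.

Lemma wd_Cmod2 F z a b : wd F z a b ->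
  wd (fun w => RtoC (Cmod (F w) ^ 2)) z (a * Cconj (F z) + F z * Cconj b)%C
    (Cconj (a * Cconj (F z) + F z * Cconj b))%C.
Proof.
  intros H. assert (X := wd_mult _ _ _ _ _ _ _ H (wd_conj _ _ _ _ H)).
  eapply wd_eq. eapply wd_ext; [|exact X]. intros w. now rewrite Cmod2_RtoC.
  reflexivity. rewrite Cplus_conj, !Cmult_conj, !Cconj_conj. ring.
Qed.

Lemma wd_ln_Cmod2 F z a : wd F z a 0 -> F z <> 0%C ->
  wd (fun w => RtoC (ln (Cmod (F w) ^ 2))) z (a / F z) (Cconj (a / F z)).
Proof.
  intros H N. assert (X := wd_Cmod2 _ _ _ _ H). assert (P := Cmod2_pos _ N).
  rewrite Cconj_0, Cmult_0_r, Cplus_0_r in X.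
  assert (Y := wd_comp_real ln (fun w => Cmod (F w) ^ 2) z _ _ X (is_derive_ln _ P)). cbv beta in Y.
  assert (E : (RtoC (/ Cmod (F z) ^ 2) * (a * Cconj (F z)))%C = (a / F z)%C).
  { rewrite RtoC_inv, Cmod2_RtoC by lra. field. split; auto. now apply Cconj_neq_0. }
  now rewrite E in Y.
Qed.

Lemma wd_real_plus (u v : C -> R) z a b :
  wd (fun w => RtoC (u w)) z a (Cconj a) -> wd (fun w => RtoC (v w)) z b (Cconj b) ->
  wd (fun w => RtoC (u w + v w)) z (a + b) (Cconj (a + b)).
Proof.
  intros H K. rewrite Cplus_conj. apply wd_ext with (2 := wd_plus _ _ _ _ _ _ _ H K).
  intros w. now rewrite RtoC_plus.
Qed.

Lemma wd_real_scal (k : R) (u : C -> R) z a :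
  wd (fun w => RtoC (u w)) z a (Cconj a) ->
  wd (fun w => RtoC (k * u w)) z (RtoC k * a) (Cconj (RtoC k * a)).
Proof.
  intros H. rewrite Cmult_conj, Cconj_RtoC. apply wd_ext with (2 := wd_scal (RtoC k) _ _ _ _ H).
  intros w. now rewrite RtoC_mult.
Qed.

Lemma mobius_identity (a z : C) :
  Cmod (1 - Cconj a * z)%C ^ 2 - Cmod (z - a)%C ^ 2 = (1 - Cmod a ^ 2) * (1 - Cmod z ^ 2).
Proof.
  apply RtoC_inj. rewrite RtoC_minus, RtoC_mult, !RtoC_minus, !Cmod2_RtoC, !Cminus_conj, Cmult_conj, Cconj_conj, Cconj_RtoC. ring.
Qed.

(** The Schwarz lemma for the section h over a disc about w, with values in the unit disc and h(w) =
    z0. As h is only known to be continuous, the maximum principle is applied in the variable z =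
    h(v), to a function built from the holomorphic p. It gives |h(v) - z0| r <= |1 - conj z0 h(v)|
    |v - w|, and the claim follows as v tends to w. *)
Lemma covering_schwarz (D : C -> Prop) (p : C -> C) (z0 l0 : C) (r d : R) :
  covering_map unit_disk D p -> (forall z, unit_disk z -> exists l, wd p z l 0) ->
  unit_disk z0 -> wd p z0 l0 0 -> l0 <> 0%C -> 0 < r < d ->
  (forall v, Cmod (v - p z0)%C < d -> D v) -> r <= (1 - Cmod z0 ^ 2) * Cmod l0.
Proof.
  intros Hp Hhol Ez Hl Nl Hr HD. set (w := p z0) in *.
  destruct (section_ball unit_disk D p w z0 d Hp Ez eq_refl ltac:(lra) HD) as [h [Hh hw]].
  assert (Hholo : forall z, unit_disk z -> holo p z).
  { intros z Hz. assert (N : near z unit_disk).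
    { unfold unit_disk in *. assert (X := near_ball z 0 1). replace (z - 0)%C with z in X by ring.
      generalize (X Hz). apply near_imp. intros v. now replace (v - 0)%C with v by ring. }
    revert N. apply near_imp. auto. }
  assert (Pz0 := Cmod_ge_0 z0). unfold unit_disk in Ez.
  assert (Sq1 : forall z : C, Cmod z < 1 -> Cmod z ^ 2 < 1).
  { intros z Hz. assert (X := Cmod_ge_0 z). nra. }
  assert (Den : forall z, Cmod z < 1 -> 1 - Cmod z0 <= Cmod (1 - Cconj z0 * z)%C).
  { intros z Hz. assert (T := Cmod_triangle_rev 1 (Cconj z0 * z)). rewrite Cmod_1, Cmod_mult, Cmod_conj in T.
    assert (Cmod z0 * Cmod z <= Cmod z0 * 1) by (apply Rmult_le_compat_l; lra). lra. }
  assert (DenN : forall z, Cmod z < 1 -> (1 - Cconj z0 * z)%C <> 0%C).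
  { intros z Hz. apply Cmod_gt_0. specialize (Den z Hz). lra. }
  assert (Phi1 : forall z, Cmod z < 1 -> Cmod (z - z0)%C ^ 2 <= Cmod (1 - Cconj z0 * z)%C ^ 2).
  { intros z Hz. assert (X := mobius_identity z0 z). assert (0 <= (1 - Cmod z0 ^ 2) * (1 - Cmod z ^ 2)); [|lra].
    apply Rmult_le_pos. specialize (Sq1 z0 Ez); lra. specialize (Sq1 z Hz); lra. }
  (* The logarithm of the squared pseudohyperbolic distance from z to z0, minus that of |p(z) -
     w|^2, with two perturbations: the exponent 1 - del sends u to minus infinity at z0, and eps
     |z|^2 has positive Laplacian, which excludes interior maxima. *)
  set (u := fun (del eps : R) (z : C) => ln (Cmod (z - z0)%C ^ 2) + (- (1)) * ln (Cmod (1 - Cconj z0 * z)%C ^ 2) +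
       (- (1 - del)) * ln (Cmod (p z - w)%C ^ 2) + eps * Cmod z ^ 2).
  set (G := fun (del eps : R) (z : C) => (1 / (z - z0) + RtoC (- (1)) * ((- Cconj z0) / (1 - Cconj z0 * z)) +
       RtoC (- (1 - del)) * (deriv p z / (p z - w)) + RtoC eps * Cconj z)%C).
  assert (Du : forall del eps z, Cmod z < 1 -> z <> z0 -> p z <> w ->
     wd (fun z => RtoC (u del eps z)) z (G del eps z) (Cconj (G del eps z))).
  { intros del eps z Hz Nz Nw. unfold u, G. repeat apply wd_real_plus; repeat apply wd_real_scal.
    - apply (wd_ln_Cmod2 (fun z => z - z0)%C). eapply wd_eq. apply wd_minus. apply wd_id. apply wd_const. ring. ring.
      now apply Cminus_neq_0.
    - apply (wd_ln_Cmod2 (fun z => 1 - Cconj z0 * z)%C). eapply wd_eq. apply wd_minus. apply wd_const.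
      apply wd_scal. apply wd_id. ring. ring. auto.
    - apply (wd_ln_Cmod2 (fun z => p z - w)%C). eapply wd_eq. apply wd_minus. apply holo_wd, Hholo, Hz. apply wd_const. ring. ring.
      now apply Cminus_neq_0.
    - assert (X := wd_Cmod2 _ _ _ _ (wd_id z)). rewrite Cconj_0, Cmult_0_r, Cplus_0_r, Cmult_1_l in X. exact X. }
  assert (DG : forall del eps z, Cmod z < 1 -> z <> z0 -> p z <> w -> exists ga, wd (G del eps) z ga (RtoC eps)).
  { intros del eps z Hz Nz Nw. eexists. eapply wd_eq. unfold G. apply wd_plus; [apply wd_plus; [apply wd_plus|]|].
    - apply wd_div. apply wd_const. apply wd_minus. apply wd_id. apply wd_const. now apply Cminus_neq_0.
    - apply wd_scal. apply wd_div. apply wd_const. apply wd_minus. apply wd_const. apply wd_scal. apply wd_id. auto.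
    - apply wd_scal. apply wd_div. apply holo_wd, holo_deriv, Hholo, Hz. apply wd_minus. apply holo_wd, Hholo, Hz. apply wd_const.
      now apply Cminus_neq_0.
    - apply wd_scal. apply wd_conj. apply wd_id.
    - reflexivity.
    - replace (Cconj 1) with (RtoC 1) by (apply injective_projections; simpl; ring). field.
      repeat split; auto using Cminus_neq_0. }
  assert (hE : forall v, Cmod (v - w)%C < d -> Cmod (h v) < 1 /\ p (h v) = v /\ cont h v) by exact Hh.
  assert (hN : forall v, Cmod (v - w)%C < d -> v <> w -> h v <> z0).
  { intros v Hv Nv E. apply Nv. destruct (hE v Hv) as [_ [E2 _]]. rewrite <- E2, E. reflexivity. }
  assert (Low : exists rho0, 0 < rho0 /\ rho0 < d /\ forall v, Cmod (v - w)%C < rho0 -> Cmod (h v - z0)%C <= 2 / Cmod l0 * Cmod (v - w)%C).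
  { assert (Pl := proj1 (Cmod_gt_0 l0) Nl).
    destruct (Hl (Cmod l0 / 2) ltac:(lra)) as [d1 [Hd1 L1]].
    assert (W0 : Cmod (w - w)%C < d). { replace (w - w)%C with (RtoC 0) by ring. rewrite Cmod_0; lra. }
    destruct (hE w W0) as [_ [_ C0]]. destruct (C0 d1 Hd1) as [d2 [Hd2 L2]]. rewrite hw in L2.
    exists (Rmin d2 (d / 2)). split. apply Rmin_pos; lra. assert (M2 := Rmin_r d2 (d / 2)). split. lra.
    intros v Hv. assert (A := L2 v (Rlt_le_trans _ _ _ Hv (Rmin_l _ _))). assert (B := L1 _ A).
    destruct (hE v ltac:(lra)) as [_ [Pv _]]. fold w in B. rewrite Pv in B.
    assert (T := Cmod_triangle_rev (l0 * (h v - z0)) (l0 * (h v - z0) - (v - w))).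
    replace (l0 * (h v - z0) - (l0 * (h v - z0) - (v - w)))%C with (v - w)%C in T by ring.
    replace (Cmod (l0 * (h v - z0) - (v - w))%C) with (Cmod (v - w - l0 * (h v - z0) - 0 * Cconj (h v - z0))%C) in T.
    2:{ rewrite Cmod_minus_sym. f_equal. ring. }
    rewrite Cmod_mult in T.
    replace (Cmod (h v - z0)%C) with (2 / Cmod l0 * (Cmod l0 / 2 * Cmod (h v - z0)%C)) by (field; lra).
    apply Rmult_le_compat_l. apply Rle_div_pos; lra. lra. }
  destruct Low as [rho0 [Hrho0 [Hrho0d Low]]].
  assert (Main : forall del eps v0, 0 < del < 1 -> 0 < eps -> 0 < Cmod (v0 - w)%C <= r ->
     u del eps (h v0) <= - (1 - del) * ln (r ^ 2) + eps).
  { intros del eps v0 Hdel Heps Hv0.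
    assert (Pl := proj1 (Cmod_gt_0 l0) Nl).
    (* The radius rho is so small that del ln rho^2 <= - K0; then u on the inner circle is below the
       bound obtained on the outer one. *)
    set (K0 := ln ((2 / Cmod l0) ^ 2) - ln ((1 - Cmod z0) ^ 2) + (1 - del) * ln (r ^ 2)).
    set (rho := Rmin (Rmin (Cmod (v0 - w)%C) (rho0 / 2)) (Rmin (exp (- K0 / (2 * del))) (r / 2))).
    assert (R1 : rho <= Cmod (v0 - w)%C) by (eapply Rle_trans; [apply Rmin_l|apply Rmin_l]).
    assert (R2 : rho <= rho0 / 2) by (eapply Rle_trans; [apply Rmin_l|apply Rmin_r]).
    assert (R3 : rho <= exp (- K0 / (2 * del))) by (eapply Rle_trans; [apply Rmin_r|apply Rmin_l]).
    assert (R4 : rho <= r / 2) by (eapply Rle_trans; [apply Rmin_r|apply Rmin_r]).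
    assert (R5 : 0 < rho). { unfold rho. repeat apply Rmin_pos; try lra. apply exp_pos. }
    set (An := fun v => rho <= Cmod (v - w)%C <= r).
    assert (CA : closed_bounded An).
    { destruct (closed_ball_closed_bounded w r) as [[M HM] Hc]. split.
      - exists M. intros z [_ Hz]. auto.
      - intros z Hz. destruct (Rle_dec (Cmod (z - w)%C) r) as [L|L].
        + assert (Lt : Cmod (z - w)%C < rho). { apply Rnot_le_lt. intros L'. apply Hz. split; auto. }
          generalize (near_ball _ _ _ Lt). apply near_imp. intros v Hv [X _]. lra.
        + generalize (Hc z L). apply near_imp. intros v Hv [_ X]. auto. }
    assert (Anw : forall v, An v -> v <> w /\ Cmod (v - w)%C < d).
    { intros v [A1 A2]. split; [|lra]. intros ->. replace (w - w)%C with (RtoC 0) in A1 by ring. rewrite Cmod_0 in A1. lra. }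
    destruct (usc_max An (fun v => u del eps (h v)) CA) as [vm [Avm Max]].
    { apply cont_RtoC_usc. intros v Av. destruct (Anw v Av) as [N1 N2]. destruct (hE v N2) as [E1 [E2 E3]].
      apply (cont_comp (fun z => RtoC (u del eps z)) h); auto. eapply wd_cont. apply Du; auto. rewrite E2; auto. }
    { exists v0. split; lra. }
    apply Rle_trans with (1 := Max v0 (conj R1 (proj2 Hv0))).
    destruct (Anw vm Avm) as [N1 N2]. destruct (hE vm N2) as [E1 [E2 E3]].
    assert (Nz := hN vm N2 N1).
    assert (P1 : 0 < Cmod (h vm - z0)%C ^ 2) by (apply Cmod2_pos, Cminus_neq_0; auto).
    assert (P2 : 0 < Cmod (1 - Cconj z0 * h vm)%C ^ 2) by (apply Cmod2_pos; auto).
    assert (Pe : eps * Cmod (h vm) ^ 2 <= eps).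
    { rewrite <- (Rmult_1_r eps) at 2. apply Rmult_le_compat_l. lra. apply Rlt_le, Sq1, E1. }
    destruct (Req_dec (Cmod (vm - w)%C) r) as [Er|Nr].
    - unfold u. rewrite E2, Er. assert (L := ln_le _ _ P1 (Phi1 _ E1)). lra.
    - destruct (Req_dec (Cmod (vm - w)%C) rho) as [Er|Nr'].
      + unfold u. rewrite E2, Er. assert (L := Low vm ltac:(lra)). rewrite Er in L.
        assert (L1 : ln (Cmod (h vm - z0)%C ^ 2) <= ln ((2 / Cmod l0) ^ 2) + ln (rho ^ 2)).
        { rewrite <- ln_mult. apply ln_le; auto. rewrite <- Rpow_mult_distr. apply pow_incr. split; auto. apply Cmod_ge_0.
          apply pow_lt, Rdiv_lt_0_compat; lra. now apply pow_lt. }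
        assert (L2 : ln ((1 - Cmod z0) ^ 2) <= ln (Cmod (1 - Cconj z0 * h vm)%C ^ 2)).
        { apply ln_le. apply pow_lt; lra. apply pow_incr. split. lra. apply Den, E1. }
        assert (L3 : ln (rho ^ 2) <= - K0 / del).
        { apply ln_le in R3; auto. rewrite ln_exp in R3. replace (rho ^ 2) with (rho * rho) by ring.
          rewrite ln_mult by auto. replace (- K0 / del) with (- K0 / (2 * del) + - K0 / (2 * del)) by (field; lra). lra. }
        assert (L4 : del * ln (rho ^ 2) <= - K0).
        { replace (- K0) with (del * (- K0 / del)) by (field; lra). apply Rmult_le_compat_l; lra. }
        unfold K0 in L4. lra.
      (* A maximum inside the annulus is a local maximum of u at h(vm), since h is a local inverse
         of p; but the Laplacian of u there is 4 eps > 0. *)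
      + exfalso. destruct Avm as [A1 A2].
        destruct (DG del eps (h vm) E1 Nz ltac:(rewrite E2; auto)) as [ga Hga].
        assert (Cp : cont p (h vm)). { eapply wd_cont. apply holo_wd, Hholo, E1. }
        assert (Inn : near vm (fun v => rho < Cmod (v - w)%C /\ Cmod (v - w)%C < r)).
        { apply near_and; [|apply near_ball; lra]. exists (Cmod (vm - w)%C - rho). split; [lra|].
          intros v Hv. assert (T := Cmod_dist_triangle vm v w). rewrite (Cmod_minus_sym vm v) in T. lra. }
        assert (Inv := section_left_inverse unit_disk D p _ h vm Hp Hh N2 (near_ball _ _ _ N2)).
        rewrite <- E2 in Inn. assert (Inn2 := cont_near _ _ _ Cp Inn).
        assert (Re (RtoC eps) <= 0).
        { apply (local_max_laplacian (u del eps) (G del eps) (h vm) ga (RtoC eps)); auto.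
          - generalize (near_and _ _ _ Inn2 (near_ball (h vm) 0 1 ltac:(replace (h vm - 0)%C with (h vm) by ring; auto))).
            apply near_imp. intros z [[B1 B2] B3]. replace (z - 0)%C with z in B3 by ring. apply Du; auto.
            + intros ->. fold w in B1. replace (w - w)%C with (RtoC 0) in B1 by ring. rewrite Cmod_0 in B1. lra.
            + intros E. rewrite E in B1. replace (w - w)%C with (RtoC 0) in B1 by ring. rewrite Cmod_0 in B1. lra.
          - generalize (near_and _ _ _ Inn2 Inv). apply near_imp. intros z [[B1 B2] B3].
            assert (X := Max (p z) (conj (Rlt_le _ _ B1) (Rlt_le _ _ B2))). now rewrite B3 in X. }
        simpl in H. lra. }
  assert (Main2 : forall v, 0 < Cmod (v - w)%C < r -> Cmod (h v - z0)%C * r <= Cmod (1 - Cconj z0 * h v)%C * Cmod (v - w)%C).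
  { intros v Hv. assert (Nv : v <> w). { intros ->. replace (w - w)%C with (RtoC 0) in Hv by ring. rewrite Cmod_0 in Hv. lra. }
    destruct (hE v ltac:(lra)) as [E1 [E2 E3]]. assert (Nz := hN v ltac:(lra) Nv).
    assert (P1 : 0 < Cmod (h v - z0)%C) by (apply Cmod_gt_0, Cminus_neq_0; auto).
    assert (P2 : 0 < Cmod (1 - Cconj z0 * h v)%C) by (apply Cmod_gt_0; auto).
    set (X := ln (Cmod (v - w)%C ^ 2) - ln (r ^ 2)).
    assert (HX : ln (Cmod (h v - z0)%C ^ 2) - ln (Cmod (1 - Cconj z0 * h v)%C ^ 2) <= X).
    { apply le_epsilon. intros e He.
      set (del := Rmin (1 / 2) (e / (2 * (Rabs X + 1)))). assert (AX := Rabs_pos X). assert (AX2 := Rle_abs (- X)).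
      rewrite Rabs_Ropp in AX2.
      assert (D1 : del <= 1 / 2) by apply Rmin_l. assert (D2 : del <= e / (2 * (Rabs X + 1))) by apply Rmin_r.
      assert (D3 : 0 < del). { apply Rmin_pos. lra. apply Rdiv_lt_0_compat; lra. }
      assert (M := Main del (e / 2) v ltac:(lra) ltac:(lra) ltac:(lra)). unfold u in M. rewrite E2 in M.
      assert (0 <= e / 2 * Cmod (h v) ^ 2). { apply Rmult_le_pos. lra. apply pow2_ge_0. }
      assert (del * (- X) <= e / 2).
      { apply Rle_trans with (del * (Rabs X + 1)). apply Rmult_le_compat_l; lra.
        apply Rle_trans with (e / (2 * (Rabs X + 1)) * (Rabs X + 1)). apply Rmult_le_compat_r; lra.
        apply Req_le. field. lra. }
      unfold X in *. lra. }
    assert (L : Cmod (h v - z0)%C ^ 2 * r ^ 2 <= Cmod (1 - Cconj z0 * h v)%C ^ 2 * Cmod (v - w)%C ^ 2).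
    { assert (Q1 := pow_lt _ 2 P1). assert (Q2 := pow_lt _ 2 P2). assert (Q3 := pow_lt _ 2 (proj1 Hv)).
      assert (Q4 := pow_lt _ 2 (proj1 Hr)).
      apply Rnot_lt_le. intros Lt. apply ln_increasing in Lt. 2: now apply Rmult_lt_0_compat.
      rewrite !ln_mult in Lt by auto. unfold X in HX. lra. }
    rewrite <- !Rpow_mult_distr in L. apply Rsqr_incr_0_var; [unfold Rsqr; simpl in L; lra|].
    apply Rmult_le_pos; lra. }
  (* The limit v -> w, evaluated at one point z so close to z0 that |p(z) - w| <= (|l0| + e1) |z -
     z0| and the Mobius denominator is within e1 of m. *)
  apply le_epsilon. intros e He.
  set (m := 1 - Cmod z0 ^ 2). assert (Hm : 0 < m) by (unfold m; specialize (Sq1 z0 Ez); lra).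
  assert (Pl := proj1 (Cmod_gt_0 l0) Nl).
  set (e1 := Rmin 1 (e / (Cmod l0 + m + 1))).
  assert (Q1 : e1 <= 1) by apply Rmin_l. assert (Q2 : e1 <= e / (Cmod l0 + m + 1)) by apply Rmin_r.
  assert (Q3 : 0 < e1). { apply Rmin_pos. lra. apply Rdiv_lt_0_compat; lra. }
  assert (Cw : cont (fun z => 1 - Cconj z0 * z)%C z0).
  { eapply wd_cont. apply wd_minus. apply wd_const. apply wd_scal. apply wd_id. }
  assert (W0 : Cmod (w - w)%C < d). { replace (w - w)%C with (RtoC 0) by ring. rewrite Cmod_0; lra. }
  assert (Inv := section_left_inverse unit_disk D p _ h w Hp Hh W0 (near_ball _ _ _ W0)). rewrite hw in Inv.
  assert (Cp := wd_cont _ _ _ _ Hl).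
  assert (Dlow : near z0 (fun z => Cmod l0 / 2 * Cmod (z - z0)%C <= Cmod (p z - w)%C)).
  { destruct (Hl (Cmod l0 / 2) ltac:(lra)) as [d1 [Hd1 L1]]. exists d1. split; auto. intros z Hz. specialize (L1 z Hz).
    fold w in L1. assert (T := Cmod_triangle_rev (l0 * (z - z0)) (l0 * (z - z0) - (p z - w))).
    replace (l0 * (z - z0) - (l0 * (z - z0) - (p z - w)))%C with (p z - w)%C in T by ring.
    replace (Cmod (l0 * (z - z0) - (p z - w))%C) with (Cmod (p z - w - l0 * (z - z0) - 0 * Cconj (z - z0))%C) in T.
    2:{ rewrite Cmod_minus_sym. f_equal. ring. }
    rewrite Cmod_mult in T. lra. }
  assert (N := near_and _ _ _ (near_and _ _ _ (Cw e1 Q3) (wd_lip _ _ _ _ e1 Hl Q3)) (near_and _ _ _ (near_and _ _ _ Inv Dlow)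
     (Cp r (proj1 Hr)))).
  destruct N as [d3 [Hd3 N]].
  set (z := (z0 + RtoC (d3 / 2))%C).
  assert (Ez1 : Cmod (z - z0)%C = d3 / 2).
  { unfold z. replace (z0 + RtoC (d3 / 2) - z0)%C with (RtoC (d3 / 2)) by ring. rewrite Cmod_RtoC_pos; lra. }
  destruct (N z ltac:(lra)) as [[N1 N2] [[N3 N4] N5]]. fold w in N2, N5.
  assert (Pv : 0 < Cmod (p z - w)%C).
  { apply Rlt_le_trans with (2 := N4). apply Rmult_lt_0_compat; lra. }
  assert (M := Main2 (p z) (conj Pv N5)). rewrite N3 in M.
  assert (Em : Cmod (1 - Cconj z0 * z0)%C = m).
  { replace (1 - Cconj z0 * z0)%C with (RtoC m). apply Cmod_RtoC_pos; lra.
    unfold m. rewrite RtoC_minus, Cmod2_RtoC. ring. }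
  assert (B1 : Cmod (1 - Cconj z0 * z)%C <= m + e1).
  { assert (T := Cmod_triangle_rev (1 - Cconj z0 * z) (1 - Cconj z0 * z0)). rewrite Em in T. lra. }
  rewrite Cmod_0, Rplus_0_r in N2.
  assert (B2 : Cmod (z - z0)%C * r <= (m + e1) * ((Cmod l0 + e1) * Cmod (z - z0)%C)).
  { apply Rle_trans with (1 := M). apply Rmult_le_compat; auto using Cmod_ge_0. }
  rewrite Ez1 in B2.
  assert (B3 : r <= (m + e1) * (Cmod l0 + e1)).
  { apply Rmult_le_reg_l with (d3 / 2). lra. lra. }
  apply Rle_trans with (1 := B3).
  replace ((m + e1) * (Cmod l0 + e1)) with (m * Cmod l0 + e1 * (Cmod l0 + m + e1)) by ring.
  apply Rplus_le_compat_l. apply Rle_trans with (e1 * (Cmod l0 + m + 1)). apply Rmult_le_compat_l; lra.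
  apply Rle_trans with (e / (Cmod l0 + m + 1) * (Cmod l0 + m + 1)). apply Rmult_le_compat_r; lra.
  apply Req_le. field. lra.
Qed.

(** For l in the set, l |p'(z)| (1 - |z|^2) = 1, and [covering_schwarz] bounds |p'(z)| (1 - |z|^2)
    below by every r' < r. *)
Lemma hyperbolic_density_bound (D : C -> Prop) (w : C) (r : R) : 0 < r ->
  (forall v, Cmod (v - w)%C < r -> D v) -> 0 <= hyperbolic_density D w <= / r.
Proof.
  intros Hr HD. unfold hyperbolic_density.
  set (S := fun l => exists (p : C -> C) (z : C), holomorphic_universal_covering D p /\ unit_disk z /\ p z = w /\
    l * Cmod (C_derive p z) = 1 / (1 - Cmod z ^ 2)).
  assert (HS : forall l, S l -> 0 < l <= / r).
  { intros l [p [z [[Hp Hhol] [Ez [Pz El]]]]].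
    assert (Q : 0 < 1 - Cmod z ^ 2).
    { unfold unit_disk in Ez. assert (X := Cmod_ge_0 z). nra. }
    assert (Dp := ex_derive_wd p z (Hhol z Ez)).
    assert (Pd : 0 < 1 / (1 - Cmod z ^ 2)) by (apply Rdiv_lt_0_compat; lra).
    assert (Cd := Cmod_ge_0 (C_derive p z)).
    assert (Nd : 0 < Cmod (C_derive p z)).
    { destruct Cd as [Cd|Cd]; auto. rewrite <- Cd, Rmult_0_r in El. lra. }
    assert (Hl : 0 < l). { apply Rmult_lt_reg_r with (Cmod (C_derive p z)); auto. lra. }
    split; auto.
    assert (B : forall r', 0 < r' < r -> r' * l <= 1).
    { intros r' Hr'. assert (X := covering_schwarz D p z (C_derive p z) r' r Hp (fun z Hz => ex_intro (fun l => wd p z l 0) _ (ex_derive_wd p z (Hhol z Hz))) Ez Dp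
        (proj2 (Cmod_gt_0 _) Nd) Hr'). rewrite Pz in X. specialize (X HD).
      replace 1 with ((1 - Cmod z ^ 2) * (l * Cmod (C_derive p z))) by (rewrite El; field; lra).
      replace ((1 - Cmod z ^ 2) * (l * Cmod (C_derive p z))) with ((1 - Cmod z ^ 2) * Cmod (C_derive p z) * l) by ring.
      apply Rmult_le_compat_r; lra. }
    apply Rmult_le_reg_l with r; auto. rewrite Rinv_r by lra.
    apply Rnot_lt_le. intros L. 
    assert (X := B ((r + / l) / 2)). assert (Il : / l < r).
    { apply Rmult_lt_reg_r with l; auto. rewrite Rinv_l; lra. }
    assert (Il' := Rinv_0_lt_compat l Hl). specialize (X ltac:(lra)).
    replace ((r + / l) / 2 * l) with ((r * l + 1) / 2) in X by (field; lra). lra. }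
  destruct (Lub_Rbar_correct S) as [U1 U2].
  (* An infinite supremum, such as that of the empty set, is sent to 0 by [real], and 0 satisfies
     both bounds. *)
  destruct (Lub_Rbar S) as [x| |] eqn:EL; simpl.
  - split.
    + destruct (classic (exists l, S l)) as [[l Hl]|N].
      * assert (X := U1 l Hl). simpl in X. specialize (HS l Hl). lra.
      * exfalso. assert (X := U2 m_infty). simpl in X. apply X. intros l Hl. exfalso. apply N. now exists l.
    + assert (X := U2 (/ r)). simpl in X. apply X. intros l Hl. simpl. apply HS, Hl.
  - split. lra. apply Rlt_le, Rinv_0_lt_compat, Hr.
  - split. lra. apply Rlt_le, Rinv_0_lt_compat, Hr.
Qed.

Lemma schwarzian_norm_pointwise (D : C -> Prop) (f : C -> C) (c : R) (z : C) (r : R) :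
  0 <= c -> Rbar_le (schwarzian_norm D f) (Finite c) -> D z -> 0 < r ->
  (forall v, Cmod (v - z)%C < r -> D v) -> Cmod (schwarzian f z) <= c / r ^ 2.
Proof.
  intros Hc H Dz Hr HD.
  set (S := fun r => exists z, D z /\ r = Rbar_mult (inv_sqr (hyperbolic_density D z)) (Cmod (schwarzian f z))).
  assert (HL : Rbar_is_lub S (schwarzian_norm D f)).
  { unfold schwarzian_norm. fold S. unfold Rbar_lub. destruct Rbar_ex_lub; assumption. }
  assert (X := proj1 HL _ (ex_intro _ z (conj Dz eq_refl)) : Rbar_le (Rbar_mult (inv_sqr (hyperbolic_density D z)) (Cmod (schwarzian f z))) (schwarzian_norm D f)).
  apply Rbar_le_trans with (2 := H) in X.
  destruct (hyperbolic_density_bound D z r Hr HD) as [L1 L2].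
  assert (P := Cmod_ge_0 (schwarzian f z)). assert (Q : 0 <= c / r ^ 2) by (apply Rle_div_pos; auto; now apply pow_lt).
  unfold inv_sqr in X. destruct Req_dec_T as [E|N].
  (* [inv_sqr 0] is [p_infty], and [p_infty] times a positive number is [p_infty]; a finite norm
     therefore forces the Schwarzian to vanish at z. *)
  - destruct P as [P|P]; [|lra]. exfalso. simpl in X.
    destruct (Rle_dec 0 (Cmod (schwarzian f z))) as [W|W]; [|lra].
    destruct (Rle_lt_or_eq_dec 0 (Cmod (schwarzian f z)) W); [|lra]. simpl in X. exact X.
  - simpl in X. set (lam := hyperbolic_density D z) in *.
    assert (Pl : 0 < lam) by lra. assert (Pl2 := pow_lt _ 2 Pl). assert (Pr2 := pow_lt _ 2 Hr).
    assert (Cmod (schwarzian f z) <= c * lam ^ 2).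
    { apply Rmult_le_reg_l with (/ lam ^ 2). now apply Rinv_0_lt_compat.
      replace (/ lam ^ 2 * (c * lam ^ 2)) with c by (field; lra). simpl in *. exact X. }
    apply Rle_trans with (1 := H0). unfold Rdiv. apply Rmult_le_compat_l; auto.
    rewrite <- pow_inv. apply pow_incr. lra.
Qed.

(** * The Jacobian, pre-Schwarzian and Schwarzian of a pair of holomorphic functions *)

(* A harmonic mapping is locally [h + conj g]; here [A = h'] and [B = g']. *)
Definition JJ (A B : C -> C) (z : C) : R := Cmod (A z) ^ 2 - Cmod (B z) ^ 2.
Definition PP (A B : C -> C) (z : C) : C :=
  ((deriv A z * Cconj (A z) - deriv B z * Cconj (B z)) / RtoC (JJ A B z))%C.
(** This is A^2 (B / A)', so that [tau] is the square of the hyperbolic derivative of the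
    dilatation. By [wd_PP], - tau is a quarter of the Laplacian of log J. *)
Definition TT (A B : C -> C) (z : C) : C := (A z * deriv B z - deriv A z * B z)%C.
Definition tau (A B : C -> C) (z : C) : R := Cmod (TT A B z) ^ 2 / JJ A B z ^ 2.
(** This is P_z - P^2/2: differentiating the denominator of P contributes - P^2, whence the
    coefficient 3/2. *)
Definition SS (A B : C -> C) (z : C) : C :=
  ((deriv (deriv A) z * Cconj (A z) - deriv (deriv B) z * Cconj (B z)) / RtoC (JJ A B z)
    - 3 / 2 * (PP A B z * PP A B z))%C.

Lemma JJ_RtoC A B z : RtoC (JJ A B z) = (A z * Cconj (A z) - B z * Cconj (B z))%C.
Proof. unfold JJ. now rewrite RtoC_minus, !Cmod2_RtoC. Qed.

Lemma JJ_neq_0 A B z : 0 < JJ A B z -> RtoC (JJ A B z) <> 0%C.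
Proof. intros H E. apply RtoC_inj in E. lra. Qed.

Lemma wd_JJ A B z : holo A z -> holo B z ->
  wd (fun w => RtoC (JJ A B w)) z (deriv A z * Cconj (A z) - deriv B z * Cconj (B z))
    (Cconj (deriv A z * Cconj (A z) - deriv B z * Cconj (B z))).
Proof.
  intros HA HB. apply holo_wd in HA. apply holo_wd in HB.
  apply wd_ext with (fun w => A w * Cconj (A w) - B w * Cconj (B w))%C.
  intros w. now rewrite JJ_RtoC.
  assert (X := wd_minus _ _ _ _ _ _ _ (wd_mult _ _ _ _ _ _ _ HA (wd_conj _ _ _ _ HA)) (wd_mult _ _ _ _ _ _ _ HB (wd_conj _ _ _ _ HB))).
  eapply wd_eq. exact X. rewrite Cconj_0. ring. rewrite Cminus_conj, !Cmult_conj, !Cconj_conj. ring.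
Qed.

Lemma wd_ln_JJ A B z : holo A z -> holo B z -> 0 < JJ A B z ->
  wd (fun w => RtoC (ln (JJ A B w))) z (PP A B z) (Cconj (PP A B z)).
Proof.
  intros HA HB HJ. assert (X := wd_comp_real ln _ z _ _ (wd_JJ A B z HA HB) (is_derive_ln _ HJ)).
  replace (PP A B z) with (RtoC (/ JJ A B z) * (deriv A z * Cconj (A z) - deriv B z * Cconj (B z)))%C; auto.
  unfold PP. rewrite RtoC_inv by lra. unfold Cdiv. ring.
Qed.

Lemma wd_PP A B z : holo A z -> holo B z -> 0 < JJ A B z ->
  wd (PP A B) z (SS A B z + PP A B z * PP A B z / 2)%C (- RtoC (tau A B z))%C.
Proof.
  intros HA HB HJ. assert (N := JJ_neq_0 _ _ _ HJ).
  assert (DA := holo_wd _ _ HA). assert (DB := holo_wd _ _ HB).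
  assert (DA2 := holo_wd _ _ (holo_deriv _ _ HA)). assert (DB2 := holo_wd _ _ (holo_deriv _ _ HB)).
  assert (X := wd_div _ _ _ _ _ _ _ (wd_minus _ _ _ _ _ _ _ (wd_mult _ _ _ _ _ _ _ DA2 (wd_conj _ _ _ _ DA))
     (wd_mult _ _ _ _ _ _ _ DB2 (wd_conj _ _ _ _ DB))) (wd_JJ A B z HA HB) N).
  unfold PP at 1. eapply wd_eq. exact X.
  - unfold SS, PP. rewrite Cconj_0. field. auto.
  - unfold tau, TT. unfold Rdiv. rewrite RtoC_mult, Cmod2_RtoC, RtoC_inv by (apply pow_nonzero; lra). simpl pow.
    rewrite Rmult_1_r, RtoC_mult. rewrite !Cminus_conj, !Cmult_conj, !Cconj_conj.
    rewrite JJ_RtoC in *. field. auto.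
Qed.

Lemma tau_nonneg A B z : 0 < JJ A B z -> 0 <= tau A B z.
Proof. intros H. apply Rle_div_pos. apply pow2_ge_0. now apply pow_lt. Qed.

Lemma holo_plus F G z : holo F z -> holo G z -> holo (fun w => F w + G w)%C z.
Proof.
  intros H K. generalize (near_and _ _ _ H K). apply near_imp. intros w [[l Hl] [m Hm]].
  exists (l + m)%C. eapply wd_eq. apply wd_plus; eassumption. reflexivity. ring.
Qed.

Lemma holo_mult F G z : holo F z -> holo G z -> holo (fun w => F w * G w)%C z.
Proof.
  intros H K. generalize (near_and _ _ _ H K). apply near_imp. intros w [[l Hl] [m Hm]].
  eexists. eapply wd_eq. apply wd_mult; eassumption. reflexivity. ring.
Qed.

Lemma holo_const c z : holo (fun _ => c) z.
Proof. exists 1. split. lra. intros w _. exists 0%C. apply wd_const. Qed.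

Lemma holo_scal c F z : holo F z -> holo (fun w => c * F w)%C z.
Proof. intros H. apply holo_mult; auto. apply holo_const. Qed.

Lemma holo_minus F G z : holo F z -> holo G z -> holo (fun w => F w - G w)%C z.
Proof.
  intros H K. generalize (near_and _ _ _ H K). apply near_imp. intros w [[l Hl] [m Hm]].
  exists (l - m)%C. eapply wd_eq. apply wd_minus; eassumption. reflexivity. ring.
Qed.

Lemma holo_div F G z : holo F z -> holo G z -> G z <> 0%C -> holo (fun w => F w / G w)%C z.
Proof.
  intros H K N. assert (N' := cont_neq_0 G z (wd_cont _ _ _ _ (holo_wd _ _ K)) N).
  generalize (near_and _ _ _ (near_and _ _ _ H K) N'). apply near_imp. intros w [[[l Hl] [m Hm]] Nw].
  eexists. eapply wd_eq. apply wd_div; eassumption. reflexivity. field. auto.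
Qed.

Lemma holo_near F z : holo F z -> near z (holo F).
Proof. apply near_near. Qed.

Lemma cont_JJ A B z : holo A z -> holo B z -> cont (fun w => RtoC (JJ A B w)) z.
Proof. intros. eapply wd_cont. apply wd_JJ; auto. Qed.

Lemma JJ_pos_near A B z : holo A z -> holo B z -> 0 < JJ A B z -> near z (fun w => 0 < JJ A B w).
Proof.
  intros HA HB HJ. generalize (cont_JJ A B z HA HB _ HJ). apply near_imp. intros w Hw.
  rewrite <- RtoC_minus, Cmod_R in Hw. apply Rabs_lt_between in Hw. lra.
Qed.

(** * From harmonic mappings to pairs of holomorphic functions *)

Lemma wd_Dx F z a b : wd F z a b -> Dx F z = (a + b)%C.
Proof.
  intros H. destruct z as [x y]. apply wd_h in H. destruct H as [H1 H2].
  apply injective_projections; simpl; apply is_derive_unique; assumption.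
Qed.

Lemma wd_Dy F z a b : wd F z a b -> Dy F z = (Ci * (a - b))%C.
Proof.
  intros H. destruct z as [x y]. apply wd_v in H. destruct H as [H1 H2].
  apply injective_projections; simpl; apply is_derive_unique; assumption.
Qed.

Lemma Ci_Ci : (Ci * Ci)%C = (-(1))%C.
Proof. apply injective_projections; simpl; ring. Qed.

Lemma wd_Dz F z a b : wd F z a b -> Dz F z = a.
Proof.
  intros H. unfold Dz. rewrite (wd_Dx _ _ _ _ H), (wd_Dy _ _ _ _ H), Cmult_assoc, Ci_Ci. field.
Qed.

Lemma locally_2d_near (P : C -> Prop) (x y : R) : near (x, y) P -> locally_2d (fun u v => P (u, v)) x y.
Proof.
  intros [d [Hd H]]. assert (Hd2 : 0 < d / 2) by lra. exists (mkposreal _ Hd2). simpl.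
  intros u v Hu Hv. apply H.
  replace ((u, v) - (x, y))%C with (RtoC (u - x) + RtoC (v - y) * Ci)%C
    by (apply injective_projections; simpl; ring).
  apply Rle_lt_trans with (1 := Cmod_triangle _ _). rewrite Cmod_mult, Cmod_Ci, !Cmod_R. lra.
Qed.

Lemma near_locally_2d (P : C -> Prop) (x y : R) : locally_2d (fun u v => P (u, v)) x y -> near (x, y) P.
Proof.
  intros [d H]. exists d. split. apply cond_pos. intros [u v] Hw. apply H.
  - apply Rle_lt_trans with (2 := Hw). exact (re_le_Cmod ((u, v) - (x, y))%C).
  - apply Rle_lt_trans with (2 := Hw). exact (im_le_Cmod ((u, v) - (x, y))%C).
Qed.

Lemma cont_continuity_2d (pr : C -> R) (F : C -> C) x y :
  (forall z w, Rabs (pr z - pr w) <= Cmod (z - w)%C) -> cont F (x, y) ->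
  continuity_2d_pt (fun u v => pr (F (u, v))) x y.
Proof.
  intros H K eps. apply (locally_2d_near (fun w => Rabs (pr (F w) - pr (F (x, y))) < eps)).
  generalize (K eps (cond_pos eps)). apply near_imp. intros w Hw. apply Rle_lt_trans with (2 := Hw). apply H.
Qed.

Lemma Re_lip (z w : C) : Rabs (Re z - Re w) <= Cmod (z - w)%C.
Proof. rewrite <- re_minus. apply re_le_Cmod. Qed.

Lemma Im_lip (z w : C) : Rabs (Im z - Im w) <= Cmod (z - w)%C.
Proof. rewrite <- im_minus. apply im_le_Cmod. Qed.

Lemma ex_derive_Re (g : R -> C) t : ex_derive g t -> ex_derive (fun t => Re (g t)) t.
Proof.
  intros [l H]. exists (Re l). apply (filterdiff_comp g (fst (A:=R) (B:=R)) _ (fst (A:=R)(B:=R)) H).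
  apply filterdiff_linear. apply is_linear_fst.
Qed.

Lemma ex_derive_Im (g : R -> C) t : ex_derive g t -> ex_derive (fun t => Im (g t)) t.
Proof.
  intros [l H]. exists (Im l). apply (filterdiff_comp g (snd (A:=R) (B:=R)) _ (snd (A:=R)(B:=R)) H).
  apply filterdiff_linear. apply is_linear_snd.
Qed.

(** A partial derivative in x that exists near z and is continuous at z, together with one in y at
    z, gives differentiability by [is_derive_filterdiff]. *)
Lemma class_C1_wd D F z : open D -> class_C1 D F -> D z -> wd F z (Dz F z) (Dzbar F z).
Proof.
  intros oD HF Dz0. destruct z as [x y].
  assert (Nd := open_near _ _ oD Dz0).
  assert (X : forall pr : C -> R, (forall z w, Rabs (pr z - pr w) <= Cmod (z - w)%C) ->
     (forall g t, ex_derive (g : R -> C) t -> ex_derive (fun t => pr (g t)) t) ->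
     (forall w, pr (Dx F w) = Derive (fun t => pr (F (t, Im w))) (Re w)) ->
     (forall w, pr (Dy F w) = Derive (fun t => pr (F (Re w, t))) (Im w)) ->
     differentiable_pt_lim (fun u v => pr (F (u, v))) x y (pr (Dx F (x, y))) (pr (Dy F (x, y)))).
  { intros pr P1 P2 P3 P4. destruct (HF (x, y) Dz0) as [E1 [E2 [C1 C2]]]. rewrite P3, P4. simpl Re; simpl Im.
    apply (filterdiff_differentiable_pt_lim (fun u v => pr (F (u, v)))).
    apply (is_derive_filterdiff (fun u v => pr (F (u, v))) x y (fun u v => Derive (fun t => pr (F (t, v))) u)).
    - apply (near_locally (x, y)). revert Nd. apply near_imp. intros w Dw. destruct (HF w Dw) as [E _].
      apply Derive_correct. now apply (P2 (fun t => F (t, Im w))).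
    - apply Derive_correct. now apply (P2 (fun t => F (x, t))).
    - apply continuous_cont in C1. apply filterlim_locally. intros eps. apply (near_locally (x, y)).
      generalize (C1 eps (cond_pos eps)). apply near_imp. intros w Hw.
      change (Rabs (Derive (fun t => pr (F (t, Im w))) (Re w) - Derive (fun t => pr (F (t, Im (x, y)))) (Re (x, y))) < eps).
      rewrite <- !P3. apply Rle_lt_trans with (2 := Hw). apply P1. }
  assert (X1 := X Re Re_lip ex_derive_Re (fun w => eq_refl) (fun w => eq_refl)).
  assert (X2 := X Im Im_lip ex_derive_Im (fun w => eq_refl) (fun w => eq_refl)).
  intros eps Heps. assert (He2 : 0 < eps / 2) by lra.
  assert (Y1 := near_locally_2d (fun w => Rabs (Re (F w) - Re (F (x, y)) - (Re (Dx F (x, y)) * (Re w - x) + Re (Dy F (x, y)) * (Im w - y))) <= eps / 2 * Rmax (Rabs (Re w - x)) (Rabs (Im w - y))) x y (X1 (mkposreal _ He2))).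
  assert (Y2 := near_locally_2d (fun w => Rabs (Im (F w) - Im (F (x, y)) - (Im (Dx F (x, y)) * (Re w - x) + Im (Dy F (x, y)) * (Im w - y))) <= eps / 2 * Rmax (Rabs (Re w - x)) (Rabs (Im w - y))) x y (X2 (mkposreal _ He2))).
  destruct (near_and _ _ _ Y1 Y2) as [d [Hd Y]]. exists d. split; auto. intros w Hw.
  destruct (Y w Hw) as [Z1 Z2].
  assert (M : Rmax (Rabs (Re w - x)) (Rabs (Im w - y)) <= Cmod (w - (x, y))%C).
  { apply Rmax_lub. exact (re_le_Cmod (w - (x, y))%C). exact (im_le_Cmod (w - (x, y))%C). }
  set (rr := Re (F w) - Re (F (x, y)) - (Re (Dx F (x, y)) * (Re w - x) + Re (Dy F (x, y)) * (Im w - y))) in *.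
  set (ii := Im (F w) - Im (F (x, y)) - (Im (Dx F (x, y)) * (Re w - x) + Im (Dy F (x, y)) * (Im w - y))) in *.
  assert (E : (F w - F (x, y) - Dz F (x, y) * (w - (x, y)) - Dzbar F (x, y) * Cconj (w - (x, y)))%C = (RtoC rr + RtoC ii * Ci)%C).
  { assert (E1 : (Dz F (x, y) * (w - (x, y)) + Dzbar F (x, y) * Cconj (w - (x, y)))%C =
      (Dx F (x, y) * RtoC (Re w - x) + Dy F (x, y) * RtoC (Im w - y))%C).
    { unfold Dz, Dzbar. set (P := Dx F (x, y)). set (Q := Dy F (x, y)).
      replace (w - (x, y))%C with (RtoC (Re w - x) + RtoC (Im w - y) * Ci)%C
        by (destruct w; apply injective_projections; simpl; ring).
      rewrite Cplus_conj, Cmult_conj, !Cconj_RtoC. replace (Cconj Ci) with (- Ci)%C by (apply injective_projections; simpl; ring).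
      replace ((P - Ci * Q) / 2 * (RtoC (Re w - x) + RtoC (Im w - y) * Ci) + (P + Ci * Q) / 2 * (RtoC (Re w - x) + RtoC (Im w - y) * - Ci))%C with
       (P * RtoC (Re w - x) - (Ci * Ci) * Q * RtoC (Im w - y))%C by field. rewrite Ci_Ci. ring. }
    replace (F w - F (x, y) - Dz F (x, y) * (w - (x, y)) - Dzbar F (x, y) * Cconj (w - (x, y)))%C with
      (F w - F (x, y) - (Dz F (x, y) * (w - (x, y)) + Dzbar F (x, y) * Cconj (w - (x, y))))%C by ring.
    rewrite E1. unfold rr, ii. apply injective_projections; unfold Re, Im; simpl; ring. }
  rewrite E. apply Rle_trans with (1 := Cmod_triangle _ _). rewrite Cmod_mult, Cmod_Ci, !Cmod_R.
  assert (eps / 2 * Rmax (Rabs (Re w - x)) (Rabs (Im w - y)) <= eps / 2 * Cmod (w - (x, y))%C) by (apply Rmult_le_compat_l; lra).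
  lra.
Qed.

Lemma mixed_partials D F z : open D -> class_C2 D F -> D z -> Dx (Dy F) z = Dy (Dx F) z.
Proof.
  intros oD [H1 [H2 H3]] Dz0. destruct z as [x y]. assert (Nd := open_near _ _ oD Dz0).
  assert (X : forall pr : C -> R, (forall z w, Rabs (pr z - pr w) <= Cmod (z - w)%C) ->
     (forall g t, ex_derive (g : R -> C) t -> ex_derive (fun t => pr (g t)) t) ->
     (forall F w, pr (Dx F w) = Derive (fun t => pr (F (t, Im w))) (Re w)) ->
     (forall F w, pr (Dy F w) = Derive (fun t => pr (F (Re w, t))) (Im w)) ->
     pr (Dx (Dy F) (x, y)) = pr (Dy (Dx F) (x, y))).
  { intros pr P1 P2 P3 P4.
    assert (E1 : forall w, pr (Dx (Dy F) w) = Derive (fun t => Derive (fun s => pr (F (t, s))) (Im w)) (Re w)).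
    { intros w. rewrite P3. apply Derive_ext. intros t. now rewrite P4. }
    assert (E2 : forall w, pr (Dy (Dx F) w) = Derive (fun t => Derive (fun s => pr (F (s, t))) (Re w)) (Im w)).
    { intros w. rewrite P4. apply Derive_ext. intros t. now rewrite P3. }
    rewrite E1, E2. simpl Re; simpl Im. apply (Schwarz (fun u v => pr (F (u, v)))).
    - apply (locally_2d_near (fun w => ex_derive (fun z => pr (F (z, Im w))) (Re w) /\ ex_derive (fun z => pr (F (Re w, z))) (Im w) /\
         ex_derive (fun z => Derive (fun t => pr (F (z, t))) (Im w)) (Re w) /\ ex_derive (fun z => Derive (fun t => pr (F (t, z))) (Re w)) (Im w))).
      revert Nd. apply near_imp. intros w Dw.
      destruct (H1 w Dw) as [A1 [A2 _]]. destruct (H2 w Dw) as [_ [B2 _]]. destruct (H3 w Dw) as [C1 _].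
      repeat split.
      + now apply (P2 (fun t => F (t, Im w))).
      + now apply (P2 (fun t => F (Re w, t))).
      + apply (P2 (fun t => Dy F (t, Im w))) in C1. revert C1. apply ex_derive_ext. intros t. now rewrite P4.
      + apply (P2 (fun t => Dx F (Re w, t))) in B2. revert B2. apply ex_derive_ext. intros t. now rewrite P3.
    - destruct (H3 _ Dz0) as [_ [_ [C1 _]]]. apply continuous_cont in C1.
      apply continuity_2d_pt_ext with (2 := cont_continuity_2d pr (Dx (Dy F)) x y P1 C1). intros u v. now rewrite E1.
    - destruct (H2 _ Dz0) as [_ [_ [_ C1]]]. apply continuous_cont in C1.
      apply continuity_2d_pt_ext with (2 := cont_continuity_2d pr (Dy (Dx F)) x y P1 C1). intros u v. now rewrite E2. }
  apply injective_projections.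
  - apply (X Re Re_lip ex_derive_Re (fun F w => eq_refl) (fun F w => eq_refl)).
  - apply (X Im Im_lip ex_derive_Im (fun F w => eq_refl) (fun F w => eq_refl)).
Qed.

Definition fA (f : C -> C) : C -> C := Dz f.
(** Conjugated so as to be the derivative of the g in h + conj g. Like [fA] it is globally defined,
    although h and g exist only locally. *)
Definition fB (f : C -> C) (z : C) : C := Cconj (Dzbar f z).

Lemma harmonic_wd D f z : open D -> harmonic D f -> D z -> wd f z (fA f z) (Cconj (fB f z)).
Proof.
  intros oD [[H _] _] Hz. unfold fA, fB. rewrite Cconj_conj. now apply class_C1_wd with D.
Qed.

(** By the symmetry of mixed partials, the derivative of f_z in conj z and that of f_zbar in z are
    both a quarter of the Laplacian; conjugation turns the second into the derivative of [fB f] in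
    conj z. *)
Lemma harmonic_holo D f z : open D -> harmonic D f -> D z -> holo (fA f) z /\ holo (fB f) z.
Proof.
  intros oD [H2 Hl] Hz.
  assert (X : forall w, D w -> (exists l, wd (fA f) w l 0) /\ (exists l, wd (fB f) w l 0)).
  { intros w Dw. assert (Sy := mixed_partials D f w oD H2 Dw). specialize (Hl w Dw).
    destruct H2 as [_ [H2 H3]].
    assert (W1 := class_C1_wd _ _ _ oD H2 Dw). assert (W2 := class_C1_wd _ _ _ oD H3 Dw).
    split.
    - eexists. unfold fA. eapply wd_eq. eapply wd_ext.
      2: apply (wd_scal (/ 2)%C _ _ _ _ (wd_minus _ _ _ _ _ _ _ W1 (wd_scal Ci _ _ _ _ W2))).
      intros v. unfold Dz. field. reflexivity.
      unfold Dzbar. rewrite Sy.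
      replace (/ 2 * ((Dx (Dx f) w + Ci * Dy (Dx f) w) / 2 - Ci * ((Dy (Dx f) w + Ci * Dy (Dy f) w) / 2)))%C with
        (/ 4 * (Dx (Dx f) w - (Ci * Ci) * Dy (Dy f) w))%C by field. rewrite Ci_Ci.
      replace (Dx (Dx f) w - - (1) * Dy (Dy f) w)%C with (Dx (Dx f) w + Dy (Dy f) w)%C by ring. rewrite Hl. ring.
    - eexists. unfold fB. eapply wd_eq. apply wd_conj. eapply wd_ext.
      2: apply (wd_scal (/ 2)%C _ _ _ _ (wd_plus _ _ _ _ _ _ _ W1 (wd_scal Ci _ _ _ _ W2))).
      intros v. unfold Dzbar. field. reflexivity.
      unfold Dz. rewrite Sy.
      replace (/ 2 * ((Dx (Dx f) w - Ci * Dy (Dx f) w) / 2 + Ci * ((Dy (Dx f) w - Ci * Dy (Dy f) w) / 2)))%C with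
        (/ 4 * (Dx (Dx f) w - (Ci * Ci) * Dy (Dy f) w))%C by field. rewrite Ci_Ci.
      replace (Dx (Dx f) w - - (1) * Dy (Dy f) w)%C with (Dx (Dx f) w + Dy (Dy f) w)%C by ring. rewrite Hl.
      rewrite Cmult_0_r. apply Cconj_0. }
  split; generalize (open_near _ _ oD Hz); apply near_imp; intros w Dw; apply X; auto.
Qed.

Lemma jacobian_JJ f z : jacobian f z = JJ (fA f) (fB f) z.
Proof. unfold jacobian, JJ, fA, fB. now rewrite Cmod_conj. Qed.

Lemma schwarzian_SS D f z : open D -> harmonic D f -> (forall z, D z -> 0 < jacobian f z) -> D z ->
  schwarzian f z = SS (fA f) (fB f) z.
Proof.
  intros oD Hf HJ Hz. unfold schwarzian. set (A := fA f). set (B := fB f).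
  assert (X : forall w, D w -> Dz (log_jacobian f) w = PP A B w).
  { intros w Dw. destruct (harmonic_holo D f w oD Hf Dw) as [HA HB].
    eapply wd_Dz. eapply wd_ext; [|apply (wd_ln_JJ A B w HA HB)].
    intros v. unfold log_jacobian. now rewrite jacobian_JJ. unfold A, B. rewrite <- jacobian_JJ. auto. }
  destruct (harmonic_holo D f z oD Hf Hz) as [HA HB].
  assert (HJz : 0 < JJ A B z) by (unfold A, B; rewrite <- jacobian_JJ; auto).
  rewrite X by auto.
  erewrite (wd_Dz (Dz (log_jacobian f))).
  2:{ eapply wd_ext_near; [|apply (wd_PP A B z HA HB HJz)].
      generalize (open_near _ _ oD Hz). apply near_imp. intros w Dw. symmetry. auto. }
  field.
Qed.

(** * Bounds on the unit disc for pairs with small Schwarzian *)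

Definition good_pair (c : R) (A B : C -> C) : Prop :=
  forall z, Cmod z < 1 -> holo A z /\ holo B z /\ 0 < JJ A B z /\ Cmod (SS A B z) <= c.

Lemma nonincreasing_of_derive (f df : R -> R) (T : R) :
  (forall t, 0 <= t <= T -> is_derive f t (df t)) -> (forall t, 0 <= t <= T -> df t <= 0) ->
  forall t, 0 <= t <= T -> f t <= f 0.
Proof.
  intros H1 H2 t Ht. destruct (MVT_gen f 0 t df) as [c [Hc E]].
  - intros x Hx. rewrite Rmin_left, Rmax_right in Hx by lra. apply H1. lra.
  - intros x Hx. rewrite Rmin_left, Rmax_right in Hx by lra.
    apply derivable_continuous_pt. exists (df x). apply is_derive_Reals, H1. lra.
  - rewrite Rmin_left, Rmax_right in Hc by lra. specialize (H2 c ltac:(lra)). nra.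
Qed.

Lemma ln_sqr x : 0 < x -> ln (x ^ 2) = 2 * ln x.
Proof. intros H. replace (x ^ 2) with (x * x) by ring. rewrite ln_mult by auto. ring. Qed.

Lemma tau_cont A B z : holo A z -> holo B z -> 0 < JJ A B z -> cont (fun w => RtoC (tau A B w)) z.
Proof.
  intros HA HB HJ.
  assert (HT : holo (TT A B) z).
  { apply holo_minus; apply holo_mult; auto using holo_deriv. }
  assert (D1 := wd_Cmod2 _ _ _ _ (holo_wd _ _ HT)). assert (D2 := wd_JJ A B z HA HB).
  assert (N := JJ_neq_0 _ _ _ HJ).
  assert (D3 := wd_div _ _ _ _ _ _ _ D1 (wd_mult _ _ _ _ _ _ _ D2 D2) (Cmult_neq_0 _ _ N N)).
  apply wd_cont in D3. revert D3. apply cont_ext_near.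
  generalize (JJ_pos_near _ _ _ HA HB HJ). apply near_imp. intros w Hw. unfold tau, Rdiv.
  rewrite RtoC_mult, RtoC_inv by (apply pow_nonzero; lra). simpl pow. rewrite !Rmult_1_r, !RtoC_mult. reflexivity.
Qed.

(** Ahlfors' argument with the weight m^2, m = rho^2 - |z|^2, which vanishes on a circle of radius
    rho < 1, so that a positive maximum of m^2 tau lies inside. There a quarter of the Laplacian of
    its logarithm is 2 tau - 2 rho^2 / m^2: ln |TT|^2 is harmonic, and the two terms come from -2 ln
    J and 2 ln m. Hence m^2 tau <= rho^2 everywhere, and m >= 0.56 for |z| <= 1/2. *)
Lemma tau_le_4 A B : (forall z, Cmod z < 1 -> holo A z /\ holo B z /\ 0 < JJ A B z) ->
  forall z, Cmod z <= 1 / 2 -> tau A B z <= 4.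
Proof.
  intros H z Hz. set (rho := 9 / 10). set (m := fun w : C => rho ^ 2 - Cmod w ^ 2).
  set (Psi := fun w => m w ^ 2 * tau A B w).
  assert (HB1 : forall w : C, Cmod (w - 0)%C = Cmod w). { intros w. f_equal. ring. }
  assert (Main : forall w, Cmod w <= rho -> Psi w <= rho ^ 2).
  { destruct (usc_max (fun w => Cmod (w - 0)%C <= rho) Psi (closed_ball_closed_bounded 0 rho)) as [zm [Hzm Max]].
    - apply cont_RtoC_usc. intros w Hw. rewrite HB1 in Hw.
      destruct (H w ltac:(unfold rho in Hw; lra)) as [HA [HB HJ]].
      assert (D1 := wd_minus _ _ _ _ _ _ _ (wd_const (RtoC (rho ^ 2)) w) (wd_Cmod2 _ _ _ _ (wd_id w))).
      assert (D2 := wd_cont _ _ _ _ (wd_mult _ _ _ _ _ _ _ D1 D1)).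
      assert (D3 := tau_cont A B w HA HB HJ).
      intros e He. 
      assert (X : cont2 (fun s t : R => RtoC s * RtoC t)%C (m w ^ 2) (tau A B w)).
      { apply cont2_mult. apply cont2_l. apply (cont2_r RtoC). intros e' He'. exists e'. split; auto. intros s Hs. now rewrite <- RtoC_minus, Cmod_R. }
      destruct (X e He) as [d [Hd G]].
      generalize (near_and _ _ _ (D2 d Hd) (D3 d Hd)). apply near_imp. intros v [V1 V2].
      unfold Psi. rewrite !RtoC_mult. apply G.
      + assert (E : forall u, (RtoC (m u ^ 2) = (RtoC (rho ^ 2) - RtoC (Cmod u ^ 2)) * (RtoC (rho ^ 2) - RtoC (Cmod u ^ 2)))%C).
        { intros u. unfold m. rewrite <- RtoC_minus, <- RtoC_mult. f_equal. ring. }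
        rewrite <- !E in V1. now rewrite <- RtoC_minus, Cmod_R in V1.
      + now rewrite <- RtoC_minus, Cmod_R in V2.
    - exists 0%C. rewrite HB1, Cmod_0. unfold rho. lra.
    - rewrite HB1 in Hzm. intros w Hw. apply Rle_trans with (Psi zm). { apply Max. now rewrite HB1. }
      destruct (Rle_lt_dec (Psi zm) 0) as [L|L]. { unfold rho. lra. }
      destruct (H zm ltac:(unfold rho in Hzm; lra)) as [HA [HB HJ]].
      assert (Pt := tau_nonneg A B zm HJ).
      assert (Pt' : 0 < tau A B zm). { destruct Pt as [Pt|Pt]; auto. unfold Psi in L. rewrite <- Pt in L. lra. }
      assert (P0 := Cmod_ge_0 zm).
      assert (Lt : Cmod zm < rho). { destruct Hzm as [Hzm|E]; auto. unfold Psi, m in L. rewrite E in L. lra. }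
      assert (Lt1 : Cmod zm < 1) by (unfold rho in Lt; lra).
      assert (Pm : 0 < m zm). { unfold m. nra. }
      assert (NT : TT A B zm <> 0%C). { intros E. unfold tau in Pt'. rewrite E, Cmod_0 in Pt'. simpl in Pt'. lra. }
      set (u := fun w => ln (Cmod (TT A B w) ^ 2) + (- (2)) * ln (JJ A B w) + 2 * ln (m w)).
      set (G := fun w => (deriv (TT A B) w / TT A B w + RtoC (- (2)) * PP A B w + RtoC 2 * ((- Cconj w) / RtoC (m w)))%C).
      assert (HT : forall w, Cmod w < 1 -> holo (TT A B) w).
      { intros v Hv. destruct (H v Hv) as [A1 [B1 _]]. apply holo_minus; apply holo_mult; auto using holo_deriv. }
      assert (Dm : forall v, wd (fun w => RtoC (m w)) v (- Cconj v)%C (Cconj (- Cconj v))).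
      { intros v. unfold m. eapply wd_eq. eapply wd_ext.
        2: apply (wd_minus _ _ _ _ _ _ _ (wd_const (RtoC (rho ^ 2)) v) (wd_Cmod2 _ _ _ _ (wd_id v))).
        intros. now rewrite RtoC_minus. rewrite Cconj_0. ring. rewrite Cconj_0.
        replace (1 * Cconj v + v * 0)%C with (Cconj v) by ring. rewrite Copp_conj. ring. }
      assert (nm : near zm (fun v => 0 < m v)).
      { generalize (wd_cont _ _ _ _ (Dm zm) _ Pm). apply near_imp. intros v Hv.
        rewrite <- RtoC_minus, Cmod_R in Hv. apply Rabs_lt_between in Hv. lra. }
      assert (nT := cont_neq_0 _ _ (wd_cont _ _ _ _ (holo_wd _ _ (HT zm ltac:(unfold rho in Lt; lra)))) NT).
      assert (n1 : near zm (fun v => Cmod v < rho)).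
      { generalize (near_ball zm 0 rho ltac:(now rewrite HB1)). apply near_imp. intros v. now rewrite HB1. }
      assert (Re (2 * RtoC (tau A B zm) - 2 * RtoC (rho ^ 2) / (RtoC (m zm) * RtoC (m zm)))%C <= 0).
      { apply (local_max_laplacian u G zm (deriv (fun w => deriv (TT A B) w / TT A B w)%C zm + RtoC (- (2)) * (SS A B zm + PP A B zm * PP A B zm / 2) +
            RtoC 2 * ((0 * RtoC (m zm) - (- Cconj zm) * (- Cconj zm)) / (RtoC (m zm) * RtoC (m zm))))%C).
        - generalize (near_and _ _ _ (near_and _ _ _ nm nT) n1). apply near_imp. intros v [[V1 V2] V3].
          destruct (H v ltac:(unfold rho in V3; lra)) as [A1 [B1 J1]].
          unfold u, G. apply wd_real_plus; [apply wd_real_plus|]; try apply wd_real_scal.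
          + apply (wd_ln_Cmod2 (TT A B)); auto. apply holo_wd, HT. unfold rho in V3; lra.
          + now apply wd_ln_JJ.
          + assert (X := wd_comp_real ln m v _ _ (Dm v) (is_derive_ln _ V1)).
            replace (- Cconj v / RtoC (m v))%C with (RtoC (/ m v) * - Cconj v)%C; auto.
            rewrite RtoC_inv by lra. unfold Cdiv. ring.
        - eapply wd_eq. unfold G. apply wd_plus; [apply wd_plus|].
          + apply holo_wd. apply holo_div; [apply holo_deriv, HT, Lt1|apply HT, Lt1|exact NT].
          + apply wd_scal. apply wd_PP; auto.
          + apply wd_scal. apply wd_div. apply wd_opp. apply wd_conj. apply wd_id. apply Dm.
            intros E. apply RtoC_inj in E. lra.
          + rewrite Cconj_0, Copp_0. reflexivity.
          + assert (Nm : RtoC (m zm) <> 0%C) by (intros E; apply RtoC_inj in E; lra).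
            rewrite Copp_conj, Cconj_conj. replace (Cconj 1) with (RtoC 1) by (apply injective_projections; simpl; ring).
            replace (RtoC (rho ^ 2)) with (RtoC (m zm) + zm * Cconj zm)%C.
            2:{ unfold m. rewrite RtoC_minus, Cmod2_RtoC. ring. }
            rewrite RtoC_opp. field. auto.
        - generalize (near_and _ _ _ (near_and _ _ _ nm nT) n1). apply near_imp. intros v [[V1 V2] V3].
          assert (Jv : 0 < JJ A B v) by (apply H; unfold rho in V3; lra).
          assert (Lu : forall x, 0 < m x -> 0 < JJ A B x -> TT A B x <> 0%C -> u x = ln (Psi x)).
          { intros x X1 X2 X3. unfold u, Psi, tau, Rdiv. assert (Q := Cmod2_pos _ X3). assert (Q2 := pow_lt _ 2 X2). assert (Q1 := pow_lt _ 2 X1).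
            assert (Q3 := Rinv_0_lt_compat _ Q2).
            rewrite ln_mult by (auto; apply Rmult_lt_0_compat; auto).
            rewrite (ln_mult _ _ Q Q3), ln_Rinv, (ln_sqr (m x)), (ln_sqr (JJ A B x)) by auto. ring. }
          rewrite !Lu by auto. apply ln_le.
          + unfold Psi. apply Rmult_lt_0_compat. now apply pow_lt. unfold tau. apply Rdiv_lt_0_compat. now apply Cmod2_pos. now apply pow_lt.
          + apply Max. rewrite HB1. lra. }
      rewrite <- RtoC_mult, <- RtoC_mult, <- RtoC_mult, <- RtoC_div, <- RtoC_minus in H0 by nra.
      change (2 * tau A B zm - 2 * rho ^ 2 / (m zm * m zm) <= 0) in H0.
      unfold Psi. replace (rho ^ 2) with (m zm ^ 2 * (rho ^ 2 / (m zm * m zm))) by (field; lra).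
      apply Rmult_le_compat_l. apply pow2_ge_0.
      replace (2 * rho ^ 2 / (m zm * m zm)) with (2 * (rho ^ 2 / (m zm * m zm))) in H0 by (field; lra). lra. }
  assert (P0 := Cmod_ge_0 z). specialize (Main z ltac:(unfold rho; lra)). unfold Psi, m, rho in Main.
  assert (Jz : 0 < JJ A B z) by (apply H; lra). assert (Pt := tau_nonneg A B z Jz).
  assert (Q : 56 / 100 <= (9 / 10) ^ 2 - Cmod z ^ 2) by nra.
  assert (Q2 : 3 / 10 <= ((9 / 10) ^ 2 - Cmod z ^ 2) ^ 2) by nra.
  assert (3 / 10 * tau A B z <= (9 / 10) ^ 2) by (apply Rle_trans with (2 := Main); apply Rmult_le_compat_r; lra). lra.
Qed.

Lemma PP_cont A B z : holo A z -> holo B z -> 0 < JJ A B z -> cont (PP A B) z.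
Proof. intros. eapply wd_cont. apply wd_PP; auto. Qed.

Lemma Re_le_bound (z : C) (b : R) : Cmod z <= b -> - b <= Re z <= b.
Proof. intros H. assert (X := re_le_Cmod z). apply Rabs_le_between. lra. Qed.

Lemma Im_le_bound (z : C) (b : R) : Cmod z <= b -> - b <= Im z <= b.
Proof. intros H. assert (X := im_le_Cmod z). apply Rabs_le_between. lra. Qed.

(* If |P| were too large at a point, the Riccati equation P_z = P^2/2 + S would
   force a blow-up within distance 3/|P|. *)
Lemma PP_bound A B : good_pair 1 A B ->
  forall z, Cmod z <= 1 / 2 -> Cmod (PP A B z) * (1 / 2 - Cmod z) <= 2 * exp 8.
Proof.
  intros H z Hz.
  assert (HB1 : forall w : C, Cmod (w - 0)%C = Cmod w). { intros w. f_equal. ring. }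
  destruct (usc_max (fun w => Cmod (w - 0)%C <= 1 / 2) (fun w => Cmod (PP A B w) * (1 / 2 - Cmod w))
     (closed_ball_closed_bounded 0 (1 / 2))) as [zm [Hzm Max]].
  - intros w Hw e He. rewrite HB1 in Hw. destruct (H w ltac:(lra)) as [HA [HB [HJ _]]].
    assert (Cn := PP_cont A B w HA HB HJ). set (M := Cmod (PP A B w) + 2).
    assert (HM : 0 < M) by (unfold M; assert (X := Cmod_ge_0 (PP A B w)); lra).
    set (e1 := Rmin 1 (e / (2 * M))).
    assert (E1 : e1 <= 1) by apply Rmin_l. assert (E2 : e1 <= e / (2 * M)) by apply Rmin_r.
    assert (E3 : 0 < e1) by (apply Rmin_pos; [lra|apply Rdiv_lt_0_compat; lra]).
    generalize (near_and _ _ _ (Cn e1 E3) (near_ball_self w e1 E3)). apply near_imp. intros v [V1 V2] Hv.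
    rewrite HB1 in Hv.
    assert (T1 := Cmod_triangle_rev (PP A B v) (PP A B w)).
    assert (T2 := Cmod_triangle_rev w v). rewrite (Cmod_minus_sym w v) in T2.
    assert (P1 := Cmod_ge_0 v). assert (P2 := Cmod_ge_0 (PP A B w)). assert (P3 := Cmod_ge_0 (PP A B v)).
    assert (Em : e1 * M <= e / 2).
    { apply Rle_trans with (e / (2 * M) * M). apply Rmult_le_compat_r; lra. apply Req_le; field; lra. }
    assert (X1 : Cmod (PP A B v) * (1 / 2 - Cmod v) <= (Cmod (PP A B w) + e1) * (1 / 2 - Cmod v)) by (apply Rmult_le_compat_r; lra).
    assert (X2 : (Cmod (PP A B w) + e1) * (1 / 2 - Cmod v) <= (Cmod (PP A B w) + e1) * (1 / 2 - Cmod w + e1)) by (apply Rmult_le_compat_l; lra).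
    assert (P4 := Cmod_ge_0 w).
    assert (X3 : e1 * (Cmod (PP A B w) + (1 / 2 - Cmod w) + e1) <= e1 * M) by (apply Rmult_le_compat_l; unfold M; lra).
    lra.
  - exists 0%C. rewrite HB1, Cmod_0. lra.
  - rewrite HB1 in Hzm. apply Rle_trans with (1 := Max z ltac:(now rewrite HB1)).
    apply Rnot_lt_le. intros Big.
    set (K := Cmod (PP A B zm)) in *. set (ds := 1 / 2 - Cmod zm) in *.
    assert (P0 := Cmod_ge_0 zm). assert (Pe := exp_pos 8).
    assert (Pds : 0 < ds). { destruct (Rle_lt_dec ds 0) as [L|L]; auto. assert (PK : 0 <= K) by apply Cmod_ge_0. nra. }
    assert (e8 : 1 + 8 <= exp 8) by (apply exp_ineq1_le).
    assert (KB : 4 * exp 8 < K). { assert (ds <= 1 / 2) by (unfold ds; lra). nra. }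
    assert (K36 : 36 < K) by lra.
    (* The 15 is 5 K T, the exponent in the estimate of the imaginary part below; exp 8 in the
       statement is large enough for K^2 to dominate 3 exp 15. *)
    assert (e15 : exp 15 <= exp 8 * exp 8). { rewrite <- exp_plus. left. apply exp_increasing. lra. }
    assert (KE : 3 * exp 15 <= K * K) by nra.
    assert (NK : (RtoC K) <> 0%C) by (intros E; apply RtoC_inj in E; lra).
    (* The direction in which e P(zm) is the positive number K. *)
    set (e := (Cconj (PP A B zm) / RtoC K)%C).
    assert (Ce : Cmod e = 1). { unfold e. rewrite Cmod_div, Cmod_conj, Cmod_RtoC_pos by (auto; lra). fold K. field. lra. }
    assert (ee : (e * Cconj e)%C = 1%C). { rewrite <- Cmod2_RtoC, Ce. f_equal. ring. }
    assert (eP : (e * PP A B zm)%C = RtoC K).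
    { unfold e. replace (Cconj (PP A B zm) / RtoC K * PP A B zm)%C with ((PP A B zm * Cconj (PP A B zm)) / RtoC K)%C by (field; auto).
      rewrite <- Cmod2_RtoC. fold K. simpl pow. rewrite Rmult_1_r, RtoC_mult. field. auto. }
    (* At a rate x' >= x^2 / 4 the reciprocal of x drops from 1 / K to at most 1 / (4 K) in time 3 /
       K, which contradicts |v| <= 2 K. *)
    set (T := 3 / K). assert (HT : 0 < T) by (apply Rdiv_lt_0_compat; lra).
    assert (TK : T * K = 3) by (unfold T; field; lra).
    assert (Tds : T <= ds / 2). { apply Rmult_le_reg_r with K; lra. }
    set (path := fun t => (zm + RtoC t * e)%C).
    assert (Hpath : forall t, 0 <= t <= T -> Cmod (path t) <= Cmod zm + ds / 2).
    { intros t Ht. unfold path. apply Rle_trans with (1 := Cmod_triangle _ _). rewrite Cmod_mult, Ce, Cmod_RtoC_pos; lra. }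
    assert (Hp2 : forall t, 0 <= t <= T -> Cmod (path t) <= 1 / 2) by (intros t Ht; specialize (Hpath t Ht); unfold ds in *; lra).
    set (v := fun t => (e * PP A B (path t))%C).
    (* Along the path the weight 1/2 - |z| keeps at least half of its value at zm, so by maximality
       |P| at most doubles. *)
    assert (Vb : forall t, 0 <= t <= T -> Cmod (v t) <= 2 * K).
    { intros t Ht. unfold v. rewrite Cmod_mult, Ce, Rmult_1_l.
      assert (X := Max (path t) ltac:(rewrite HB1; auto)). assert (Y := Hpath t Ht).
      assert (P := Cmod_ge_0 (PP A B (path t))).
      assert (Cmod (PP A B (path t)) * (ds / 2) <= K * ds).
      { apply Rle_trans with (2 := X). apply Rmult_le_compat_l; auto. unfold ds in *. lra. }
      nra. }
    (* The perturbation of v' = v^2 / 2: e^2 S comes from the derivative in z, and - tau from the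
       one in conj z, through e conj e = 1. *)
    set (er := fun t => (e * e * SS A B (path t) - RtoC (tau A B (path t)))%C).
    assert (Dv : forall t, 0 <= t <= T ->
       is_derive (fun t => Re (v t)) t (Re (v t * v t / 2 + er t)%C) /\
       is_derive (fun t => Im (v t)) t (Im (v t * v t / 2 + er t)%C)).
    { intros t Ht. assert (Y := Hp2 t Ht). destruct (H (path t) ltac:(lra)) as [HA [HB [HJ _]]].
      assert (X := wd_line _ _ _ _ _ _ (wd_scal e _ _ _ _ (wd_PP A B (path t) HA HB HJ))).
      replace (e * (SS A B (path t) + PP A B (path t) * PP A B (path t) / 2) * e + e * - RtoC (tau A B (path t)) * Cconj e)%C
        with (v t * v t / 2 + er t)%C in X. exact X.
      unfold v, er. replace (e * - RtoC (tau A B (path t)) * Cconj e)%C with (- RtoC (tau A B (path t)) * (e * Cconj e))%C by ring.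
      rewrite ee. field. }
    assert (Er : forall t, 0 <= t <= T -> - (5) <= Re (er t) /\ - (1) <= Im (er t) <= 1).
    { intros t Ht. assert (Y := Hp2 t Ht). destruct (H (path t) ltac:(lra)) as [HA [HB [HJ HS]]].
      assert (B1 : Cmod (e * e * SS A B (path t))%C <= 1) by (rewrite !Cmod_mult, Ce; lra).
      assert (R1 := Re_le_bound _ _ B1). assert (I1 := Im_le_bound _ _ B1).
      assert (t4 := tau_le_4 A B (fun z Hz => let H' := H z Hz in conj (proj1 H') (conj (proj1 (proj2 H')) (proj1 (proj2 (proj2 H'))))) (path t) Y).
      unfold er. rewrite re_minus, im_minus.
      change (Re (RtoC (tau A B (path t)))) with (tau A B (path t)).
      change (Im (RtoC (tau A B (path t)))) with 0. lra. }
    set (x := fun t => Re (v t)). set (y := fun t => Im (v t)).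
    assert (x0 : x 0 = K). { unfold x, v, path. replace (zm + RtoC 0 * e)%C with zm by ring. now rewrite eP. }
    assert (y0 : y 0 = 0). { unfold y, v, path. replace (zm + RtoC 0 * e)%C with zm by ring. now rewrite eP. }
    assert (ReX : forall t, Re (v t * v t / 2 + er t)%C = (x t * x t - y t * y t) / 2 + Re (er t)).
    { intros t. unfold x, y. replace (v t * v t / 2 + er t)%C with (RtoC (/ 2) * (v t * v t) + er t)%C by (rewrite RtoC_inv by lra; field).
      rewrite re_plus, re_scal_l, re_mult. field. }
    assert (ImX : forall t, Im (v t * v t / 2 + er t)%C = x t * y t + Im (er t)).
    { intros t. unfold x, y. replace (v t * v t / 2 + er t)%C with (RtoC (/ 2) * (v t * v t) + er t)%C by (rewrite RtoC_inv by lra; field).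
      rewrite im_plus, im_scal_l, im_mult. field. }
    assert (Dx : forall t, 0 <= t <= T -> is_derive x t ((x t * x t - y t * y t) / 2 + Re (er t))).
    { intros t Ht. rewrite <- ReX. apply Dv, Ht. }
    assert (Dy : forall t, 0 <= t <= T -> is_derive y t (x t * y t + Im (er t))).
    { intros t Ht. rewrite <- ImX. apply Dv, Ht. }
    assert (xb : forall t, 0 <= t <= T -> x t <= 2 * K). { intros t Ht. specialize (Vb t Ht). apply Re_le_bound in Vb. unfold x. lra. }
    (* The imaginary part starts at 0, and x <= 2 K gives (y^2)' <= 5 K y^2 + 1 / K. Over the time 3
       / K this leaves y^2 <= 3 exp 15 / K^2. *)
    assert (yb : forall t, 0 <= t <= T -> y t * y t <= 1).
    { assert (M : forall t, 0 <= t <= T -> y t * y t * exp (- (5 * K) * t) - t / K <= y 0 * y 0 * exp (- (5 * K) * 0) - 0 / K).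
      { apply (nonincreasing_of_derive (fun t => y t * y t * exp (- (5 * K) * t) - t / K)
          (fun t => (2 * y t * (x t * y t + Im (er t)) - 5 * K * (y t * y t)) * exp (- (5 * K) * t) - 1 / K)).
        - intros t Ht. assert (D := Dy t Ht). auto_derive. split; auto. exists (x t * y t + Im (er t)). exact D.
          split; auto. exists (x t * y t + Im (er t)). exact D.
          rewrite (is_derive_unique (fun x : R => y x) t _ D). field. lra.
        - intros t Ht. assert (Q := xb t Ht). destruct (Er t Ht) as [_ I1].
          assert (Ex : 0 < exp (- (5 * K) * t) <= 1).
          { split. apply exp_pos. rewrite <- exp_0. destruct (Req_dec t 0) as [->|N]. rewrite Rmult_0_r. lra.
            left. apply exp_increasing. nra. }
          assert (B1 : 2 * y t * (x t * y t + Im (er t)) - 5 * K * (y t * y t) <= 1 / K).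
          { assert (S1 : x t * (y t * y t) <= 2 * K * (y t * y t)) by (apply Rmult_le_compat_r; [apply Rle_0_sqr|auto]).
            assert (S2 : 2 * (y t * Im (er t)) <= K * (y t * y t) + 1 / K).
            { assert (S3 : 0 <= (K * y t - Im (er t)) * (K * y t - Im (er t)) / K) by (apply Rle_div_pos; [apply Rle_0_sqr|lra]).
              replace ((K * y t - Im (er t)) * (K * y t - Im (er t)) / K) with (K * (y t * y t) - 2 * (y t * Im (er t)) + Im (er t) * Im (er t) / K) in S3 by (field; lra).
              assert (Im (er t) * Im (er t) / K <= 1 / K). { apply Rmult_le_compat_r. apply Rlt_le, Rinv_0_lt_compat; lra. nra. }
              lra. }
            lra. }
          assert (PK : 0 < 1 / K) by (apply Rdiv_lt_0_compat; lra). nra. }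
      intros t Ht. specialize (M t Ht). rewrite y0 in M.
      assert (t / K <= 3 / (K * K)). { replace (3 / (K * K)) with (T / K) by (unfold T; field; lra). apply Rmult_le_compat_r. apply Rlt_le, Rinv_0_lt_compat; lra. lra. }
      assert (L1 : y t * y t * exp (- (5 * K) * t) <= 3 / (K * K)) by lra.
      assert (L2 : exp (5 * K * t) <= exp 15). { destruct (Req_dec (5 * K * t) 15) as [->|N]. lra. left. apply exp_increasing. nra. }
      replace (y t * y t) with (y t * y t * exp (- (5 * K) * t) * exp (5 * K * t)).
      2:{ rewrite Rmult_assoc, <- exp_plus. replace (- (5 * K) * t + 5 * K * t) with 0 by ring. rewrite exp_0. ring. }
      apply Rle_trans with (3 / (K * K) * exp 15).
      { apply Rmult_le_compat; auto. apply Rmult_le_pos. apply Rle_0_sqr. apply Rlt_le, exp_pos. apply Rlt_le, exp_pos. }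
      replace (3 / (K * K) * exp 15) with ((3 * exp 15) / (K * K)) by (field; lra). apply Rle_div_l; nra. }
    (* x' >= -6, because y^2 <= 1 and the real part of the perturbation is at least -5; moreover T
       <= 1 and K > 36. *)
    assert (xl : forall t, 0 <= t <= T -> K / 2 <= x t).
    { assert (M : forall t, 0 <= t <= T -> - x t - 6 * t <= - x 0 - 6 * 0).
      { apply (nonincreasing_of_derive (fun t => - x t - 6 * t) (fun t => - ((x t * x t - y t * y t) / 2 + Re (er t)) - 6)).
        - intros t Ht. assert (D := Dx t Ht). auto_derive. eexists; exact D.
          rewrite (is_derive_unique (fun x0 : R => x x0) t _ D). ring.
        - intros t Ht. destruct (Er t Ht) as [R1 _]. assert (Q := yb t Ht). assert (0 <= x t * x t) by apply Rle_0_sqr. lra. }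
      intros t Ht. specialize (M t Ht). rewrite x0 in M. assert (T <= 1). { apply Rmult_le_reg_r with K; lra. } lra. }
    (* As x >= 18, half of x^2 / 2 absorbs y^2 and the perturbation, so that x' >= x^2 / 4. *)
    assert (M : forall t, 0 <= t <= T -> / x t + t / 4 <= / x 0 + 0 / 4).
    { apply (nonincreasing_of_derive (fun t => / x t + t / 4) (fun t => - ((x t * x t - y t * y t) / 2 + Re (er t)) / (x t * x t) + 1 / 4)).
      - intros t Ht. assert (D := Dx t Ht). assert (Q := xl t Ht). auto_derive. split; auto. eexists; exact D. lra.
        rewrite (is_derive_unique (fun x0 : R => x x0) t _ D). field. lra.
      - intros t Ht. destruct (Er t Ht) as [R1 _]. assert (Q := yb t Ht). assert (Q2 := xl t Ht).
        assert (X2 : 0 < x t * x t) by nra.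
        assert (1 / 4 <= ((x t * x t - y t * y t) / 2 + Re (er t)) / (x t * x t)). { apply (Rle_div_r (1 / 4)). lra. assert (18 * 18 <= x t * x t) by (apply Rmult_le_compat; lra). lra. }
        replace (- ((x t * x t - y t * y t) / 2 + Re (er t)) / (x t * x t)) with (- (((x t * x t - y t * y t) / 2 + Re (er t)) / (x t * x t))) by (field; lra).
        lra. }
    assert (HT' : 0 <= T <= T) by lra.
    specialize (M T HT'). rewrite x0 in M. specialize (xb T HT'). specialize (xl T HT').
    assert (/ (2 * K) <= / x T) by (apply Rinv_le_contravar; lra).
    replace (T / 4) with (3 / 4 * / K) in M by (unfold T; field; lra).
    replace (/ (2 * K)) with (/ 2 * / K) in H0 by (field; lra).
    assert (0 < / K) by (apply Rinv_0_lt_compat; lra). lra.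
Qed.

Lemma deriv_lin a b A B z : holo A z -> holo B z ->
  deriv (fun w => a * A w + b * B w)%C z = (a * deriv A z + b * deriv B z)%C.
Proof.
  intros HA HB. apply deriv_unique. eapply wd_eq. apply wd_plus; apply wd_scal; apply holo_wd; eassumption.
  reflexivity. ring.
Qed.

Lemma deriv_ext_near F G z : near z (fun w => F w = G w) -> holo F z -> deriv G z = deriv F z.
Proof. intros E H. apply deriv_unique. apply wd_ext_near with (1 := E). now apply holo_wd. Qed.

Lemma deriv2_lin a b A B z : holo A z -> holo B z ->
  deriv (deriv (fun w => a * A w + b * B w)%C) z = (a * deriv (deriv A) z + b * deriv (deriv B) z)%C.
Proof.
  intros HA HB. rewrite (deriv_ext_near (fun w => a * deriv A w + b * deriv B w)%C).
  - apply deriv_lin; now apply holo_deriv.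
  - generalize (near_and _ _ _ (holo_near _ _ HA) (holo_near _ _ HB)). apply near_imp. intros w [H K].
    symmetry. now apply deriv_lin.
  - apply holo_plus; apply holo_scal; now apply holo_deriv.
Qed.

(* The affine change of variable w -> a w + b conj w in the target. *)
Lemma affine_invariance a b A B z : holo A z -> holo B z -> 0 < JJ A B z -> Cmod b ^ 2 < Cmod a ^ 2 ->
  let A' := (fun w => a * A w + b * B w)%C in
  let B' := (fun w => Cconj b * A w + Cconj a * B w)%C in
  holo A' z /\ holo B' z /\ 0 < JJ A' B' z /\ SS A' B' z = SS A B z /\ tau A' B' z = tau A B z.
Proof.
  intros HA HB HJ Hab A' B'.
  assert (H1 : holo A' z) by (apply holo_plus; apply holo_scal; auto).
  assert (H2 : holo B' z) by (apply holo_plus; apply holo_scal; auto).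
  set (D := Cmod a ^ 2 - Cmod b ^ 2). assert (HD : 0 < D) by (unfold D; lra).
  assert (ED : RtoC D = (a * Cconj a - b * Cconj b)%C) by (unfold D; now rewrite RtoC_minus, !Cmod2_RtoC).
  assert (ND : (a * Cconj a - b * Cconj b)%C <> 0%C). { rewrite <- ED. intros E. apply RtoC_inj in E. lra. }
  assert (EJ : JJ A' B' z = D * JJ A B z).
  { apply RtoC_inj. rewrite RtoC_mult, ED, !JJ_RtoC. unfold A', B'.
    rewrite !Cplus_conj, !Cmult_conj, !Cconj_conj. ring. }
  assert (NJ := JJ_neq_0 _ _ _ HJ). assert (HJ' : 0 < JJ A' B' z) by (rewrite EJ; now apply Rmult_lt_0_compat).
  assert (D1 : deriv A' z = (a * deriv A z + b * deriv B z)%C) by (apply deriv_lin; auto).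
  assert (D2 : deriv B' z = (Cconj b * deriv A z + Cconj a * deriv B z)%C) by (apply deriv_lin; auto).
  assert (D3 : deriv (deriv A') z = (a * deriv (deriv A) z + b * deriv (deriv B) z)%C) by (apply deriv2_lin; auto).
  assert (D4 : deriv (deriv B') z = (Cconj b * deriv (deriv A) z + Cconj a * deriv (deriv B) z)%C) by (apply deriv2_lin; auto).
  assert (EP : PP A' B' z = PP A B z).
  { unfold PP. rewrite D1, D2, EJ, RtoC_mult, ED. unfold A', B'.
    rewrite !Cplus_conj, !Cmult_conj, !Cconj_conj. field. auto. }
  repeat split; auto.
  - unfold SS. rewrite EP, D3, D4, EJ, RtoC_mult, ED. unfold A', B'.
    rewrite !Cplus_conj, !Cmult_conj, !Cconj_conj. field. auto.
  - assert (ET : TT A' B' z = (RtoC D * TT A B z)%C).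
    { unfold TT. rewrite D1, D2, ED. unfold A', B'. ring. }
    unfold tau. rewrite ET, EJ, Cmod_mult, Cmod_RtoC_pos by lra. field. split; lra.
Qed.

(** Finite Fourier analysis at eight points of modulus at most 2 s, namely s times 1, -1, i, -i and
    s times their four diagonal sums. Differences over opposite points on the axes isolate q01. Sums
    over opposite points give q20 + q02 on the axes and q20 - q02 on the diagonals, and these are
    combined into q02. *)
Lemma coefficient_extraction (q00 q10 q20 q01 q02 q11 : C) (s Q : R) : 0 < s ->
  (forall z, Cmod z <= 2 * s ->
    Cmod (q00 + q10 * z + q20 * (z * z) + q01 * Cconj z + q02 * (Cconj z * Cconj z) + q11 * (z * Cconj z))%C <= Q) ->
  Cmod q01 <= Q / s /\ Cmod q02 <= Q / s ^ 2.
Proof.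
  intros Hs H.
  set (q := fun z => (q00 + q10 * z + q20 * (z * z) + q01 * Cconj z + q02 * (Cconj z * Cconj z) + q11 * (z * Cconj z))%C) in *.
  assert (Ns : RtoC s <> 0%C) by (intros E; apply RtoC_inj in E; lra).
  assert (CI : Cconj Ci = (- Ci)%C) by (apply injective_projections; simpl; ring).
  assert (C1 : Cconj 1 = 1%C) by (apply injective_projections; simpl; ring).
  assert (II : (Ci * Ci)%C = (-(1))%C) by (apply injective_projections; simpl; ring).
  assert (Bd : forall e, Cmod e <= 2 -> Cmod (q (RtoC s * e)%C) <= Q).
  { intros e He. apply H. rewrite Cmod_mult, Cmod_RtoC_pos by lra. rewrite Rmult_comm. apply Rmult_le_compat_r; lra. }
  assert (M1 : Cmod (-(1)) <= 2) by (rewrite Cmod_m1; lra).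
  assert (B1 := Bd 1%C ltac:(rewrite Cmod_1; lra)). assert (B2 := Bd (-(1))%C M1).
  assert (B3 := Bd Ci ltac:(rewrite Cmod_Ci; lra)). assert (B4 := Bd (- Ci)%C ltac:(rewrite Cmod_opp, Cmod_Ci; lra)).
  assert (Mi : forall u v, Cmod u = 1 -> Cmod v = 1 -> Cmod (u + v)%C <= 2) by (intros u v Hu Hv; assert (T := Cmod_triangle u v); lra).
  assert (B5 := Bd (1 + Ci)%C (Mi _ _ Cmod_1 Cmod_Ci)). assert (B6 := Bd (-(1) + - Ci)%C (Mi _ _ Cmod_m1 (eq_trans (Cmod_opp _) Cmod_Ci))).
  assert (B7 := Bd (1 + - Ci)%C (Mi _ _ Cmod_1 (eq_trans (Cmod_opp _) Cmod_Ci))). assert (B8 := Bd (-(1) + Ci)%C (Mi _ _ Cmod_m1 Cmod_Ci)).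
  assert (PQ : 0 <= Q). { eapply Rle_trans; [apply Cmod_ge_0|exact B1]. }
  split.
  - assert (E : (RtoC (4 * s) * q01)%C = ((q (RtoC s * 1) - q (RtoC s * -(1))) - (- Ci) * (q (RtoC s * Ci) - q (RtoC s * - Ci)))%C).
    { unfold q. rewrite !Cmult_conj, !Copp_conj, C1, CI, !Cconj_RtoC, RtoC_mult.
      match goal with |- ?l = ?r => replace r with (l + (- (Ci * Ci) - 1) * 2 * RtoC s * (q01 - q10))%C by ring end. rewrite II. ring. }
    assert (E2 : 4 * s * Cmod q01 <= 4 * Q).
    { rewrite <- (Cmod_RtoC_pos (4 * s)) by lra. rewrite <- Cmod_mult, E.
      eapply Rle_trans; [apply Cmod_triangle_sub|]. rewrite Cmod_mult, Cmod_opp, Cmod_Ci.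
      assert (T1 := Cmod_triangle_sub (q (RtoC s * 1)%C) (q (RtoC s * -(1))%C)).
      assert (T2 := Cmod_triangle_sub (q (RtoC s * Ci)%C) (q (RtoC s * - Ci)%C)). lra. }
    apply Rle_div_r; auto. lra.
  - set (X := ((q (RtoC s * 1) + q (RtoC s * -(1))) - (q (RtoC s * Ci) + q (RtoC s * - Ci)))%C).
    set (Y := ((q (RtoC s * (1 + Ci)) + q (RtoC s * (-(1) + - Ci))) - (q (RtoC s * (1 + - Ci)) + q (RtoC s * (-(1) + Ci))))%C).
    assert (EX : X = (RtoC (4 * (s * s)) * (q20 + q02))%C).
    { unfold X, q. rewrite !Cmult_conj, !Copp_conj, C1, CI, !Cconj_RtoC, !RtoC_mult.
      match goal with |- ?l = ?r => replace l with (r + (- (Ci * Ci) - 1) * 2 * RtoC s * RtoC s * (q20 + q02 - q11))%C end.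
      rewrite II. ring. ring. }
    assert (EY : Y = (RtoC (8 * (s * s)) * Ci * (q20 - q02))%C).
    { unfold Y, q. rewrite !Cmult_conj, !Cplus_conj, !Copp_conj, C1, CI, !Cconj_RtoC, !RtoC_mult. ring. }
    assert (E : (RtoC (16 * (s * s)) * q02)%C = (2 * X + Ci * Y)%C).
    { rewrite EX, EY, !RtoC_mult. 
      match goal with |- ?l = ?r => replace r with (l + (Ci * Ci + 1) * 8 * RtoC s * RtoC s * (q20 - q02))%C by ring end. rewrite II. ring. }
    assert (BX : Cmod X <= 4 * Q).
    { unfold X. eapply Rle_trans; [apply Cmod_triangle_sub|].
      assert (T1 := Cmod_triangle (q (RtoC s * 1)%C) (q (RtoC s * -(1))%C)).
      assert (T2 := Cmod_triangle (q (RtoC s * Ci)%C) (q (RtoC s * - Ci)%C)). lra. }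
    assert (BY : Cmod Y <= 4 * Q).
    { unfold Y. eapply Rle_trans; [apply Cmod_triangle_sub|].
      assert (T1 := Cmod_triangle (q (RtoC s * (1 + Ci))%C) (q (RtoC s * (-(1) + - Ci))%C)).
      assert (T2 := Cmod_triangle (q (RtoC s * (1 + - Ci))%C) (q (RtoC s * (-(1) + Ci))%C)). lra. }
    assert (E2 : 16 * (s * s) * Cmod q02 <= 12 * Q).
    { rewrite <- (Cmod_RtoC_pos (16 * (s * s))) by nra. rewrite <- Cmod_mult, E.
      eapply Rle_trans; [apply Cmod_triangle|]. rewrite !Cmod_mult, Cmod_Ci, (Cmod_RtoC_pos 2) by lra. lra. }
    apply Rle_div_r. nra. replace (s ^ 2) with (s * s) by ring. nra.
Qed.

Lemma Cauchy_estimate F z0 R0 r M : 0 < r -> r < R0 ->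
  (forall w, Cmod (w - z0)%C < R0 -> holo F w) ->
  (forall w, Cmod (w - z0)%C < R0 -> Cmod (F w) <= M) -> Cmod (deriv F z0) <= M / r.
Proof.
  intros H1 H2 H3 H4. destruct (taylor_circle F z0 R0 r M H1 H2 H3 H4) as [c [_ [E [B _]]]].
  rewrite <- E. specialize (B 1%nat). now rewrite pow_1 in B.
Qed.

(** Integrating |P| <= 8 exp 8 from 0, where J = 1, bounds J. For |z| < 1/8 the dilatation satisfies
    |B / A| <= 1/2, hence J >= 3/4 |A|^2, which turns the bound on J into one on A. *)
Lemma normalized_bound : exists M1, 0 < M1 /\ forall A B, good_pair 1 A B -> A 0%C = 1%C -> B 0%C = 0%C ->
  forall z, Cmod z < 1 / 8 -> Cmod (A z) <= M1 /\ Cmod (B z) <= Cmod (A z).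
Proof.
  set (C1 := 8 * exp 8). assert (Pe := exp_pos 8).
  exists (2 * exp C1). split. { assert (X := exp_pos C1). lra. }
  intros A B H A0 B0 z Hz.
  assert (PC : 0 < C1) by (unfold C1; lra).
  assert (HBA : forall w, Cmod w < 1 -> Cmod (B w) < Cmod (A w)).
  { intros w Hw. destruct (H w Hw) as [_ [_ [HJ _]]]. unfold JJ in HJ. assert (P1 := Cmod_ge_0 (A w)). assert (P2 := Cmod_ge_0 (B w)). nra. }
  assert (NA : forall w, Cmod w < 1 -> A w <> 0%C).
  { intros w Hw E. specialize (HBA w Hw). rewrite E, Cmod_0 in HBA. assert (P2 := Cmod_ge_0 (B w)). lra. }
  assert (HPP : forall w, Cmod w <= 1 / 4 -> Cmod (PP A B w) <= C1).
  { intros w Hw. assert (X := PP_bound A B H w ltac:(lra)). assert (P := Cmod_ge_0 (PP A B w)). unfold C1. nra. }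
  assert (PZ := Cmod_ge_0 z).
  assert (HJ1 : ln (JJ A B z) <= 2 * C1).
  { assert (M : ln (JJ A B (0 + RtoC 1 * z)%C) - 2 * C1 * 1 <= ln (JJ A B (0 + RtoC 0 * z)%C) - 2 * C1 * 0).
    { apply (nonincreasing_of_derive (fun t => ln (JJ A B (0 + RtoC t * z)%C) - 2 * C1 * t)
        (fun t => Re (PP A B (0 + RtoC t * z) * z + Cconj (PP A B (0 + RtoC t * z)) * Cconj z)%C - 2 * C1) 1); [| |lra].
      - intros t Ht. assert (Ct : Cmod (0 + RtoC t * z)%C <= Cmod z).
        { rewrite Cplus_0_l, Cmod_mult, Cmod_RtoC_pos by lra. rewrite <- (Rmult_1_l (Cmod z)) at 2. apply Rmult_le_compat_r; lra. }
        destruct (H (0 + RtoC t * z)%C ltac:(lra)) as [HA [HB [HJ _]]].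
        assert (X := proj1 (wd_line _ _ _ _ _ _ (wd_ln_JJ _ _ _ HA HB HJ))).
        apply (is_derive_minus (fun t => ln (JJ A B (0 + RtoC t * z)%C)) (fun t => 2 * C1 * t)). exact X.
        auto_derive; auto. ring.
      - intros t Ht. assert (Ct : Cmod (0 + RtoC t * z)%C <= Cmod z).
        { rewrite Cplus_0_l, Cmod_mult, Cmod_RtoC_pos by lra. rewrite <- (Rmult_1_l (Cmod z)) at 2. apply Rmult_le_compat_r; lra. }
        set (P := PP A B (0 + RtoC t * z)%C). assert (BP : Cmod P <= C1) by (apply HPP; lra).
        assert (X := Re_le_Cmod (P * z + Cconj P * Cconj z)%C).
        assert (Y := Cmod_triangle (P * z) (Cconj P * Cconj z)). rewrite !Cmod_mult, !Cmod_conj in Y.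
        assert (Cmod P * Cmod z <= C1 * 1) by (apply Rmult_le_compat; auto using Cmod_ge_0; lra). lra. }
    replace (0 + RtoC 1 * z)%C with z in M by ring. replace (0 + RtoC 0 * z)%C with (RtoC 0) in M by ring.
    assert (J0 : JJ A B 0 = 1). { unfold JJ. rewrite A0, B0, Cmod_1, Cmod_0. ring. }
    rewrite J0, ln_1 in M. lra. }
  destruct (H z ltac:(lra)) as [HA [HB [HJ _]]].
  assert (HJ2 : JJ A B z <= exp C1 * exp C1).
  { rewrite <- exp_plus, <- (exp_ln (JJ A B z)) by auto. destruct (Req_dec (ln (JJ A B z)) (C1 + C1)) as [->|N]. lra.
    left. apply exp_increasing. lra. }
  assert (Om : Cmod (B z / A z)%C <= 1 / 2).
  { assert (O0 : (B 0 / A 0)%C = 0%C) by (rewrite A0, B0; field; intros E; apply RtoC_inj in E; lra).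
    (* With M = 1 and r = 1/2 the first order remainder is 4 |z|, at most 1/2. *)
    destruct (taylor_circle (fun w => B w / A w)%C 0 1 (1 / 2) 1 ltac:(lra) ltac:(lra)) as [c [c0 [_ [_ T]]]].
    - intros w Hw. replace (w - 0)%C with w in Hw by ring. destruct (H w Hw) as [HA' [HB' _]]. apply holo_div; auto.
    - intros w Hw. replace (w - 0)%C with w in Hw by ring. rewrite Cmod_div by auto. specialize (HBA w Hw).
      apply Rle_div_l. apply Cmod_gt_0; auto. lra.
    - cbv beta in c0. rewrite O0 in c0.
      destruct (T z) as [T1 _]. { replace (z - 0)%C with z by ring. lra. }
      rewrite c0 in T1. replace (B z / A z - 0)%C with (B z / A z)%C in T1 by ring.
      replace (z - 0)%C with z in T1 by ring. lra. }
  assert (PA : 0 < Cmod (A z)) by (apply Cmod_gt_0, NA; lra).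
  rewrite Cmod_div in Om by (apply NA; lra). apply (Rle_div_l (Cmod (B z))) in Om; auto.
  assert (PB := Cmod_ge_0 (B z)). assert (PE := exp_pos C1).
  split; [|lra]. unfold JJ in HJ2.
  assert (BB : Cmod (B z) * Cmod (B z) <= (1 / 2 * Cmod (A z)) * (1 / 2 * Cmod (A z))) by (apply Rmult_le_compat; lra).
  apply Rsqr_incr_0_var; [|lra]. unfold Rsqr. assert (EE := Rmult_lt_0_compat _ _ PE PE). lra.
Qed.

Lemma tau_small (eps : R) : 0 < eps -> exists c, 0 < c <= 1 /\
  forall A B, good_pair c A B -> tau A B 0 <= eps ^ 2.
Proof.
  intros Heps. destruct normalized_bound as [M1 [HM1 NB]].
  (* On the disc of radius 1/32 the first derivatives of A and B are at most 32 M1 and the second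
     ones at most 2048 M1; the coefficients [fa], [fb], [fe] below then stay under 10000 M1^2. *)
  set (M3 := 10000 * M1 ^ 2). assert (HM3 : 0 < M3) by (unfold M3; nra).
  set (r0 := 1 / 64).
  (* s makes the Taylor remainder small, then c the remaining term *)
  set (KK := 184 * M3 / r0 ^ 3).
  assert (HKK : 0 < KK) by (unfold KK, r0; apply Rdiv_lt_0_compat; lra).
  (* The first two Taylor coefficients of B / A are at most 1 / r0 and 1 / r0^2; the factor r0^2 / 4
     makes up for them in [Fin]. *)
  set (target := eps ^ 5 * r0 ^ 2 / 4). assert (He5 := pow_lt _ 5 Heps).
  assert (Htg : 0 < target) by (unfold target, r0; nra).
  set (s := Rmin (r0 / 4) (target / KK)).
  assert (Hs1 : s <= r0 / 4) by apply Rmin_l. assert (Hs2 : s <= target / KK) by apply Rmin_r.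
  assert (Hs : 0 < s). { apply Rmin_pos. unfold r0; lra. now apply Rdiv_lt_0_compat. }
  exists (Rmin 1 (target * s ^ 2 / M1 ^ 2)).
  assert (HM2 := pow_lt _ 2 HM1). assert (Hs22 := pow_lt _ 2 Hs).
  set (c := Rmin 1 (target * s ^ 2 / M1 ^ 2)).
  assert (Hc : 0 < c). { apply Rmin_pos. lra. apply Rdiv_lt_0_compat; auto. now apply Rmult_lt_0_compat. }
  assert (Hc1 : c <= 1) by apply Rmin_l. assert (Hc2 : c <= target * s ^ 2 / M1 ^ 2) by apply Rmin_r.
  split; [lra|].
  assert (Norm : forall A B, good_pair c A B -> A 0%C = 1%C -> B 0%C = 0%C -> tau A B 0 <= eps ^ 2).
  { intros A B H A0 B0.
    assert (HB1 : forall w : C, Cmod (w - 0)%C = Cmod w) by (intros w; f_equal; ring).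
    assert (H1 : good_pair 1 A B). { intros w Hw. destruct (H w Hw) as [X1 [X2 [X3 X4]]]. repeat split; auto. lra. }
    assert (Bd := NB A B H1 A0 B0).
    assert (NA : forall w, Cmod w < 1 -> A w <> 0%C).
    { intros w Hw E. destruct (H w Hw) as [_ [_ [HJ _]]]. unfold JJ in HJ. rewrite E, Cmod_0 in HJ. assert (X := pow2_ge_0 (Cmod (B w))). lra. }
    assert (hA : forall w, Cmod w < 1 -> holo A w) by (intros w Hw; apply H; auto).
    assert (hB : forall w, Cmod w < 1 -> holo B w) by (intros w Hw; apply H; auto).
    (* Cauchy's estimate asks for a radius strictly inside the disc; each application below uses
       half of the available margin [d]. *)
    assert (Est : forall F M rad d r z, 0 < r < d -> Cmod z + d <= rad -> (forall w, Cmod w < rad -> holo F w /\ Cmod (F w) <= M) -> Cmod (deriv F z) <= M / r).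
    { intros F M rad d r z Hr Hd HF.
      assert (Z : forall w, Cmod (w - z)%C < d -> Cmod w < rad). { intros w Hw. assert (T := Cmod_triangle_rev w z). lra. }
      apply (Cauchy_estimate F z d r M); try lra; intros w Hw; apply HF, Z, Hw. }
    assert (dA : forall w, Cmod w < 1 / 16 -> Cmod (deriv A w) <= 32 * M1).
    { intros w Hw. replace (32 * M1) with (M1 / (1 / 32)) by field. apply (Est A M1 (1 / 8) (1 / 16)); try lra.
      intros v Hv. split. apply hA; lra. apply Bd; auto. }
    assert (dB : forall w, Cmod w < 1 / 16 -> Cmod (deriv B w) <= 32 * M1).
    { intros w Hw. replace (32 * M1) with (M1 / (1 / 32)) by field. apply (Est B M1 (1 / 8) (1 / 16)); try lra.
      intros v Hv. split. apply hB; lra. destruct (Bd v Hv). lra. }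
    assert (d2A : forall w, Cmod w < 1 / 32 -> Cmod (deriv (deriv A) w) <= 2048 * M1).
    { intros w Hw. replace (2048 * M1) with (32 * M1 / (1 / 64)) by field. apply (Est (deriv A) (32 * M1) (1 / 16) (1 / 32)); try lra.
      intros v Hv. split. apply holo_deriv, hA; lra. apply dA; auto. }
    assert (d2B : forall w, Cmod w < 1 / 32 -> Cmod (deriv (deriv B) w) <= 2048 * M1).
    { intros w Hw. replace (2048 * M1) with (32 * M1 / (1 / 64)) by field. apply (Est (deriv B) (32 * M1) (1 / 16) (1 / 32)); try lra.
      intros v Hv. split. apply holo_deriv, hB; lra. apply dB; auto. }
    (* The holomorphic coefficients of J^2 S / conj(A)^2 as a polynomial in the conjugate of B / A;
       the identity is [EqS]. *)
    set (fa := fun w => (A w * deriv (deriv A) w - 3 / 2 * (deriv A w * deriv A w))%C).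
    set (fb := fun w => (3 * (deriv A w * deriv B w) - A w * deriv (deriv B) w - B w * deriv (deriv A) w)%C).
    set (fe := fun w => (B w * deriv (deriv B) w - 3 / 2 * (deriv B w * deriv B w))%C).
    set (om := fun w => (B w / A w)%C).
    assert (C32 : Cmod (3 / 2)%C = 3 / 2). { rewrite <- RtoC_div by lra. apply Cmod_RtoC_pos; lra. }
    assert (C3 : Cmod (RtoC 3) = 3). { apply Cmod_RtoC_pos; lra. }
    assert (PM : forall x y a b : C, forall u v, Cmod x <= u -> Cmod y <= v -> Cmod (x * y)%C <= u * v).
    { intros x y _ _ u v Hx Hy. rewrite Cmod_mult. apply Rmult_le_compat; auto using Cmod_ge_0. }
    assert (Q : forall w, Cmod w < 1 / 32 -> (holo fa w /\ Cmod (fa w) <= M3) /\ (holo fb w /\ Cmod (fb w) <= M3) /\ (holo fe w /\ Cmod (fe w) <= M3) /\ (holo om w /\ Cmod (om w) <= 1)).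
    { intros w Hw. assert (HA := hA w ltac:(lra)). assert (HB := hB w ltac:(lra)).
      assert (HA1 := holo_deriv _ _ HA). assert (HB1' := holo_deriv _ _ HB). assert (HA2 := holo_deriv _ _ HA1). assert (HB2 := holo_deriv _ _ HB1').
      destruct (Bd w ltac:(lra)) as [b1 b2]. assert (b3 : Cmod (B w) <= M1) by lra.
      assert (b4 := dA w ltac:(lra)). assert (b5 := dB w ltac:(lra)). assert (b6 := d2A w Hw). assert (b7 := d2B w Hw).
      assert (HM : 0 < M1 * M1) by nra. assert (EM : M3 = 10000 * (M1 * M1)) by (unfold M3; ring).
      repeat split.
      - unfold fa. apply holo_minus. apply holo_mult; auto. apply holo_scal. apply holo_mult; auto.
      - unfold fa. eapply Rle_trans; [apply Cmod_triangle_sub|]. rewrite (Cmod_mult (3 / 2)), C32.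
        assert (X1 := PM _ _ 0%C 0%C _ _ b1 b6). assert (X2 := PM _ _ 0%C 0%C _ _ b4 b4). lra.
      - unfold fb. apply holo_minus. apply holo_minus. apply holo_scal. apply holo_mult; auto. apply holo_mult; auto. apply holo_mult; auto.
      - unfold fb. eapply Rle_trans; [apply Cmod_triangle_sub|]. eapply Rle_trans; [apply Rplus_le_compat_r, Cmod_triangle_sub|].
        rewrite (Cmod_mult 3), C3.
        assert (X1 := PM _ _ 0%C 0%C _ _ b4 b5). assert (X2 := PM _ _ 0%C 0%C _ _ b1 b7). assert (X3 := PM _ _ 0%C 0%C _ _ b3 b6). lra.
      - unfold fe. apply holo_minus. apply holo_mult; auto. apply holo_scal. apply holo_mult; auto.
      - unfold fe. eapply Rle_trans; [apply Cmod_triangle_sub|]. rewrite (Cmod_mult (3 / 2)), C32.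
        assert (X1 := PM _ _ 0%C 0%C _ _ b3 b7). assert (X2 := PM _ _ 0%C 0%C _ _ b5 b5). lra.
      - unfold om. apply holo_div; auto. apply NA; lra.
      - unfold om. rewrite Cmod_div by (apply NA; lra). apply Rle_div_l. apply Cmod_gt_0, NA; lra. lra. }
    assert (Tay : forall F M, (forall w, Cmod w < 1 / 32 -> holo F w /\ Cmod (F w) <= M) ->
       exists c : nat -> C, c O = F 0%C /\ c 1%nat = deriv F 0%C /\ (forall n, Cmod (c n) <= M / r0 ^ n) /\
        forall z, Cmod z <= r0 / 2 -> Cmod (F z - c O)%C <= 2 * M * (Cmod z / r0) /\
          Cmod (F z - c O - c 1%nat * z)%C <= 2 * M * (Cmod z / r0) ^ 2 /\
          Cmod (F z - c O - c 1%nat * z - c 2%nat * z ^ 2)%C <= 2 * M * (Cmod z / r0) ^ 3).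
    { intros F M HF. destruct (taylor_circle F 0 (1 / 32) r0 M) as [cc [c0 [c1 [c2 c3]]]].
      unfold r0; lra. unfold r0; lra. intros w Hw. rewrite HB1 in Hw. apply HF, Hw. intros w Hw. rewrite HB1 in Hw. apply HF, Hw.
      exists cc. repeat split; auto; specialize (c3 z); rewrite HB1 in c3; replace (z - 0)%C with z in c3 by ring; apply c3; auto. }
    destruct (Tay fa M3 (fun w Hw => proj1 (Q w Hw))) as [ca [_ [_ [_ Ta]]]].
    destruct (Tay fb M3 (fun w Hw => proj1 (proj2 (Q w Hw)))) as [cb [_ [_ [Cb Tb]]]].
    destruct (Tay fe M3 (fun w Hw => proj1 (proj2 (proj2 (Q w Hw))))) as [ce [Ce0 [_ [Ce Te]]]].
    destruct (Tay om 1 (fun w Hw => proj2 (proj2 (proj2 (Q w Hw))))) as [co [Co0 [Co1 [Co To]]]].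
    assert (o0 : co O = 0%C). { rewrite Co0. unfold om. rewrite A0, B0. field; intros E; apply RtoC_inj in E; lra. }
    assert (z1 : Cmod (RtoC 0) < 1) by (rewrite Cmod_0; lra).
    assert (DB0 : co 1%nat = deriv B 0%C).
    { rewrite Co1. unfold om. apply deriv_unique. eapply wd_eq.
      apply (wd_div _ _ _ _ _ _ _ (holo_wd _ _ (hB _ z1)) (holo_wd _ _ (hA _ z1)) (NA _ z1)).
      rewrite A0, B0. field; intros E; apply RtoC_inj in E; lra. rewrite A0, B0. field; intros E; apply RtoC_inj in E; lra. }
    assert (e0 : ce O = (- (3 / 2) * (co 1%nat * co 1%nat))%C).
    { rewrite Ce0, DB0. unfold fe. rewrite B0. ring. }
    set (w1 := co 1%nat) in *. set (w2 := co 2%nat) in *.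
    assert (Pr0 : 0 < r0) by (unfold r0; lra).
    (* The polynomial keeps the terms of degree at most 2 in z and conj z. Since S is small it is
       small up to the discarded terms, which are cubic in |z|. *)
    destruct (coefficient_extraction (ca O) (ca 1%nat) (ca 2%nat) (cb O * Cconj w1)%C (cb O * Cconj w2 + ce O * (Cconj w1 * Cconj w1))%C
      (cb 1%nat * Cconj w1)%C s (c * M1 ^ 2 + 23 * M3 * (2 * s / r0) ^ 3) Hs) as [L1 L2].
    { intros z Hz. assert (Hz2 : Cmod z <= r0 / 2) by lra. assert (Pz := Cmod_ge_0 z).
      assert (Hz3 : Cmod z < 1 / 32) by (unfold r0 in Hz2; lra).
      destruct (Ta z Hz2) as [_ [_ Ta3]]. destruct (Tb z Hz2) as [_ [Tb2 _]]. destruct (Te z Hz2) as [Te1 _].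
      destruct (To z Hz2) as [To1 [To2 To3]]. rewrite o0 in To1, To2, To3. fold w1 in To2, To3. fold w2 in To3.
      destruct (Q z Hz3) as [_ [[_ Bb] [[_ Be] _]]].
      destruct (H z ltac:(lra)) as [HA [HB [HJ HS]]]. destruct (Bd z ltac:(lra)) as [b1 b2].
      assert (Nz := NA z ltac:(lra)). assert (NzC := Cconj_neq_0 _ Nz).
      assert (EqS : (fa z + fb z * Cconj (om z) + fe z * (Cconj (om z) * Cconj (om z)))%C =
         (RtoC (JJ A B z) * RtoC (JJ A B z) * SS A B z / (Cconj (A z) * Cconj (A z)))%C).
      { assert (NJ := JJ_neq_0 _ _ _ HJ). unfold fa, fb, fe, om, SS, PP. rewrite Cdiv_conj by auto. rewrite !JJ_RtoC in *. field. auto. }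
      assert (BS : Cmod (RtoC (JJ A B z) * RtoC (JJ A B z) * SS A B z / (Cconj (A z) * Cconj (A z)))%C <= c * M1 ^ 2).
      { rewrite Cmod_div by (now apply Cmult_neq_0). rewrite !Cmod_mult, Cmod_conj, Cmod_RtoC_pos by lra.
        assert (PA : 0 < Cmod (A z)) by now apply Cmod_gt_0.
        assert (J2 : JJ A B z <= Cmod (A z) * Cmod (A z)). { unfold JJ. assert (X := pow2_ge_0 (Cmod (B z))). lra. }
        apply Rle_div_l. nra.
        apply Rle_trans with ((Cmod (A z) * Cmod (A z)) * (Cmod (A z) * Cmod (A z)) * c).
        - apply Rmult_le_compat; auto using Cmod_ge_0. nra. apply Rmult_le_compat; lra.
        - replace (c * M1 ^ 2 * (Cmod (A z) * Cmod (A z))) with ((M1 * M1) * (Cmod (A z) * Cmod (A z)) * c) by ring.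
          apply Rmult_le_compat_r; [lra|]. apply Rmult_le_compat_r; nra. }
      set (x := Cmod z / r0) in *.
      assert (Hx : 0 <= x <= 1 / 2). { unfold x. split. apply Rle_div_pos; lra. apply Rle_div_l; lra. }
      assert (Hxs : x <= 2 * s / r0). { unfold x. apply Rmult_le_compat_r. apply Rlt_le, Rinv_0_lt_compat; lra. lra. }
      assert (Ezx : Cmod z = x * r0) by (unfold x; field; lra).
      assert (W1z : Cmod (w1 * z)%C <= x). { rewrite Cmod_mult, Ezx. specialize (Co 1%nat). fold w1 in Co. rewrite pow_1 in Co.
        replace x with (1 / r0 * (x * r0)) at 2 by (field; lra). apply Rmult_le_compat_r; nra. }
      assert (W2z : Cmod (w2 * z ^ 2)%C <= x * x). { rewrite Cmod_mult, Cmod_pow, Ezx. specialize (Co 2%nat). fold w2 in Co.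
        replace (x * x) with (1 / r0 ^ 2 * (x * r0) ^ 2) by (field; lra). apply Rmult_le_compat_r; [apply pow2_ge_0|exact Co]. }
      assert (B1z : Cmod (cb 1%nat * z)%C <= M3 * x). { rewrite Cmod_mult, Ezx. specialize (Cb 1%nat). rewrite pow_1 in Cb.
        replace (M3 * x) with (M3 / r0 * (x * r0)) by (field; lra). apply Rmult_le_compat_r; nra. }
      assert (Ce0' : Cmod (ce O) <= M3). { specialize (Ce O). simpl in Ce. lra. }
      set (ra := (fa z - ca 0%nat - ca 1%nat * z - ca 2%nat * z ^ 2)%C) in *.
      set (rb := (fb z - cb 0%nat - cb 1%nat * z)%C) in *.
      set (re_ := (fe z - ce 0%nat)%C) in *.
      set (ro1 := (om z - 0)%C) in *.
      set (ro2 := (om z - 0 - w1 * z)%C) in *. set (ro3 := (om z - 0 - w1 * z - w2 * z ^ 2)%C) in *.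
      (* The discarded terms, arranged so that every product of Taylor remainders and leading terms
         has order at least 3 in |z|. *)
      match goal with |- Cmod ?p <= _ => replace p with
        ((fa z + fb z * Cconj (om z) + fe z * (Cconj (om z) * Cconj (om z))) -
         (ra + (fb z * Cconj ro3 + rb * (Cconj (w1 * z) + Cconj (w2 * z ^ 2)) + cb 1%nat * z * Cconj (w2 * z ^ 2)) +
           (re_ * (Cconj ro1 * Cconj ro1) + ce O * (Cconj ro2 * (Cconj ro1 + Cconj (w1 * z))))))%C end.
      2:{ unfold ra, rb, re_, ro1, ro2, ro3. rewrite !Cpow_2, !Cminus_conj, !Cmult_conj, Cconj_0. ring. }
      rewrite EqS.
      assert (K1 : Cmod (fb z * Cconj ro3)%C <= M3 * (2 * 1 * x ^ 3)) by (rewrite Cmod_mult, Cmod_conj; apply Rmult_le_compat; auto using Cmod_ge_0).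
      assert (K2 : Cmod (rb * (Cconj (w1 * z) + Cconj (w2 * z ^ 2)))%C <= 2 * M3 * x ^ 2 * (x + x * x)).
      { rewrite Cmod_mult. apply Rmult_le_compat; auto using Cmod_ge_0. eapply Rle_trans; [apply Cmod_triangle|]. rewrite !Cmod_conj. lra. }
      assert (K3 : Cmod (cb 1%nat * z * Cconj (w2 * z ^ 2))%C <= M3 * x * (x * x)).
      { rewrite Cmod_mult, Cmod_conj. apply Rmult_le_compat; auto using Cmod_ge_0. }
      assert (K4 : Cmod (re_ * (Cconj ro1 * Cconj ro1))%C <= 2 * M3 * x * ((2 * 1 * x) * (2 * 1 * x))).
      { rewrite !Cmod_mult, Cmod_conj. apply Rmult_le_compat; auto using Cmod_ge_0. apply Rmult_le_pos; apply Cmod_ge_0.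
        apply Rmult_le_compat; auto using Cmod_ge_0. }
      assert (K5 : Cmod (ce O * (Cconj ro2 * (Cconj ro1 + Cconj (w1 * z))))%C <= M3 * ((2 * 1 * x ^ 2) * (2 * 1 * x + x))).
      { rewrite !Cmod_mult, Cmod_conj. apply Rmult_le_compat; auto using Cmod_ge_0. apply Rmult_le_pos; apply Cmod_ge_0.
        apply Rmult_le_compat; auto using Cmod_ge_0. eapply Rle_trans; [apply Cmod_triangle|]. rewrite !Cmod_conj. lra. }
      eapply Rle_trans; [apply Cmod_triangle_sub|].
      apply Rplus_le_compat; auto.
      apply Rle_trans with (23 * M3 * x ^ 3).
      - eapply Rle_trans; [apply Cmod_triangle|]. eapply Rle_trans; [apply Rplus_le_compat; apply Cmod_triangle|].
        assert (T1 := Cmod_triangle (fb z * Cconj ro3 + rb * (Cconj (w1 * z) + Cconj (w2 * z ^ 2))) (cb 1%nat * z * Cconj (w2 * z ^ 2))).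
        assert (T2 := Cmod_triangle (fb z * Cconj ro3) (rb * (Cconj (w1 * z) + Cconj (w2 * z ^ 2)))).
        assert (X4 : 0 <= M3 * x ^ 3 * (1 - x)). { apply Rmult_le_pos. apply Rmult_le_pos. lra. apply pow_le; lra. lra. }
        assert (Poly : 2 * M3 * x ^ 3 + (M3 * (2 * 1 * x ^ 3) + 2 * M3 * x ^ 2 * (x + x * x) + M3 * x * (x * x)) +
          (2 * M3 * x * ((2 * 1 * x) * (2 * 1 * x)) + M3 * ((2 * 1 * x ^ 2) * (2 * 1 * x + x))) = 23 * M3 * x ^ 3 - 2 * (M3 * x ^ 3 * (1 - x))) by ring.
        lra.
      - apply Rmult_le_compat_l. lra. apply pow_incr. lra. }
    set (QQ := c * M1 ^ 2 + 23 * M3 * (2 * s / r0) ^ 3) in *.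
    assert (HQ : QQ / s ^ 2 <= 2 * target).
    { unfold QQ. replace ((c * M1 ^ 2 + 23 * M3 * (2 * s / r0) ^ 3) / s ^ 2) with (c * M1 ^ 2 / s ^ 2 + KK * s) by (unfold KK; field; lra).
      assert (X1 : c * M1 ^ 2 / s ^ 2 <= target).
      { apply Rle_div_l; auto. apply Rle_div_r in Hc2; auto. }
      assert (X2 : KK * s <= target). { apply Rle_div_r in Hs2; auto. lra. }
      lra. }
    assert (HQ1 : QQ / s <= 2 * target * s). { replace (QQ / s) with (QQ / s ^ 2 * s) by (field; lra). apply Rmult_le_compat_r; lra. }
    assert (Fin : 3 / 2 * Cmod w1 ^ 5 <= 1 / r0 * (2 * target) + 1 / r0 ^ 2 * (2 * target * s)).
    { set (X := (cb O * Cconj w1)%C) in *. set (Y := (cb O * Cconj w2 + ce O * (Cconj w1 * Cconj w1))%C) in *.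
      (* This combination eliminates [cb O]; only ce 0 = - 3/2 w1^2, known because B(0) = 0,
         survives and gives the fifth power. *)
      assert (E : (3 / 2 * (w1 * w1 * (Cconj w1 * Cconj w1 * Cconj w1)))%C = (X * Cconj w2 - Y * Cconj w1)%C).
      { unfold X, Y. rewrite e0. ring. }
      apply (f_equal Cmod) in E. rewrite (Cmod_mult (3 / 2)), C32, !(Cmod_mult (_ * _)), !(Cmod_mult w1), !(Cmod_mult (Cconj w1)), !Cmod_conj in E.
      replace (3 / 2 * Cmod w1 ^ 5) with (3 / 2 * (Cmod w1 * Cmod w1 * (Cmod w1 * Cmod w1 * Cmod w1))) by ring.
      rewrite E. eapply Rle_trans; [apply Cmod_triangle_sub|].
      rewrite !Cmod_mult, !Cmod_conj.
      assert (W1 := Co 1%nat). fold w1 in W1. rewrite pow_1 in W1. assert (W2 := Co 2%nat). fold w2 in W2.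
      assert (Y1 : Cmod X * Cmod w2 <= (2 * target * s) * (1 / r0 ^ 2)) by (apply Rmult_le_compat; auto using Cmod_ge_0; lra).
      assert (Y2 : Cmod Y * Cmod w1 <= (2 * target) * (1 / r0)) by (apply Rmult_le_compat; auto using Cmod_ge_0; lra).
      lra. }
    assert (Fin2 : Cmod w1 <= eps).
    { apply Rnot_lt_le. intros L. assert (L5 : eps ^ 5 <= Cmod w1 ^ 5) by (apply pow_incr; lra).
      assert (1 / r0 * (2 * target) + 1 / r0 ^ 2 * (2 * target * s) <= eps ^ 5).
      { replace (1 / r0 * (2 * target) + 1 / r0 ^ 2 * (2 * target * s)) with (eps ^ 5 / 2 * r0 + eps ^ 5 / 2 * s).
        assert (r0 <= 1) by (unfold r0; lra). assert (s <= 1) by lra. nra. unfold target. field. lra. }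
      lra. }
    unfold tau, TT, JJ. rewrite A0, B0, Cmod_1, Cmod_0, <- DB0.
    replace (1 * w1 - deriv A 0 * 0)%C with w1 by ring.
    replace (Cmod w1 ^ 2 / (1 ^ 2 - 0 ^ 2) ^ 2) with (Cmod w1 ^ 2) by field. apply pow_incr. split; auto. apply Cmod_ge_0. }
  intros A B H.
  assert (z1 : Cmod (RtoC 0) < 1) by (rewrite Cmod_0; lra).
  destruct (H 0%C z1) as [HA [HB [HJ _]]]. assert (NJ := JJ_neq_0 _ _ _ HJ).
  (* With this choice a A + b B equals J / J = 1 at 0, while conj(b) A + conj(a) B cancels there. *)
  set (J0 := RtoC (JJ A B 0)) in *. set (a := (Cconj (A 0%C) / J0)%C). set (b := (- Cconj (B 0%C) / J0)%C).
  assert (CJ : Cconj J0 = J0) by apply Cconj_RtoC.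
  assert (Hab : Cmod b ^ 2 < Cmod a ^ 2).
  { unfold a, b. rewrite !Cmod_div, Cmod_opp, !Cmod_conj by auto. unfold Rdiv. rewrite !Rpow_mult_distr. apply Rmult_lt_compat_r.
    apply pow_lt, Rinv_0_lt_compat. now apply Cmod_gt_0. unfold JJ in HJ. lra. }
  assert (EJ : J0 = (A 0 * Cconj (A 0) - B 0 * Cconj (B 0))%C) by apply JJ_RtoC.
  rewrite <- (proj2 (proj2 (proj2 (proj2 (affine_invariance a b A B 0%C HA HB HJ Hab))))).
  apply Norm.
  - intros z Hz. destruct (H z Hz) as [HA' [HB' [HJ' HS]]].
    destruct (affine_invariance a b A B z HA' HB' HJ' Hab) as [Y1 [Y2 [Y3 [Y4 Y5]]]]. repeat split; auto. now rewrite Y4.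
  - unfold a, b. rewrite EJ in *. field. auto.
  - unfold a, b. rewrite !Cdiv_conj, Copp_conj, !Cconj_conj, CJ by auto. field. auto.
Qed.

(** * The Riccati equation along a curve *)

(* [NN] is (f - f(z1)) normalized so that d(NN)/dz = J. For holomorphic [f],
   [WW] is f'/(f - f(z1)) - f''/(2 f'), the logarithmic derivative of a
   solution of u'' + (S/2) u = 0 vanishing at z1. *)
Definition NN (f A B : C -> C) (z1 z : C) : C :=
  (Cconj (A z) * (f z - f z1) - Cconj (B z) * Cconj (f z - f z1))%C.
Definition EE (f A B : C -> C) (z1 z : C) : C := (RtoC (JJ A B z) / NN f A B z1 z)%C.
Definition WW (f A B : C -> C) (z1 z : C) : C := (EE f A B z1 z - PP A B z / 2)%C.
(** The deviation of W from 1 / (z - z1), which is 0 for a Mobius transformation f. The weight (z -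
    z1)^2 is an integrating factor: it cancels the term linear in the deviation, as [wd_QQ]
    shows. *)
Definition QQ (f A B : C -> C) (z1 z : C) : C :=
  ((z - z1) * (z - z1) * WW f A B z1 z - (z - z1))%C.

Definition pair_of (f A B : C -> C) (z : C) : Prop :=
  holo A z /\ holo B z /\ 0 < JJ A B z /\ wd f z (A z) (Cconj (B z)).

Lemma wd_NN f A B z1 z : pair_of f A B z ->
  wd (NN f A B z1) z (RtoC (JJ A B z))
    (Cconj (deriv A z) * (f z - f z1) - Cconj (deriv B z) * Cconj (f z - f z1))%C.
Proof.
  intros [HA [HB [HJ Hf]]]. assert (X := wd_minus _ _ _ _ _ _ _ Hf (wd_const (f z1) z)).
  unfold NN. eapply wd_eq. apply wd_minus; apply wd_mult.
  apply wd_conj, holo_wd, HA. exact X. apply wd_conj, holo_wd, HB. apply wd_conj. exact X.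
  - rewrite JJ_RtoC, !Cminus_conj, Cconj_conj, !Cconj_0. ring.
  - rewrite !Cminus_conj, !Cconj_0. ring.
Qed.

(** Since N_z = J, the logarithmic derivative of J / N in z is P - J / N; this is the source of the
    Riccati equation. The derivative in conj z has modulus t |J / N|. *)
Lemma wd_EE f A B z1 z : pair_of f A B z -> NN f A B z1 z <> 0%C ->
  wd (EE f A B z1) z (EE f A B z1 z * (PP A B z - EE f A B z1 z))%C
    (Cconj (TT A B z) * Cconj (NN f A B z1 z) / (NN f A B z1 z * NN f A B z1 z))%C.
Proof.
  intros Hp HN. assert (HP := Hp). destruct HP as [HA [HB [HJ Hf]]]. assert (NJ := JJ_neq_0 _ _ _ HJ).
  unfold EE. eapply wd_eq. apply wd_div. apply wd_JJ; auto. apply wd_NN; auto. auto.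
  - unfold PP. field. auto.
  - match goal with |- (?x / ?y)%C = (?x' / ?y)%C => replace x' with x; [reflexivity|] end.
    rewrite JJ_RtoC. unfold NN, TT. rewrite !Cminus_conj, !Cmult_conj, !Cminus_conj, !Cconj_conj. ring.
Qed.

Lemma wd_WW f A B z1 z : pair_of f A B z -> NN f A B z1 z <> 0%C ->
  wd (WW f A B z1) z (- (WW f A B z1 z * WW f A B z1 z) - SS A B z / 2)%C
    (Cconj (TT A B z) * Cconj (NN f A B z1 z) / (NN f A B z1 z * NN f A B z1 z) + RtoC (tau A B z) / 2)%C.
Proof.
  intros Hp HN. assert (HP := Hp). destruct HP as [HA [HB [HJ Hf]]].
  assert (X := wd_minus _ _ _ _ _ _ _ (wd_EE f A B z1 z Hp HN) (wd_scal (/ 2)%C _ _ _ _ (wd_PP A B z HA HB HJ))).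
  unfold WW. eapply wd_eq. eapply wd_ext; [|exact X]. intros w. cbv beta. field. field. field. auto.
Qed.

Lemma wd_QQ f A B z1 z : pair_of f A B z -> NN f A B z1 z <> 0%C -> z <> z1 ->
  wd (QQ f A B z1) z
    (- (QQ f A B z1 z * QQ f A B z1 z) / ((z - z1) * (z - z1)) - (z - z1) * (z - z1) * SS A B z / 2)%C
    ((z - z1) * (z - z1) * (Cconj (TT A B z) * Cconj (NN f A B z1 z) / (NN f A B z1 z * NN f A B z1 z) + RtoC (tau A B z) / 2))%C.
Proof.
  intros Hp HN Hz. assert (X := wd_minus _ _ _ _ _ _ _ (wd_id z) (wd_const z1 z)).
  assert (Nz := Cminus_neq_0 _ _ Hz).
  unfold QQ. eapply wd_eq. apply wd_minus. apply wd_mult. apply wd_mult; exact X. apply wd_WW; auto. exact X.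
  - cbv beta. field. auto.
  - cbv beta. ring.
Qed.

Lemma NN_eq_0 f A B z1 z : 0 < JJ A B z -> f z = f z1 -> NN f A B z1 z = 0%C.
Proof. intros _ E. unfold NN. rewrite E. replace (f z1 - f z1)%C with (RtoC 0) by ring. rewrite Cconj_0. ring. Qed.

Lemma wd_bound (a b : C) (F : C -> C) z k : wd F z a b -> Cmod a + Cmod b < k ->
  near z (fun w => Cmod (F w - F z)%C <= k * Cmod (w - z)%C).
Proof.
  intros H Hk. generalize (wd_lip F z a b (k - Cmod a - Cmod b) H ltac:(lra)). apply near_imp.
  intros w Hw. replace k with (Cmod a + Cmod b + (k - Cmod a - Cmod b)) by ring. exact Hw.
Qed.

(** With zeta = z - z1, N = J(z1) zeta + o(|zeta|) and J is continuous, so J / N = (1 + o(1)) /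
    zeta, while P stays bounded; hence Q = o(|zeta|). *)
Lemma QQ_initial f A B z1 K : pair_of f A B z1 -> near z1 (pair_of f A B) -> 0 < K ->
  near z1 (fun z => z <> z1 -> NN f A B z1 z <> 0%C /\ Cmod (QQ f A B z1 z) <= K * Cmod (z - z1)%C).
Proof.
  intros Hp HpN HK. assert (HP := Hp). destruct HP as [HA [HB [HJ Hf]]].
  set (J1 := JJ A B z1) in *.
  (* J1 / 2 keeps |N| >= J1 |zeta| / 2, and J1 K / 16 limits the error coming from J / N to K |zeta|
     / 4. *)
  set (eta := Rmin (J1 / 2) (J1 * K / 16)).
  assert (Q1 : eta <= J1 / 2) by apply Rmin_l. assert (Q2 : eta <= J1 * K / 16) by apply Rmin_r.
  assert (Heta : 0 < eta). { apply Rmin_pos. lra. assert (0 < J1 * K) by now apply Rmult_lt_0_compat. lra. }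
  assert (N1 := wd_NN f A B z1 z1 Hp). assert (NZ : NN f A B z1 z1 = 0%C) by (now apply NN_eq_0).
  replace (f z1 - f z1)%C with (RtoC 0) in N1 by ring. rewrite Cconj_0, !Cmult_0_r in N1.
  replace (0 - 0)%C with (RtoC 0) in N1 by ring.
  destruct (cont_bounded _ _ (PP_cont A B z1 HA HB HJ)) as [Mp [dp [HMp [Hdp BP]]]].
  generalize (near_and _ _ _ (near_and _ _ _ (N1 eta Heta : near z1 _) (cont_JJ A B z1 HA HB eta Heta))
    (near_and _ _ _ (ex_intro _ dp (conj Hdp BP) : near z1 _) (near_ball_self z1 (K / Mp) ltac:(now apply Rdiv_lt_0_compat)))).
  apply near_imp. intros z [[X1 X2] [X3 X4]] Hz.
  set (ze := (z - z1)%C) in *. assert (Nze : ze <> 0%C) by (apply Cminus_neq_0; auto).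
  assert (Pze := proj1 (Cmod_gt_0 ze) Nze).
  rewrite NZ in X1. fold J1 in X1. set (N := NN f A B z1 z) in *.
  replace (N - 0 - RtoC J1 * ze - 0 * Cconj ze)%C with (N - RtoC J1 * ze)%C in X1 by ring.
  fold J1 in X2.
  assert (LN : J1 / 2 * Cmod ze <= Cmod N).
  { assert (T := Cmod_triangle_rev (RtoC J1 * ze) N). rewrite Cmod_minus_sym in X1. rewrite Cmod_mult, Cmod_RtoC_pos in T by lra.
    assert (eta * Cmod ze <= J1 / 2 * Cmod ze) by (apply Rmult_le_compat_r; lra). lra. }
  assert (PN : 0 < Cmod N). { apply Rlt_le_trans with (2 := LN). apply Rmult_lt_0_compat; lra. }
  assert (NN0 : N <> 0%C) by now apply Cmod_gt_0.
  split; auto.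
  assert (E : QQ f A B z1 z = (ze * ((ze * (RtoC (JJ A B z) - RtoC J1) - (N - RtoC J1 * ze)) / N) - ze * ze * (PP A B z / 2))%C).
  { unfold QQ, WW, EE. fold ze N. field. auto. }
  rewrite E. eapply Rle_trans; [apply Cmod_triangle_sub|].
  assert (B1 : Cmod (ze * ((ze * (RtoC (JJ A B z) - RtoC J1) - (N - RtoC J1 * ze)) / N))%C <= K / 4 * Cmod ze).
  { rewrite Cmod_mult, Cmod_div by auto.
    assert (T := Cmod_triangle_sub (ze * (RtoC (JJ A B z) - RtoC J1)) (N - RtoC J1 * ze)). rewrite Cmod_mult in T.
    assert (Cmod ze * Cmod (RtoC (JJ A B z) - RtoC J1)%C <= Cmod ze * eta) by (apply Rmult_le_compat_l; lra).
    rewrite Rmult_comm. apply Rmult_le_compat_r; [lra|].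
    apply Rle_div_l; auto. apply Rle_trans with (K / 4 * (J1 / 2 * Cmod ze)).
    - apply Rle_trans with (2 * (J1 * K / 16) * Cmod ze). 2: apply Req_le; field.
      apply Rle_trans with (2 * eta * Cmod ze). lra. apply Rmult_le_compat_r; lra.
    - apply Rmult_le_compat_l; lra. }
  assert (B2 : Cmod (ze * ze * (PP A B z / 2))%C <= K / 2 * Cmod ze).
  { rewrite !Cmod_mult, Cmod_div, (Cmod_RtoC_pos 2) by (try lra; intros Z; apply RtoC_inj in Z; lra).
    assert (Y : Cmod ze * Mp <= K). { apply Rlt_le. apply Rlt_div_r in X4; auto. }
    assert (Cmod ze * Cmod (PP A B z) <= Cmod ze * Mp) by (apply Rmult_le_compat_l; lra).
    replace (Cmod ze * Cmod ze * (Cmod (PP A B z) / 2)) with (Cmod ze * Cmod (PP A B z) / 2 * Cmod ze) by field.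
    apply Rmult_le_compat_r; lra. }
  assert (0 < K * Cmod ze) by now apply Rmult_lt_0_compat. lra.
Qed.

(* A bound on Q keeps N away from zero, since E = (Q + zeta)/zeta^2 + P/2. *)
Lemma QQ_closure f A B z1 z M : pair_of f A B z -> near z (pair_of f A B) -> z <> z1 ->
  (forall eta, 0 < eta -> exists w, Cmod (w - z)%C < eta /\ NN f A B z1 w <> 0%C /\ Cmod (QQ f A B z1 w) <= M) ->
  NN f A B z1 z <> 0%C /\ Cmod (QQ f A B z1 z) <= M.
Proof.
  intros Hp HpN Hz H. assert (HP := Hp). destruct HP as [HA [HB [HJ Hf]]].
  assert (Nze := Cminus_neq_0 _ _ Hz). assert (Pze := proj1 (Cmod_gt_0 _) Nze). set (d0 := Cmod (z - z1)%C) in *.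
  destruct (cont_bounded _ _ (PP_cont A B z HA HB HJ)) as [Mp [dp [HMp [Hdp BP]]]].
  assert (CN := wd_cont _ _ _ _ (wd_NN f A B z1 z Hp)).
  assert (HM0 : 0 <= M). { destruct (H 1 Rlt_0_1) as [w [_ [_ X]]]. eapply Rle_trans; [apply Cmod_ge_0|exact X]. }
  assert (NNz : NN f A B z1 z <> 0%C).
  (* [ME] bounds |J / N| at the nearby points w, so |N(w)| is at least J(w) / ME, with J(w) > J(z) /
     2; but N(w) is close to N(z) = 0. *)
  { intros E0. set (ME := (M + 2 * d0) / (d0 * d0 / 4) + Mp).
    assert (HME : 0 < ME). { unfold ME. assert (0 <= (M + 2 * d0) / (d0 * d0 / 4)) by (apply Rle_div_pos; nra). lra. }
    assert (Hsm : 0 < JJ A B z / (4 * ME)) by (apply Rdiv_lt_0_compat; lra).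
    destruct (near_and _ _ _ (near_and _ _ _ (CN _ Hsm) (cont_JJ A B z HA HB (JJ A B z / 2) ltac:(lra)))
      (near_and _ _ _ (ex_intro _ dp (conj Hdp BP) : near z _) (near_ball_self z (d0 / 2) ltac:(lra)))) as [d [Hd X]].
    destruct (H d Hd) as [w [W1 [W2 W3]]]. destruct (X w W1) as [[X1 X2] [X3 X4]].
    rewrite E0 in X1. replace (NN f A B z1 w - 0)%C with (NN f A B z1 w) in X1 by ring.
    assert (T1 := Cmod_dist_triangle z w z1). fold d0 in T1. rewrite (Cmod_minus_sym z w) in T1.
    assert (T2 := Cmod_dist_triangle w z z1). fold d0 in T2.
    set (ze := (w - z1)%C) in *. assert (L1 : d0 / 2 <= Cmod ze) by lra. assert (L2 : Cmod ze <= 2 * d0) by lra.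
    assert (Nze' : ze <> 0%C) by (apply Cmod_gt_0; lra).
    assert (EE1 : EE f A B z1 w = ((QQ f A B z1 w + ze) / (ze * ze) + PP A B w / 2)%C).
    { unfold QQ, WW. fold ze. field. auto. }
    assert (BE : Cmod (EE f A B z1 w) <= ME).
    { rewrite EE1. eapply Rle_trans; [apply Cmod_triangle|]. unfold ME. apply Rplus_le_compat.
      - rewrite Cmod_div by (now apply Cmult_neq_0). rewrite Cmod_mult. unfold Rdiv at 1 2. apply Rmult_le_compat.
        apply Cmod_ge_0. apply Rlt_le, Rinv_0_lt_compat. nra.
        eapply Rle_trans; [apply Cmod_triangle|]. lra. apply Rinv_le_contravar; nra.
      - rewrite Cmod_div, (Cmod_RtoC_pos 2) by (try lra; intros Z; apply RtoC_inj in Z; lra). assert (PP0 := Cmod_ge_0 (PP A B w)). lra. }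
    rewrite <- RtoC_minus, Cmod_R in X2. apply Rabs_lt_between in X2.
    assert (EJ : (EE f A B z1 w * NN f A B z1 w)%C = RtoC (JJ A B w)). { unfold EE. field. auto. }
    apply (f_equal Cmod) in EJ. rewrite Cmod_mult, Cmod_RtoC_pos in EJ by lra.
    assert (Cmod (EE f A B z1 w) * Cmod (NN f A B z1 w) <= ME * (JJ A B z / (4 * ME))) by (apply Rmult_le_compat; auto using Cmod_ge_0; lra).
    replace (ME * (JJ A B z / (4 * ME))) with (JJ A B z / 4) in H0 by (field; lra). lra. }
  split; auto. apply le_epsilon. intros e He.
  assert (CQ := wd_cont _ _ _ _ (wd_QQ f A B z1 z Hp NNz Hz)).
  destruct (CQ e He) as [d [Hd X]]. destruct (H d Hd) as [w [W1 [W2 W3]]]. specialize (X w W1).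
  rewrite Cmod_minus_sym in X. assert (T := Cmod_triangle_rev (QQ f A B z1 z) (QQ f A B z1 w)). lra.
Qed.

Definition ball_in (D : C -> Prop) (z : C) (r : R) : Prop := forall v, Cmod (v - z)%C < r -> D v.

(** Scale-invariant bounds, stated for every disc contained in D; such a disc stands for the
    distance to the boundary. *)
Definition local_control (D : C -> Prop) (A B : C -> C) (c C0 eps : R) : Prop :=
  forall z r, 0 < r -> ball_in D z r ->
    Cmod (SS A B z) <= c / r ^ 2 /\ Cmod (PP A B z) <= C0 / r /\ tau A B z <= (eps / r) ^ 2.

(** [s] is the arclength travelled from z1, comparable with |z - z1| and with the room available in
    D. The four terms of the smallness condition bound, in this order, the contributions of Q^2 /
    zeta^2, zeta^2 S / 2, zeta^2 t |J / N| and zeta^2 t^2 / 2; J / N is recovered from Q and P. *)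
Lemma QQ_derivative_bound D f A B z1 z c C0 eps mu K s :
  pair_of f A B z -> local_control D A B c C0 eps -> 0 <= c -> 0 <= C0 -> 0 <= eps -> 0 < mu -> 0 < K -> 0 < s ->
  mu * s <= Cmod (z - z1)%C <= s -> ball_in D z (mu * s) ->
  NN f A B z1 z <> 0%C -> Cmod (QQ f A B z1 z) <= K * s ->
  K ^ 2 / mu ^ 2 + c / mu ^ 2 + eps / mu * ((K + 1) / mu ^ 2 + C0 / mu) + (eps / mu) ^ 2 < K ->
  near z (fun w => Cmod (QQ f A B z1 w - QQ f A B z1 z)%C <= K * Cmod (w - z)%C).
Proof.
  intros Hp HL Hc HC0 He Hmu HK Hs [Hz1 Hz2] HD HN HQ HC.
  assert (HP := Hp). destruct HP as [HA [HB [HJ Hf]]].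
  assert (Pms : 0 < mu * s) by now apply Rmult_lt_0_compat.
  destruct (HL z (mu * s) Pms HD) as [L1 [L2 L3]].
  set (ze := (z - z1)%C) in *. assert (Pze : 0 < Cmod ze) by lra. assert (Nze : ze <> 0%C) by now apply Cmod_gt_0.
  assert (Hz : z <> z1). { intros ->. apply Nze. unfold ze. ring. }
  eapply wd_bound. apply wd_QQ; auto. fold ze.
  apply Rle_lt_trans with (2 := HC).
  assert (Pmu2 : 0 < mu ^ 2) by now apply pow_lt. assert (Ps2 : 0 < s ^ 2) by now apply pow_lt.
  assert (Z2 : Cmod ze * Cmod ze <= s ^ 2) by nra.
  assert (Z3 : mu ^ 2 * s ^ 2 <= Cmod ze * Cmod ze). { replace (mu ^ 2 * s ^ 2) with ((mu * s) * (mu * s)) by ring. apply Rmult_le_compat; lra. }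
  assert (C2 : Cmod 2 = 2) by (apply Cmod_RtoC_pos; lra).
  assert (N2 : RtoC 2 <> 0%C) by (intros Z; apply RtoC_inj in Z; lra).
  set (Q := QQ f A B z1 z) in *. set (N := NN f A B z1 z) in *.
  assert (B1 : Cmod (- (Q * Q) / (ze * ze))%C <= K ^ 2 / mu ^ 2).
  { rewrite Cmod_div, Cmod_opp, !Cmod_mult by (now apply Cmult_neq_0).
    apply Rle_trans with ((K * s) * (K * s) / (mu ^ 2 * s ^ 2)). 2: apply Req_le; field; lra.
    unfold Rdiv. apply Rmult_le_compat. apply Rmult_le_pos; apply Cmod_ge_0. apply Rlt_le, Rinv_0_lt_compat; nra.
    apply Rmult_le_compat; auto using Cmod_ge_0. apply Rinv_le_contravar; auto. now apply Rmult_lt_0_compat. }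
  assert (B2 : Cmod (ze * ze * SS A B z / 2)%C <= c / mu ^ 2).
  { rewrite Cmod_div, !Cmod_mult, C2 by auto. assert (PS := Cmod_ge_0 (SS A B z)).
    apply Rle_trans with (s ^ 2 * (c / (mu * s) ^ 2)). 2: apply Req_le; field; lra.
    apply Rle_trans with (Cmod ze * Cmod ze * Cmod (SS A B z)). assert (0 <= Cmod ze * Cmod ze * Cmod (SS A B z)) by nra. lra.
    apply Rmult_le_compat; auto; nra. }
  assert (PT := tau_nonneg A B z HJ).
  assert (NJ := JJ_neq_0 _ _ _ HJ).
  assert (PN : 0 < Cmod N) by now apply Cmod_gt_0.
  assert (ES : eps / (mu * s) = eps / mu / s) by (field; lra). rewrite ES in L3.
  assert (Pes : 0 <= eps / mu / s) by (apply Rle_div_pos; auto; apply Rle_div_pos; auto).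
  assert (BE : Cmod (EE f A B z1 z) <= ((K + 1) / mu ^ 2 + C0 / mu) / s).
  { assert (EE1 : EE f A B z1 z = ((Q + ze) / (ze * ze) + PP A B z / 2)%C). { unfold Q, QQ, WW. fold ze. field. auto. }
    rewrite EE1. eapply Rle_trans; [apply Cmod_triangle|].
    rewrite !Cmod_div, Cmod_mult, C2 by (auto; now apply Cmult_neq_0).
    assert (Y1 : Cmod (Q + ze)%C / (Cmod ze * Cmod ze) <= (K + 1) * s / (mu ^ 2 * s ^ 2)).
    { unfold Rdiv. apply Rmult_le_compat. apply Cmod_ge_0. apply Rlt_le, Rinv_0_lt_compat; nra.
      eapply Rle_trans; [apply Cmod_triangle|]. lra. apply Rinv_le_contravar; auto. now apply Rmult_lt_0_compat. }
    replace ((K + 1) * s / (mu ^ 2 * s ^ 2)) with ((K + 1) / mu ^ 2 / s) in Y1 by (field; lra).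
    assert (Y2 : Cmod (PP A B z) / 2 <= C0 / mu / s).
    { replace (C0 / mu / s) with (C0 / (mu * s)) by (field; lra). assert (X := Cmod_ge_0 (PP A B z)). lra. }
    replace (((K + 1) / mu ^ 2 + C0 / mu) / s) with ((K + 1) / mu ^ 2 / s + C0 / mu / s) by (field; lra). lra. }
  assert (BT : Cmod (Cconj (TT A B z) * Cconj N / (N * N))%C <= eps / mu / s * (((K + 1) / mu ^ 2 + C0 / mu) / s)).
  { rewrite Cmod_div, !Cmod_mult, !Cmod_conj by (now apply Cmult_neq_0).
    replace (Cmod (TT A B z) * Cmod N / (Cmod N * Cmod N)) with (Cmod (TT A B z) / JJ A B z * (JJ A B z / Cmod N)) by (field; lra).
    apply Rmult_le_compat.
    - apply Rle_div_pos; auto. apply Cmod_ge_0.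
    - apply Rle_div_pos; lra.
    - apply Rsqr_incr_0_var; auto. unfold Rsqr. unfold tau in L3.
      replace (Cmod (TT A B z) / JJ A B z * (Cmod (TT A B z) / JJ A B z)) with (Cmod (TT A B z) ^ 2 / JJ A B z ^ 2) by (field; lra). lra.
    - replace (JJ A B z / Cmod N) with (Cmod (EE f A B z1 z)); auto. unfold EE. fold N. rewrite Cmod_div, Cmod_RtoC_pos by (auto; lra). reflexivity. }
  assert (B3 : Cmod (ze * ze * (Cconj (TT A B z) * Cconj N / (N * N) + RtoC (tau A B z) / 2))%C <=
     eps / mu * ((K + 1) / mu ^ 2 + C0 / mu) + (eps / mu) ^ 2).
  { rewrite !Cmod_mult. apply Rle_trans with (s ^ 2 * (eps / mu / s * (((K + 1) / mu ^ 2 + C0 / mu) / s) + (eps / mu / s) ^ 2)).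
    2: apply Req_le; field; lra.
    apply Rmult_le_compat; auto using Cmod_ge_0. nra.
    eapply Rle_trans; [apply Cmod_triangle|]. apply Rplus_le_compat; auto.
    rewrite Cmod_div, C2, Cmod_RtoC_pos by auto. lra. }
  eapply Rle_trans; [apply Rplus_le_compat_r, Cmod_triangle_sub|]. lra.
Qed.

Definition path_cont (g : R -> C) (T : R) : Prop :=
  forall t, 0 <= t <= T -> forall eps, 0 < eps -> exists d, 0 < d /\
    forall s, 0 <= s <= T -> Rabs (s - t) < d -> Cmod (g s - g t)%C < eps.

(** Continuity induction with a speed limit: locally Q moves by at most K times the chord, the chord
    is at most the growth of [sg], and [QQ_closure] passes to limits. On the open set [G0] the bound
    is already known; it starts the induction at z1 and covers later returns. *)
Lemma QQ_growth D f A B z1 c C0 eps mu K (G0 : C -> Prop) (g : R -> C) (sg : R -> R) (T : R) :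
  (forall z, D z -> near z D) -> (forall z, D z -> pair_of f A B z) ->
  local_control D A B c C0 eps -> 0 <= c -> 0 <= C0 -> 0 <= eps -> 0 < mu -> 0 < K ->
  K ^ 2 / mu ^ 2 + c / mu ^ 2 + eps / mu * ((K + 1) / mu ^ 2 + C0 / mu) + (eps / mu) ^ 2 < K ->
  (forall z, G0 z -> near z G0) ->
  (forall z, G0 z -> z <> z1 -> NN f A B z1 z <> 0%C /\ Cmod (QQ f A B z1 z) <= K * Cmod (z - z1)%C) ->
  T <= 1 -> path_cont g T -> g 0 = z1 -> sg 0 = 0 -> (forall t, 0 <= t <= T -> D (g t)) ->
  (forall t t', 0 <= t <= t' -> t' <= T -> Cmod (g t' - g t)%C <= sg t' - sg t) ->
  (forall t, 0 <= t < T -> G0 (g t) \/ (0 < sg t /\ mu * sg t <= Cmod (g t - z1)%C /\ ball_in D (g t) (mu * sg t))) ->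
  forall t, 0 <= t < T -> g t <> z1 -> NN f A B z1 (g t) <> 0%C /\ Cmod (QQ f A B z1 (g t)) <= K * sg t.
Proof.
  intros HDo Hpair HL Hc HC0 Heps Hmu HK HC HG0 HG HT1 Hg g0 sg0 HDg Hch Hreg.
  assert (Hsg : forall t, 0 <= t <= T -> Cmod (g t - z1)%C <= sg t).
  { intros t Ht. rewrite <- g0. assert (X := Hch 0 t ltac:(lra) ltac:(lra)). rewrite sg0 in X. lra. }
  assert (Main : forall t, 0 <= t <= 1 -> t < T -> g t <> z1 -> NN f A B z1 (g t) <> 0%C /\ Cmod (QQ f A B z1 (g t)) <= K * sg t).
  { apply (real_induction (fun t => t < T -> g t <> z1 -> NN f A B z1 (g t) <> 0%C /\ Cmod (QQ f A B z1 (g t)) <= K * sg t)).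
    - intros _ N. contradiction.
    - intros t Ht Pt. destruct (Rlt_dec t T) as [L|L].
      2:{ exists 1. split. lra. intros s Hs _ Hs'. lra. }
      assert (Near : forall P : C -> Prop, near (g t) P -> exists d, 0 < d /\ forall s, t < s < t + d -> s <= T -> P (g s)).
      { intros P [e [He HP]]. destruct (Hg t ltac:(lra) e He) as [d [Hd X]]. exists d. split; auto.
        intros s Hs Hs'. apply HP, X. lra. apply Rabs_lt_between. lra. }
      destruct (classic (G0 (g t))) as [G|G].
      + destruct (Near _ (HG0 _ G)) as [d [Hd X]]. exists d. split; auto. intros s Hs _ Hs' Ns.
        destruct (HG (g s) (X s Hs ltac:(lra)) Ns) as [Y1 Y2]. split; auto. apply Rle_trans with (1 := Y2).
        apply Rmult_le_compat_l. lra. apply Hsg. lra.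
      + destruct (Hreg t ltac:(lra)) as [R|[R1 [R2 R3]]]; [contradiction|].
        assert (Nt : g t <> z1). { intros E. rewrite E in R2. replace (z1 - z1)%C with (RtoC 0) in R2 by ring. rewrite Cmod_0 in R2.
          assert (0 < mu * sg t) by now apply Rmult_lt_0_compat. lra. }
        destruct (Pt L Nt) as [P1 P2].
        assert (Hp := Hpair _ (HDg t ltac:(lra))).
        assert (X1 := QQ_derivative_bound D f A B z1 (g t) c C0 eps mu K (sg t) Hp HL Hc HC0 Heps Hmu HK R1 (conj R2 (Hsg t ltac:(lra))) R3 P1 P2 HC).
        assert (X2 := cont_neq_0 _ _ (wd_cont _ _ _ _ (wd_NN f A B z1 (g t) Hp)) P1).
        destruct (Near _ (near_and _ _ _ X1 X2)) as [d [Hd X]]. exists d. split; auto. intros s Hs _ Hs' Ns.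
        destruct (X s Hs ltac:(lra)) as [Y1 Y2]. split; auto.
        assert (Y3 := Hch t s ltac:(lra) ltac:(lra)).
        assert (Y4 := Cmod_triangle_rev (QQ f A B z1 (g s)) (QQ f A B z1 (g t))).
        assert (K * Cmod (g s - g t)%C <= K * (sg s - sg t)) by (apply Rmult_le_compat_l; lra). lra.
    - intros t Ht Hl L Nt.
      apply QQ_closure; auto.
      + apply Hpair, HDg; lra.
      + generalize (HDo _ (HDg t ltac:(lra))). apply near_imp. exact Hpair.
      + intros eta Heta.
        assert (Pd : 0 < Cmod (g t - z1)%C) by (apply Cmod_gt_0, Cminus_neq_0; auto).
        destruct (Hg t ltac:(lra) (Rmin eta (Cmod (g t - z1)%C)) ltac:(now apply Rmin_pos)) as [d [Hd X]].
        set (s := Rmax 0 (t - d / 2)). assert (T1 := Rmax_l 0 (t - d / 2)). assert (T2 := Rmax_r 0 (t - d / 2)). fold s in T1, T2.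
        assert (T3 : s < t) by (apply Rmax_lub_lt; lra).
        specialize (X s ltac:(lra) ltac:(apply Rabs_lt_between; lra)).
        assert (M1 := Rmin_l eta (Cmod (g t - z1)%C)). assert (M2 := Rmin_r eta (Cmod (g t - z1)%C)).
        assert (Ns : g s <> z1). { intros E. rewrite E, Cmod_minus_sym in X. lra. }
        destruct (Hl s ltac:(lra) ltac:(lra) Ns) as [Y1 Y2].
        exists (g s). split. lra. split; auto. apply Rle_trans with (1 := Y2). apply Rmult_le_compat_l. lra.
        assert (Y3 := Hch s t ltac:(lra) ltac:(lra)). assert (Y4 := Cmod_ge_0 (g t - g s)%C). lra. }
  intros t Ht. apply Main; lra.
Qed.

(* The points of the disc about z1 of half the distance to the boundary. *)
Definition inner_disc (D : C -> Prop) (z1 z : C) : Prop :=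
  exists del, Cmod (z - z1)%C < del /\ ball_in D z1 (2 * del).

(** On a radial segment arclength equals the distance from z1, and the disc of twice the radius
    provides the room, so [QQ_growth] applies with a small disc about z1 as [G0]. *)
Lemma QQ_inner_disc D f A B z1 c C0 eps mu K :
  (forall z, D z -> near z D) -> (forall z, D z -> pair_of f A B z) ->
  local_control D A B c C0 eps -> 0 <= c -> 0 <= C0 -> 0 <= eps -> 0 < mu <= 1 -> 0 < K ->
  K ^ 2 / mu ^ 2 + c / mu ^ 2 + eps / mu * ((K + 1) / mu ^ 2 + C0 / mu) + (eps / mu) ^ 2 < K ->
  D z1 -> forall z, inner_disc D z1 z -> z <> z1 ->
  NN f A B z1 z <> 0%C /\ Cmod (QQ f A B z1 z) <= K * Cmod (z - z1)%C.
Proof.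
  intros HDo Hpair HL Hc HC0 Heps Hmu HK HC D1 z [del [Hdel HB]] Hz.
  set (d := Cmod (z - z1)%C) in *. assert (Pd : 0 < d) by (apply Cmod_gt_0, Cminus_neq_0; auto).
  assert (Npair : near z1 (pair_of f A B)) by (generalize (HDo _ D1); apply near_imp; exact Hpair).
  destruct (QQ_initial f A B z1 K (Hpair _ D1) Npair HK) as [r0 [Hr0 Ini]].
  (* extend the segment slightly beyond z, as the growth lemma stops short of its end *)
  set (rho := del / d). assert (Hrho : 1 < rho) by (apply Rlt_div_r; lra).
  assert (Crho : Cmod (RtoC rho * (z - z1))%C = del).
  { rewrite Cmod_mult, Cmod_RtoC_pos by lra. fold d. unfold rho. field. lra. }
  set (g := fun t => (z1 + RtoC t * (RtoC rho * (z - z1)))%C).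
  assert (Eg : forall t, (g t - z1)%C = (RtoC t * (RtoC rho * (z - z1)))%C) by (intros t; unfold g; ring).
  assert (Cg : forall t, 0 <= t -> Cmod (g t - z1)%C = t * del).
  { intros t Ht. rewrite Eg, Cmod_mult, Crho, Cmod_RtoC_pos; auto. }
  assert (Eg2 : forall t t', Cmod (g t' - g t)%C = Rabs (t' - t) * del).
  { intros t t'. replace (g t' - g t)%C with (RtoC (t' - t) * (RtoC rho * (z - z1)))%C by (unfold g; rewrite RtoC_minus; ring).
    now rewrite Cmod_mult, Crho, Cmod_R. }
  assert (Pdel : 0 < del) by lra.
  assert (Pi : 0 < / rho < 1). { split. apply Rinv_0_lt_compat; lra. rewrite <- Rinv_1. apply Rinv_lt_contravar; lra. }
  assert (Gz : g (/ rho) = z).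
  { unfold g. replace (RtoC (/ rho) * (RtoC rho * (z - z1)))%C with (RtoC (/ rho * rho) * (z - z1))%C by (rewrite RtoC_mult; ring).
    rewrite Rinv_l by lra. ring. }
  destruct (QQ_growth D f A B z1 c C0 eps mu K (fun w => Cmod (w - z1)%C < r0) g (fun t => t * del) 1) with (t := / rho) as [Y1 Y2];
    auto; try lra.
  - intros w Hw. now apply near_ball.
  - intros t Ht e He. exists (e / del). split. now apply Rdiv_lt_0_compat. intros s Hs Hs'. rewrite Eg2. now apply Rlt_div_r in Hs'.
  - unfold g. ring.
  - intros t Ht. apply HB. rewrite Cg by lra. nra.
  - intros t t' Ht Ht'. rewrite Eg2, Rabs_pos_eq by lra. lra.
  - intros t Ht. destruct (Rlt_dec (Cmod (g t - z1)%C) r0) as [L|L]; auto. right.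
    assert (Pt : 0 < t). { rewrite Cg in L by lra. destruct (Req_dec t 0) as [->|N]; lra. }
    assert (Ptd : 0 < t * del) by now apply Rmult_lt_0_compat.
    rewrite Cg by lra. split; auto. split. { rewrite <- (Rmult_1_l (t * del)) at 2. apply Rmult_le_compat_r; lra. }
    intros v Hv. apply HB. assert (T := Cmod_dist_triangle v (g t) z1). rewrite Cg in T by lra.
    assert (mu * (t * del) <= 1 * (t * del)) by (apply Rmult_le_compat_r; lra). nra.
  - now rewrite Gz.
  - rewrite Gz in Y1, Y2. split; auto. replace d with (/ rho * del) by (unfold rho; field; lra). exact Y2.
Qed.

(** * Rescaling to the unit disc *)

Lemma wd_rescale F z0 r w l : wd F (z0 + RtoC r * w)%C l 0 ->
  wd (fun w => F (z0 + RtoC r * w)%C) w (RtoC r * l)%C 0.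
Proof.
  intros H. assert (X := wd_plus _ _ _ _ _ _ _ (wd_const z0 w) (wd_scal (RtoC r) _ _ _ _ (wd_id w))).
  eapply wd_eq. apply (wd_comp F (fun w => z0 + RtoC r * w)%C w _ _ _ _ X H).
  ring. rewrite Cplus_conj, Cmult_conj, Cconj_0. ring.
Qed.

Lemma holo_rescale F z0 r w : holo F (z0 + RtoC r * w)%C -> holo (fun w => F (z0 + RtoC r * w)%C) w.
Proof.
  intros H.
  assert (C0 : cont (fun w => z0 + RtoC r * w)%C w).
  { eapply wd_cont. apply wd_plus. apply wd_const. apply wd_scal. apply wd_id. }
  generalize (cont_near _ _ _ C0 H). apply near_imp. intros v [l Hl]. exists (RtoC r * l)%C. now apply wd_rescale.
Qed.

Lemma deriv_rescale F z0 r w : holo F (z0 + RtoC r * w)%C ->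
  deriv (fun w => F (z0 + RtoC r * w)%C) w = (RtoC r * deriv F (z0 + RtoC r * w))%C.
Proof. intros H. apply deriv_unique. apply wd_rescale. now apply holo_wd. Qed.

Lemma deriv2_rescale F z0 r w : holo F (z0 + RtoC r * w)%C ->
  deriv (deriv (fun w => F (z0 + RtoC r * w)%C)) w = (RtoC r * RtoC r * deriv (deriv F) (z0 + RtoC r * w))%C.
Proof.
  intros H.
  assert (C0 : cont (fun w => z0 + RtoC r * w)%C w).
  { eapply wd_cont. apply wd_plus. apply wd_const. apply wd_scal. apply wd_id. }
  rewrite (deriv_ext_near (fun w => RtoC r * deriv F (z0 + RtoC r * w))%C).
  - apply deriv_unique. eapply wd_eq. apply wd_scal. apply (wd_rescale (deriv F)). apply holo_wd, holo_deriv, H. ring. ring.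
  - generalize (cont_near _ _ _ C0 (holo_near _ _ H)). apply near_imp. intros v Hv. symmetry. now apply deriv_rescale.
  - apply holo_scal. apply (holo_rescale (deriv F)). now apply holo_deriv.
Qed.

(** P is a logarithmic derivative and has weight 1 under dilation; S and [tau] are of second order
    and have weight 2. *)
Lemma rescale_pair A B z0 r w : holo A (z0 + RtoC r * w)%C -> holo B (z0 + RtoC r * w)%C ->
  0 < JJ A B (z0 + RtoC r * w)%C ->
  let A' := fun w => A (z0 + RtoC r * w)%C in let B' := fun w => B (z0 + RtoC r * w)%C in
  let z := (z0 + RtoC r * w)%C in
  PP A' B' w = (RtoC r * PP A B z)%C /\ SS A' B' w = (RtoC r * RtoC r * SS A B z)%C /\
  tau A' B' w = r ^ 2 * tau A B z.
Proof.
  intros HA HB HJ A' B' z. assert (NJ := JJ_neq_0 _ _ _ HJ). fold z in HJ, NJ, HA, HB.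
  assert (D1 : deriv A' w = (RtoC r * deriv A z)%C) by now apply deriv_rescale.
  assert (D2 : deriv B' w = (RtoC r * deriv B z)%C) by now apply deriv_rescale.
  assert (D3 : deriv (deriv A') w = (RtoC r * RtoC r * deriv (deriv A) z)%C) by now apply deriv2_rescale.
  assert (D4 : deriv (deriv B') w = (RtoC r * RtoC r * deriv (deriv B) z)%C) by now apply deriv2_rescale.
  assert (EJ : JJ A' B' w = JJ A B z) by reflexivity.
  assert (EP : PP A' B' w = (RtoC r * PP A B z)%C).
  { unfold PP. rewrite D1, D2, EJ. change (A' w) with (A z). change (B' w) with (B z). field. auto. }
  split; auto. split.
  - unfold SS. rewrite EP, D3, D4, EJ. change (A' w) with (A z). change (B' w) with (B z). field. auto.
  - unfold tau, TT. rewrite D1, D2, EJ. change (A' w) with (A z). change (B' w) with (B z).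
    replace (A z * (RtoC r * deriv B z) - RtoC r * deriv A z * B z)%C with (RtoC r * (A z * deriv B z - deriv A z * B z))%C by ring.
    rewrite Cmod_mult, Cmod_R, Rpow_mult_distr, pow2_abs. field. lra.
Qed.

(** Halving the radius leaves room r / 2 around every point, so the rescaled pair has Schwarzian at
    most c on the whole unit disc. There |P(0)| <= 4 exp 8, and scaling back by h = r / 2 gives 8
    exp 8 / r; likewise t <= eps / h = 2 eps / r. *)
Lemma local_control_of_schwarzian (eps : R) : 0 < eps -> exists c1, 0 < c1 /\
  forall c (D : C -> Prop) A B, 0 <= c <= c1 ->
  (forall z, D z -> holo A z /\ holo B z /\ 0 < JJ A B z) ->
  (forall z r, 0 < r -> ball_in D z r -> Cmod (SS A B z) <= c / r ^ 2) ->
  local_control D A B c (8 * exp 8) (2 * eps).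
Proof.
  intros He. destruct (tau_small eps He) as [c1 [Hc1 HT]]. exists c1. split; [lra|].
  intros c D A B Hc HD HS z r Hr HB. split; [now apply HS|].
  set (h := r / 2). assert (Hh : 0 < h) by (unfold h; lra).
  set (A' := fun w => A (z + RtoC h * w)%C). set (B' := fun w => B (z + RtoC h * w)%C).
  assert (In : forall w, Cmod w < 1 -> ball_in D (z + RtoC h * w)%C h).
  { intros w Hw v Hv. apply HB. assert (T := Cmod_dist_triangle v (z + RtoC h * w) z).
    replace (z + RtoC h * w - z)%C with (RtoC h * w)%C in T by ring. rewrite Cmod_mult, Cmod_RtoC_pos in T by lra.
    assert (h * Cmod w < h * 1) by (apply Rmult_lt_compat_l; lra). unfold h in *. lra. }
  assert (InD : forall w, Cmod w < 1 -> D (z + RtoC h * w)%C).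
  { intros w Hw. apply (In w Hw). replace (z + RtoC h * w - (z + RtoC h * w))%C with (RtoC 0) by ring. rewrite Cmod_0. lra. }
  assert (GP : forall c', c <= c' -> good_pair c' A' B').
  { intros c' Hc' w Hw. destruct (HD _ (InD w Hw)) as [HA [HB' HJ]].
    destruct (rescale_pair A B z h w HA HB' HJ) as [_ [R2 _]].
    repeat split. now apply holo_rescale. now apply holo_rescale. exact HJ.
    unfold A', B'. rewrite R2, !Cmod_mult, Cmod_RtoC_pos by lra.
    assert (X := HS _ h Hh (In w Hw)). apply Rle_trans with (2 := Hc').
    replace c with (h * h * (c / h ^ 2)) by (field; lra). apply Rmult_le_compat_l; auto. nra. }
  assert (z1 : Cmod (RtoC 0) < 1) by (rewrite Cmod_0; lra).
  destruct (HD _ (InD _ z1)) as [HA [HB' HJ]]. destruct (rescale_pair A B z h 0%C HA HB' HJ) as [R1 [_ R3]].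
  assert (E : (z + RtoC h * 0)%C = z) by ring. rewrite E in R1, R3.
  split.
  - assert (X := PP_bound A' B' (GP 1 ltac:(lra)) 0%C ltac:(rewrite Cmod_0; lra)).
    unfold A', B' in X. rewrite R1, Cmod_mult, Cmod_0, Cmod_RtoC_pos in X by lra.
    apply Rle_div_r; auto. unfold h in X. lra.
  - assert (X := HT A' B' (GP c1 (proj2 Hc))). unfold A', B' in X. rewrite R3 in X.
    replace ((2 * eps / r) ^ 2) with (eps ^ 2 / h ^ 2) by (unfold h; field; lra).
    apply (Rle_div_r (tau A B z) (eps ^ 2) (h ^ 2)); [now apply pow_lt | lra].
Qed.

(** * Lengths and distances *)

Definition is_polygon (g : R -> C) (s t L : R) : Prop :=
  exists (p : nat -> R) (n : nat), (forall i, (i <= n)%nat -> p i <= p (S i)) /\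
    s <= p 0%nat /\ p (S n) <= t /\ L = polygonal_length g p n.

Lemma polygon_le_length g s t L : is_polygon g s t L -> Rbar_le L (curve_length g s t).
Proof. intros H. apply (proj1 (Lub_Rbar_correct (is_polygon g s t)) L H). Qed.

Lemma length_le g s t (M : Rbar) : (forall L, is_polygon g s t L -> Rbar_le L M) -> Rbar_le (curve_length g s t) M.
Proof. intros H. apply (proj2 (Lub_Rbar_correct (is_polygon g s t)) M). exact H. Qed.

Lemma polygon_const g s t : s <= t -> is_polygon g s t 0.
Proof.
  intros H. exists (fun _ => s), 0%nat. repeat split; try lra. intros. lra. unfold polygonal_length. simpl.
  replace (g s - g s)%C with (RtoC 0) by ring. now rewrite Cmod_0.
Qed.

Lemma polygon_extend_right g s t t' L : t <= t' -> is_polygon g s t L ->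
  exists L', is_polygon g s t' L' /\ L + Cmod (g t' - g t)%C <= L'.
Proof.
  intros Ht [p [n [H1 [H2 [H3 ->]]]]].
  (* The vertices of p have indices 0 to n + 1; t and t' are appended as two more. *)
  set (p' := fun i => if le_dec i (S n) then p i else if Nat.eq_dec i (S (S n)) then t else t').
  assert (P1 : forall i, (i <= S n)%nat -> p' i = p i). { intros i Hi. unfold p'. destruct le_dec; auto. lia. }
  assert (P2 : p' (S (S n)) = t). { unfold p'. destruct le_dec; [lia|]. destruct Nat.eq_dec; auto. lia. }
  assert (P3 : p' (S (S (S n))) = t'). { unfold p'. destruct le_dec; [lia|]. destruct Nat.eq_dec; auto. lia. }
  exists (polygonal_length g p' (S (S n))). split.
  - exists p', (S (S n)). repeat split.
    + intros i Hi. destruct (le_dec i n). rewrite !P1 by lia. auto.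
      destruct (Nat.eq_dec i (S n)) as [->|]. rewrite P1, P2 by lia. auto.
      replace i with (S (S n)) by lia. rewrite P2, P3. auto.
    + rewrite P1 by lia. auto.
    + rewrite P3. lra.
  - unfold polygonal_length. cbn [sum_f_R0]. rewrite P2, P3.
    rewrite (sum_eq _ (fun i => Cmod (g (p' (S i)) - g (p' i))%C) n).
    2:{ intros i Hi. now rewrite !P1 by lia. }
    assert (X := Cmod_ge_0 (g t - g (p' (S n)))%C). lra.
Qed.

Lemma polygon_extend_left g s s' t L : s' <= s -> is_polygon g s t L ->
  exists L', is_polygon g s' t L' /\ L + Cmod (g s - g s')%C <= L'.
Proof.
  intros Hs [p [n [H1 [H2 [H3 ->]]]]].
  set (p' := fun i => match i with O => s' | S O => s | S (S i) => p i end).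
  exists (polygonal_length g p' (S (S n))). split.
  - exists p', (S (S n)). repeat split; try (simpl; lra).
    + intros [|[|i]] Hi; simpl; auto. apply H1. lia.
    + simpl. auto.
  - unfold polygonal_length. rewrite (decomp_sum _ (S (S n))) by lia. cbn [pred].
    rewrite (decomp_sum _ (S n)) by lia. cbn [pred].
    cbn [p']. assert (X := Cmod_ge_0 (g (p 0%nat) - g s)%C). 
    change (fun i => Cmod (g (p' (S (S (S i)))) - g (p' (S (S i))))%C) with (fun i => Cmod (g (p (S i)) - g (p i))%C). lra.
Qed.

Lemma polygon_wider g s t s' t' L : s' <= s -> t <= t' -> is_polygon g s t L -> is_polygon g s' t' L.
Proof. intros Hs Ht [p [n [H1 [H2 [H3 H4]]]]]. exists p, n. repeat split; auto; lra. Qed.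

Lemma length_finite g (M : R) u v : Rbar_le (curve_length g 0 1) M -> 0 <= u <= v -> v <= 1 ->
  curve_length g u v = Finite (real (curve_length g u v)) /\ 0 <= real (curve_length g u v).
Proof.
  intros HM Hu Hv.
  assert (L1 : Rbar_le 0 (curve_length g u v)) by (apply polygon_le_length, polygon_const; lra).
  assert (L2 : Rbar_le (curve_length g u v) M).
  { apply length_le. intros L HL. apply Rbar_le_trans with (2 := HM). apply polygon_le_length.
    apply polygon_wider with u v; auto; lra. }
  destruct (curve_length g u v); simpl in *; tauto.
Qed.

(** Every polygon on [0, t] is prolonged by the chord to t'. Arclength thus dominates chords, the
    form in which [QQ_growth] uses it. *)
Lemma length_right g M t t' : Rbar_le (curve_length g 0 1) (Finite M) -> 0 <= t <= t' -> t' <= 1 ->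
  Cmod (g t' - g t)%C <= real (curve_length g 0 t') - real (curve_length g 0 t).
Proof.
  intros HM Ht Ht'.
  destruct (length_finite g M 0 t HM ltac:(lra) ltac:(lra)) as [E1 _].
  destruct (length_finite g M 0 t' HM ltac:(lra) ltac:(lra)) as [E2 _].
  assert (X : Rbar_le (curve_length g 0 t) (real (curve_length g 0 t') - Cmod (g t' - g t)%C)).
  { apply length_le. intros L HL. destruct (polygon_extend_right g 0 t t' L ltac:(lra) HL) as [L' [H1 H2]].
    apply polygon_le_length in H1. rewrite E2 in H1. simpl in *. lra. }
  rewrite E1 in X. simpl in X. lra.
Qed.

Lemma length_left g M t t' : Rbar_le (curve_length g 0 1) (Finite M) -> 0 <= t <= t' -> t' <= 1 ->
  Cmod (g t' - g t)%C <= real (curve_length g t 1) - real (curve_length g t' 1).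
Proof.
  intros HM Ht Ht'.
  destruct (length_finite g M t 1 HM ltac:(lra) ltac:(lra)) as [E1 _].
  destruct (length_finite g M t' 1 HM ltac:(lra) ltac:(lra)) as [E2 _].
  assert (X : Rbar_le (curve_length g t' 1) (real (curve_length g t 1) - Cmod (g t' - g t)%C)).
  { apply length_le. intros L HL. destruct (polygon_extend_left g t' t 1 L ltac:(lra) HL) as [L' [H1 H2]].
    apply polygon_le_length in H1. rewrite E1 in H1. simpl in *. lra. }
  rewrite E2 in X. simpl in X. lra.
Qed.

Lemma length_point g t : real (curve_length g t t) = 0.
Proof.
  assert (X : Rbar_le (curve_length g t t) 0).
  { apply length_le. intros L [p [n [H1 [H2 [H3 ->]]]]].
    assert (Up : forall i, (i <= S n)%nat -> t <= p i).
    { induction i; intros Hi; auto. apply Rle_trans with (p i). apply IHi; lia. apply H1; lia. }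
    assert (Dn : forall k, (k <= S n)%nat -> p (S n - k)%nat <= t).
    { induction k; intros Hk. now rewrite Nat.sub_0_r. apply Rle_trans with (2 := IHk ltac:(lia)).
      replace (S n - k)%nat with (S (S n - S k)) by lia. apply H1. lia. }
    assert (E : forall i, (i <= S n)%nat -> p i = t).
    { intros i Hi. apply Rle_antisym. replace i with (S n - (S n - i))%nat by lia. apply Dn; lia. now apply Up. }
    simpl. apply Req_le. unfold polygonal_length. rewrite (sum_eq _ (fun _ => 0) n).
    rewrite sum_cte. ring. intros i Hi. rewrite !E by lia. replace (g t - g t)%C with (RtoC 0) by ring. now rewrite Cmod_0. }
  assert (Y : Rbar_le 0 (curve_length g t t)) by (apply polygon_le_length, polygon_const; lra).
  destruct (curve_length g t t); simpl in *; try tauto; lra.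
Qed.

(* The first exit point of a segment leaving D is a boundary point. *)
Lemma ball_in_of_dist (D : C -> Prop) z b m : open D -> D z -> 0 < b -> 0 < m ->
  Rbar_le (Finite m) (Rbar_mult b (dist_to z (boundary D))) -> ball_in D z (m / b).
Proof.
  intros oD Dz Hb Hm H v Hv. apply NNPP. intros Nv.
  set (seg := fun t => (z + RtoC t * (v - z))%C).
  assert (Bd : exists y, boundary D y /\ Cmod (z - y)%C <= Cmod (v - z)%C).
  { apply NNPP. intros NB.
    assert (G : forall t, 0 <= t <= 1 -> D (seg t)).
    { apply (real_induction (fun t => D (seg t))).
      - unfold seg. now replace (z + RtoC 0 * (v - z))%C with z by ring.
      - intros t Ht Dt. destruct (seg_point_near z v t D (open_near _ _ oD Dt)) as [d [Hd X]].
        exists d. split; auto. intros s Hs _. apply X. apply Rabs_lt_between. lra.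
      - intros t Ht Hl. apply NNPP. intros Nt. apply NB. exists (seg t). split.
        + intros U oU Ut. split.
          * destruct (seg_point_near z v t U (open_near _ _ oU Ut)) as [d [Hd X]].
            set (s := Rmax 0 (t - d / 2)). assert (T1 := Rmax_l 0 (t - d / 2)). assert (T2 := Rmax_r 0 (t - d / 2)). fold s in T1, T2.
            assert (T3 : s < t) by (apply Rmax_lub_lt; lra).
            exists (seg s). split. apply X. apply Rabs_lt_between; lra. apply Hl. lra.
          * exists (seg t). split; auto.
        + rewrite Cmod_minus_sym. replace (seg t - z)%C with (RtoC t * (v - z))%C by (unfold seg; ring).
          rewrite Cmod_mult, Cmod_RtoC_pos by lra. rewrite <- (Rmult_1_l (Cmod (v - z)%C)) at 2.
          apply Rmult_le_compat_r. apply Cmod_ge_0. lra. }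
    apply Nv. specialize (G 1 ltac:(lra)). unfold seg in G. now replace (z + RtoC 1 * (v - z))%C with v in G by ring. }
  destruct Bd as [y [By Hy]].
  unfold dist_to in H.
  destruct (Glb_Rbar_correct (fun r => exists w, boundary D w /\ r = Cmod (z - w)%C)) as [G1 G2].
  specialize (G1 (Cmod (z - y)%C) (ex_intro _ y (conj By eq_refl))).
  assert (G0 : Rbar_le 0 (Glb_Rbar (fun r => exists w, boundary D w /\ r = Cmod (z - w)%C))).
  { apply G2. intros r [w [_ ->]]. apply Cmod_ge_0. }
  destruct (Glb_Rbar _) as [x| |]; simpl in G0, G1; try tauto. simpl in H.
  apply Rlt_div_r in Hv; auto. nra.
Qed.

(** * Injectivity *)

Lemma inner_disc_near D z1 z : inner_disc D z1 z -> near z (inner_disc D z1).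
Proof.
  intros [del [H1 H2]]. generalize (near_ball _ _ _ H1). apply near_imp. intros w Hw. exists del. auto.
Qed.

(** The curve may come back close to z1 after a long way, and then |g t - z1| is not comparable with
    the arclength. At such times g t lies in the inner disc, where [QQ_inner_disc] applies. In terms
    of |g T - z1| the bound costs a factor 1 / mu. *)
Lemma QQ_along_cigar D f A B z1 c C0 eps mu K b (g : R -> C) (sg : R -> R) (T : R) :
  (forall z, D z -> near z D) -> (forall z, D z -> pair_of f A B z) ->
  local_control D A B c C0 eps -> 0 <= c -> 0 <= C0 -> 0 <= eps -> 0 < mu <= 1 -> 0 < K -> 0 < b -> 4 * b * mu <= 1 ->
  K ^ 2 / mu ^ 2 + c / mu ^ 2 + eps / mu * ((K + 1) / mu ^ 2 + C0 / mu) + (eps / mu) ^ 2 < K ->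
  0 <= T <= 1 -> path_cont g T -> g 0 = z1 -> sg 0 = 0 -> (forall t, 0 <= t <= T -> D (g t)) ->
  (forall t t', 0 <= t <= t' -> t' <= T -> Cmod (g t' - g t)%C <= sg t' - sg t) ->
  (forall t, 0 <= t < T -> 0 < sg t -> ball_in D (g t) (sg t / b)) ->
  g T <> z1 ->
  NN f A B z1 (g T) <> 0%C /\ Cmod (QQ f A B z1 (g T)) <= K / mu * Cmod (g T - z1)%C.
Proof.
  intros HDo Hpair HL Hc HC0 Heps Hmu HK Hb Hbm HC HT Hg g0 sg0 HDg Hch Hball NT.
  assert (D1 : D z1) by (rewrite <- g0; apply HDg; lra).
  assert (Disc := QQ_inner_disc D f A B z1 c C0 eps mu K HDo Hpair HL Hc HC0 Heps Hmu HK HC D1).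
  assert (Dz1 : inner_disc D z1 z1).
  { destruct (HDo _ D1) as [d [Hd X]]. exists (d / 2). split. replace (z1 - z1)%C with (RtoC 0) by ring. rewrite Cmod_0. lra.
    intros v Hv. apply X. lra. }
  assert (Hsg : forall t, 0 <= t <= T -> Cmod (g t - z1)%C <= sg t).
  { intros t Ht. rewrite <- g0. assert (X := Hch 0 t ltac:(lra) ltac:(lra)). rewrite sg0 in X. lra. }
  assert (Reg : forall t, 0 <= t < T -> inner_disc D z1 (g t) \/
     (0 < sg t /\ mu * sg t <= Cmod (g t - z1)%C /\ ball_in D (g t) (mu * sg t))).
  { intros t Ht. destruct (classic (inner_disc D z1 (g t))) as [I|I]; auto. right.
    assert (Ps : 0 < sg t).
    { assert (X := Hsg t ltac:(lra)). assert (Y := Cmod_ge_0 (g t - z1)%C). destruct (Req_dec (sg t) 0) as [E|N]; [|lra].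
      exfalso. apply I. assert (Z : Cmod (g t - z1)%C = 0) by lra. apply Cmod_eq_0, Cminus_eq_0 in Z. now rewrite Z. }
    assert (HBt := Hball t Ht Ps).
    assert (Q : mu * sg t <= sg t / (4 * b)).
    { apply (Rle_div_r (mu * sg t)); [lra|]. replace (mu * sg t * (4 * b)) with (4 * b * mu * sg t) by ring.
      rewrite <- (Rmult_1_l (sg t)) at 2. apply Rmult_le_compat_r; lra. }
    assert (Q2 : sg t / (4 * b) * 4 = sg t / b) by (field; lra).
    assert (Q3 : 0 < sg t / (4 * b)) by (apply Rdiv_lt_0_compat; lra).
    split; auto. split.
    (* If |g t - z1| < sg t / (4 b), the disc about z1 of radius sg t / (2 b) lies in the disc of
       radius sg t / b about g t, hence in D. *)
    - apply Rle_trans with (1 := Q). apply Rnot_lt_le. intros L. apply I. exists (sg t / (4 * b)). split; auto.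
      intros v Hv. apply HBt. assert (X := Cmod_dist_triangle v z1 (g t)). rewrite (Cmod_minus_sym z1) in X. lra.
    - intros v Hv. apply HBt. lra. }
  assert (Gr := QQ_growth D f A B z1 c C0 eps mu K (inner_disc D z1) g sg T HDo Hpair HL Hc HC0 Heps (proj1 Hmu) HK HC
     (inner_disc_near D z1) Disc (proj2 HT) Hg g0 sg0 HDg Hch Reg).
  assert (Kmu : K <= K / mu). { apply Rle_div_r; nra. }
  assert (Gr2 : forall t, 0 <= t < T -> g t <> z1 -> NN f A B z1 (g t) <> 0%C /\ Cmod (QQ f A B z1 (g t)) <= K / mu * Cmod (g t - z1)%C).
  { intros t Ht Nt. destruct (Reg t Ht) as [I|[P1 [P2 _]]].
    - destruct (Disc _ I Nt) as [Y1 Y2]. split; auto. apply Rle_trans with (1 := Y2). apply Rmult_le_compat_r; auto. apply Cmod_ge_0.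
    - destruct (Gr t Ht Nt) as [Y1 Y2]. split; auto. apply Rle_trans with (1 := Y2).
      replace (K * sg t) with (K / mu * (mu * sg t)) by (field; lra). apply Rmult_le_compat_l; lra. }
  assert (PT : 0 < T). { destruct HT as [[HT|HT] _]; auto. exfalso. apply NT. now rewrite <- HT. }
  set (d0 := Cmod (g T - z1)%C). assert (Pd : 0 < d0) by (apply Cmod_gt_0, Cminus_neq_0; auto).
  (* The estimates so far are for t < T; [QQ_closure] carries them to T with an arbitrarily small
     loss. *)
  assert (Cl : forall e, 0 < e -> NN f A B z1 (g T) <> 0%C /\ Cmod (QQ f A B z1 (g T)) <= K / mu * (d0 + e)).
  { intros e He. apply QQ_closure; auto.
    - apply Hpair, HDg; lra.
    - generalize (HDo _ (HDg T ltac:(lra))). apply near_imp. exact Hpair.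
    - intros eta Heta.
      destruct (Hg T ltac:(lra) (Rmin (Rmin eta e) d0) ltac:(repeat apply Rmin_pos; auto)) as [d [Hd X]].
      set (s := Rmax 0 (T - d / 2)). assert (T1 := Rmax_l 0 (T - d / 2)). assert (T2 := Rmax_r 0 (T - d / 2)). fold s in T1, T2.
      assert (T3 : s < T) by (apply Rmax_lub_lt; lra).
      specialize (X s ltac:(lra) ltac:(apply Rabs_lt_between; lra)).
      assert (M1 := Rmin_l (Rmin eta e) d0). assert (M2 := Rmin_r (Rmin eta e) d0).
      assert (M3 := Rmin_l eta e). assert (M4 := Rmin_r eta e).
      assert (Ns : g s <> z1). { intros E. rewrite E, Cmod_minus_sym in X. fold d0 in X. lra. }
      destruct (Gr2 s ltac:(lra) Ns) as [Y1 Y2]. exists (g s). split. lra. split; auto.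
      apply Rle_trans with (1 := Y2). apply Rmult_le_compat_l. lra.
      assert (Y3 := Cmod_dist_triangle (g s) (g T) z1). fold d0 in Y3. lra. }
  split. apply (Cl 1 Rlt_0_1).
  apply le_epsilon. intros e He. destruct (Cl (e / (K / mu)) ltac:(apply Rdiv_lt_0_compat; lra)) as [_ X].
  apply Rle_trans with (1 := X). apply Req_le. field. lra.
Qed.

(** mu is chosen from b, K from mu and a, then eps and c2 from these. K <= mu^2 / 8 absorbs the term
    quadratic in K, and K <= mu / (2 a) yields the factor 1/2 of the final contradiction. The four
    terms are then at most K/8, K/8, K/4 and K/4. *)
Lemma constants (a b : R) : 0 < a -> 0 < b -> exists mu K eps c2,
  0 < mu <= 1 /\ 4 * b * mu <= 1 /\ 0 < K /\ K / mu * a <= 1 / 2 /\ 0 < eps /\ 0 < c2 /\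
  forall c, 0 <= c <= c2 ->
  K ^ 2 / mu ^ 2 + c / mu ^ 2 + 2 * eps / mu * ((K + 1) / mu ^ 2 + 8 * exp 8 / mu) + (2 * eps / mu) ^ 2 < K.
Proof.
  intros Ha Hb. set (mu := Rmin 1 (1 / (4 * b))).
  assert (M1 : mu <= 1) by apply Rmin_l. assert (M2 : mu <= 1 / (4 * b)) by apply Rmin_r.
  assert (M0 : 0 < mu) by (apply Rmin_pos; [lra|apply Rdiv_lt_0_compat; lra]).
  set (K := Rmin (mu ^ 2 / 8) (mu / (2 * a))). assert (Pm2 : 0 < mu ^ 2) by now apply pow_lt.
  assert (K1 : K <= mu ^ 2 / 8) by apply Rmin_l. assert (K2 : K <= mu / (2 * a)) by apply Rmin_r.
  assert (K0 : 0 < K) by (apply Rmin_pos; apply Rdiv_lt_0_compat; lra).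
  set (X := (K + 1) / mu ^ 2 + 8 * exp 8 / mu).
  assert (PX : 0 < X). { unfold X. assert (P := exp_pos 8). assert (0 < (K + 1) / mu ^ 2) by (apply Rdiv_lt_0_compat; lra).
    assert (0 < 8 * exp 8 / mu) by (apply Rdiv_lt_0_compat; lra). lra. }
  set (e := Rmin (Rmin 1 (K / 4)) (K / (4 * X))).
  assert (E1 : e <= 1) by (eapply Rle_trans; [apply Rmin_l|apply Rmin_l]).
  assert (E2 : e <= K / 4) by (eapply Rle_trans; [apply Rmin_l|apply Rmin_r]).
  assert (E3 : e <= K / (4 * X)) by apply Rmin_r.
  assert (E0 : 0 < e). { unfold e. repeat apply Rmin_pos; try lra. apply Rdiv_lt_0_compat; lra. }
  exists mu, K, (e * mu / 2), (mu ^ 2 * K / 8).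
  repeat split; auto.
  - apply Rle_div_r in M2; lra.
  - apply Rle_div_r in K2; [|lra]. replace (K / mu * a) with (K * (2 * a) / mu / 2) by (field; lra).
    assert (K * (2 * a) / mu <= 1) by (apply Rle_div_l; lra). lra.
  - assert (0 < e * mu) by now apply Rmult_lt_0_compat. lra.
  - assert (0 < mu ^ 2 * K) by now apply Rmult_lt_0_compat. lra.
  - intros c Hc. fold X. replace (2 * (e * mu / 2) / mu) with e by (field; lra).
    assert (Y1 : K ^ 2 / mu ^ 2 <= K / 8). { apply Rle_div_l; auto. nra. }
    assert (Y2 : c / mu ^ 2 <= K / 8). { apply Rle_div_l; auto. lra. }
    assert (Y3 : e * X <= K / 4). { apply Rle_div_r in E3; lra. }
    assert (Y4 : e ^ 2 <= K / 4) by nra. lra.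
Qed.

Theorem theorem2 :
  forall D : C -> Prop,
    uniform_domain D -> compl_three_points D ->
    exists c : R, 0 < c /\
      forall f : C -> C,
        harmonic D f ->
        (forall z : C, D z -> 0 < jacobian f z) ->
        Rbar_le (schwarzian_norm D f) (Finite c) ->
        forall z w : C, D z -> D w -> f z = f w -> z = w.
Proof.
  intros D [[oD [_ _]] [a [b [Ha [Hb Hu]]]]] _.
  destruct (constants a b Ha Hb) as [mu [K [eps [c2 [Hmu [Hbm [HK [HKa [Heps [Hc2 HC]]]]]]]]]].
  destruct (local_control_of_schwarzian eps Heps) as [c1 [Hc1 HLC]].
  set (c := Rmin c1 c2). assert (Lc1 : c <= c1) by apply Rmin_l. assert (Lc2 : c <= c2) by apply Rmin_r.
  assert (Hc : 0 < c) by now apply Rmin_pos.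
  exists c. split; auto. intros f Hf HJ HS z1 z2 D1 D2 Efz.
  apply NNPP. intros Nz.
  set (A := fA f). set (B := fB f).
  assert (HDo : forall z, D z -> near z D) by (intros z Hz; now apply open_near).
  assert (Hpair : forall z, D z -> pair_of f A B z).
  { intros z Hz. destruct (harmonic_holo D f z oD Hf Hz) as [HA HB]. repeat split; auto.
    unfold A, B. rewrite <- jacobian_JJ. auto. now apply harmonic_wd with D. }
  assert (HL : local_control D A B c (8 * exp 8) (2 * eps)).
  { apply HLC. lra. intros z Hz. destruct (Hpair z Hz) as [X1 [X2 [X3 _]]]. auto.
    intros z r Hr HB. assert (Dz : D z). { apply HB. replace (z - z)%C with (RtoC 0) by ring. now rewrite Cmod_0. }
    unfold A, B. rewrite <- (schwarzian_SS D f z oD Hf HJ Dz). apply schwarzian_norm_pointwise with D; auto. lra. }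
  assert (HCc := HC c ltac:(lra)). assert (Pe8 := exp_pos 8).
  destruct (Hu z1 z2 D1 D2 Nz) as [g [[Hg [_ [g0 [g1 HDg]]]] [HLen Hcig]]].
  set (s1 := fun t => real (curve_length g 0 t)). set (s2 := fun t => real (curve_length g t 1)).
  set (M := a * Cmod (z1 - z2)%C) in *.
  assert (Hcont : forall t, 0 <= t <= 1 -> forall e, 0 < e -> exists d, 0 < d /\ forall s, 0 <= s <= 1 -> Rabs (s - t) < d -> Cmod (g s - g t)%C < e).
  { intros t Ht e He. assert (X := Hg t Ht (fun y => Cmod (y - g t)%C < e) (proj1 (near_locally _ _) (near_ball_self (g t) e He))).
    destruct X as [d X]. exists d. split. apply cond_pos. intros s Hs Hs'. apply X; auto. }
  assert (Fin1 : forall t, 0 <= t <= 1 -> curve_length g 0 t = Finite (s1 t)) by (intros t Ht; apply (length_finite g M 0 t HLen); lra).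
  assert (Fin2 : forall t, 0 <= t <= 1 -> curve_length g t 1 = Finite (s2 t)) by (intros t Ht; apply (length_finite g M t 1 HLen); lra).
  assert (Ch1 : forall t t', 0 <= t <= t' -> t' <= 1 -> Cmod (g t' - g t)%C <= s1 t' - s1 t) by (intros; now apply length_right with M).
  assert (Ch2 : forall t t', 0 <= t <= t' -> t' <= 1 -> Cmod (g t' - g t)%C <= s2 t - s2 t') by (intros; now apply length_left with M).
  assert (Ball : forall t m, 0 <= t <= 1 -> 0 < m -> m <= s1 t -> m <= s2 t -> ball_in D (g t) (m / b)).
  { intros t m Ht Hm H1 H2. apply ball_in_of_dist; auto. apply Rbar_le_trans with (2 := Hcig t Ht).
    rewrite Fin1, Fin2 by auto. simpl. apply Rmin_glb; auto. }
  (* The midpoint in arclength, taken as a supremum; [Lo] and [Hi] follow from the monotonicity of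
     s1 and s2. *)
  set (S := fun t => 0 <= t <= 1 /\ s1 t <= s2 t).
  assert (P2 : 0 <= s2 0) by (apply (length_finite g M 0 1 HLen); lra).
  destruct (completeness S) as [T [T1 T2]].
  { exists 1. intros t [Ht _]. lra. }
  { exists 0. split. lra. unfold s1 at 1. now rewrite length_point. }
  assert (HT : 0 <= T <= 1).
  { split. apply T1. split. lra. unfold s1 at 1. now rewrite length_point. apply T2. intros t [Ht _]. lra. }
  assert (Lo : forall t, 0 <= t < T -> s1 t <= s2 t).
  { intros t Ht. assert (X : exists t', S t' /\ t < t').
    { apply NNPP. intros N. assert (T <= t); [|lra]. apply T2. intros t' St'. apply Rnot_lt_le. intros L. apply N. exists t'. auto. }
    destruct X as [t' [[Ht' St'] Ltt]].
    assert (X1 := Ch1 t t' ltac:(lra) ltac:(lra)). assert (X2 := Ch2 t t' ltac:(lra) ltac:(lra)).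
    assert (X3 := Cmod_ge_0 (g t' - g t)%C). lra. }
  assert (Hi : forall t, T < t <= 1 -> s2 t <= s1 t).
  { intros t Ht. apply Rnot_lt_le. intros L. assert (t <= T); [|lra]. apply T1. split; lra. }
  set (z0 := g T).
  assert (From1 : z0 <> z1 -> NN f A B z1 z0 <> 0%C /\ Cmod (QQ f A B z1 z0) <= K / mu * Cmod (z0 - z1)%C).
  { apply (QQ_along_cigar D f A B z1 c (8 * exp 8) (2 * eps) mu K b g s1 T); auto; try lra.
    - intros t Ht e He. destruct (Hcont t ltac:(lra) e He) as [d [Hd X]]. exists d. split; auto. intros s Hs. apply X. lra.
    - apply length_point.
    - intros t Ht. apply HDg. lra.
    - intros t t' Ht Ht'. apply Ch1; lra.
    - intros t Ht Ps. apply Ball; auto; try lra. }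
  (* The same estimate from the other end, for the reversed curve t -> g (1 - t). *)
  assert (From2 : z0 <> z2 -> NN f A B z2 z0 <> 0%C /\ Cmod (QQ f A B z2 z0) <= K / mu * Cmod (z0 - z2)%C).
  { assert (E0 : z0 = g (1 - (1 - T))) by (unfold z0; f_equal; ring). rewrite E0.
    apply (QQ_along_cigar D f A B z2 c (8 * exp 8) (2 * eps) mu K b (fun t => g (1 - t)) (fun t => s2 (1 - t)) (1 - T)); auto; try lra.
    - intros t Ht e He. destruct (Hcont (1 - t) ltac:(lra) e He) as [d [Hd X]]. exists d. split; auto. intros s Hs Hs'. apply X. lra.
      replace (1 - s - (1 - t)) with (- (s - t)) by ring. now rewrite Rabs_Ropp.
    - now rewrite Rminus_0_r.
    - rewrite Rminus_0_r. apply length_point.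
    - intros t Ht. apply HDg. lra.
    - intros t t' Ht Ht'. rewrite Cmod_minus_sym. apply Ch2; lra.
    - intros t Ht Ps. apply Ball; auto; try lra. apply Hi. lra. }
  assert (HDz0 : D z0) by (apply HDg; lra).
  assert (J0 : 0 < JJ A B z0) by apply (Hpair z0 HDz0).
  (* If z0 is an endpoint, f(z1) = f(z2) makes N for the other endpoint vanish at z0, against the
     estimate from that endpoint. *)
  destruct (classic (z0 = z1)) as [E1|N1].
  { assert (N2 : z0 <> z2) by congruence. apply (proj1 (From2 N2)). apply NN_eq_0; auto. congruence. }
  destruct (classic (z0 = z2)) as [E2|N2].
  { apply (proj1 (From1 N1)). apply NN_eq_0; auto. congruence. }
  destruct (From1 N1) as [F1 Q1]. destruct (From2 N2) as [F2 Q2].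
  set (x1 := (z0 - z1)%C) in *. set (x2 := (z0 - z2)%C) in *.
  assert (Nx1 : x1 <> 0%C) by now apply Cminus_neq_0. assert (Nx2 : x2 <> 0%C) by now apply Cminus_neq_0.
  assert (Px1 := proj1 (Cmod_gt_0 _) Nx1). assert (Px2 := proj1 (Cmod_gt_0 _) Nx2).
  (* N depends on the base point only through its image under f. *)
  assert (EW : WW f A B z1 z0 = WW f A B z2 z0) by (unfold WW, EE, NN; now rewrite Efz).
  (* W is eliminated between Q1 = x1^2 W - x1 and Q2 = x2^2 W - x2. Dividing by x1 x2 leaves |z1 -
     z2| <= k (|x1| + |x2|) <= k a |z1 - z2| <= |z1 - z2| / 2. *)
  assert (Eq : (x1 * x2 * (z1 - z2))%C = (QQ f A B z2 z0 * (x1 * x1) - QQ f A B z1 z0 * (x2 * x2))%C).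
  { unfold QQ. rewrite EW. fold x1 x2. replace (z1 - z2)%C with (x2 - x1)%C by (unfold x1, x2; ring). ring. }
  apply (f_equal Cmod) in Eq. rewrite !Cmod_mult in Eq.
  set (k := K / mu) in *. assert (Pk : 0 < k) by (apply Rdiv_lt_0_compat; lra).
  assert (Pz : 0 < Cmod (z1 - z2)%C) by (apply Cmod_gt_0, Cminus_neq_0; auto).
  assert (B0 : Cmod x1 * Cmod x2 * Cmod (z1 - z2)%C <= Cmod x1 * Cmod x2 * (k * (Cmod x1 + Cmod x2))).
  { rewrite Eq. eapply Rle_trans; [apply Cmod_triangle_sub|]. rewrite !Cmod_mult.
    assert (Cmod (QQ f A B z2 z0) * (Cmod x1 * Cmod x1) <= k * Cmod x2 * (Cmod x1 * Cmod x1)) by (apply Rmult_le_compat_r; nra).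
    assert (Cmod (QQ f A B z1 z0) * (Cmod x2 * Cmod x2) <= k * Cmod x1 * (Cmod x2 * Cmod x2)) by (apply Rmult_le_compat_r; nra).
    lra. }
  apply Rmult_le_reg_l in B0. 2: now apply Rmult_lt_0_compat.
  assert (B1 : Cmod x1 + Cmod x2 <= a * Cmod (z1 - z2)%C).
  { assert (X1 := Ch1 0 T ltac:(lra) ltac:(lra)). assert (X2 := Ch1 T 1 ltac:(lra) ltac:(lra)).
    rewrite g0 in X1. rewrite g1, Cmod_minus_sym in X2. fold z0 in X1, X2. fold x1 in X1. fold x2 in X2.
    assert (X3 : s1 0 = 0) by apply length_point. rewrite (Fin1 1) in HLen by lra. simpl in HLen. fold M. lra. }
  assert (k * (Cmod x1 + Cmod x2) <= k * (a * Cmod (z1 - z2)%C)) by (apply Rmult_le_compat_l; lra).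
  assert (k * a * Cmod (z1 - z2)%C <= 1 / 2 * Cmod (z1 - z2)%C) by (apply Rmult_le_compat_r; lra).
  lra.
Qed.
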